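(* The solution $u=\{u(t,x);\,t\ge0,\,x\in\mathbb{R}^d\}$ of the linear stochastic wave equation $$\frac{\partial^2u}{\partial t^2}(t,x)=\Delta u(t,x)+\dot W(t,x),\ t>0,\,x\in\mathbb{R}^d,\qquad u(0,x)=0,\quad \frac{\partial u}{\partial t}(0,x)=0,\ x\in\mathbb{R}^d,$$ exists if and only if the measure $\mu$ satisfies $$\int_{\mathbb{R}^d}\left(\frac{1}{1+|\xi|^2}\right)^{H+1/2}\mu(d\xi)<\infty.$$ In this case, for all $p\ge2$ and $T>0$, $$\sup_{t\in[0,T]}\sup_{x\in\mathbb{R}^d}E|u(t,x)|^p<\infty,$$ and the map $(t,x)\mapsto u(t,x)$ is continuous from $\mathbb{R}_+\times\mathbb{R}^d$ into $L^2(\Omega)$.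
   Context: Fix $d\ge 1$ and $H\in(1/2,1)$; put $\alpha_H=H(2H-1)$ and $R_H(t,s)=\frac12(t^{2H}+s^{2H}-|t-s|^{2H})$. $\mathcal{F}\varphi(\xi)=\int_{\mathbb{R}^d}e^{-i\xi\cdot x}\varphi(x)\,dx$ is the Fourier transform in space. $\mu$ is a non-negative tempered measure on $\mathbb{R}^d$, i.e. $\int_{\mathbb{R}^d}(1+|\xi|^2)^{-l}\mu(d\xi)<\infty$ for some $l>0$, whose Fourier transform in $\mathcal{S}'(\mathbb{R}^d)$ is a function $f:\mathbb{R}^d\to\mathbb{R}_+$, i.e. $\int f\phi\,dx=\int\mathcal{F}\phi\,d\mu$ for all $\phi\in\mathcal{S}(\mathbb{R}^d)$. Noise: on a complete probability space, $W=\{W_t(A);\,t\ge0,\,A\subset\mathbb{R}^d\text{ bounded Borel}\}$ is a zero-mean Gaussian process with $E(W_t(A)W_s(B))=R_H(t,s)\int_A\int_Bf(x-y)\,dx\,dy=:\langle1_{[0,t]\times A},1_{[0,s]\times B}\rangle_{\mathcal{HP}}$. $\mathcal{E}$ is the set of linear combinations of the functions $1_{[0,t]\times A}$, and $\mathcal{HP}$ is the Hilbert space closure of $\mathcal{E}$ for $\langle\cdot,\cdot\rangle_{\mathcal{HP}}$. On $\mathcal{E}$, $$\|\varphi\|_{\mathcal{HP}}^2=\alpha_H\int_{\mathbb{R}^d}\int_0^\infty\int_0^\infty\mathcal{F}\varphi(u,\cdot)(\xi)\overline{\mathcal{F}\varphi(v,\cdot)(\xi)}|u-v|^{2H-2}\,du\,dv\,\mu(d\xi).$$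 The map $1_{[0,t]\times A}\mapsto W_t(A)$ extends to an isometry $\varphi\mapsto W(\varphi)=\int_0^\infty\int_{\mathbb{R}^d}\varphi(t,x)W(dt,dx)$ from $\mathcal{HP}$ into $L^2(\Omega)$. A map $t\mapsto\varphi(t,\cdot)\in\mathcal{S}'(\mathbb{R}^d)$ vanishing for $t$ outside a bounded interval, with $\mathcal{F}\varphi(t,\cdot)(\xi)$ a jointly measurable function bounded in $t$ for each $\xi$, is said to belong to $\mathcal{HP}$ if it is the limit of elements of $\mathcal{E}$ in the norm given by the displayed formula; it is then identified with the corresponding element of $\mathcal{HP}$. Solution: let $G_1$ be the fundamental solution of $u_{tt}-\Delta u=0$; $G_1(t,\cdot)\in\mathcal{S}'(\mathbb{R}^d)$ is the distribution with $\mathcal{F}G_1(t,\cdot)(\xi)=\sin(t|\xi|)/|\xi|$, $t>0$. The solution is the process $u(t,x)=\int_0^t\int_{\mathbb{R}^d}G_1(t-s,x-y)W(ds,dy)=W(g_{tx})$, where $g_{tx}(s,\cdot)=G_1(t-s,x-\cdot)$ for $s\in[0,t]$ and $0$ otherwise. By definition $u(t,x)$ exists if and only if $g_{tx}\in\mathcal{HP}$; the solution $u$ exists if this holds for all $(t,x)$. *)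

(* Defs.v *)
From HB Require Import structures.
From mathcomp Require Import all_boot all_order all_algebra.
From mathcomp Require Import all_classical all_reals all_analysis.
From mathcomp Require Import complex measurable_realfun.

Set Implicit Arguments.
Unset Strict Implicit.
Unset Printing Implicit Defensive.

Import Order.TTheory GRing.Theory Num.Theory.
Import numFieldNormedType.Exports.

Local Open Scope classical_set_scope.
Local Open Scope ring_scope.

Section borel_rV.
Context {R : realType} {d : nat}.

Let borel_setC (A : set 'rV[R]_d) :
  <<s @open 'rV[R]_d >> A -> <<s @open 'rV[R]_d >> (~` A).
Proof. exact: sigma_algebraC. Qed.

HB.instance Definition _ :=
  @isMeasurable.Build (sigma_display (@open 'rV[R]_d)) 'rV[R]_d
    <<s @open 'rV[R]_d >> (@sigma_algebra0 _ _ _) borel_setC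
    (@sigma_algebra_bigcup _ _ _).

Lemma continuous_measurable_rV (f : 'rV[R]_d -> R) :
  continuous f -> measurable_fun setT f.
Proof.
move=> cf; apply: (measurability (@RGenOpens.G R)).
  exact: RGenOpens.measurableE.
move=> _ [_ [a [b ->] <-]]; rewrite setTI; apply: sub_sigma_algebra.
by apply: open_comp => [x _|]; [exact: cf|exact: interval_open].
Qed.

Lemma measurable_coord (i : 'I_d) :
  measurable_fun setT (fun x : 'rV[R]_d => x 0 i).
Proof. by apply: continuous_measurable_rV; exact: coord_continuous. Qed.

Lemma open_bigcup_ball_rV (U : set 'rV[R]_d) : open U ->
  U = \bigcup_(p : 'rV[rat]_d * nat)
    (if `[< ball (map_mx ratr p.1 : 'rV[R]_d) (p.2.+1%:R^-1) `<=` U >] then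
       ball (map_mx ratr p.1 : 'rV[R]_d) (p.2.+1%:R^-1) else set0).
Proof.
move=> oU; apply/seteqP; split => [x Ux|x [p _]]; last first.
  by case: ifPn => // /asboolP; apply.
have /nbhs_ballP[e /= e0 xeU] : nbhs x U by exact: open_nbhs_nbhs.
have [n ne] : exists n, n.+1%:R^-1 < e / 2 :> R.
  have e20 : 0 < (e / 2)^-1 by rewrite invr_gt0 divr_gt0.
  exists (Num.truncn (e / 2)^-1); rewrite invf_plt ?posrE ?divr_gt0//.
  exact: truncnS_gt.
have n0 : 0 < n.+1%:R^-1 :> R by rewrite invr_gt0.
have /choice[q qP] : forall i : 'I_d, exists q : rat,
    ball (ratr q : R) (n.+1%:R^-1) (x 0 i).
  move=> i; have : x 0 i - n.+1%:R^-1 < x 0 i + n.+1%:R^-1.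
    by rewrite ltrD2l gtrN.
  move=> /rat_in_itvoo[q]; rewrite in_itv/= => qx; exists q.
  by rewrite /ball/= distrC ltr_distlC.
exists (\row_i q i, n) => //=.
have xq : ball (map_mx ratr (\row_i q i) : 'rV[R]_d) (n.+1%:R^-1) x.
  by split => // i j; rewrite !mxE (ord1 i); exact: qP.
case: ifPn => // /asboolPn; apply: contra_notP => _ y qy; apply: xeU.
apply: (@le_ball _ _ _ (n.+1%:R^-1 + n.+1%:R^-1)).
  by rewrite [leRHS](splitr e) lerD// ltW.
by apply: ball_triangle qy; exact: ball_sym.
Qed.

Lemma measurable_fun_rVP d' (T : measurableType d') (f : T -> 'rV[R]_d) :
  measurable_fun setT f <->
  forall i, measurable_fun setT (fun t => f t 0 i).
Proof.
split=> [mf i|mf]; first exact: measurableT_comp (measurable_coord i) mf.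
apply: (measurability (@open 'rV[R]_d)) => //.
move=> _ [U oU <-]; rewrite setTI (open_bigcup_ball_rV oU) preimage_bigcup.
apply: countable_bigcupT_measurable => // -[q n].
case: ifPn => _; last by rewrite preimage_set0.
rewrite (_ : _ @^-1` _ = \bigcap_(i in [set: 'I_d])
    ((fun t => f t 0 i) @^-1` ball (ratr (q 0 i) : R) n.+1%:R^-1)).
  apply: fin_bigcap_measurable => // i _; rewrite -[X in measurable X]setTI.
  by apply: mf => //; exact: measurable_ball.
apply/seteqP; split => [t [_ qt] i _|t qt].
  by have := qt 0 i; rewrite !mxE.
by split => [|i j]; [rewrite invr_gt0|rewrite mxE (ord1 i); exact: qt].
Qed.

End borel_rV.

Section lebesgue_rV.
Context {R : realType}.

Definition rV_cons d (p : R * 'rV[R]_d) : 'rV[R]_d.+1 := row_mx (p.1)%:M p.2.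

Lemma rV_cons0 d (p : R * 'rV[R]_d) : rV_cons p 0 ord0 = p.1.
Proof.
have := row_mxEl ((p.1)%:M : 'M[R]_1) p.2 0 ord0; rewrite [RHS]mxE mulr1n => <-.
by congr (row_mx _ _ _ _); exact/val_inj.
Qed.

Lemma rV_consS d (p : R * 'rV[R]_d) (j : 'I_d) :
  rV_cons p 0 (lift ord0 j) = p.2 0 j.
Proof.
rewrite -(row_mxEr ((p.1)%:M : 'M[R]_1) p.2 0 j).
by congr (row_mx _ _ _ _); exact/val_inj.
Qed.

Lemma measurable_rV_cons d : measurable_fun setT (@rV_cons d).
Proof.
apply/measurable_fun_rVP => i; case: (unliftP ord0 i) => [j ->|->].
  apply: (eq_measurable_fun (fun p : R * 'rV[R]_d => p.2 0 j)) => [p _|].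
    by rewrite rV_consS.
  exact: measurableT_comp (measurable_coord j) measurable_snd.
apply: (eq_measurable_fun fst) => [p _|]; last exact: measurable_fst.
by rewrite rV_cons0.
Qed.

Section lebesgue_cons.
Context (d : nat) (m : {sigma_finite_measure set 'rV[R]_d -> \bar R}).

Definition lebesgue_cons :=
  pushforward (@lebesgue_measure R \x m)%E (@rV_cons d).

Let lebesgue_cons0 : lebesgue_cons set0 = 0%E.
Proof. by rewrite /lebesgue_cons /pushforward preimage_set0 measure0. Qed.

Let lebesgue_cons_ge0 A : (0 <= lebesgue_cons A)%E.
Proof. exact: (measure_ge0 (@lebesgue_measure R \x m)%E). Qed.

Let lebesgue_cons_sigma_additive : semi_sigma_additive lebesgue_cons.
Proof.
move=> F mF tF mUF; rewrite /lebesgue_cons /pushforward preimage_bigcup.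
have mV A : measurable A -> measurable (@rV_cons d @^-1` A).
  by move=> mA; rewrite -[X in measurable X]setTI; exact: measurable_rV_cons.
apply: measure_semi_sigma_additive => [n||]; first exact: mV.
- apply/trivIsetP => /= i j _ _ ij; rewrite -preimage_setI.
  by move/trivIsetP : tF => /(_ _ _ _ _ ij) ->//; rewrite preimage_set0.
- by rewrite -preimage_bigcup; exact: mV.
Qed.

HB.instance Definition _ := isMeasure.Build _ _ _ lebesgue_cons
  lebesgue_cons0 lebesgue_cons_ge0 lebesgue_cons_sigma_additive.

Let lebesgue_cons_sigma_finite : sigma_finite setT lebesgue_cons.
Proof.
have /sigma_finiteP[F [TF ndF Foo]] := sigma_finiteT (@lebesgue_measure R).
have /sigma_finiteP[G [TG ndG Goo]] := sigma_finiteT m.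
pose g (x : 'rV[R]_d.+1) : R * 'rV[R]_d := (x 0 ord0, \row_j x 0 (lift ord0 j)).
have gK p : g (rV_cons p) = p.
  rewrite /g rV_cons0 [RHS]surjective_pairing; congr pair.
  by apply/rowP => j; rewrite mxE rV_consS.
have mg : measurable_fun setT g.
  apply: measurable_fun_pair; first exact: measurable_coord.
  apply/measurable_fun_rVP => i.
  apply: (eq_measurable_fun (fun x : 'rV[R]_d.+1 => x 0 (lift ord0 i))).
    by move=> x _; rewrite mxE.
  exact: measurable_coord.
have FgE n : @rV_cons d @^-1` (g @^-1` (F n `*` G n)) = F n `*` G n.
  rewrite -comp_preimage (_ : g \o _ = id) ?preimage_id//.
  by apply/funext => p /=; exact: gK.
exists (fun n => g @^-1` (F n `*` G n)).
  rewrite -preimage_bigcup -[LHS](preimage_setT g); congr (_ @^-1` _).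
  rewrite -setXTT TF TG; apply/seteqP; split => -[x y].
    move=> [/= [n _ Fnx] [k _ Gky]]; exists (maxn n k) => //; split.
    - by move: x Fnx; exact/subsetPset/ndF/leq_maxl.
    - by move: y Gky; exact/subsetPset/ndG/leq_maxr.
  by move=> [n _ []/= ? ?]; split; exists n.
move=> n; have [mFn Fnoo] := Foo n; have [mGn Gnoo] := Goo n; split.
  by rewrite -[X in measurable X]setTI; apply: mg => //; exact: measurableX.
rewrite /lebesgue_cons /pushforward FgE product_measure1E//.
by rewrite lte_mul_pinfty// ge0_fin_numE.
Qed.

HB.instance Definition _ := Measure_isSigmaFinite.Build _ _ _ lebesgue_cons
  lebesgue_cons_sigma_finite.

End lebesgue_cons.

Fixpoint leb d : {sigma_finite_measure set 'rV[R]_d -> \bar R} :=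
  if d is d'.+1 then lebesgue_cons (leb d') else dirac (0 : 'rV[R]_0).

Lemma leb_box d (a b : 'I_d -> R) : (forall i, a i <= b i) ->
  leb d [set x | forall i, a i <= x 0 i <= b i] =
  (\prod_(i < d) (b i - a i))%:E.
Proof.
elim: d => [|d IHd] in a b * => ab.
  by rewrite big_ord0 /= diracE mem_set// => -[].
rewrite /= /lebesgue_cons /pushforward big_ord_recl.
rewrite (_ : _ @^-1` _ = `[a ord0, b ord0] `*` [set x : 'rV[R]_d |
    forall i, a (lift ord0 i) <= x 0 i <= b (lift ord0 i)]).
  rewrite product_measure1E//; last first.
    rewrite (_ : [set _ | _] = \bigcap_(i in [set: 'I_d])
      ((fun x : 'rV[R]_d => x 0 i) @^-1` `[a (lift ord0 i), b (lift ord0 i)])).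
      apply: fin_bigcap_measurable => // i _; rewrite -[X in measurable X]setTI.
      exact: measurable_coord.
    apply/seteqP; split => x /= xab i; last by have := xab i I; rewrite /= in_itv.
    by move=> _; rewrite /= in_itv/=.
  rewrite IHd// EFinM; congr (_ * _)%E.
  have := @lebesgue_measure_itv R `[a ord0, b ord0].
  rewrite /= lte_fin lt_neqAle ab andbT => ->.
  by case: eqVneq => [->|_] /=; rewrite ?subrr// -EFinB.
apply/seteqP; split => -[x y] /=.
  move=> xyab; split => [|i]; first by have := xyab ord0; rewrite rV_cons0 in_itv.
  by have := xyab (lift ord0 i); rewrite rV_consS.
move=> -[]; rewrite in_itv/= => xab yab i.
by case: (unliftP ord0 i) => [j ->|->]; rewrite ?rV_cons0 ?rV_consS.
Qed.

End lebesgue_rV.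

Section fourier.
Context {R : realType} {d : nat}.

Definition dotp (x y : 'rV[R]_d) : R := \sum_(i < d) x 0 i * y 0 i.

(* The norm of the library on 'rV[R]_d is the sup norm. *)
Definition enorm (x : 'rV[R]_d) : R := Num.sqrt (dotp x x).

End fourier.

Section complex_integral.
Context {R : realType} d (T : measurableType d).

Definition cmeasurable (D : set T) (h : T -> R[i]) : Prop :=
  measurable_fun D (fun x => complex.Re (h x)) /\
  measurable_fun D (fun x => complex.Im (h x)).

Definition cintegrable (mu : {measure set T -> \bar R}) (h : T -> R[i]) : Prop :=
  mu.-integrable setT (fun x => (complex.Re (h x))%:E) /\
  mu.-integrable setT (fun x => (complex.Im (h x))%:E).

Definition cintegral (mu : {measure set T -> \bar R}) (D : set T)
    (h : T -> R[i]) : R[i] :=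
  Complex (\int[mu]_(x in D) complex.Re (h x))
          (\int[mu]_(x in D) complex.Im (h x)).

End complex_integral.

Definition ccontinuous {R : realType} (T : topologicalType) (h : T -> R[i]) : Prop :=
  continuous (fun x => complex.Re (h x)) /\
  continuous (fun x => complex.Im (h x)).

Definition cexp {R : realType} (theta : R) : R[i] := Complex (cos theta) (sin theta).

Definition fourier {R : realType} {d} (phi : 'rV[R]_d -> R[i]) (xi : 'rV[R]_d) : R[i] :=
  cintegral (leb d) setT (fun x => cexp (- dotp xi x) * phi x).

(* Only the values on Schwartz functions are relevant. *)
Definition rV_distr (R : realType) (d : nat) := ('rV[R]_d -> R[i]) -> R[i].

Section tempered_distributions.
Context {R : realType} {d : nat}.
Implicit Types (phi psi : 'rV[R]_d -> R[i]).

Fixpoint partials (s : seq 'I_d) (phi : 'rV[R]_d -> R) : 'rV[R]_d -> R :=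
  if s is i :: s' then 'D_(delta_mx 0 i) (partials s' phi) else phi.

(* Since all the iterated partial derivatives are required to exist and to be
   bounded, they are continuous. *)
Definition schwartz_real (phi : 'rV[R]_d -> R) : Prop :=
  (forall s i x, derivable (partials s phi) x (delta_mx 0 i)) /\
  (forall s (k : nat), exists M : R, forall x,
     (1 + enorm x ^+ 2) ^+ k * `|partials s phi x| <= M).

Definition schwartz phi : Prop :=
  schwartz_real (fun x => complex.Re (phi x)) /\
  schwartz_real (fun x => complex.Im (phi x)).

Definition seminorm_le (k : nat) phi (M : R) : Prop :=
  forall s : seq 'I_d, (size s <= k)%N -> forall x,
    (1 + enorm x ^+ 2) ^+ k * `|partials s (fun y => complex.Re (phi y)) x| <= M /\
    (1 + enorm x ^+ 2) ^+ k * `|partials s (fun y => complex.Im (phi y)) x| <= M.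

Definition tempered (D : rV_distr R d) : Prop :=
  (forall (a : R[i]) phi psi, schwartz phi -> schwartz psi ->
     D (fun x => a * phi x + psi x) = a * D phi + D psi) /\
  (exists (k : nat) (C : R), forall phi M, schwartz phi -> seminorm_le k phi M ->
     ComplexField.Normc.normc (D phi) <= C * M).

Definition distr_fourier (D : rV_distr R d) : rV_distr R d :=
  fun phi => D (fourier phi).

Definition distr_of_measure (mu : {measure set 'rV[R]_d -> \bar R}) : rV_distr R d :=
  fun phi => cintegral mu setT phi.

Definition distr_is_function (D : rV_distr R d) (h : 'rV[R]_d -> R[i]) : Prop :=
  forall phi, schwartz phi ->
    cintegrable (leb d) (fun x => h x * phi x) /\
    D phi = cintegral (leb d) setT (fun x => h x * phi x).

(* The distribution D(x - .), i.e. D reflected and translated by x. *)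
Definition distr_reflect (x : 'rV[R]_d) (D : rV_distr R d) : rV_distr R d :=
  fun phi => D (fun y => phi (x - y)).

End tempered_distributions.

Section noise.
Context {R : realType} {d : nat}.

Definition alphaH (H : R) : R := H * (2 * H - 1).

Definition RH (H t s : R) : R :=
  (t `^ (2 * H) + s `^ (2 * H) - `|t - s| `^ (2 * H)) / 2.

Definition tempered_measure (mu : {measure set 'rV[R]_d -> \bar R}) : Prop :=
  exists l : R, 0 < l /\
    (\int[mu]_xi ((1 + enorm xi ^+ 2) `^ (- l))%:E < +oo)%E.

Definition bounded_borel (A : set 'rV[R]_d) : Prop :=
  measurable A /\ bounded_set A.

(* A (presentation of a) real linear combination of functions 1_{[0,t] x A}. *)
Record elementary := Elementary {
  el_size : nat;
  el_coef : 'I_el_size -> R;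
  el_time : 'I_el_size -> R;
  el_set : 'I_el_size -> set 'rV[R]_d;
  el_time_ge0 : forall j, 0 <= el_time j;
  el_set_bounded_borel : forall j, bounded_borel (el_set j) }.

Definition el_fun (e : elementary) (s : R) (y : 'rV[R]_d) : R :=
  \sum_(j < el_size e) el_coef j * \1_(`[0, el_time j]%classic) s * \1_(el_set j) y.

Definition el_fourier (e : elementary) (s : R) : 'rV[R]_d -> R[i] :=
  fourier (fun y => (el_fun e s y)%:C%C).

(* [h u xi] stands for the Fourier transform in space of phi(u, .) at xi. The
   double integral is a nonnegative real number. *)
Definition HP_norm2 (H : R) (mu : {measure set 'rV[R]_d -> \bar R})
    (h : R -> 'rV[R]_d -> R[i]) : \bar R :=
  ((alphaH H)%:E * \int[mu]_xi
    (complex.Re (cintegral (@lebesgue_measure R) `]0, +oo[ (fun u =>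
       cintegral (@lebesgue_measure R) `]0, +oo[ (fun v =>
         h u xi * (h v xi)^*%C * (`|u - v| `^ (2 * H - 2))%:C%C))))%:E)%E.

(* As mu may charge Lebesgue-null sets, F phi(t, .) must be a well-defined
   function and not just an almost-everywhere class: it is the continuous
   function representing the distribution F phi(t, .). *)
Definition fourier_in_space (phi : R -> rV_distr R d)
    (h : R -> 'rV[R]_d -> R[i]) : Prop :=
  [/\ forall t, [/\ tempered (phi t),
        distr_is_function (distr_fourier (phi t)) (h t) & ccontinuous (h t)],
      cmeasurable setT (fun p : R * 'rV[R]_d => h p.1 p.2),
      forall xi, exists M : R, forall t, ComplexField.Normc.normc (h t xi) <= M &
      exists b : R, forall t, b < `|t| -> forall psi, schwartz psi -> phi t psi = 0].

Definition HP_limit (H : R) (mu : {measure set 'rV[R]_d -> \bar R})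
    (e : nat -> elementary) (phi : R -> rV_distr R d) : Prop :=
  exists2 h, fourier_in_space phi h &
    HP_norm2 H mu (fun s xi => h s xi - el_fourier (e n) s xi) @[n --> \oo] --> 0%E.

Definition in_HP (H : R) (mu : {measure set 'rV[R]_d -> \bar R})
    (phi : R -> rV_distr R d) : Prop :=
  exists e, HP_limit H mu e phi.

End noise.

Section wiener_integral.
Context {R : realType} {d : nat} {dOm : measure_display} {Om : measurableType dOm}
  (P : probability Om R).
Implicit Types W : R -> set 'rV[R]_d -> {RV P >-> R}.

Definition el_integral W (e : @elementary R d) (w : Om) : R :=
  \sum_(j < el_size e) el_coef j * W (el_time j) (el_set j) w.

(* normal_prob m s is the Gaussian law of standard deviation s only if s != 0. *)
Definition gaussian (X : Om -> R) : Prop :=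
  exists m s : R, 0 <= s /\ forall B : set R, measurable B ->
    P (X @^-1` B) = if s == 0 then \d_m B else normal_prob m s B.

Definition gaussian_noise (H : R) (f : 'rV[R]_d -> R) W : Prop :=
  [/\ forall e : elementary, gaussian (el_integral W e),
      forall (t : R) (A : set 'rV[R]_d), 0 <= t -> bounded_borel A -> ('E_P[W t A] = 0)%E &
      forall (t s : R) (A B : set 'rV[R]_d), 0 <= t -> 0 <= s -> bounded_borel A -> bounded_borel B ->
        ('E_P[fun w => (W t A w * W s B w)%R] =
        (RH H t s)%:E *
          \int[leb d]_(x in A) \int[leb d]_(y in B) (f (x - y))%:E)%E].

(* X is (a version of) W(phi). *)
Definition is_wiener_integral (H : R) (mu : {measure set 'rV[R]_d -> \bar R}) W
    (phi : R -> rV_distr R d) (X : {RV P >-> R}) : Prop :=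
  exists2 e, HP_limit H mu e phi &
    ('E_P[fun w => ((el_integral W (e n) w - X w) ^+ 2)%R])%E @[n --> \oo] --> 0%E.

End wiener_integral.

Section wave_equation.
Context {R : realType} {d : nat}.

(* sin (t|xi|) / |xi|, extended by continuity at xi = 0. *)
Definition wave_fourier (t : R) (xi : 'rV[R]_d) : R :=
  if enorm xi == 0 then t else sin (t * enorm xi) / enorm xi.

(* G1 t is the fundamental solution of the wave equation at time t; the formula
   gives G1 0 = 0. *)
Definition wave_kernel (G1 : R -> rV_distr R d) : Prop :=
  forall t, 0 <= t -> tempered (G1 t) /\
    distr_is_function (distr_fourier (G1 t)) (fun xi => (wave_fourier t xi)%:C%C).

Definition wave_integrand (G1 : R -> rV_distr R d) (t : R) (x : 'rV[R]_d) :
    R -> rV_distr R d :=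
  fun s => if 0 <= s <= t then distr_reflect x (G1 (t - s)) else fun=> 0.

Definition wave_solution_exists (H : R) (mu : {measure set 'rV[R]_d -> \bar R})
    (G1 : R -> rV_distr R d) : Prop :=
  forall t x, 0 <= t -> in_HP H mu (wave_integrand G1 t x).

Definition wave_solution (H : R) (mu : {measure set 'rV[R]_d -> \bar R})
    (G1 : R -> rV_distr R d)
    {dOm : measure_display} {Om : measurableType dOm} (P : probability Om R)
    (W : R -> set 'rV[R]_d -> {RV P >-> R})
    (u : R -> 'rV[R]_d -> {RV P >-> R}) : Prop :=
  forall t x, 0 <= t ->
    is_wiener_integral H mu W (wave_integrand G1 t x) (u t x).

End wave_equation.

(* Main.v *)
Require Import Defs.
From HB Require Import structures.
From mathcomp Require Import all_boot all_order all_algebra.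
From mathcomp Require Import all_classical all_reals all_analysis.
From mathcomp Require Import complex measurable_realfun.
From mathcomp Require Import ring lra.

(** A fundamental solution with transform [sin (t r) / r], [r] the modulus of the frequency,
    is integrated against the noise. Everything rests on a good expression for the norm of
    the space of integrands. Up to a constant, the fractional kernel [|u - v|^(2H-2)] is the
    superposition over [l > 0], with weight [l^(2H-4)], of the tents [max 0 (l - |u - v|)], and a
    tent is the length of the set of windows [[z - l, z]] that contain both [u] and [v]. Hence
    the double time integral of a function [a] is the integral, over all windows, of the square
    of the integral of [a] over the window ([energy], [energy_kernel]). In this form it is
    plainly the square of a seminorm, it is measurable in a parameter, and it can be bounded
    from both sides; the norm is the integral of the energy with respect to [mu]
    ([HP_norm2E]).

    For the wave multiplier the integral over a window of length [l] is at most
    [min (l / r) (2 / r^2)], and for long times it is of this order on a large set of windows;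
    so the energy is comparable to [(1 + r^2)^-(H + 1/2)] ([wave_energy_upper],
    [wave_energy_lower]). Since the transform of the integrand is the only continuous function
    representing it ([HP_limit_waveE]), membership at time 4 bounds the energy of the wave up to
    a simple function, whose norm is finite, and gives the integrability condition
    ([wave_weight_fin]).

    Conversely the integrand must be approximated by simple functions. Testing the relation
    between [f] and [mu] on Gaussians yields Parseval's identity for indicators of bounded sets
    ([parseval_sets]); a staircase below a Gaussian then approximates a damped character in the
    square norm of [mu] ([gauss_el_approx]). The frequency profiles that can be reached are
    closed under sums and dominated limits, contain the powers of [r^2] because
    [n (1 - exp (- y / n))] tends to [y], and so contain the damped multiplier, by the power
    series of the sine ([sp_approx_wave]). Cutting time into steps and removing the damping by
    dominated convergence gives [wave_approximation].

    On the probability side the Wiener integral is an isometry on simple functions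
    ([el_integral_isometry]), and completeness provides the solution. The second moment of a
    Gaussian variable controls all the others ([gaussian_moments]); the bound passes to the
    limit by Fatou's lemma ([wave_solution_moment]). Continuity in mean square is, by the
    isometry, continuity of the wave in the energy norm, which is dominated convergence
    ([wave_profile_cvg], [wave_solution_dist]). *)

Set Implicit Arguments.
Unset Strict Implicit.
Unset Printing Implicit Defensive.
Import Order.TTheory GRing.Theory Num.Theory.
Import numFieldNormedType.Exports.
Local Open Scope classical_set_scope.
Local Open Scope ring_scope.

(** * Integrals of powers *)

Section power_integrals.
Context {R : realType}.
Notation leb1 := (@lebesgue_measure R).

Lemma continuous_powR_gt0 (p x : R) : 0 < x -> {for x, continuous (@powR R ^~ p)}.
Proof.
move=> x0; apply: differentiable_continuous; apply/derivable1_diffP.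
by apply: derivable_powR; rewrite in_itv/= x0.
Qed.

Lemma is_derive_powR_div (p x : R) : p + 1 != 0 -> 0 < x ->
  is_derive x 1 (fun y => y `^ (p + 1) / (p + 1)) (x `^ p).
Proof.
move=> p0 x0.
have D := is_derive1_powR (p + 1) x0.
apply: (@is_derive_eq _ _ _ _ _ _ _ _ (is_deriveM D (is_derive_cst (p+1)^-1 x 1))).
by rewrite addrK scaler0 add0r /GRing.scale/= mulrA mulVf// mul1r.
Qed.

Lemma integral_powR_itv (p a b : R) : p + 1 != 0 -> 0 < a -> a < b ->
  (\int[leb1]_(x in `[a, b]) (x `^ p)%:E =
   (b `^ (p + 1) / (p + 1) - a `^ (p + 1) / (p + 1))%:E)%E.
Proof.
move=> p0 a0 ab.
have cF x : 0 < x -> {for x, continuous (fun y : R => y `^ (p + 1) / (p + 1))}.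
  move=> x0; apply: differentiable_continuous; apply/derivable1_diffP.
  by have [] := is_derive_powR_div p0 x0.
rewrite (@continuous_FTC2 _ (fun x => x `^ p) (fun x => x `^ (p + 1) / (p + 1)))//.
- apply: continuous_in_subspaceT => x; rewrite inE/= in_itv/= => /andP[ax _].
  exact/continuous_powR_gt0/(lt_le_trans a0).
- split.
  + move=> x; rewrite in_itv/= => /andP[ax _].
    by have [] := is_derive_powR_div p0 (lt_trans a0 ax).
  + exact/cvg_at_right_filter/cF.
  + exact/cvg_at_left_filter/cF/(lt_trans a0).
- move=> x; rewrite in_itv/= => /andP[ax _].
  rewrite derive1E; have X := is_derive_powR_div p0 (lt_trans a0 ax).
  by rewrite derive_val.
Qed.

(** Limit of the integrals over the intervals [[c / (n + 2), c]], since the primitive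
    vanishes at 0. *)
Lemma integral_powR_0 (p c : R) : -1 < p -> 0 < c ->
  (\int[leb1]_(x in `]0%R, c]) (x `^ p)%:E = (c `^ (p + 1) / (p + 1))%:E)%E.
Proof.
move=> p1 c0.
have p0 : 0 < p + 1 by rewrite -ltrBlDr sub0r.
pose F n := `[c / n.+2%:R, c]%classic.
have -> : `]0, c]%classic = \bigcup_n F n.
  apply/seteqP; split => x /=.
    rewrite in_itv/= => /andP[x0 xc].
    exists (Num.truncn (c / x)) => //; rewrite /F/= in_itv/= xc andbT.
    rewrite ler_pdivrMr// mulrC -ler_pdivrMr//.
    apply: le_trans (ltW (truncnS_gt _)) _; by rewrite ler_nat.
  move=> [n _]; rewrite /F/= !in_itv/= => /andP[+ ->]; rewrite andbT.
  by apply: lt_le_trans; rewrite divr_gt0.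
have H1 : (\int[leb1]_(x in F i) (x `^ p)%:E @[i --> \oo] -->
    \int[leb1]_(x in \bigcup_i F i) (x `^ p)%:E)%E.
  apply: ge0_nondecreasing_set_cvg_integral => //.
  - apply/nondecreasing_seqP => n; apply/subsetPset => x.
    rewrite /F/= !in_itv/= => /andP[+ ->]; rewrite andbT; apply: le_trans.
    by rewrite ler_pM2l// lef_pV2 ?posrE// ler_nat.
  - by move=> n; exact: measurable_itv.
  - by move=> n; apply/measurable_EFinP; apply: measurable_funTS; exact: measurable_powR.
  - by move=> *; rewrite lee_fin powR_ge0.
have H2 : (\int[leb1]_(x in F i) (x `^ p)%:E @[i --> \oo] -->
    (c `^ (p + 1) / (p + 1))%:E)%E.
  under eq_fun => n.
    rewrite integral_powR_itv ?gt_eqF ?divr_gt0//; last first.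
      by rewrite ltr_pdivrMr// ltr_pMr// ltr1n.
    over.
  apply: cvg_EFin; first exact: nearW.
  rewrite /comp/= -[X in _ --> X]subr0; apply: cvgB; first exact: cvg_cst.
  rewrite -[X in _ --> X](mul0r (p + 1)^-1); apply: cvgM; last exact: cvg_cst.
  have := powR_cvg0 p0; move/cvg_at_rightP; apply; split.
    by move=> n; rewrite divr_gt0.
  rewrite -[X in _ --> X](mulr0 c); apply: cvgM; first exact: cvg_cst.
  by have := @cvg_harmonic R; rewrite -cvg_shiftS.
exact: cvg_unique H1 H2.
Qed.

Lemma powR_cvgy0 (q : R) : q < 0 -> x `^ q @[x --> +oo] --> (0 : R).
Proof.
move=> q0; rewrite -oppr_gt0 in q0.
rewrite (_ : (fun x => x `^ q) = (fun x => (x `^ (- q))^-1)); last first.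
  by apply/funext => x; rewrite -powRN opprK.
apply/(@gtr0_cvgV0 _ _ _ _ (fun x => x `^ (- q))).
  by near=> x; apply: powR_gt0; near: x; exact: nbhs_pinfty_gt.
apply/cvgryPge => A; near=> x.
have H : (`|A| + 1) `^ ((- q)^-1) <= x by near: x; apply: nbhs_pinfty_ge; rewrite num_real.
apply: (@le_trans _ _ (`|A| + 1)).
  by rewrite (le_trans (ler_norm _))// lerDl.
have -> : `|A| + 1 = ((`|A| + 1) `^ ((- q)^-1)) `^ (- q).
  by rewrite -powRrM mulVf ?lt0r_neq0// powRr1 ?addr_ge0.
apply: ge0_ler_powR => //; rewrite ?nnegrE ?powR_ge0//; exact: ltW.
Unshelve. all: by end_near. Qed.

Lemma integral_powR_y (q c : R) : q < -1 -> 0 < c ->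
  (\int[leb1]_(x in `[c, +oo[) (x `^ q)%:E = (c `^ (q + 1) / - (q + 1))%:E)%E.
Proof.
move=> q1 c0.
have q0 : q + 1 < 0 by rewrite -ltrBrDr sub0r.
have cF x : 0 < x -> {for x, continuous (fun y : R => y `^ (q + 1) / (q + 1))}.
  move=> x0; apply: differentiable_continuous; apply/derivable1_diffP.
  by have [] := is_derive_powR_div (ltr0_neq0 q0) x0.
rewrite (@ge0_continuous_FTC2y _ _ (fun x => x `^ (q + 1) / (q + 1)) _ 0)//.
- by rewrite -EFinB sub0r invrN mulrN.
- by move=> x _; exact: powR_ge0.
- apply: continuous_in_subspaceT => x; rewrite inE/= in_itv/= andbT => ax.
  exact/continuous_powR_gt0/(lt_le_trans c0).
- rewrite -[X in _ --> X](mul0r (q + 1)^-1); apply: cvgM; last exact: cvg_cst.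
  exact: powR_cvgy0.
- move=> x cx; by have [] := is_derive_powR_div (ltr0_neq0 q0) (lt_trans c0 cx).
- exact/cvg_at_right_filter/cF.
- move=> x; rewrite in_itv/= andbT => ax.
  rewrite derive1E; have X := is_derive_powR_div (ltr0_neq0 q0) (lt_trans c0 ax).
  by rewrite derive_val.
Qed.

End power_integrals.

(** * Tonelli theorem and affine changes of variable *)

Section tonelli.
Context d1 d2 (T1 : measurableType d1) (T2 : measurableType d2) (R : realType).

Lemma integral_swap (m1 : {sigma_finite_measure set T1 -> \bar R})
  (m2 : {sigma_finite_measure set T2 -> \bar R}) (F : T1 -> T2 -> \bar R) :
  measurable_fun setT (fun q => F q.1 q.2) -> (forall x y, (0 <= F x y)%E) ->
  (\int[m1]_x \int[m2]_y F x y = \int[m2]_y \int[m1]_x F x y)%E.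
Proof.
move=> mF F0.
by rewrite (fubini_tonelli (m1 := m1) (m2 := m2) (fun q => F q.1 q.2)).
Qed.

Lemma integral_prod_measure (m1 : {sigma_finite_measure set T1 -> \bar R})
  (m2 : {sigma_finite_measure set T2 -> \bar R}) (F : T1 -> T2 -> \bar R) :
  measurable_fun setT (fun q => F q.1 q.2) -> (forall x y, (0 <= F x y)%E) ->
  (\int[m1 \x m2]_q F q.1 q.2 = \int[m1]_x \int[m2]_y F x y)%E.
Proof. by move=> mF F0; rewrite fubini_tonelli1. Qed.

Lemma measurable_integralr (m2 : {sigma_finite_measure set T2 -> \bar R})
  (F : T1 -> T2 -> \bar R) :
  measurable_fun setT (fun q => F q.1 q.2) -> (forall x y, (0 <= F x y)%E) ->
  measurable_fun setT (fun x => \int[m2]_y F x y)%E.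
Proof.
move=> mF F0.
exact: (measurable_fun_fubini_tonelli_F (m2 := m2) (fun q => F q.1 q.2)).
Qed.

Lemma measurable_Rintegralr (m2 : {sigma_finite_measure set T2 -> \bar R})
  (F : T1 -> T2 -> R) :
  measurable_fun setT (fun q => F q.1 q.2) ->
  measurable_fun setT (fun x => \int[m2]_y F x y)%R.
Proof.
move=> mF; rewrite /Rintegral.
apply: measurableT_comp; first exact: fine_measurable.
under eq_fun do rewrite integralE.
apply: emeasurable_funB.
- apply: (eq_measurable_fun (fun x => \int[m2]_y maxe (F x y)%:E 0)%E).
    by move=> x _; apply: eq_integral => y _; rewrite funeposE.
  apply: measurable_integralr => [|x y].
    by apply: measurable_maxe => //; exact/measurable_EFinP.
  by rewrite le_max lexx orbT.
- apply: (eq_measurable_fun (fun x => \int[m2]_y maxe (- (F x y)%:E) 0)%E).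
    by move=> x _; apply: eq_integral => y _; rewrite funenegE.
  apply: measurable_integralr => [|x y].
    apply: measurable_maxe => //; apply: measurableT_comp => //.
    exact/measurable_EFinP.
  by rewrite le_max lexx orbT.
Qed.

End tonelli.
Arguments integral_swap {d1 d2 T1 T2 R} m1 m2 F.
Arguments measurable_integralr {d1 d2 T1 T2 R} m2 F.
Arguments measurable_Rintegralr {d1 d2 T1 T2 R} m2 F.

Section product_sigma_finite.
Context d1 d2 (T1 : measurableType d1) (T2 : measurableType d2) (R : realType).
Variables (m1 : {sigma_finite_measure set T1 -> \bar R})
  (m2 : {sigma_finite_measure set T2 -> \bar R}).

Lemma product_sigma_finite : sigma_finite setT (m1 \x m2)%E.
Proof.
have /sigma_finiteP[F [TF ndF Foo]] := sigma_finiteT m1.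
have /sigma_finiteP[G [TG ndG Goo]] := sigma_finiteT m2.
exists (fun n => F n `*` G n).
  rewrite -setXTT TF TG; apply/seteqP; split => -[x y].
    move=> [/= [n _ Fnx] [k _ Gky]]; exists (maxn n k) => //; split.
    - by move: x Fnx; exact/subsetPset/ndF/leq_maxl.
    - by move: y Gky; exact/subsetPset/ndG/leq_maxr.
  by move=> [n _ []/= ? ?]; split; exists n.
move=> n; have [mFn Fnoo] := Foo n; have [mGn Gnoo] := Goo n; split.
  exact: measurableX.
by rewrite product_measure1E// lte_mul_pinfty// ge0_fin_numE.
Qed.

Definition sigma_finite_product : {sigma_finite_measure set (T1 * T2)%type -> \bar R} :=
  HB.pack (product_measure1 m1 m2)
    (Measure_isSigmaFinite.Build _ _ _ (m1 \x m2)%E product_sigma_finite).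

End product_sigma_finite.

Section affine_change.
Context {R : realType}.
Notation leb1 := (@lebesgue_measure R).

Lemma measurable_affine (c b : R) :
  measurable_fun setT (fun x : R => c * x + b).
Proof.
by apply: measurable_funD; [apply: measurable_funM|].
Qed.

Lemma lebesgue_measure_affine (c b : R) : c != 0 -> forall A : set R, measurable A ->
  (leb1 A = `|c|%:E * leb1 ((fun x : R => c * x + b)%R @^-1` A))%E.
Proof.
move=> c0.
pose phi (x : measurableTypeR R) : measurableTypeR R := c * x + b.
pose m : {measure set (measurableTypeR R) -> \bar R} := mscale (NngNum (normr_ge0 c)) (pushforward leb1 phi).
have mphi := measurable_affine c b.
move=> A mA; rewrite (@lebesgue_measure_unique _ (m mphi))//.
move=> _ [[x y]] _ <-; rewrite /m/= /mscale/= /pushforward.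
have [c0'|c0'|c0'] := ltgtP c 0; last by rewrite c0' eqxx in c0.
- have -> : phi @^-1` [set` `]x, y]] = `[(y - b) / c, (x - b) / c[%classic.
    apply/seteqP; split => z /=; rewrite !in_itv/= ler_ndivrMr// ltr_ndivlMr// lerBrDr ltrBlDr;
      by rewrite (mulrC z) andbC.
  rewrite !lebesgue_measure_itv/= !lte_fin.
  rewrite ltr_nM2r ?invr_lt0// ltrD2r ltr0_norm//.
  case: ifPn => _; rewrite ?mule0// -!EFinD -EFinM; congr EFin; by field.
- have -> : phi @^-1` [set` `]x, y]] = `](x - b) / c, (y - b) / c]%classic.
    apply/seteqP; split => z /=; rewrite !in_itv/= ltr_pdivrMr// ler_pdivlMr// lerBrDr ltrBlDr;
      by rewrite (mulrC z).
  rewrite !lebesgue_measure_itv/= !lte_fin.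
  rewrite ltr_pM2r ?invr_gt0// ltrD2r gtr0_norm//.
  case: ifPn => _; rewrite ?mule0// -!EFinD -EFinM; congr EFin; by field.
Qed.

(** Lebesgue measure is characterised by its values on intervals. *)
Lemma integral_affine (c b : R) (f : R -> \bar R) : c != 0 ->
  measurable_fun setT f -> (forall x, (0 <= f x)%E) ->
  (\int[leb1]_x f x = `|c|%:E * \int[leb1]_x f (c * x + b)%R)%E.
Proof.
move=> c0 mf f0.
pose phi (x : measurableTypeR R) : measurableTypeR R := c * x + b.
pose m : {measure set (measurableTypeR R) -> \bar R} := mscale (NngNum (normr_ge0 c)) (pushforward leb1 phi).
have mphi := measurable_affine c b.
rewrite (eq_measure_integral (m mphi)); last first.
  by move=> A mA _; rewrite /m/= /mscale/= /pushforward; exact: lebesgue_measure_affine.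
rewrite ge0_integral_mscale//; congr (_ * _)%E.
by rewrite ge0_integral_pushforward.
Qed.

End affine_change.

(** * Decomposition of the fractional kernel into tents *)

Lemma measurable_fun_fst d d1 d2 (T : measurableType d) (T1 : measurableType d1)
  (T2 : measurableType d2) (D : set T) (f : T -> T1 * T2) :
  measurable_fun D f -> measurable_fun D (fun x => (f x).1).
Proof. exact: measurableT_comp measurable_fst. Qed.

Lemma measurable_fun_snd d d1 d2 (T : measurableType d) (T1 : measurableType d1)
  (T2 : measurableType d2) (D : set T) (f : T -> T1 * T2) :
  measurable_fun D f -> measurable_fun D (fun x => (f x).2).
Proof. exact: measurableT_comp measurable_snd. Qed.

Ltac meas1 := lazymatch goal with
| |- measurable_fun _ (fun _ => ?c) => exact: measurable_cst
| |- measurable_fun _ (fun x => x) => exact: measurable_id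
| |- measurable_fun _ (fun x => EFin (@?f x)) => apply/measurable_EFinP
| |- measurable_fun _ (EFin \o _) => apply/measurable_EFinP
| |- measurable_fun _ (fun x => (@?f x * @?g x)%R) => apply: (@measurable_funM _ _ _ _ f g)
| |- measurable_fun _ (fun x => (@?f x + - @?g x)%R) => apply: (@measurable_funB _ _ _ _ f g)
| |- measurable_fun _ (fun x => (@?f x + @?g x)%R) => apply: (@measurable_funD _ _ _ _ f g)
| |- measurable_fun _ (fun x => (- @?f x)%R) => apply: (@measurable_funN _ _ _ _ f)
| |- measurable_fun _ (fun x => (@?f x ^+ ?n)%R) => apply: (@measurable_funX _ _ _ _ f n)
| |- measurable_fun _ (fun x => Num.max (@?f x) (@?g x)) => apply: (@measurable_maxr _ _ _ _ f g)
| |- measurable_fun _ (fun x => Num.min (@?f x) (@?g x)) => apply: (@measurable_minr _ _ _ _ f g)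
| |- measurable_fun _ (fun x => (@?f x <= @?g x)%R) => apply: (@measurable_fun_ler _ _ _ _ f g)
| |- measurable_fun _ (fun x => (@?f x < @?g x)%R) => apply: (@measurable_fun_ltr _ _ _ _ f g)
| |- measurable_fun _ (Order.lt ?c) => apply: (@measurable_fun_ltr _ _ _ _ (fun=> c) id)
| |- measurable_fun _ (Order.le ?c) => apply: (@measurable_fun_ler _ _ _ _ (fun=> c) id)
| |- measurable_fun _ (GRing.add ?c) => apply: (@measurable_funD _ _ _ _ (fun=> c) id)
| |- measurable_fun _ (GRing.mul ?c) => apply: (@measurable_funM _ _ _ _ (fun=> c) id)
| |- measurable_fun _ id => exact: measurable_id
| |- measurable_fun _ (fun x => (@?f x && @?g x)) => apply: (@measurable_and _ _ _ f g)
| |- measurable_fun _ (fun x => powR (@?f x) ?p) => apply: (measurableT_comp (measurable_powR p) (g := f))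
| |- measurable_fun _ (fun x => expR (@?f x)) => apply: (measurableT_comp (@measurable_expR _) (g := f))
| |- measurable_fun _ (fun x => (`|@?f x|)%R) => apply: (measurableT_comp (@normr_measurable _ setT) (g := f))
| |- measurable_fun _ (fun x => fst x) => exact: measurable_fst
| |- measurable_fun _ (fun x => snd x) => exact: measurable_snd
| |- measurable_fun _ fst => exact: measurable_fst
| |- measurable_fun _ snd => exact: measurable_snd
| |- measurable_fun _ (fun x => fst (@?f x)) => apply: measurable_fun_fst
| |- measurable_fun _ (fun x => snd (@?f x)) => apply: measurable_fun_snd
| |- measurable_fun _ (fun x => (@?f x, @?g x)) => apply: (@measurable_fun_pair _ _ _ _ _ _ f g)
| |- measurable_fun _ _ => apply: measurable_fun_ifT
end.
(** Redefined below, whenever a new function is known to be measurable. *)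
Ltac meas_hint := fail.
Ltac meas := repeat first [assumption | meas_hint | meas1].

Section energy.
Context {R : realType} (H : R).
Notation leb1 := (@lebesgue_measure R).

Definition tent_cst : R := alphaH H * (2 - 2 * H) * (3 - 2 * H).
Definition tent_weight (l : R) : R :=
  if 0 < l then tent_cst * l `^ (2 * H - 4) else 0.
(** The indicator of the window [[z - l, z]], where [p = (l, z)], cut at the origin of
    time. *)
Definition window (p : R * R) (u : R) : R :=
  if ((p.2 - p.1 <= u) && (u <= p.2)) && (0 < u) then 1 else 0.
Definition time_kernel (u v : R) : R :=
  if (0 < u) && (0 < v) then alphaH H * `|u - v| `^ (2 * H - 2) else 0.

(** The windows are weighted so that this is the double integral of [a u * a v] against
    [time_kernel u v]; as an integral of squares it makes sense, and behaves well, for all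
    [a]. *)
Definition energy (a : R -> R) : \bar R :=
  (\int[leb1 \x leb1]_p
    (tent_weight p.1 * (\int[leb1]_u (window p u * a u)) ^+ 2)%R%:E)%E.

Lemma measurable_window :
  measurable_fun setT (fun q : (R * R) * R => window q.1 q.2).
Proof. by rewrite /window; meas. Qed.

Lemma measurable_tent_weight : measurable_fun setT tent_weight.
Proof. by rewrite /tent_weight; meas. Qed.

Lemma measurable_time_kernel :
  measurable_fun setT (fun q : R * R => time_kernel q.1 q.2).
Proof. by rewrite /time_kernel; meas. Qed.

Lemma measurable_windowl u : measurable_fun setT (fun p => window p u).
Proof. by rewrite /window; meas. Qed.

Lemma measurable_windowr p : measurable_fun setT (window p).
Proof. by rewrite /window; meas. Qed.

Ltac meas_hint ::= first [exact: measurable_windowr | exact: measurable_windowl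
 | exact: measurable_tent_weight | exact: measurable_time_kernel].

Lemma window_ge0 p u : 0 <= window p u.
Proof. by rewrite /window; case: ifP. Qed.

Hypothesis hH : 1 / 2 < H < 1.

Lemma alphaH_gt0 : 0 < alphaH H.
Proof. by have /andP[h1 h2] := hH; rewrite /alphaH; nra. Qed.

Lemma tent_cst_gt0 : 0 < tent_cst.
Proof. by have /andP[h1 h2] := hH; rewrite /tent_cst !mulr_gt0 ?alphaH_gt0//; lra. Qed.

Lemma tent_weight_ge0 l : 0 <= tent_weight l.
Proof.
rewrite /tent_weight; case: ifP => // _.
by rewrite mulr_ge0 ?powR_ge0// ltW// tent_cst_gt0.
Qed.

Lemma time_kernel_ge0 u v : 0 <= time_kernel u v.
Proof.
rewrite /time_kernel; case: ifP => // _.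
by rewrite mulr_ge0 ?powR_ge0// ltW// alphaH_gt0.
Qed.

(** Differentiating the right hand side twice in [r] gives the tent weight at [r]; the
    constant [tent_cst] is chosen for that. *)
Lemma integral_tent (r : R) : 0 < r ->
  (\int[leb1]_l (tent_weight l * Num.max 0 (l - r))%:E =
    (alphaH H * r `^ (2 * H - 2))%:E)%E.
Proof.
move=> r0; have /andP[h1 h2] := hH.
have -> : (\int[leb1]_l (tent_weight l * Num.max 0 (l - r))%:E =
  \int[leb1]_(l in `[r, +oo[) (tent_cst%:E * (l `^ (2 * H - 4) * (l - r))%:E))%E.
  rewrite [RHS]integral_mkcond; apply: eq_integral => l _.
  rewrite patchE mem_setE in_itv/= andbT; case: ifPn => rl.
    by rewrite -EFinM /tent_weight (lt_le_trans r0 rl) max_r ?subr_ge0// mulrA.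
  by rewrite max_l ?mulr0// subr_le0 ltW// ltNge.
have m1 : measurable_fun `[r, +oo[ (fun l : R => (l `^ (2 * H - 4) * (l - r))%:E).
  by apply/measurable_EFinP; apply: measurable_funTS; meas.
rewrite ge0_integralZl//; last 2 first.
- by move=> l /=; rewrite in_itv/= andbT => rl; rewrite lee_fin mulr_ge0 ?powR_ge0 ?subr_ge0.
- by rewrite lee_fin ltW// tent_cst_gt0.
have E1 : (\int[leb1]_(l in `[r, +oo[) (l `^ (2 * H - 3))%:E =
   \int[leb1]_(l in `[r, +oo[) (l `^ (2 * H - 4) * (l - r))%:E +
   r%:E * \int[leb1]_(l in `[r, +oo[) (l `^ (2 * H - 4))%:E)%E.
  rewrite -ge0_integralZl//; last 3 first.
  - by apply/measurable_EFinP; apply: measurable_funTS; meas.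
  - by move=> l _; rewrite lee_fin powR_ge0.
  - by rewrite lee_fin ltW.
  rewrite -ge0_integralD//; last 3 first.
  - by move=> l /=; rewrite in_itv/= andbT => rl; rewrite lee_fin mulr_ge0 ?powR_ge0 ?subr_ge0.
  - by move=> l _; rewrite -EFinM lee_fin mulr_ge0 ?powR_ge0// ltW.
  - apply: measurable_funeM.
    by apply/measurable_EFinP; apply: measurable_funTS; meas.
  apply: eq_integral => l; rewrite inE/= in_itv/= andbT => rl.
  rewrite -EFinM -EFinD; congr EFin.
  have -> : 2 * H - 3 = (2 * H - 4) + 1 by ring.
  have l0 : 0 < l := lt_le_trans r0 rl.
  rewrite (@powRD _ l) ?(gt_eqF l0) ?implybT//; last first.
  rewrite powRr1 ?ltW//; ring.
move: E1; rewrite !integral_powR_y//; [|lra|lra].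
have -> : 2 * H - 3 + 1 = 2 * H - 2 by ring.
have -> : 2 * H - 4 + 1 = 2 * H - 3 by ring.
have -> : r `^ (2 * H - 2) = r * r `^ (2 * H - 3).
  have -> : 2 * H - 2 = (2 * H - 3) + 1 by ring.
  by rewrite (@powRD _ r) ?(gt_eqF r0) ?implybT// powRr1 ?ltW// mulrC.
set X := (\int[_]_(x in _) _)%E; case: X => [x| |] //.
rewrite -!EFinM -EFinD => -[xE]; congr EFin; rewrite /tent_cst.
set q := r `^ _ in xE *.
have -> : x = r * q / - (2 * H - 2) - r * (q / - (2 * H - 3)) by rewrite xE; ring.
by field; apply/andP; split; apply/eqP; lra.
Qed.

Lemma window_window (l u v z : R) : 0 < l -> window (l, z) u * window (l, z) v =
  (if (0 < u) && (0 < v) then 1 else 0) *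
  \1_(`[Num.max u v, (Num.min u v + l)]%classic) z.
Proof.
move=> l0; rewrite /window/= indicE mem_setE in_itv/= ge_max.
have -> : (z <= Num.min u v + l) = (z - l <= u) && (z - l <= v).
  by rewrite -lerBlDr le_min.
case: (0 < u); case: (0 < v); rewrite ?andbF ?andbT/= ?mulr0 ?mul0r// mul1r.
by case: (_ - _ <= u); case: (_ - _ <= v); case: (u <= z); case: (v <= z);
  rewrite /= ?mulr0 ?mul0r ?mulr1.
Qed.

(** The windows of length [l] that contain both points are those whose right end lies
    between [max u v] and [min u v + l]. *)
Lemma integral_window (l u v : R) : 0 < l ->
  (\int[leb1]_z (window (l, z) u * window (l, z) v)%:E =
   ((if (0 < u) && (0 < v) then 1 else 0) * Num.max 0 (l - `|u - v|))%:E)%E.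
Proof.
move=> l0; under eq_integral => z _ do rewrite window_window// EFinM.
rewrite ge0_integralZl//; last 2 first.
- by apply/measurable_EFinP; exact: measurable_indic.
- by rewrite lee_fin; case: ifP.
rewrite integral_indic// setIT EFinM; congr (_ * _)%E.
have := @lebesgue_measure_itv R `[Num.max u v, (Num.min u v + l)].
rewrite /= => ->; rewrite lte_fin -EFinB.
have E : Num.min u v + l - Num.max u v = l - `|u - v|.
  have [uv|uv] := leP u v; first by rewrite ler0_norm ?subr_le0//; ring.
  by rewrite ger0_norm ?subr_ge0 1?ltW//; ring.
rewrite -E -subr_gt0; by case: ltP.
Qed.

Lemma integral_window2 (u v : R) : u != v ->
  (\int[leb1 \x leb1]_p (tent_weight p.1 * window p u * window p v)%:E =
   (time_kernel u v)%:E)%E.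
Proof.
move=> uv.
rewrite fubini_tonelli1//=; last 2 first.
- apply/measurable_EFinP; apply: measurable_funM; first apply: measurable_funM.
  + exact: measurableT_comp measurable_tent_weight measurable_fst.
  + exact: measurable_windowl.
  + exact: measurable_windowl.
- by move=> p; rewrite lee_fin !mulr_ge0 ?tent_weight_ge0 ?window_ge0.
transitivity (\int[leb1]_l ((if (0 < u) && (0 < v) then 1 else 0)%:E *
   (tent_weight l * Num.max 0 (l - `|u - v|))%:E))%E.
  apply: eq_integral => l _; rewrite /fubini_F/=; have [l0|l0] := ltP 0 l; last first.
    rewrite /tent_weight ltNge l0/= mul0r mule0.
    by under eq_integral do rewrite !mul0r; rewrite integral0.
  under eq_integral => z _ do rewrite -mulrA EFinM.
  rewrite ge0_integralZl//; last 3 first.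
  - apply/measurable_EFinP; apply: measurable_funM.
      by rewrite /window; meas.
    by rewrite /window; meas.
  - by move=> z _; rewrite lee_fin mulr_ge0 ?window_ge0.
  - by rewrite lee_fin tent_weight_ge0.
  by rewrite integral_window// -!EFinM; congr EFin; rewrite mulrCA.
rewrite ge0_integralZl//; last 3 first.
- apply/measurable_EFinP; apply: measurable_funM; first exact: measurable_tent_weight.
  by apply: measurable_maxr; meas.
- by move=> l _; rewrite lee_fin mulr_ge0 ?tent_weight_ge0// le_max lexx.
- by rewrite lee_fin; case: ifP.
rewrite integral_tent ?normr_gt0 ?subr_eq0// /time_kernel -EFinM.
by case: ifP => _; rewrite ?mul1r ?mul0r.
Qed.

(** Tonelli and [integral_window2]; the diagonal, where the kernel is not the
    superposition of the tents, is negligible. *)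
Lemma energy_bilinear (a b : R -> R) : measurable_fun setT a -> measurable_fun setT b ->
  (forall u, 0 <= a u) -> (forall u, 0 <= b u) ->
  (\int[leb1 \x leb1]_p ((tent_weight p.1)%:E *
     ((\int[leb1]_u (window p u * a u)%:E) * (\int[leb1]_v (window p v * b v)%:E))) =
   \int[leb1]_u \int[leb1]_v (time_kernel u v * (a u * b v))%:E)%E.
Proof.
move=> ma mb a0 b0.
pose F (q : ((R * R) * R) * R) : R :=
  tent_weight q.1.1.1 * window q.1.1 q.1.2 * window q.1.1 q.2 * (a q.1.2 * b q.2).
have mF : measurable_fun setT F.
  apply: measurable_funM; [apply: measurable_funM; [apply: measurable_funM|]|apply: measurable_funM].
  - by apply: measurableT_comp measurable_tent_weight _; meas.
  - exact: measurableT_comp measurable_window measurable_fst.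
  - apply: (measurableT_comp measurable_window (g := fun q : ((R * R) * R) * R => (q.1.1, q.2))).
    by apply: measurable_fun_pair; meas.
  - by apply: measurableT_comp ma _; meas.
  - by apply: measurableT_comp mb _; meas.
have F0 q : 0 <= F q.
  by rewrite /F !mulr_ge0 ?tent_weight_ge0 ?window_ge0.
have mw p : measurable_fun setT (window p).
  exact: measurable_windowr.
transitivity (\int[leb1 \x leb1]_p \int[leb1]_u \int[leb1]_v (F ((p, u), v))%:E)%E.
  apply: eq_integral => p _.
  rewrite -ge0_integralZr//; last 3 first.
  - by apply/measurable_EFinP; meas.
  - by move=> u _; rewrite lee_fin mulr_ge0 ?window_ge0.
  - by apply: integral_ge0 => v _; rewrite lee_fin mulr_ge0 ?window_ge0.
  rewrite -ge0_integralZl//; last 3 first.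
  - apply: emeasurable_funM; first by apply/measurable_EFinP; meas.
    exact: measurable_cst.
  - move=> u _; rewrite mule_ge0//; first by rewrite lee_fin mulr_ge0 ?window_ge0.
    by apply: integral_ge0 => v _; rewrite lee_fin mulr_ge0 ?window_ge0.
  - by rewrite lee_fin tent_weight_ge0.
  apply: eq_integral => u _.
  rewrite muleA -EFinM -ge0_integralZl//; last 3 first.
  - by apply/measurable_EFinP; meas.
  - by move=> v _; rewrite lee_fin mulr_ge0 ?window_ge0.
  - by rewrite lee_fin !mulr_ge0 ?tent_weight_ge0 ?window_ge0.
  apply: eq_integral => v _; rewrite -EFinM /F/=; congr EFin; ring.
pose F1 (q : (R * R) * R) := (\int[leb1]_v (F (q, v))%:E)%E.
have mF1 : measurable_fun setT F1.
  apply: (measurable_fun_fubini_tonelli_F (m2 := leb1) (EFin \o F)) => //.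
  exact/measurable_EFinP.
have F10 q : (0 <= F1 q)%E by apply: integral_ge0 => v _; rewrite lee_fin.
rewrite (integral_swap (sigma_finite_product leb1 leb1) leb1 (fun p u => F1 (p, u)))//.
apply: eq_integral => u _; rewrite /F1.
rewrite (integral_swap (sigma_finite_product leb1 leb1) leb1 (fun p v => (F ((p, u), v))%:E)); last 2 first.
- apply/measurable_EFinP; apply: (measurableT_comp mF (g := fun q : (R * R) * R => ((q.1, u), q.2))).
  by apply: measurable_fun_pair; meas; apply: measurable_fun_pair; meas.
- by move=> p v; rewrite lee_fin.
have E v : u != v -> (\int[(leb1 \x leb1)%E]_x (F (x, u, v))%:E = (time_kernel u v * (a u * b v))%:E)%E.
  move=> uv; under eq_integral => p _ do rewrite /F/= EFinM.
  rewrite ge0_integralZr//; last 3 first.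
  - apply/measurable_EFinP; apply: measurable_funM; first apply: measurable_funM.
    + exact: measurableT_comp measurable_tent_weight measurable_fst.
    + exact: measurable_windowl.
    + exact: measurable_windowl.
  - by move=> p _; rewrite lee_fin !mulr_ge0 ?tent_weight_ge0 ?window_ge0.
  - by rewrite lee_fin mulr_ge0.
  by rewrite integral_window2.
apply: ge0_ae_eq_integral => //.
- apply: (measurable_fun_fubini_tonelli_G (m1 := sigma_finite_product leb1 leb1) (fun q : (R * R) * R => (F ((q.1, u), q.2))%:E)) => //.
  + apply/measurable_EFinP; apply: (measurableT_comp mF (g := fun q : (R * R) * R => ((q.1, u), q.2))).
    by apply: measurable_fun_pair; meas; apply: measurable_fun_pair; meas.
  + by move=> q; rewrite lee_fin.
- apply/measurable_EFinP; apply: measurable_funM.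
    by rewrite /time_kernel; meas.
  by meas.
- by move=> v _; apply: integral_ge0 => p _; rewrite lee_fin.
- by move=> v _; rewrite lee_fin mulr_ge0 ?time_kernel_ge0// mulr_ge0.
- exists ([set u] : set R); split => //; first exact: lebesgue_measure_set1.
  move=> v /=; apply: contra_notP => uv _; apply: E.
  by apply/eqP => uv'; apply: uv.
Qed.

End energy.

(** * The fractional covariance *)

Section rh_kernel.
Context {R : realType} (H : R).
Notation leb1 := (@lebesgue_measure R).
Notation time_kernel := (time_kernel H).
Hypothesis hH : 1 / 2 < H < 1.

Lemma integral_itv_shift (f : R -> R) (a b c : R) :
  measurable_fun setT f -> (forall x, 0 <= f x) ->
  (\int[leb1]_(x in `]a, b]) (f (x - c))%:E =
   \int[leb1]_(x in `](a - c)%R, (b - c)%R]) (f x)%:E)%E.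
Proof.
move=> mf f0; rewrite integral_mkcond [RHS]integral_mkcond.
rewrite (@integral_affine _ 1 c)//; last 2 first.
- apply/(measurable_restrictT _ _).1 => //; apply/measurable_EFinP.
  apply: measurable_funTS; apply: measurableT_comp => //; meas.
- by move=> x; rewrite patchE; case: ifP => // _; rewrite lee_fin.
rewrite normr1 mul1e; apply: eq_integral => x _.
rewrite !patchE !mem_setE !in_itv/= mul1r addrK.
by rewrite ltrBlDr lerBrDr.
Qed.

Lemma integral_itv_reflect (f : R -> R) (a b c : R) :
  measurable_fun setT f -> (forall x, 0 <= f x) ->
  (\int[leb1]_(x in `]a, b]) (f (c - x))%:E =
   \int[leb1]_(x in `](c - b)%R, (c - a)%R]) (f x)%:E)%E.
Proof.
move=> mf f0; rewrite -[RHS]integral_itv_bndo_bndc; last first.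
  by apply/measurable_EFinP; apply: measurable_funTS.
rewrite [RHS](@integral_itv_obnd_cbnd _ (c - b) (BLeft (c - a))); last first.
  by apply/measurable_EFinP; apply: measurable_funTS.
rewrite integral_mkcond [RHS]integral_mkcond.
rewrite (@integral_affine _ (-1) c)//; last 2 first.
- apply/(measurable_restrictT _ _).1 => //; apply/measurable_EFinP.
  apply: measurable_funTS; apply: measurableT_comp => //; meas.
- by move=> x; rewrite patchE; case: ifP => // _; rewrite lee_fin.
rewrite normrN1 mul1e; apply: eq_integral => x _.
rewrite !patchE !mem_setE !in_itv/= mulN1r opprD opprK addrCA subrr addr0.
have -> // : (a < - x + c <= b) = (c - b <= x < c - a).
by apply/andP/andP => -[? ?]; split; lra.
Qed.

Lemma integral_powR_itv0 (p a b : R) : -1 < p -> 0 <= a -> a <= b ->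
  (\int[leb1]_(x in `]a, b]) (x `^ p)%:E =
   (b `^ (p + 1) / (p + 1) - a `^ (p + 1) / (p + 1))%:E)%E.
Proof.
move=> p1 a0; have p0 : 0 < p + 1 by rewrite -ltrBlDr sub0r.
rewrite le_eqVlt => /predU1P[<-|ab].
  by rewrite set_itvoc0 integral_set0 subrr.
have := integral_powR_0 p1 (le_lt_trans a0 ab).
move: a0; rewrite le_eqVlt => /predU1P[<- ->|a0].
  by rewrite powR0 ?gt_eqF// mul0r subr0.
have -> : `]0, b]%classic = `]0, a] `|` `]a, b].
  by rewrite -itv_bndbnd_setU// bnd_simp// ltW.
have mp D : measurable_fun D (fun x : R => (x `^ p)%:E).
  by apply/measurable_EFinP; apply: measurable_funTS; exact: measurable_powR.
rewrite ge0_integral_setU//; last 3 first.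
- exact: mp.
- by move=> x _; rewrite lee_fin powR_ge0.
- apply/disj_setPS => x [] /=; rewrite !in_itv/= => /andP[_ xa] /andP[ax _].
  by rewrite ltNge xa in ax.
rewrite integral_powR_0//; set X := (\int[_]_(x in _) _)%E.
by case: X => [x| |]// -[<-]; rewrite addrAC subrr add0r.
Qed.

Lemma integral_kernel_slice (s u : R) : 0 < u -> u <= s ->
  (\int[leb1]_v (time_kernel u v * \1_(`[0, s]%classic) v)%:E =
   (H * (u `^ (2 * H - 1) + (s - u) `^ (2 * H - 1)))%:E)%E.
Proof.
move=> u0 us; have /andP[h1 h2] := hH.
have s0 : 0 < s := lt_le_trans u0 us.
transitivity (\int[leb1]_(v in `]0%R, s]) ((alphaH H)%:E * (`|u - v| `^ (2 * H - 2))%:E))%E.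
  rewrite [RHS]integral_mkcond; apply: eq_integral => v _.
  rewrite patchE mem_setE indicE mem_setE !in_itv/= /time_kernel u0/=.
  case: (ltP 0 v) => v0; rewrite ?mul0r//= (ltW v0)/=.
  by case: (v <= s); rewrite ?mulr1 ?mulr0.
have mp D : measurable_fun D (fun v : R => (`|u - v| `^ (2 * H - 2))%:E).
  by apply/measurable_EFinP; apply: measurable_funTS; meas.
rewrite ge0_integralZl//; try solve [exact: mp | by move=> *; rewrite lee_fin powR_ge0 |
  by rewrite lee_fin ltW// alphaH_gt0].
have -> : `]0, s]%classic = `]0, u] `|` `]u, s].
  by rewrite -itv_bndbnd_setU// bnd_simp// ltW.
rewrite ge0_integral_setU//; try solve [exact: mp | by move=> *; rewrite lee_fin powR_ge0]; last first.
  apply/disj_setPS => x [] /=; rewrite !in_itv/= => /andP[_ xa] /andP[ax _].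
  by rewrite ltNge xa in ax.
have -> : (\int[leb1]_(x in `]0%R, u]) (`|u - x| `^ (2 * H - 2))%:E =
  \int[leb1]_(x in `]0%R, u]) ((fun y => y `^ (2 * H - 2)) (u - x)%R)%:E)%E.
  apply: eq_integral => x; rewrite inE/= in_itv/= => /andP[_ xu].
  by rewrite ger0_norm// subr_ge0.
have -> : (\int[leb1]_(x in `]u, s]) (`|u - x| `^ (2 * H - 2))%:E =
  \int[leb1]_(x in `]u, s]) ((fun y => y `^ (2 * H - 2)) (x - u)%R)%:E)%E.
  apply: eq_integral => x; rewrite inE/= in_itv/= => /andP[ux _].
  by rewrite distrC ger0_norm// subr_ge0 ltW.
rewrite (@integral_itv_reflect (fun y => y `^ (2 * H - 2)) 0 u u)//; try solve [exact: measurable_powR | by move=> ?; exact: powR_ge0].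
rewrite (@integral_itv_shift (fun y => y `^ (2 * H - 2)) u s u)//; try solve [exact: measurable_powR | by move=> ?; exact: powR_ge0].
rewrite !subrr subr0 !integral_powR_itv0//; [|lra|by rewrite subr_ge0|lra|exact: ltW].
have -> : 2 * H - 2 + 1 = 2 * H - 1 by ring.
rewrite powR0; last by rewrite gt_eqF//; lra.
rewrite -EFinD -EFinM; congr EFin; rewrite /alphaH; field; apply/eqP; lra.
Qed.

(** For [t <= s] the inner integral runs on both sides of [u] and is explicit. *)
Lemma integral_kernel_le (t s : R) : 0 <= t -> t <= s ->
  (\int[leb1]_u \int[leb1]_v
     (time_kernel u v * (\1_(`[0, t]%classic) u * \1_(`[0, s]%classic) v))%:E
   = (RH H t s)%:E)%E.
Proof.
move=> t0 ts; have /andP[h1 h2] := hH.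
transitivity (\int[leb1]_(u in `]0%R, t]) (H%:E * ((u `^ (2 * H - 1))%:E + ((s - u) `^ (2 * H - 1))%:E)))%E.
  rewrite [RHS]integral_mkcond; apply: eq_integral => u _.
  rewrite patchE mem_setE in_itv/=.
  case: ifPn => [/andP[u0 ut]|ut].
    rewrite -EFinD -EFinM -integral_kernel_slice// ?(le_trans ut)//.
    by apply: eq_integral => v _; rewrite [X in X * _ v]indicE mem_setE in_itv/= (ltW u0) ut mul1r.
  rewrite integral0_eq// => v _; rewrite indicE mem_setE in_itv/= /time_kernel.
  move: ut; rewrite negb_and -leNgt -ltNge => /orP[u0|tu].
    by rewrite ltNge u0 mul0r.
  by rewrite (leNgt u) tu andbF mul0r mulr0.
have mp D : measurable_fun D (fun u : R => (u `^ (2 * H - 1))%:E).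
  by apply/measurable_EFinP; apply: measurable_funTS; meas.
have mq D : measurable_fun D (fun u : R => ((s - u) `^ (2 * H - 1))%:E).
  by apply/measurable_EFinP; apply: measurable_funTS; meas.
rewrite ge0_integralZl//; last 3 first.
- by apply: emeasurable_funD; [exact: mp|exact: mq].
- by move=> v _; rewrite lee_fin addr_ge0// powR_ge0.
- by rewrite lee_fin; lra.
rewrite ge0_integralD//; try solve [exact: mp | exact: mq | by move=> *; rewrite lee_fin powR_ge0].
have := @integral_itv_reflect (fun y => y `^ (2 * H - 1)) 0 t s.
move=> /(_ (measurable_powR _))/= ->; last by move=> ?; exact: powR_ge0.
rewrite subr0 !integral_powR_itv0//; [|lra|by rewrite subr_ge0|by rewrite gerBl|lra].
have -> : 2 * H - 1 + 1 = 2 * H by ring.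
rewrite powR0; last by rewrite gt_eqF//; lra.
rewrite -EFinD -EFinM; congr EFin; rewrite /RH distrC ger0_norm ?subr_ge0//.
field; apply/eqP; lra.
Qed.

Lemma time_kernelC u v : time_kernel u v = time_kernel v u.
Proof. by rewrite /time_kernel andbC distrC. Qed.

Lemma integral_kernel_indic (t s : R) : 0 <= t -> 0 <= s ->
  (\int[leb1]_u \int[leb1]_v
     (time_kernel u v * (\1_(`[0, t]%classic) u * \1_(`[0, s]%classic) v))%:E
   = (RH H t s)%:E)%E.
Proof.
move=> t0 s0; have [ts|/ltW st] := leP t s; first exact: integral_kernel_le.
rewrite (integral_swap leb1 leb1 (fun u v => (time_kernel u v * (\1_(`[0, t]%classic) u * \1_(`[0, s]%classic) v))%:E)); last 2 first.
- apply/measurable_EFinP; apply: measurable_funM; first exact: measurable_time_kernel.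
  by apply: measurable_funM; apply: (measurableT_comp (measurable_indic _)) => //.
- by move=> u v; rewrite lee_fin mulr_ge0 ?time_kernel_ge0// mulr_ge0.
transitivity (RH H s t)%:E; last first.
  by rewrite /RH distrC addrC (addrC (s `^ _)) addrC.
apply: etrans (integral_kernel_le s0 st); apply: eq_integral => u _.
by apply: eq_integral => v _; rewrite time_kernelC (mulrC (\1_ `[0, t] _)).
Qed.

End rh_kernel.

(** * The energy of signed functions *)

Arguments integral_prod_measure {d1 d2 T1 T2 R} m1 m2 F.

Section Rintegral_product.
Context d1 d2 (T1 : measurableType d1) (T2 : measurableType d2) (R : realType).
Variables (m1 : {sigma_finite_measure set T1 -> \bar R})
  (m2 : {sigma_finite_measure set T2 -> \bar R}).

(** The inner integral may be infinite on a negligible set, where its real value is taken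
    to be 0. *)
Lemma Rintegral_Fubini (k : T1 * T2 -> R) :
  (m1 \x m2)%E.-integrable setT (EFin \o k) ->
  ((\int[m1]_x \int[m2]_y k (x, y))%R%:E = \int[m1 \x m2]_q (k q)%:E)%E.
Proof.
move=> IK; have IF := integrable_fubini_F IK.
have mF : measurable_fun setT (fun x => (fine (fubini_F m2 (EFin \o k) x))%:E).
  apply/measurable_EFinP; apply: measurableT_comp; first exact: fine_measurable.
  exact: measurable_int IF.
rewrite -integral12_prod_meas1//.
transitivity (\int[m1]_x (fine (fubini_F m2 (EFin \o k) x))%:E)%E.
  rewrite fineK//; apply: integrable_fin_num => //.
  apply: (le_integrable _ _ _ IF) => //.
  have fle (x : \bar R) : (`|(fine x)%:E| <= `|x|)%E by case: x => [r| |] //=; exact: leey.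
  by move=> u _; exact: fle.
apply: ae_eq_integral => //; first exact: measurable_int IF.
have := integrable_ae measurableT IF; apply: filterS => u /(_ I) h _.
by rewrite fineK.
Qed.

End Rintegral_product.

Section signed_energy.
Context {R : realType} (H : R).
Notation leb1 := (@lebesgue_measure R).
Notation time_kernel := (time_kernel H).
Notation tent_weight := (tent_weight H).
Notation energy := (energy H).
Hypothesis hH : 1 / 2 < H < 1.

(** The functions of time for which all integrals below converge. *)
Definition tame (b M : R) (a : R -> R) : Prop :=
  [/\ measurable_fun setT a, forall u, `|a u| <= M & forall u, b < `|u| -> a u = 0].

Definition window_integral (a : R -> R) (p : R * R) : R :=
  \int[leb1]_u (window p u * a u).

Lemma window_integrable (a : R -> R) b M p : tame b M a ->
  leb1.-integrable setT (fun u => (window p u * a u)%:E).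
Proof.
case=> ma aM _.
have I1 : leb1.-integrable setT (fun u => (M * \1_(`[p.2 - p.1, p.2]%classic) u)%:E).
  under eq_fun do rewrite EFinM.
  by apply: integrableZl => //; apply: integrable_indic_itv.
apply: le_integrable I1 => //.
  by apply/measurable_EFinP; apply: measurable_funM => //; exact: measurable_windowr.
move=> u _; rewrite lee_fin /window indicE mem_setE in_itv/=.
have M0 : 0 <= M := le_trans (normr_ge0 _) (aM u).
case: (_ <= u); case: (u <= _); case: (0 < u); rewrite /= ?mul1r ?mul0r ?mulr1 ?mulr0 ?normr0//.
by rewrite (le_trans (aM u))// ler_norm.
Qed.

Lemma window_integralE (a : R -> R) b M p : tame b M a ->
  ((window_integral a p)%:E = \int[leb1]_u (window p u * a u)%:E)%E.
Proof.
by move=> ta; rewrite fineK//; apply: integrable_fin_num => //; exact: window_integrable ta.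
Qed.

Lemma measurable_window_integral (a : R -> R) :
  measurable_fun setT a -> measurable_fun setT (window_integral a).
Proof.
move=> ma; apply: (measurable_Rintegralr leb1 (fun p u => window p u * a u)).
by apply: measurable_funM; [exact: measurable_window|exact: measurableT_comp ma measurable_snd].
Qed.

Definition pairing (a a' : R -> R) : \bar R :=
  (\int[leb1]_u \int[leb1]_v (time_kernel u v * (a u * a' v))%:E)%E.

Lemma pairingE (a a' : R -> R) b M M' : tame b M a -> tame b M' a' ->
  (forall u, 0 <= a u) -> (forall u, 0 <= a' u) ->
  (\int[leb1 \x leb1]_p (tent_weight p.1 * (window_integral a p * window_integral a' p))%:E
   = pairing a a')%E.
Proof.
move=> ta ta' a0 a0'; have [ma _ _] := ta; have [ma' _ _] := ta'.
rewrite /pairing -energy_bilinear//; apply: eq_integral => p _.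
by rewrite -(window_integralE _ ta) -(window_integralE _ ta').
Qed.

Lemma measurable_kernel_prod (a a' : R -> R) : measurable_fun setT a -> measurable_fun setT a' ->
  measurable_fun setT (fun q : R * R => (time_kernel q.1 q.2 * (a q.1 * a' q.2))%:E).
Proof.
move=> ma ma'; apply/measurable_EFinP; apply: measurable_funM; first exact: measurable_time_kernel.
by apply: measurable_funM; [apply: measurableT_comp ma _|apply: measurableT_comp ma' _]; meas.
Qed.

Lemma kernel_term_ge0 u v (x y : R) : 0 <= x -> 0 <= y ->
  (0 <= (time_kernel u v * (x * y))%:E)%E.
Proof. by move=> x0 y0; rewrite lee_fin mulr_ge0 ?time_kernel_ge0// mulr_ge0. Qed.

Lemma measurable_pairing_slice (a a' : R -> R) :
  measurable_fun setT a -> measurable_fun setT a' ->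
  (forall u, 0 <= a u) -> (forall u, 0 <= a' u) ->
  measurable_fun setT (fun u => \int[leb1]_v (time_kernel u v * (a u * a' v))%:E)%E.
Proof.
move=> ma ma' a0 a0'.
apply: (measurable_integralr leb1 (fun u v => (time_kernel u v * (a u * a' v))%:E)).
  exact: measurable_kernel_prod.
by move=> u v; exact: kernel_term_ge0.
Qed.

(** The kernel integrated over the square of side [b] is [b^(2H)]. *)
Lemma pairing_le (a a' : R -> R) b M M' : 0 <= b -> tame b M a -> tame b M' a' ->
  (forall u, 0 <= a u) -> (forall u, 0 <= a' u) ->
  (pairing a a' <= (M * M' * b `^ (2 * H))%:E)%E.
Proof.
move=> b0 [ma aM ab] [ma' aM' ab'] a0 a0'.
have M0 : 0 <= M := le_trans (normr_ge0 _) (aM 0).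
have M0' : 0 <= M' := le_trans (normr_ge0 _) (aM' 0).
have -> : b `^ (2 * H) = RH H b b.
  rewrite /RH subrr normr0 powR0; last by have /andP[h1 h2] := hH; rewrite gt_eqF//; lra.
  by rewrite subr0; field.
rewrite EFinM -integral_kernel_indic//.
have mk (x y : R) : measurable_fun setT (fun q : R * R =>
    (time_kernel q.1 q.2 * (\1_`[0, b]%classic q.1 * \1_`[0, b]%classic q.2))%:E).
  by apply: measurable_kernel_prod => //; exact: measurable_indic.
have i0 u : 0 <= \1_`[0, b]%classic u :> R by [].
have mi : measurable_fun setT (\1_`[0, b]%classic : R -> R) by exact: measurable_indic.
have sl0 a1 a2 : (forall u, 0 <= a1 u) -> (forall u, 0 <= a2 u) -> forall u,
    (0 <= \int[leb1]_v (time_kernel u v * (a1 u * a2 v))%:E)%E.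
  by move=> *; apply: integral_ge0 => v _; exact: kernel_term_ge0.
have MM0 : (0 <= (M * M')%:E)%E by rewrite lee_fin mulr_ge0.
have ms := measurable_pairing_slice mi mi i0 i0.
have ms' := measurable_pairing_slice ma ma' a0 a0'.
rewrite -ge0_integralZl//; try solve [by move=> *; exact: sl0].
have m1 u : measurable_fun setT (fun v => (time_kernel u v * (\1_`[0, b]%classic u * \1_`[0, b]%classic v))%:E).
  apply/measurable_EFinP; apply: measurable_funM; first by rewrite /time_kernel; meas.
  by apply: measurable_funM => //; exact: measurable_indic.
have m2 u : measurable_fun setT (fun v => (time_kernel u v * (a u * a' v))%:E).
  apply/measurable_EFinP; apply: measurable_funM; first by rewrite /time_kernel; meas.
  exact: measurable_funM.
apply: ge0_le_integral => //; try solve [by move=> *; exact: sl0 | exact: measurable_funeM].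
move=> u _; rewrite -ge0_integralZl//; try solve [by move=> v _; exact: kernel_term_ge0 | exact: m1].
apply: ge0_le_integral => //; try solve [by move=> *; exact: kernel_term_ge0 | exact: m2 | apply: measurable_funeM; exact: m1].
move=> v _; rewrite -EFinM lee_fin /time_kernel.
case: ifPn => [/andP[u0 v0]|]; last by rewrite !mul0r mulr0.
rewrite [leRHS]mulrCA ler_wpM2l//.
  by rewrite mulr_ge0 ?powR_ge0// ltW// alphaH_gt0.
rewrite !indicE !mem_setE !in_itv/= (ltW u0) (ltW v0)/=.
have [ub|ub] := leP u b; last by rewrite ab ?mul0r ?mulr0// (lt_le_trans ub)// ler_norm.
have [vb|vb] := leP v b; last by rewrite ab' ?mul0r ?mulr0// (lt_le_trans vb)// ler_norm.
have -> : true%:R = 1 :> R by [].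
by rewrite !mulr1; apply: ler_pM => //; apply: le_trans (ler_norm _) _.
Qed.

Definition pos_part (a : R -> R) u := Num.max 0 (a u).
Definition neg_part (a : R -> R) u := Num.max 0 (- a u).

Lemma tame_pos b M a : tame b M a -> tame b M (pos_part a).
Proof.
case=> ma aM ab; split.
- by rewrite /pos_part; apply: measurable_maxr.
- move=> u; rewrite /pos_part ger0_norm ?le_max ?lexx// ge_max (le_trans (normr_ge0 _) (aM u)).
  by rewrite (le_trans (ler_norm _)).
- by move=> u /ab; rewrite /pos_part => ->; rewrite maxxx.
Qed.

Lemma tameN b M a : tame b M a -> tame b M (fun u => - a u).
Proof.
case=> ma aM ab; split.
- exact: measurable_funN.
- by move=> u; rewrite normrN.
- by move=> u /ab ->; rewrite oppr0.
Qed.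

Lemma tame_neg b M a : tame b M a -> tame b M (neg_part a).
Proof. by move=> /tameN/tame_pos. Qed.

Lemma pos_neg_part a u : a u = pos_part a u - neg_part a u.
Proof. rewrite /pos_part /neg_part; case: (ltgtP 0 (a u)) => h; case: (ltgtP 0 (- a u)) => h'; lra. Qed.

Lemma window_integral_split a b M p : tame b M a ->
  window_integral a p = window_integral (pos_part a) p - window_integral (neg_part a) p.
Proof.
move=> ta; rewrite /window_integral -RintegralB//; last 2 first.
- exact: window_integrable (tame_pos ta).
- exact: window_integrable (tame_neg ta).
by apply: eq_Rintegral => u _; rewrite -mulrBr -pos_neg_part.
Qed.

Lemma kernel_integrable a a' b M M' : 0 <= b -> tame b M a -> tame b M' a' ->
  (forall u, 0 <= a u) -> (forall u, 0 <= a' u) ->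
  (leb1 \x leb1)%E.-integrable setT (fun q : R * R => (time_kernel q.1 q.2 * (a q.1 * a' q.2))%:E).
Proof.
move=> b0 ta ta' a0 a0'; have [ma _ _] := ta; have [ma' _ _] := ta'.
apply/integrableP; split; first exact: measurable_kernel_prod.
under eq_integral => q _ do rewrite gee0_abs ?lee_fin ?mulr_ge0 ?time_kernel_ge0//.
rewrite (integral_prod_measure leb1 leb1 (fun u v => (time_kernel u v * (a u * a' v))%:E)).
- exact: le_lt_trans (pairing_le b0 ta ta' a0 a0') (ltry _).
- exact: measurable_kernel_prod.
- by move=> u v; rewrite lee_fin ?mulr_ge0 ?time_kernel_ge0.
Qed.

Lemma pairing_prod a a' b M M' : 0 <= b -> tame b M a -> tame b M' a' ->
  (forall u, 0 <= a u) -> (forall u, 0 <= a' u) ->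
  (\int[leb1 \x leb1]_q (time_kernel q.1 q.2 * (a q.1 * a' q.2))%:E)%E = pairing a a'.
Proof.
move=> b0 ta ta' a0 a0'; have [ma _ _] := ta; have [ma' _ _] := ta'.
rewrite (integral_prod_measure leb1 leb1 (fun u v => (time_kernel u v * (a u * a' v))%:E))//.
- exact: measurable_kernel_prod.
- by move=> u v; rewrite lee_fin ?mulr_ge0 ?time_kernel_ge0.
Qed.

Lemma pos_part_ge0 a u : 0 <= pos_part a u. Proof. by rewrite le_max lexx. Qed.
Lemma neg_part_ge0 a u : 0 <= neg_part a u. Proof. by rewrite le_max lexx. Qed.

Lemma energy_finite_le a b M : 0 <= b -> tame b M a -> (energy a <= (M ^+ 2 * b `^ (2 * H))%:E)%E.
Proof.
move=> b0 ta; have [ma aM ab] := ta.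
have ta' : tame b M (fun u => `|a u|).
  split; first exact: measurableT_comp.
    by move=> u; rewrite normr_id.
  by move=> u /ab ->; rewrite normr0.
rewrite expr2; apply: le_trans (pairing_le b0 ta' ta' _ _) => //.
rewrite -(pairingE ta' ta')//; apply: ge0_le_integral => //.
- by move=> p _; rewrite lee_fin mulr_ge0 ?tent_weight_ge0 ?sqr_ge0.
- apply/measurable_EFinP; apply: measurable_funM.
    exact: measurableT_comp (measurable_tent_weight _) measurable_fst.
  by apply: measurable_funX; exact: measurable_window_integral.
- apply/measurable_EFinP; apply: measurable_funM.
    exact: measurableT_comp (measurable_tent_weight _) measurable_fst.
  by apply: measurable_funM; apply: measurable_window_integral; case: ta'.
move=> p _; rewrite lee_fin ler_wpM2l ?tent_weight_ge0// -expr2.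
rewrite -[leLHS]real_normK ?num_real// ler_pXn2r ?nnegrE//; last first.
  by rewrite /window_integral; apply: Rintegral_ge0 => u _; rewrite mulr_ge0 ?window_ge0.
have := le_normr_Rintegral measurableT (window_integrable p ta).
move=> /le_trans; apply; rewrite le_eqVlt; apply/orP; left; apply/eqP.
by apply: eq_Rintegral => u _; rewrite normrM (ger0_norm (window_ge0 _ _)).
Qed.

(** Expands the square of the integral of [a] over a window; the cross term is moved to
    the left so that only nonnegative integrals occur. *)
Lemma energy_parts a b M : 0 <= b -> tame b M a ->
  (energy a + 2%:E * pairing (pos_part a) (neg_part a) =
   pairing (pos_part a) (pos_part a) + pairing (neg_part a) (neg_part a))%E.
Proof.
move=> b0 ta; have tp := tame_pos ta; have tn := tame_neg ta.
have [ma _ _] := ta; have [mp _ _] := tp; have [mn _ _] := tn.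
have mw : measurable_fun setT (fun p : R * R => tent_weight p.1).
  exact: measurableT_comp (measurable_tent_weight _) measurable_fst.
have ma' := measurable_window_integral ma.
have mp' := measurable_window_integral mp.
have mn' := measurable_window_integral mn.
have w0 p a' : (forall u, 0 <= a' u) -> 0 <= window_integral a' p.
  by move=> h; apply: Rintegral_ge0 => u _; rewrite mulr_ge0 ?window_ge0.
have p0 p := w0 p _ (pos_part_ge0 a).
have n0 p := w0 p _ (neg_part_ge0 a).
rewrite -(pairingE tp tn (pos_part_ge0 a) (neg_part_ge0 a)).
rewrite -(pairingE tp tp (pos_part_ge0 a) (pos_part_ge0 a)).
rewrite -(pairingE tn tn (neg_part_ge0 a) (neg_part_ge0 a)).
rewrite -ge0_integralZl//; try solve [ by move=> *; rewrite lee_fin mulr_ge0 ?tent_weight_ge0// mulr_ge0 | by meas].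
rewrite -ge0_integralD//; try solve [ by move=> *; rewrite lee_fin mulr_ge0 ?tent_weight_ge0 ?sqr_ge0 | by move=> *; rewrite -?EFinM lee_fin ?mulr_ge0 ?tent_weight_ge0// ?mulr_ge0// ?sqr_ge0 | by meas | by apply: emeasurable_funM; meas].
rewrite -ge0_integralD//; try solve [ by move=> *; rewrite lee_fin mulr_ge0 ?tent_weight_ge0// mulr_ge0 | by meas].
apply: eq_integral => p _; rewrite -EFinM -!EFinD; congr EFin.
rewrite -/(window_integral a p) (window_integral_split _ ta); ring.
Qed.

Lemma kernel_expand a (q : R * R) :
  (time_kernel q.1 q.2 * (a q.1 * a q.2))%:E =
  ((time_kernel q.1 q.2 * (pos_part a q.1 * pos_part a q.2))%:E -
   (time_kernel q.1 q.2 * (pos_part a q.1 * neg_part a q.2))%:E -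
   (time_kernel q.1 q.2 * (neg_part a q.1 * pos_part a q.2))%:E +
   (time_kernel q.1 q.2 * (neg_part a q.1 * neg_part a q.2))%:E)%E.
Proof.
rewrite -!EFinB -EFinD; congr EFin.
by rewrite (pos_neg_part a q.1) (pos_neg_part a q.2); ring.
Qed.

Lemma signed_kernel_integrable a b M : 0 <= b -> tame b M a ->
  (leb1 \x leb1)%E.-integrable setT
    (fun q : R * R => (time_kernel q.1 q.2 * (a q.1 * a q.2))%:E).
Proof.
move=> b0 ta; have tp := tame_pos ta; have tn := tame_neg ta.
have p0 := pos_part_ge0 a; have n0 := neg_part_ge0 a.
under eq_fun do rewrite kernel_expand.
apply: integrableD => //; last exact: (kernel_integrable b0 tn tn n0 n0).
apply: integrableB => //; last exact: (kernel_integrable b0 tn tp n0 p0).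
apply: integrableB => //; last exact: (kernel_integrable b0 tp tn p0 n0).
exact: (kernel_integrable b0 tp tp p0 p0).
Qed.

(** The bilinear identity for nonnegative functions extends to signed ones by splitting
    into positive and negative parts. *)
Lemma energy_kernel a b M : 0 <= b -> tame b M a ->
  energy a = (\int[leb1 \x leb1]_q (time_kernel q.1 q.2 * (a q.1 * a q.2))%:E)%E.
Proof.
move=> b0 ta; have tp := tame_pos ta; have tn := tame_neg ta.
have p0 := pos_part_ge0 a; have n0 := neg_part_ge0 a.
have Ipp := kernel_integrable b0 tp tp p0 p0.
have Ipn := kernel_integrable b0 tp tn p0 n0.
have Inp := kernel_integrable b0 tn tp n0 p0.
have Inn := kernel_integrable b0 tn tn n0 n0.
have I1 := integrableB measurableT Ipp Ipn.
have I2 := integrableB measurableT I1 Inp.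
under eq_integral do rewrite kernel_expand.
rewrite integralD// integralB// integralB//.
rewrite !(pairing_prod b0 tp tp, pairing_prod b0 tp tn, pairing_prod b0 tn tp, pairing_prod b0 tn tn)//.
have := energy_parts b0 ta.
have F x y : tame b M x -> tame b M y -> (forall u, 0 <= x u) -> (forall u, 0 <= y u) -> pairing x y \is a fin_num.
  move=> tx ty x0 y0; rewrite ge0_fin_numE.
    exact: le_lt_trans (pairing_le b0 tx ty x0 y0) (ltry _).
  by apply: integral_ge0 => u _; apply: integral_ge0 => v _; rewrite lee_fin ?mulr_ge0 ?time_kernel_ge0.
have -> : pairing (neg_part a) (pos_part a) = pairing (pos_part a) (neg_part a).
  apply: (etrans (esym (pairingE tn tp n0 p0))); apply: (etrans _ (pairingE tp tn p0 n0)).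
  by apply: eq_integral => p _; rewrite (mulrC (window_integral (neg_part a) p)).
have := F _ _ tp tn p0 n0; have := F _ _ tp tp p0 p0; have := F _ _ tn tn n0 n0.
have : energy a \is a fin_num.
  rewrite ge0_fin_numE; first exact: le_lt_trans (energy_finite_le b0 ta) (ltry _).
  by apply: integral_ge0 => p _; rewrite lee_fin mulr_ge0 ?tent_weight_ge0 ?sqr_ge0.
case: (energy a) => // e _; case: (pairing _ _) => // x _; case: (pairing _ _) => // y _; case: (pairing _ _) => // z _.
rewrite -EFinM -!EFinD => -[ez]; congr EFin; lra.
Qed.

End signed_energy.

(** * The energy seminorm and the norm of integrands *)

Section Rintegral_scale.
Context d (T : measurableType d) (R : realType) (mu : {measure set T -> \bar R}).

(** Holds for every measurable function: the conventional values of the integral in the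
    undefined cases are scaled as well. *)
Lemma Rintegral_posZ (D : set T) (f : T -> R) (k : R) : measurable D ->
  measurable_fun D f -> 0 < k ->
  \int[mu]_(x in D) (k * f x) = k * \int[mu]_(x in D) f x.
Proof.
move=> mD mf k0; rewrite /Rintegral.
have mf' : measurable_fun D (EFin \o f) by exact/measurable_EFinP.
have -> : (\int[mu]_(x in D) (k * f x)%:E = k%:E * \int[mu]_(x in D) (f x)%:E)%E.
  rewrite integralE [in RHS]integralE.
  have -> : (fun x => (k * f x)%:E) = (fun x => k%:E * (EFin \o f) x)%E by [].
  rewrite ge0_funeposM ?ltW// ge0_funenegM ?ltW//.
  rewrite !ge0_integralZl ?lee_fin ?ltW//; last 2 first.
  - exact: measurable_funeneg.
  - exact: measurable_funepos.
  have : (0 <= \int[mu]_(x in D) (EFin \o f)^\+ x)%E by apply: integral_ge0.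
  have : (0 <= \int[mu]_(x in D) (EFin \o f)^\- x)%E by apply: integral_ge0.
  rewrite /comp; case: (\int[mu]_(x in D) _)%E => [x| |]; case: (\int[mu]_(x in D) _)%E => [y| |]//= _ _;
    rewrite ?gt0_muley ?lte_fin// ?gt0_muleNy ?lte_fin//.
  by change ((k * y - k * x)%:E = (k * (y - x))%:E); rewrite mulrBr.
case: (\int[mu]_(x in D) _)%E => [x| |] //=; rewrite ?gt0_muley ?gt0_muleNy ?lte_fin//= mulr0//.
Qed.

End Rintegral_scale.

Section energy_algebra.
Context {R : realType} (H : R).
Notation leb1 := (@lebesgue_measure R).
Notation tent_weight := (tent_weight H).
Notation energy := (energy H).
Hypothesis hH : 1 / 2 < H < 1.

Lemma energy_ge0 a : (0 <= energy a)%E.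
Proof.
by apply: integral_ge0 => p _; rewrite lee_fin mulr_ge0 ?tent_weight_ge0 ?sqr_ge0.
Qed.

Lemma measurable_energy_integrand a : measurable_fun setT a ->
  measurable_fun setT (fun p : R * R => (tent_weight p.1 * (window_integral a p) ^+ 2)%:E).
Proof.
move=> ma; have mw := measurable_window_integral ma.
apply/measurable_EFinP; apply: measurable_funM; last exact: measurable_funX.
exact: measurableT_comp (measurable_tent_weight _) measurable_fst.
Qed.

Lemma energyE (a : R -> R) :
  energy a = (\int[leb1 \x leb1]_p (tent_weight p.1 * (window_integral a p) ^+ 2)%:E)%E.
Proof. by []. Qed.

Lemma energyZ c (a : R -> R) b M : tame b M a ->
  (energy (fun u => c * a u)%R = (c ^+ 2)%:E * energy a)%E.
Proof.
move=> ta; have [ma _ _] := ta.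
rewrite -ge0_integralZl//; try solve [exact: measurable_energy_integrand |
  by move=> *; rewrite lee_fin mulr_ge0 ?tent_weight_ge0 ?sqr_ge0 | by rewrite lee_fin sqr_ge0].
apply: eq_integral => p _; rewrite -EFinM; congr EFin.
have -> : \int[leb1]_u (window p u * (c * a u)) = c * window_integral a p.
  rewrite /window_integral -RintegralZl//; last exact: window_integrable ta.
  by apply: eq_Rintegral => u _; rewrite mulrCA.
by rewrite exprMn /window_integral mulrCA.
Qed.

(** Pointwise in the window: [(x + y)^2 <= 2 x^2 + 2 y^2]. *)
Lemma energyD (a a' : R -> R) b M M' : tame b M a -> tame b M' a' ->
  (energy (fun u => a u + a' u)%R <= 2%:E * energy a + 2%:E * energy a')%E.
Proof.
move=> ta ta'; have [ma _ _] := ta; have [ma' _ _] := ta'.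
have w0 a1 (p : R * R) : (0 <= (tent_weight p.1 * (window_integral a1 p) ^+ 2)%:E)%E.
  by rewrite lee_fin mulr_ge0 ?tent_weight_ge0 ?sqr_ge0.
have m1 := measurable_energy_integrand ma; have m2 := measurable_energy_integrand ma'.
have Z a1 : measurable_fun setT a1 -> (2%:E * energy a1 =
    \int[leb1 \x leb1]_p (2%:E * (tent_weight p.1 * (window_integral a1 p) ^+ 2)%:E))%E.
  move=> m; rewrite ge0_integralZl//; exact: measurable_energy_integrand.
rewrite (Z _ ma) (Z _ ma') -ge0_integralD//; try solve [by move=> *; rewrite mule_ge0
  | exact: measurable_funeM].
rewrite energyE.
apply: ge0_le_integral => //; try solve [by move=> *; exact: w0
  | by move=> *; rewrite adde_ge0// mule_ge0//; exact: w0 ].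
- by apply: measurable_energy_integrand; exact: measurable_funD.
- by apply: emeasurable_funD; apply: measurable_funeM.
move=> p _; rewrite -!EFinM -EFinD lee_fin.
have -> : window_integral (fun u => a u + a' u) p = window_integral a p + window_integral a' p.
  rewrite /window_integral -RintegralD//; try exact: window_integrable ta; try exact: window_integrable ta'.
  by apply: eq_Rintegral => u _; rewrite mulrDr.
rewrite /window_integral; set x := \int[_]_u _; set y := \int[_]_u _.
have := tent_weight_ge0 hH p.1; move: (tent_weight p.1) => w w0'.
have -> : 2 * (w * x ^+ 2) + 2 * (w * y ^+ 2) = w * (x + y) ^+ 2 + w * (x - y) ^+ 2 by ring.
by rewrite lerDl mulr_ge0 ?sqr_ge0.
Qed.

Lemma measurable_energy d (T : measurableType d) (a : R -> T -> R) :
  measurable_fun setT (fun q : R * T => a q.1 q.2) ->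
  measurable_fun setT (fun x => energy (a^~ x)).
Proof.
move=> ma.
pose F (x : T) (p : R * R) : \bar R := (tent_weight p.1 * (window_integral (a^~ x) p) ^+ 2)%:E.
apply: (measurable_integralr (sigma_finite_product leb1 leb1) F); last first.
  by move=> x p; rewrite lee_fin mulr_ge0 ?tent_weight_ge0 ?sqr_ge0.
apply/measurable_EFinP; apply: measurable_funM.
  by apply: (measurableT_comp (measurable_tent_weight _)); meas.
apply: measurable_funX.
apply: (measurable_Rintegralr leb1 (fun (q : T * (R * R)) u => window q.2 u * a u q.1)).
apply: measurable_funM.
  apply: (measurableT_comp (@measurable_window R) (g := fun q : (T * (R * R)) * R => (q.1.2, q.2))).
  by meas.
apply: (measurableT_comp ma (g := fun q : (T * (R * R)) * R => (q.2, q.1.1))).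
by meas.
Qed.

End energy_algebra.

Section complex_energy.
Context {R : realType} (H : R).
Notation leb1 := (@lebesgue_measure R).
Hypothesis hH : 1 / 2 < H < 1.

Definition cenergy (h : R -> R[i]) : \bar R :=
  (energy H (fun u => complex.Re (h u)) + energy H (fun u => complex.Im (h u)))%E.

Definition ctame (b M : R) (h : R -> R[i]) : Prop :=
  tame b M (fun u => complex.Re (h u)) /\ tame b M (fun u => complex.Im (h u)).

Lemma cenergy_ge0 h : (0 <= cenergy h)%E.
Proof. by rewrite adde_ge0// energy_ge0. Qed.

Lemma cenergyD b M M' h h' : ctame b M h -> ctame b M' h' ->
  (cenergy (fun u => h u + h' u)%R <= 2%:E * cenergy h + 2%:E * cenergy h')%E.
Proof.
move=> [tr ti] [tr' ti'].
have Er : (fun u => complex.Re (h u + h' u)) = (fun u => complex.Re (h u) + complex.Re (h' u)).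
  by apply/funext => u; case: (h u); case: (h' u).
have Ei : (fun u => complex.Im (h u + h' u)) = (fun u => complex.Im (h u) + complex.Im (h' u)).
  by apply/funext => u; case: (h u); case: (h' u).
rewrite /cenergy Er Ei.
apply: le_trans (leeD (energyD hH tr tr') (energyD hH ti ti')) _.
move: (energy_ge0 hH (fun u => complex.Re (h u))) (energy_ge0 hH (fun u => complex.Im (h u)))
  (energy_ge0 hH (fun u => complex.Re (h' u))) (energy_ge0 hH (fun u => complex.Im (h' u))).
move: (energy H _) (energy H _) (energy H _) (energy H _) => x y z t x0 y0 z0 t0.
by rewrite !ge0_muleDr// addeACA.
Qed.

Lemma cenergyN b M h : ctame b M h -> cenergy (fun u => - h u) = cenergy h.
Proof.
move=> [tr ti]; rewrite /cenergy.
have E a : tame b M a -> energy H (fun u => - a u) = energy H a.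
  move=> ta; have := energyZ hH (-1) ta; rewrite sqrrN expr1n mul1e.
  by have -> : (fun u => -1 * a u) = (fun u => - a u) by apply/funext => u; rewrite mulN1r.
have Er : (fun u => complex.Re (- h u)) = (fun u => - complex.Re (h u)).
  by apply/funext => u; case: (h u).
have Ei : (fun u => complex.Im (- h u)) = (fun u => - complex.Im (h u)).
  by apply/funext => u; case: (h u).
by rewrite Er Ei (E _ tr) (E _ ti).
Qed.

Lemma cenergy_phase c s b M a : c ^+ 2 + s ^+ 2 = 1 -> tame b M a ->
  cenergy (fun u => Complex (c * a u) (s * a u)) = energy H a.
Proof.
move=> cs ta; rewrite /cenergy /= (energyZ hH c ta) (energyZ hH s ta).
by rewrite -ge0_muleDl ?lee_fin ?sqr_ge0// -EFinD cs mul1e.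
Qed.

Lemma cenergy_le b M h : 0 <= b -> ctame b M h ->
  (cenergy h <= (2 * M ^+ 2 * b `^ (2 * H))%:E)%E.
Proof.
move=> b0 [tr ti]; apply: le_trans (leeD (energy_finite_le hH b0 tr) (energy_finite_le hH b0 ti)) _.
by rewrite -EFinD lee_fin; lra.
Qed.

Section in_xi.
Context {d : nat} (mu : {measure set 'rV[R]_d -> \bar R}).
Implicit Types h : R -> 'rV[R]_d -> R[i].

(** The integrands for which the double time integral converges absolutely. *)
Definition admissible (b : R) h : Prop :=
  [/\ cmeasurable setT (fun p : R * 'rV[R]_d => h p.1 p.2),
      forall xi, exists M : R, forall t, ComplexField.Normc.normc (h t xi) <= M &
      forall t xi, b < `|t| -> h t xi = 0].

Lemma normc_Re (z : R[i]) : `|complex.Re z| <= ComplexField.Normc.normc z.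
Proof.
case: z => x y /=; rewrite -sqrtr_sqr ler_wsqrtr// lerDl sqr_ge0 //.
Qed.

Lemma normc_Im (z : R[i]) : `|complex.Im z| <= ComplexField.Normc.normc z.
Proof.
case: z => x y /=; rewrite -sqrtr_sqr ler_wsqrtr// lerDr sqr_ge0 //.
Qed.

Lemma admissible_ctame b h xi : admissible b h -> exists M, ctame b M (h^~ xi).
Proof.
move=> [[mR mI] bd sp]; have [M hM] := bd xi; exists M; split; split.
- exact: (measurableT_comp mR (g := fun u : R => (u, xi))).
- by move=> u; rewrite (le_trans (normc_Re _)).
- by move=> u bu; rewrite sp.
- exact: (measurableT_comp mI (g := fun u : R => (u, xi))).
- by move=> u; rewrite (le_trans (normc_Im _)).
- by move=> u bu; rewrite sp.
Qed.

Definition xi_energy h : \bar R := (\int[mu]_xi cenergy (h^~ xi))%E.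

Lemma measurable_cenergy b h : admissible b h ->
  measurable_fun setT (fun xi => cenergy (h^~ xi)).
Proof.
move=> [[mR mI] _ _]; apply: emeasurable_funD.
- exact: (measurable_energy hH (a := fun u xi => complex.Re (h u xi))).
- exact: (measurable_energy hH (a := fun u xi => complex.Im (h u xi))).
Qed.

(** The real part of [h u * conj (h v)] splits into the products of real and of imaginary
    parts. *)
Lemma HP_norm2E b h : 0 <= b -> admissible b h -> HP_norm2 H mu h = xi_energy h.
Proof.
move=> b0 ah; rewrite /HP_norm2 /xi_energy.
have al0 : 0 <= alphaH H by rewrite ltW// alphaH_gt0.
have E xi : cenergy (h^~ xi) = ((alphaH H)%:E * (complex.Re (cintegral (@lebesgue_measure R) `]0, +oo[ (fun u =>
       cintegral (@lebesgue_measure R) `]0, +oo[ (fun v =>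
         h u xi * (h v xi)^*%C * (`|u - v| `^ (2 * H - 2))%:C%C))))%:E)%E.
  have [M [tr ti]] := admissible_ctame xi ah.
  rewrite /cenergy (energy_kernel hH b0 tr) (energy_kernel hH b0 ti).
  have Ir := signed_kernel_integrable hH b0 tr.
  have Ii := signed_kernel_integrable hH b0 ti.
  rewrite -integralD//.
  pose k (q : R * R) := time_kernel H q.1 q.2 * (complex.Re (h q.1 xi) * complex.Re (h q.2 xi)
     + complex.Im (h q.1 xi) * complex.Im (h q.2 xi)).
  have kE : (EFin \o k) = (fun q : R * R => (time_kernel H q.1 q.2 * (complex.Re (h q.1 xi) * complex.Re (h q.2 xi)))%:E
      + (time_kernel H q.1 q.2 * (complex.Im (h q.1 xi) * complex.Im (h q.2 xi)))%:E)%E.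
    by apply/funext => q; rewrite /= -EFinD -mulrDr.
  have Ik : (leb1 \x leb1)%E.-integrable setT (EFin \o k).
    by rewrite kE; apply: integrableD.
  transitivity (\int[leb1 \x leb1]_q (k q)%:E)%E.
    by apply: eq_integral => q _; rewrite -EFinD -mulrDr.
  rewrite -Rintegral_Fubini// -EFinM; congr EFin.
  rewrite /cintegral /=.
  pose g (u v : R) := (complex.Re (h u xi) * complex.Re (h v xi)
     + complex.Im (h u xi) * complex.Im (h v xi)) * `|u - v| `^ (2 * H - 2).
  have mg : measurable_fun setT (fun q : R * R => g q.1 q.2).
    have [mr _ _] := tr; have [mi _ _] := ti.
    by rewrite /g; meas; [apply: (measurableT_comp mr)|apply: (measurableT_comp mr)
      |apply: (measurableT_comp mi)|apply: (measurableT_comp mi)]; meas.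
  have mD : measurable (`]0, +oo[%classic : set R) by exact: measurable_itv.
  transitivity (alphaH H * \int[leb1]_(u in `]0, +oo[) \int[leb1]_(v in `]0, +oo[) g u v).
    rewrite -Rintegral_posZ//; last 2 first.
    - apply: measurable_funTS.
      under eq_fun do rewrite Rintegral_mkcond.
      apply: (measurable_Rintegralr leb1 (fun u v => (g u \_ `]0, +oo[) v)).
      rewrite (_ : (fun q : R * R => _) = (fun q => if 0 < q.2 then g q.1 q.2 else 0)).
        by apply: measurable_fun_ifT => //; meas.
      by apply/funext => q; rewrite patchE mem_setE in_itv/= andbT.
    - exact: alphaH_gt0.
    rewrite [RHS]Rintegral_mkcond; apply: eq_Rintegral => u _.
    rewrite patchE mem_setE in_itv/= andbT; case: ifPn => u0; last first.
      under eq_Rintegral do rewrite /k/= /time_kernel (negbTE u0)/= mul0r.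
      by rewrite /Rintegral integral0.
    rewrite -Rintegral_posZ//; last 2 first.
    - by apply: measurable_funTS; exact: (measurableT_comp mg (pair1_measurable u)).
    - exact: alphaH_gt0.
    rewrite [RHS]Rintegral_mkcond; apply: eq_Rintegral => v _.
    rewrite patchE mem_setE in_itv/= andbT /k/= /time_kernel u0/=.
    by case: ifPn => v0; rewrite ?mul0r// /g; ring.
  congr (_ * _); apply: eq_Rintegral => u _; apply: eq_Rintegral => v _.
  by rewrite /g; case: (h u xi) => x y; case: (h v xi) => x' y' /=; ring.
under [RHS]eq_integral => xi _ do rewrite E.
have S0 xi : (0 <= (complex.Re (cintegral (@lebesgue_measure R) `]0, +oo[ (fun u =>
       cintegral (@lebesgue_measure R) `]0, +oo[ (fun v =>
         h u xi * (h v xi)^*%C * (`|u - v| `^ (2 * H - 2))%:C%C))))%:E)%E.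
  have := cenergy_ge0 (h^~ xi); rewrite E; rewrite pmule_rge0//.
  by rewrite lte_fin alphaH_gt0.
rewrite ge0_integralZl//.
have mc := measurable_cenergy ah.
have := measurable_funeM (alphaH H)^-1%:E mc.
apply: eq_measurable_fun => xi _; rewrite E -!EFinM mulrA mulVf ?mul1r//.
by rewrite gt_eqF// alphaH_gt0.
Qed.

End in_xi.
End complex_energy.

(** * The energy of the wave multiplier *)

Section sine_bounds.
Context {R : realType}.

Lemma sin_lipschitz (x y : R) : `|sin x - sin y| <= `|x - y|.
Proof.
wlog xy : x y / y <= x => [W|].
  by have [/W//|/ltW/W] := leP y x; rewrite distrC (distrC y).
have [c _ ->] := @MVT_segment R sin cos y x xy (fun x _ => is_derive_sin x)
  (continuous_subspaceT (@continuous_sin R)).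
by rewrite normrM ler_piMl// cos_max.
Qed.

Lemma norm_sin_le (x : R) : `|sin x| <= `|x|.
Proof. by have := sin_lipschitz x 0; rewrite sin0 !subr0. Qed.

Lemma cos_lipschitz (x y : R) : `|cos x - cos y| <= `|x - y|.
Proof.
rewrite -!sinDpihalf (le_trans (sin_lipschitz _ _))//.
by rewrite opprD addrACA subrr addr0.
Qed.

Lemma cos_ge_quad (x : R) : 1 - x ^+ 2 / 2 <= cos x.
Proof.
have -> : x = (x / 2) *+ 2 by rewrite -mulr_natr; field.
rewrite cos_mulr2n cos2sin2; set y := x / 2.
have : sin y ^+ 2 <= y ^+ 2.
  by rewrite -[leLHS]real_normK ?num_real// -[leRHS]real_normK ?num_real// ler_pXn2r ?nnegrE// norm_sin_le.
move: (sin y) => s h; lra.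
Qed.

Lemma sin_ge_half (x : R) : 0 <= x <= 1 -> x / 2 <= sin x.
Proof.
move=> /andP[x0 x1].
have [c] := @MVT_segment R sin cos 0 x x0 (fun x _ => is_derive_sin x)
  (continuous_subspaceT (@continuous_sin R)).
rewrite in_itv/= sin0 !subr0 => /andP[c0 cx] ->.
have := cos_ge_quad c; nra.
Qed.

End sine_bounds.

Section wave_multiplier.
Context {R : realType}.
Notation leb1 := (@lebesgue_measure R).

Definition wave (r t : R) : R := if r == 0 then t else sin (t * r) / r.

Lemma wave0 r : wave r 0 = 0.
Proof. by rewrite /wave; case: eqP => // _; rewrite mul0r sin0 mul0r. Qed.

Lemma wave_lipschitz r t t' : 0 <= r -> `|wave r t - wave r t'| <= `|t - t'|.
Proof.
rewrite le_eqVlt /wave => /predU1P[<-|r0]; first by rewrite eqxx.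
rewrite (gt_eqF r0) -mulrBl normrM normfV (gtr0_norm r0) ler_pdivrMr//.
by rewrite (le_trans (sin_lipschitz _ _))// -mulrBl normrM (gtr0_norm r0).
Qed.

Lemma norm_wave_le r t : 0 <= r -> `|wave r t| <= `|t|.
Proof. by move=> /(wave_lipschitz t 0); rewrite wave0 !subr0. Qed.

Lemma wave_ge_half r t : 0 <= r -> 0 <= t -> t * r <= 1 -> t / 2 <= wave r t.
Proof.
rewrite le_eqVlt /wave => /predU1P[<-|r0] t0 tr; first by rewrite eqxx; lra.
rewrite (gt_eqF r0) ler_pdivlMr//.
have := @sin_ge_half R (t * r); rewrite tr mulr_ge0// ?(ltW r0)// => /(_ isT).
by rewrite mulrAC.
Qed.

Definition wave_slice (t r u : R) : R := if (0 <= u) && (u <= t) then wave r (t - u) else 0.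

Lemma measurable_wave_time r : measurable_fun setT (wave r).
Proof.
rewrite /wave; case: eqP => _; first exact: measurable_id.
apply: measurable_funM; last exact: measurable_cst.
apply: continuous_measurable_fun => x; apply: continuous_comp; last exact: continuous_sin.
by apply: cvgM; [exact: cvg_id|exact: cvg_cst].
Qed.

Lemma measurable_wave_slice t r : measurable_fun setT (wave_slice t r).
Proof.
rewrite /wave_slice.
apply: measurable_fun_ifT; [by meas| |by []].
by apply: (measurableT_comp (measurable_wave_time r)); meas.
Qed.

Lemma wave_slice_tame t T r : 0 <= r -> 0 <= t -> t <= T -> tame T t (wave_slice t r).
Proof.
move=> r0 t0 tT; split.
- exact: measurable_wave_slice.
- move=> u; rewrite /wave_slice; case: ifPn => [/andP[u0 ut]|_]; last by rewrite normr0.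
  rewrite (le_trans (norm_wave_le _ r0))// ger0_norm ?subr_ge0// gerBl//.
- move=> u Tu; rewrite /wave_slice; case: ifPn => // /andP[u0 ut].
  by move: Tu; rewrite ger0_norm// ltNge (le_trans ut).
Qed.

Lemma integral_sin_affine (t r a b : R) : 0 < r -> a < b ->
  (\int[leb1]_(u in `[a, b]) (sin ((t - u) * r) / r)%:E =
   ((cos ((t - b) * r) - cos ((t - a) * r)) / r ^+ 2)%:E)%E.
Proof.
move=> r0 ab.
have dF (x : R) : is_derive x 1 (fun u => cos ((t - u) * r) / r ^+ 2) (sin ((t - x) * r) / r).
  have D1 : is_derive x 1 (fun u => (t - u) * r) (- r).
    have D0 := is_deriveM (is_deriveB (is_derive_cst t x 1) (is_derive_id x 1)) (is_derive_cst r x 1).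
    by apply: (is_derive_eq D0); rewrite scaler0 add0r sub0r /GRing.scale/= mulrN1.
  have D2 := @is_derive1_comp R cos (fun u => (t - u) * r) x _ _ (is_derive_cos _) D1.
  have D3 := is_deriveM D2 (is_derive_cst (r ^- 2) x 1).
  apply: (is_derive_eq D3); rewrite scaler0 add0r /GRing.scale/=.
  by field; rewrite gt_eqF.
have cF : continuous (fun u => cos ((t - u) * r) / r ^+ 2).
  by move=> x; apply: differentiable_continuous; apply/derivable1_diffP; have [] := dF x.
have cf : continuous (fun u => sin ((t - u) * r) / r).
  move=> x; apply: cvgM; last exact: cvg_cst.
  apply: continuous_comp; last exact: continuous_sin.
  by apply: cvgM; [apply: cvgB; [exact: cvg_cst|exact: cvg_id]|exact: cvg_cst].
rewrite (@continuous_FTC2 _ _ (fun u => cos ((t - u) * r) / r ^+ 2))//.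
- by rewrite -EFinB -mulrBl.
- exact: continuous_subspaceT.
- split.
  + by move=> x _; have [] := dF x.
  + exact/cvg_at_right_filter/cF.
  + exact/cvg_at_left_filter/cF.
- by move=> x _; rewrite derive1E; have X := dF x; rewrite derive_val.
Qed.

(** The window meets the time interval [[0, t]] in [[a, b]], where the sine is integrated
    exactly. *)
Lemma window_integral_wave (t r l z : R) : 0 < r ->
  window_integral (wave_slice t r) (l, z) =
  let a := Num.max (z - l) 0 in let b := Num.min z t in
  if a < b then (cos ((t - b) * r) - cos ((t - a) * r)) / r ^+ 2 else 0.
Proof.
move=> r0 /=; set a := Num.max _ _; set b := Num.min _ _.
pose g (u : R) := sin ((t - u) * r) / r.
have mg : measurable_fun setT g.
  apply: continuous_measurable_fun => x; apply: cvgM; last exact: cvg_cst.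
  apply: continuous_comp; last exact: continuous_sin.
  by apply: cvgM; [apply: cvgB; [exact: cvg_cst|exact: cvg_id]|exact: cvg_cst].
have -> : window_integral (wave_slice t r) (l, z) = \int[leb1]_(u in `[a, b]) g u.
  rewrite /window_integral /Rintegral; congr fine.
  rewrite -integral_itv_obnd_cbnd; last first.
    by apply/measurable_EFinP; exact: measurable_funTS.
  rewrite [RHS]integral_mkcond.
  apply: ae_eq_integral => //.
  - apply/measurable_EFinP; apply: measurable_funM; first exact: measurable_windowr.
    exact: measurable_wave_slice.
  - apply/(measurable_restrictT _ _).1 => //; apply/measurable_EFinP.
    exact: measurable_funTS.
  exists ([set a] : set R); split => //; first exact: lebesgue_measure_set1.
  move=> u /=; apply: contra_notP => ua _; rewrite patchE mem_setE in_itv/=.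
  have E : (((z - l <= u) && (u <= z)) && (0 < u)) && ((0 <= u) && (u <= t)) = (a < u) && (u <= b).
    rewrite /a /b gt_max le_min; apply/idP/idP.
      move=> /andP[/andP[/andP[lu uz] u0] /andP[_ ut]].
      rewrite u0 uz ut !andbT lt_neqAle lu andbT; apply/eqP => zu; apply: ua.
      by rewrite /a max_l// zu ltW.
    move=> /andP[/andP[lu u0] /andP[uz ut]].
    by rewrite uz ut u0 (ltW lu) (ltW u0).
  rewrite -E /window/= /wave_slice /wave (gt_eqF r0) /g.
  by case: ifP => _; case: ifP => _; rewrite /= ?mul1r ?mul0r.
case: ifPn => ab; first by rewrite /Rintegral integral_sin_affine.
move: ab; rewrite -leNgt le_eqVlt => /predU1P[<-|ba].
  by rewrite set_itv1 Rintegral_set1.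
by rewrite set_itv_ge ?Rintegral_set0// -leNgt bnd_simp.
Qed.

(** Both cosines are at most 1. *)
Lemma window_integral_le_inv (t r l z : R) : 0 < r ->
  `|window_integral (wave_slice t r) (l, z)| <= 2 / r ^+ 2.
Proof.
move=> r0; rewrite window_integral_wave//=; case: ifP => _; last first.
  by rewrite normr0 divr_ge0// sqr_ge0.
rewrite normrM normfV (ger0_norm (sqr_ge0 r)) ler_wpM2r ?invr_ge0 ?sqr_ge0//.
have := cos_max ((t - Num.min z t) * r); have := cos_max ((t - Num.max (z - l) 0) * r).
by move=> h1 h2; rewrite (le_trans (ler_normB _ _))// -[2]/(1 + 1) lerD.
Qed.

(** The cosine is 1-Lipschitz. *)
Lemma window_integral_le_length (t r l z : R) : 0 < r -> 0 <= l ->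
  `|window_integral (wave_slice t r) (l, z)| <= l / r.
Proof.
move=> r0 l0; rewrite window_integral_wave//=; case: ifP => ab; last first.
  by rewrite normr0 divr_ge0// ltW.
rewrite expr2 invfM mulrA normrM normfV (gtr0_norm r0) ler_wpM2r ?invr_ge0 ?(ltW r0)//.
rewrite normrM normfV (gtr0_norm r0) ler_pdivrMr//.
rewrite (le_trans (cos_lipschitz _ _))// -mulrBl normrM (gtr0_norm r0) ler_wpM2r ?(ltW r0)//.
move: ab; rewrite /Num.max /Num.min.
case: ifP => h1; case: ifP => h2 h3; rewrite ler_norml; apply/andP; split; lra.
Qed.

Lemma window_integral_eq0 (t r l z : R) : (z < 0) || (t + l < z) ->
  window_integral (wave_slice t r) (l, z) = 0.
Proof.
move=> h; rewrite /window_integral /Rintegral integral0_eq// => u _.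
rewrite /window /wave_slice/=; congr EFin.
case: ifP => [/andP[/andP[h1 h2] h3]|_]; last by rewrite mul0r.
case: ifP => [/andP[h4 h5]|_]; last by rewrite mulr0.
by move/orP : h => [?|?]; exfalso; lra.
Qed.

Variables (H : R).
Hypothesis hH : 1 / 2 < H < 1.

Definition wave_upper_cst (T : R) : R :=
  tent_cst H * ((T + 1) / (2 * H - 1) + 4 * T / (3 - 2 * H) + 4 / (2 - 2 * H)).

Lemma powR_shift (x p : R) (n : nat) : 0 < x -> x ^+ n * x `^ p = x `^ (p + n%:R).
Proof.
by move=> x0; rewrite powRD ?(gt_eqF x0) ?implybT// powR_mulrn ?ltW// mulrC.
Qed.

(** The two bounds on the window integral are of the same order at length [1 / r]. Each of
    the two ranges of [l] contributes at most a multiple of [r^-(2H+1)]: the power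
    [-(2H-1)] of [r] from short windows is multiplied by [r^-2], the powers [3-2H] and
    [2-2H] from long ones by [r^-4]. *)
Lemma wave_energy_high (T t r : R) : 0 <= t -> t <= T -> 1 <= r ->
  (energy H (wave_slice t r) <= (wave_upper_cst T * (r^-1) `^ (2 * H + 1))%:E)%E.
Proof.
move=> t0 tT r1; have r0 : 0 < r := lt_le_trans ltr01 r1.
have [h1 h2] := andP hH; have T0 := le_trans t0 tT.
have kap0 := tent_cst_gt0 hH.
set e := r^-1; have e0 : 0 < e by rewrite invr_gt0.
have e1 : e <= 1 by rewrite invf_le1.
(* The square of [m] bounds the square of the window integral; windows outside [[0, T + l]] miss the time interval. *)
pose m (l : R) := if l <= e then l * e else 2 * e ^+ 2.
pose G (l z : R) : R := tent_weight H l * m l ^+ 2 * \1_(`[0, T + l]%classic) z.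
have mm : measurable_fun setT m.
  by apply: measurable_fun_ifT; meas.
have mG : measurable_fun setT (fun q : R * R => G q.1 q.2).
  apply: measurable_funM; first apply: measurable_funM.
  - exact: measurableT_comp (measurable_tent_weight _) measurable_fst.
  - by apply: measurable_funX; exact: measurableT_comp mm measurable_fst.
  - rewrite (_ : (fun q : R * R => _) = (fun q => if (0 <= q.2) && (q.2 <= T + q.1) then 1 else 0)).
      apply: measurable_fun_ifT; meas.
    by apply/funext => q; rewrite indicE mem_setE in_itv/=; case: (_ && _).
have G0 l z : 0 <= G l z by rewrite /G mulr_ge0// mulr_ge0 ?tent_weight_ge0 ?sqr_ge0.
have tw := wave_slice_tame (ltW r0) t0 tT; have [mw _ _] := tw.
rewrite energyE.
apply: (@le_trans _ _ (\int[leb1 \x leb1]_q (G q.1 q.2)%:E)%E).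
  apply: ge0_le_integral => //.
  - by move=> p _; rewrite lee_fin mulr_ge0 ?tent_weight_ge0 ?sqr_ge0.
  - exact: measurable_energy_integrand.
  - exact/measurable_EFinP.
  move=> [l z] _; rewrite lee_fin /G/= -mulrA.
  have [l0|l0] := ltP 0 l; last by rewrite /tent_weight ltNge l0/= !mul0r.
  rewrite ler_wpM2l ?tent_weight_ge0// indicE mem_setE in_itv/=.
  have [z0|z0] := leP 0 z; last by rewrite window_integral_eq0 ?z0// expr0n mulr0.
  have [zt|zt] := leP z (T + l); last first.
    by rewrite window_integral_eq0 ?expr0n ?mulr0//; apply/orP; right; lra.
  rewrite mulr1 -[leLHS]real_normK ?num_real// ler_pXn2r ?nnegrE//; last first.
    by rewrite /m; case: ifP => _; rewrite mulr_ge0 ?sqr_ge0// ltW.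
  rewrite /m; case: ifP => _; first exact/window_integral_le_length/ltW.
  by rewrite /e exprVn; exact: window_integral_le_inv.
rewrite (integral_prod_measure leb1 leb1 (fun l z => (G l z)%:E)); last 2 first.
- exact/measurable_EFinP.
- by move=> l z; rewrite lee_fin.
have sl l : 0 < l -> (\int[leb1]_z (G l z)%:E = (tent_weight H l * m l ^+ 2 * (T + l))%:E)%E.
  move=> l0; rewrite /G; under eq_integral do rewrite EFinM.
  rewrite ge0_integralZl//; last 2 first.
  - by apply/measurable_EFinP; exact: measurable_indic.
  - by rewrite lee_fin mulr_ge0 ?tent_weight_ge0 ?sqr_ge0.
  rewrite integral_indic// setIT.
  have := @lebesgue_measure_itv R `[0, T + l]; rewrite /= => ->.
  by rewrite lte_fin ltr_wpDl// oppr0 adde0 -EFinM.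
have -> : (\int[leb1]_l \int[leb1]_z (G l z)%:E =
    \int[leb1]_(l in `]0%R, +oo[) (tent_weight H l * m l ^+ 2 * (T + l))%:E)%E.
  rewrite [RHS]integral_mkcond; apply: eq_integral => l _.
  rewrite patchE mem_setE in_itv/= andbT; case: ifPn => [/sl//|l0].
  by rewrite integral0_eq// => z _; rewrite /G /tent_weight (negbTE l0) !mul0r.
have mp (p : R) D : measurable_fun D (fun x : R => (x `^ p)%:E).
  by apply/measurable_EFinP; apply: measurable_funTS; meas.
have mF D : measurable_fun D (fun l : R => (tent_weight H l * m l ^+ 2 * (T + l))%:E).
  apply/measurable_EFinP; apply: measurable_funTS.
  apply: measurable_funM; last exact: (@measurable_funD _ _ _ _ (fun=> T) id).
  apply: measurable_funM; last exact: (measurable_funX _ mm).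
  exact: measurable_tent_weight.
have F0 l : 0 <= l -> (0 <= (tent_weight H l * m l ^+ 2 * (T + l))%:E)%E.
  by move=> l0; rewrite lee_fin mulr_ge0 ?addr_ge0// mulr_ge0 ?tent_weight_ge0 ?sqr_ge0.
have -> : `]0, +oo[%classic = `]0, e] `|` `]e, +oo[.
  by rewrite -itv_bndbnd_setU// ?bnd_simp// ltW.
rewrite ge0_integral_setU//; try exact: mF; last 2 first.
- by move=> l [] /=; rewrite in_itv/= => /andP[h3 _]; apply: F0; lra.
- apply/disj_setPS => x [] /=; rewrite !in_itv/= andbT => /andP[_ xa] ax.
  by rewrite ltNge xa in ax.
have near0 : (\int[leb1]_(l in `]0%R, e]) (tent_weight H l * m l ^+ 2 * (T + l))%:E <=
    (tent_cst H * (T + 1) * e ^+ 2 * (e `^ (2 * H - 1) / (2 * H - 1)))%:E)%E.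
  have E0 := @integral_powR_0 R (2 * H - 2) e ltac:(lra) e0.
  rewrite (_ : 2 * H - 2 + 1 = 2 * H - 1) in E0; last by ring.
  rewrite [leRHS]EFinM -E0.
  rewrite -ge0_integralZl//; try solve [exact: mp | by move=> *; rewrite lee_fin powR_ge0
    | by rewrite lee_fin mulr_ge0 ?sqr_ge0// mulr_ge0 ?addr_ge0// ltW].
  apply: ge0_le_integral => //.
  - by move=> l /=; rewrite in_itv/= => /andP[h3 _]; apply: F0; lra.
  - exact: mF.
  - by apply: measurable_funeM; exact: mp.
  move=> l /=; rewrite in_itv/= => /andP[l0 le].
  rewrite -EFinM lee_fin /m le /tent_weight l0 exprMn.
  have -> : tent_cst H * l `^ (2 * H - 4) * (l ^+ 2 * e ^+ 2) * (T + l) =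
    (l ^+ 2 * l `^ (2 * H - 4)) * (tent_cst H * e ^+ 2 * (T + l)) by ring.
  rewrite powR_shift//; have -> : 2 * H - 4 + 2%:R = 2 * H - 2 by ring.
  rewrite [leRHS]mulrC; apply: ler_wpM2l; first exact: powR_ge0.
  have -> : tent_cst H * (T + 1) * e ^+ 2 = tent_cst H * e ^+ 2 * (T + 1) by ring.
  apply: ler_wpM2l; first by rewrite mulr_ge0 ?sqr_ge0// ltW.
  lra.
have far : (\int[leb1]_(l in `]e, +oo[) (tent_weight H l * m l ^+ 2 * (T + l))%:E =
    (tent_cst H * 4 * e ^+ 4 * (T * (e `^ (2 * H - 3) / (3 - 2 * H)) + e `^ (2 * H - 2) / (2 - 2 * H)))%:E)%E.
  rewrite integral_itv_obnd_cbnd; last exact: mF.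
  have := @integral_powR_y R (2 * H - 4) e; have -> : 2 * H - 4 + 1 = 2 * H - 3 by ring.
  move=> /(_ _ e0); have -> : - (2 * H - 3) = 3 - 2 * H by ring.
  move=> E1; have {}E1 := E1 ltac:(lra).
  have := @integral_powR_y R (2 * H - 3) e; have -> : 2 * H - 3 + 1 = 2 * H - 2 by ring.
  move=> /(_ _ e0); have -> : - (2 * H - 2) = 2 - 2 * H by ring.
  move=> E2; have {}E2 := E2 ltac:(lra).
  rewrite [RHS]EFinM EFinD [(T * _)%:E]EFinM -E1 -E2.
  rewrite -ge0_integralZl//; try solve [exact: mp | by move=> *; rewrite lee_fin powR_ge0].
  rewrite -ge0_integralD//; try solve [exact: mp | by move=> *; rewrite lee_fin powR_ge0
    | by apply: measurable_funeM; exact: mp | by move=> *; rewrite -EFinM lee_fin mulr_ge0 ?powR_ge0].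
  rewrite -ge0_integralZl//; last 3 first.
  - by apply: emeasurable_funD; [apply: measurable_funeM|]; exact: mp.
  - by move=> l _; rewrite -EFinM -EFinD lee_fin addr_ge0 ?mulr_ge0 ?powR_ge0.
  - by rewrite lee_fin mulr_ge0 ?exprn_ge0 ?(ltW e0)// mulr_ge0// ltW.
  rewrite -integral_itv_obnd_cbnd; last exact: mF.
  rewrite -[RHS]integral_itv_obnd_cbnd; last first.
    by apply: measurable_funeM; apply: emeasurable_funD; [apply: measurable_funeM|]; exact: mp.
  apply: eq_integral => l; rewrite inE/= in_itv/= andbT => el.
  have l0 := lt_trans e0 el.
  suff -> : tent_weight H l * m l ^+ 2 * (T + l) =
    tent_cst H * 4 * e ^+ 4 * (T * l `^ (2 * H - 4) + l `^ (2 * H - 3)) by [].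
  rewrite /m leNgt el/= /tent_weight l0.
  have -> : 2 * H - 3 = 2 * H - 4 + 1%:R by ring.
  rewrite -powR_shift//; ring.
apply: le_trans (leeD near0 (lexx _)) _; rewrite far -EFinD lee_fin.
have E1 : e ^+ 2 * e `^ (2 * H - 1) = e `^ (2 * H + 1).
  by rewrite powR_shift//; congr (_ `^ _); ring.
have E2 : e ^+ 4 * e `^ (2 * H - 3) = e `^ (2 * H + 1).
  by rewrite powR_shift//; congr (_ `^ _); ring.
have E3 : e ^+ 4 * e `^ (2 * H - 2) <= e `^ (2 * H + 1).
  rewrite powR_shift//; have -> : 2 * H - 2 + 4%:R = (2 * H + 1) + 1%:R by ring.
  by rewrite -powR_shift// ler_piMl ?powR_ge0.
have -> : tent_cst H * (T + 1) * e ^+ 2 * (e `^ (2 * H - 1) / (2 * H - 1)) +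
  tent_cst H * 4 * e ^+ 4 * (T * (e `^ (2 * H - 3) / (3 - 2 * H)) + e `^ (2 * H - 2) / (2 - 2 * H)) =
  tent_cst H * ((T + 1) / (2 * H - 1) * (e ^+ 2 * e `^ (2 * H - 1)) +
    4 * T / (3 - 2 * H) * (e ^+ 4 * e `^ (2 * H - 3)) +
    4 / (2 - 2 * H) * (e ^+ 4 * e `^ (2 * H - 2))) by ring.
rewrite E1 E2 /wave_upper_cst -[leRHS]mulrA; apply: ler_wpM2l; first exact: ltW.
rewrite [leRHS]mulrDl [X in _ <= X + _]mulrDl lerD2l; apply: ler_wpM2l => //; apply: divr_ge0; lra.
Qed.

(** The weight of the integrability condition. *)
Definition wave_weight (r : R) : R := ((1 + r ^+ 2)^-1) `^ (H + 1 / 2).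

Lemma wave_weight_ge0 r : 0 <= wave_weight r.
Proof. exact: powR_ge0. Qed.

Lemma inv_powR_double (r : R) : 0 < r -> (r^-1) `^ (2 * H + 1) = ((r ^+ 2)^-1) `^ (H + 1 / 2).
Proof.
move=> r0; rewrite -exprVn -powR_mulrn ?invr_ge0 ?(ltW r0)// -powRrM.
by congr (_ `^ _); field.
Qed.

(** High frequencies by [wave_energy_high]; for [r <= 1] the multiplier is bounded by [T]
    and the weight is bounded from below. *)
Lemma wave_energy_upper (T : R) : 0 <= T -> exists2 C, 0 <= C &
  forall t r, 0 <= t -> t <= T -> 0 <= r ->
  (energy H (wave_slice t r) <= (C * wave_weight r)%:E)%E.
Proof.
move=> T0; have [h1 h2] := andP hH; have kap0 := tent_cst_gt0 hH.
have U0 : 0 <= wave_upper_cst T.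
  rewrite /wave_upper_cst; apply: mulr_ge0; first exact: ltW.
  by rewrite !addr_ge0//; apply: divr_ge0; lra.
pose D : R := 2 `^ (H + 1 / 2).
have D0 : 0 < D by exact: powR_gt0.
pose A := T ^+ 2 * T `^ (2 * H).
have A0 : 0 <= A by rewrite mulr_ge0 ?sqr_ge0 ?powR_ge0.
exists ((wave_upper_cst T + A) * D); first by rewrite mulr_ge0 ?addr_ge0// ltW.
have W (x : R) : 0 < x -> 1 <= 2 * x -> x `^ (H + 1 / 2) * D >= 1.
  move=> x0 x1; rewrite /D -powRM ?(ltW x0)//.
  apply: (@le_trans _ _ (1 `^ (H + 1 / 2))); first by rewrite powR1.
  by apply: ge0_ler_powR; rewrite ?nnegrE ?mulr_ge0 ?(ltW x0)// 1?mulrC//; lra.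
move=> t r t0 tT r0; have [r1|/ltW r1] := leP 1 r.
  have r0' : 0 < r by lra.
  apply: le_trans (wave_energy_high t0 tT r1) _; rewrite lee_fin.
  have -> : (wave_upper_cst T + A) * D * wave_weight r = (wave_upper_cst T + A) * (wave_weight r * D) by ring.
  apply: (@le_trans _ _ (wave_upper_cst T * (wave_weight r * D))); last first.
    by rewrite ler_wpM2r ?mulr_ge0 ?wave_weight_ge0 ?lerDl// ltW.
  apply: ler_wpM2l => //; rewrite inv_powR_double// /wave_weight /D -powRM ?invr_ge0 ?addr_ge0 ?sqr_ge0//.
  apply: ge0_ler_powR; rewrite ?nnegrE ?mulr_ge0 ?invr_ge0 ?addr_ge0 ?sqr_ge0//; first lra.
  have p1 : 0 < 1 + r ^+ 2 by rewrite ltr_wpDr ?sqr_ge0.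
  have p2 : 0 < r ^+ 2 by rewrite exprn_gt0.
  rewrite -(ler_pM2r (mulr_gt0 p1 p2)) mulrCA mulVf ?gt_eqF// mulr1.
  have -> : (1 + r ^+ 2)^-1 * 2 * ((1 + r ^+ 2) * r ^+ 2) = 2 * r ^+ 2 by field; rewrite gt_eqF.
  by nra.
apply: le_trans (energy_finite_le hH T0 (wave_slice_tame r0 t0 tT)) _; rewrite lee_fin.
apply: (@le_trans _ _ (A * 1)).
  rewrite mulr1 /A; apply: ler_pM; rewrite ?sqr_ge0 ?powR_ge0//.
  by rewrite ler_pXn2r ?nnegrE.
have -> : (wave_upper_cst T + A) * D * wave_weight r = (wave_upper_cst T + A) * (wave_weight r * D) by ring.
apply: ler_pM => //; first by rewrite lerDr.
apply: W; first by rewrite invr_gt0 ltr_wpDr ?sqr_ge0.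
by rewrite ler_pdivlMr ?ltr_wpDr ?sqr_ge0//; nra.
Qed.

Lemma measurable_energy_slice (a : R -> R) (z1 z2 : R) : measurable_fun setT a ->
  measurable_fun setT (fun l => \int[leb1]_(z in `[z1, z2])
     (tent_weight H l * window_integral a (l, z) ^+ 2)%:E)%E.
Proof.
move=> ma; have mE := measurable_energy_integrand H ma.
under eq_fun do rewrite integral_mkcond.
apply: (measurable_integralr leb1 (fun l z => ((fun z => (tent_weight H l * window_integral a (l, z) ^+ 2)%:E) \_ `[z1, z2]) z)).
  rewrite (_ : (fun q : R * R => _) = (fun q => if (z1 <= q.2) && (q.2 <= z2) then (tent_weight H q.1 * window_integral a q ^+ 2)%:E else 0%E)).
    by apply: measurable_fun_ifT => //; meas.
  by apply/funext => -[l z]; rewrite patchE mem_setE in_itv/=.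
move=> l z; rewrite patchE; case: ifP => // _.
by rewrite lee_fin mulr_ge0 ?tent_weight_ge0 ?sqr_ge0.
Qed.

Lemma energy_ge_rectangle (a : R -> R) (l1 l2 z1 z2 : R) : measurable_fun setT a ->
  (\int[leb1]_(l in `[l1, l2]) \int[leb1]_(z in `[z1, z2])
     (tent_weight H l * window_integral a (l, z) ^+ 2)%:E <= energy H a)%E.
Proof.
move=> ma; have mE := measurable_energy_integrand H ma.
have E0 (p : R * R) : (0 <= (tent_weight H p.1 * window_integral a p ^+ 2)%:E)%E.
  by rewrite lee_fin mulr_ge0 ?tent_weight_ge0 ?sqr_ge0.
rewrite energyE.
have -> : (\int[leb1 \x leb1]_p (tent_weight H p.1 * window_integral a p ^+ 2)%:E =
   \int[leb1]_l \int[leb1]_z (tent_weight H l * window_integral a (l, z) ^+ 2)%:E)%E.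
  rewrite -(integral_prod_measure leb1 leb1 (fun l z => (tent_weight H l * window_integral a (l, z) ^+ 2)%:E)).
  - by apply: eq_integral => -[l z].
  - by move: mE; apply: eq_measurable_fun => -[l z].
  - by move=> l z; exact: (E0 (l, z)).
have ms l : measurable_fun setT (fun z => (tent_weight H l * window_integral a (l, z) ^+ 2)%:E).
  exact: (measurableT_comp mE (pair1_measurable l)).
have mi : measurable_fun setT (fun l => \int[leb1]_z (tent_weight H l * window_integral a (l, z) ^+ 2)%:E)%E.
  apply: (measurable_integralr leb1 (fun l z => (tent_weight H l * window_integral a (l, z) ^+ 2)%:E)).
    by move: mE; apply: eq_measurable_fun => -[l z].
  by move=> l z; exact: (E0 (l, z)).
apply: (@le_trans _ _ (\int[leb1]_(l in `[l1, l2]) \int[leb1]_z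
     (tent_weight H l * window_integral a (l, z) ^+ 2)%:E)%E).
  apply: ge0_le_integral => //.
  - by move=> l _; apply: integral_ge0 => z _; exact: (E0 (l, z)).
  - by apply: measurable_funTS; exact: measurable_energy_slice.
  - exact: measurable_funTS.
  - move=> l _; apply: ge0_subset_integral => //; first exact: ms.
    by move=> z _; exact: (E0 (l, z)).
apply: ge0_subset_integral => //.
by move=> l _; apply: integral_ge0 => z _; exact: (E0 (l, z)).
Qed.

Lemma integral_cst_itv (k a b : R) : 0 <= k -> a <= b ->
  (\int[leb1]_(x in `[a, b]) k%:E = (k * (b - a))%:E)%E.
Proof.
move=> k0; rewrite le_eqVlt => /predU1P[<-|ab].
  by rewrite set_itv1 integral_set1 subrr mulr0.
rewrite integral_cst//; have := @lebesgue_measure_itv R `[a, b]; rewrite /= => ->.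
by rewrite lte_fin ab -EFinB -EFinM.
Qed.

(** Over an interval of length 3 the mean value 1/2 of the square is corrected by at most
    1/2. *)
Lemma integral_sin2_affine (c r : R) : 1 <= r ->
  ((1)%:E <= \int[leb1]_(z in `[1%R, 4%R]) (sin ((c - z) * r) ^+ 2)%:E)%E.
Proof.
move=> r1; have r0 : 0 < r by lra.
pose F (z : R) := z / 2 + sin ((c - z) * (2 * r)) / (4 * r).
have dF (x : R) : is_derive x 1 F (sin ((c - x) * r) ^+ 2).
  have D0 := is_deriveM (is_deriveB (is_derive_cst c x 1) (is_derive_id x 1)) (is_derive_cst (2 * r) x 1).
  have D1 : is_derive x 1 (fun u => (c - u) * (2 * r)) (- (2 * r)).
    by apply: (is_derive_eq D0); rewrite scaler0 add0r sub0r /GRing.scale/= mulrN1.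
  have D2 := @is_derive1_comp R sin (fun u => (c - u) * (2 * r)) x _ _ (is_derive_sin _) D1.
  have D3 := is_deriveM D2 (is_derive_cst ((4 * r)^-1) x 1).
  have D4 := is_deriveM (is_derive_id x 1) (is_derive_cst (2^-1 : R) x 1).
  apply: (is_derive_eq (is_deriveD D4 D3)); rewrite !scaler0 !add0r /GRing.scale/=.
  have -> : (c - x) * (2 * r) = ((c - x) * r) *+ 2 by rewrite -mulr_natr; ring.
  rewrite cos_mulr2n cos2sin2; field; rewrite gt_eqF//.
have cF : continuous F.
  by move=> x; apply: differentiable_continuous; apply/derivable1_diffP; have [] := dF x.
have cf : continuous (fun z => sin ((c - z) * r) ^+ 2).
  move=> x; apply: (@continuous_comp _ _ _ (fun z => sin ((c - z) * r)) (fun y => y ^+ 2)); last exact: exprn_continuous.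
  apply: continuous_comp; last exact: continuous_sin.
  by apply: cvgM; [apply: cvgB; [exact: cvg_cst|exact: cvg_id]|exact: cvg_cst].
rewrite (@continuous_FTC2 _ _ F) ?ltr1n//.
- rewrite -EFinB lee_fin /F.
  have h x : `|sin x / (4 * r)| <= 1 / 4.
    have p4 : 0 < 4 * r by lra.
    rewrite normrM normfV (gtr0_norm p4) ler_pdivrMr//.
    by rewrite (le_trans (sin_max _))//; lra.
  have := h ((c - 4) * (2 * r)); have := h ((c - 1) * (2 * r)).
  by rewrite !ler_norml => /andP[h1 h2] /andP[h3 h4]; lra.
- exact: continuous_subspaceT.
- split.
  + by move=> x _; have [] := dF x.
  + exact/cvg_at_right_filter/cF.
  + exact/cvg_at_left_filter/cF.
- by move=> x _; rewrite derive1E; have X := dF x; rewrite derive_val.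
Qed.

(** The low frequencies give [1/4096 * 1/2 * 1/8 = 2^-16], the high ones [1/32]. *)
Definition wave_lower_cst : R := tent_cst H / 65536%:R.

Lemma wave_lower_cst_gt0 : 0 < wave_lower_cst.
Proof. by rewrite divr_gt0// tent_cst_gt0. Qed.

Lemma window_integral_wave4 (r l z : R) : 1 <= r -> 0 < l -> l <= 1 -> 1 <= z -> z <= 4 ->
  window_integral (wave_slice 4 r) (l, z) =
  2 * sin ((4 + l / 2 - z) * r) * sin (l / 2 * r) / r ^+ 2.
Proof.
move=> r1 l0 l1 z1 z4; rewrite window_integral_wave/=; last lra.
rewrite max_l; last lra.
rewrite min_l//.
have -> : z - l < z by lra.
have -> : (4 - z) * r = (4 + l / 2 - z) * r - l / 2 * r by field.
have -> : (4 - (z - l)) * r = (4 + l / 2 - z) * r + l / 2 * r by field.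
rewrite cosB cosD; congr (_ / _); ring.
Qed.

Lemma energy_ge_slices (a : R -> R) (B l1 l2 z1 z2 : R) : measurable_fun setT a ->
  0 <= B -> l1 <= l2 ->
  (forall l, l1 <= l <= l2 -> (B%:E <= \int[leb1]_(z in `[z1, z2])
     (tent_weight H l * window_integral a (l, z) ^+ 2)%:E)%E) ->
  ((B * (l2 - l1))%:E <= energy H a)%E.
Proof.
move=> ma B0 l12 hB; apply: le_trans (@energy_ge_rectangle _ l1 l2 z1 z2 ma).
rewrite -integral_cst_itv//; apply: ge0_le_integral => //.
by apply: measurable_funTS; exact: measurable_energy_slice.
Qed.

Lemma powR_neg_le (x y p : R) : 0 < x -> x <= y -> p <= 0 -> y `^ p <= x `^ p.
Proof.
move=> x0 xy p0; rewrite -[p]opprK [leLHS]powRN [leRHS]powRN.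
have y0 := lt_le_trans x0 xy.
rewrite lef_pV2 ?posrE ?powR_gt0//.
by apply: ge0_ler_powR; rewrite ?nnegrE ?oppr_ge0// ltW.
Qed.

(** Windows of length between [1 / (2 r)] and [1 / r]: there [sin (l r / 2)] is bounded
    from below, and the other sine has a square integral at least 1 in [z]. *)
Lemma wave_energy_lower_high (r : R) : 1 <= r ->
  ((wave_lower_cst * (r^-1) `^ (2 * H + 1))%:E <= energy H (wave_slice 4 r))%E.
Proof.
move=> r1; have r0 : 0 < r by lra.
have [h1 h2] := andP hH; have kap0 := tent_cst_gt0 hH.
set e := r^-1; have e0 : 0 < e by rewrite invr_gt0.
have e1 : e <= 1 by rewrite invf_le1.
have er : e * r = 1 by rewrite mulVf ?gt_eqF.
pose B := tent_cst H * e `^ (2 * H - 4) * (e ^+ 4 / 16).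
have K0 : 0 <= tent_cst H * e `^ (2 * H - 4) by rewrite mulr_ge0 ?powR_ge0// ltW.
have B0 : 0 <= B by rewrite /B mulr_ge0// divr_ge0// exprn_ge0// ltW.
apply: (@le_trans _ _ (B * (e - e / 2))%:E).
  rewrite lee_fin /B /wave_lower_cst.
  have -> : e `^ (2 * H + 1) = e ^+ 5 * e `^ (2 * H - 4).
    by rewrite powR_shift//; congr (_ `^ _); ring.
  have := mulr_ge0 K0 (exprn_ge0 5 (ltW e0)).
  move: (e `^ _) => q; rewrite !exprS expr0; set X := tent_cst H; lra.
apply: (@energy_ge_slices _ B (e / 2) e 1 4) => //; [exact: measurable_wave_slice|lra|].
move=> l /andP[l1 l2]; have l0 : 0 < l by lra.
have mS : measurable_fun setT (fun z : R => (sin ((4 + l / 2 - z) * r) ^+ 2)%:E).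
  apply/measurable_EFinP; apply: measurable_funX; apply: continuous_measurable_fun => x.
  apply: continuous_comp; last exact: continuous_sin.
  by apply: cvgM; [apply: cvgB; [exact: cvg_cst|exact: cvg_id]|exact: cvg_cst].
apply: (@le_trans _ _ (\int[leb1]_(z in `[1%R, 4%R]) (B%:E * (sin ((4 + l / 2 - z) * r) ^+ 2)%:E))%E).
  rewrite ge0_integralZl//; last 2 first.
  - exact: measurable_funTS.
  - by move=> z _; rewrite lee_fin sqr_ge0.
  by rewrite -[leLHS]mule1; apply: lee_wpmul2l; [rewrite lee_fin|exact: integral_sin2_affine].
have ma := measurable_wave_slice 4 r.
apply: ge0_le_integral => //.
- by move=> z _; rewrite mule_ge0// lee_fin sqr_ge0.
- by apply: measurable_funeM; exact: measurable_funTS.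
- apply: measurable_funTS.
  exact: (measurableT_comp (measurable_energy_integrand H ma) (pair1_measurable l)).
move=> z /=; rewrite in_itv/= => /andP[z1 z4]; rewrite -EFinM lee_fin.
rewrite window_integral_wave4//; last lra.
rewrite /tent_weight l0 /B.
(* [l r / 2] lies between 1/4 and 1/2. *)
have s8 : 1 / 8 <= sin (l / 2 * r).
  have lr : e / 2 * r <= l * r by rewrite ler_pM2r.
  have lr' : l * r <= e * r by rewrite ler_pM2r.
  have := @sin_ge_half R (l / 2 * r); rewrite (_ : l / 2 * r = (l * r) / 2); last by field.
  move=> h; have {}h := h ltac:(apply/andP; split; lra); lra.
have -> : (2 * sin ((4 + l / 2 - z) * r) * sin (l / 2 * r) / r ^+ 2) ^+ 2 =
  sin ((4 + l / 2 - z) * r) ^+ 2 * (e ^+ 4 * (4 * sin (l / 2 * r) ^+ 2)).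
  by rewrite /e; field; rewrite gt_eqF.
have p : e `^ (2 * H - 4) <= l `^ (2 * H - 4) by apply: powR_neg_le => //; lra.
have s64 : 1 / 16 <= 4 * sin (l / 2 * r) ^+ 2 by nra.
rewrite [leLHS]mulrAC [leRHS]mulrA; apply: ler_pM.
- by rewrite mulr_ge0// sqr_ge0.
- by rewrite divr_ge0// exprn_ge0// ltW.
- by rewrite ler_wpM2r ?sqr_ge0// ler_wpM2l// ltW.
- by apply: ler_wpM2l; [rewrite exprn_ge0// ltW|rewrite -[leLHS]mul1r].
Qed.

(** For such windows [u] stays between [3] and [15/4], so that [(4 - u) r <= 1] and the
    multiplier is at least [(4 - u) / 2 >= 1 / 8]. *)
Lemma window_integral_wave_low (r l z : R) : 0 <= r -> r <= 1 ->
  0 < l -> l <= 1 / 4 -> 13 / 4 <= z -> z <= 15 / 4 ->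
  l / 8 <= window_integral (wave_slice 4 r) (l, z).
Proof.
move=> r0 r1 l0 l1 z1 z4.
have tw : tame 4 4 (wave_slice 4 r) by apply: wave_slice_tame.
have I1 : leb1.-integrable setT (fun u => (8^-1 * \1_(`[z - l, z]%classic) u)%:E : \bar R).
  under eq_fun do rewrite EFinM.
  by apply: integrableZl => //; apply: integrable_indic_itv.
have -> : l / 8 = \int[leb1]_u (8^-1 * \1_(`[z - l, z]%classic) u).
  rewrite RintegralZl//; last exact: integrable_indic_itv.
  rewrite /Rintegral integral_indic// setIT.
  have := @lebesgue_measure_itv R `[z - l, z]; rewrite /= => ->.
  by rewrite lte_fin ltrBlDr ltrDl l0 -EFinB/= mulrC opprB addrC subrK.
apply: le_Rintegral => //; first exact: (window_integrable (l, z) tw).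
move=> u _; rewrite indicE mem_setE in_itv/= /window/=.
case: (boolP (z - l <= u <= z)) => [/andP[u1 u2]|_] /=; last by rewrite mulr0n mulr0 mul0r.
have u0 : 0 < u by lra.
rewrite u0/= mulr1n mulr1 mul1r /wave_slice (ltW u0)/=.
have -> : u <= 4 by lra.
have h : (4 - u) / 2 <= wave r (4 - u) by apply: wave_ge_half => //; [lra|nra].
by apply: le_trans h; lra.
Qed.

Lemma wave_energy_lower_low (r : R) : 0 <= r -> r <= 1 ->
  (wave_lower_cst%:E <= energy H (wave_slice 4 r))%E.
Proof.
move=> r0 r1; have [h1 h2] := andP hH; have kap0 := tent_cst_gt0 hH.
have B0 : 0 <= tent_cst H / 4096 * (1 / 2) by lra.
apply: (@le_trans _ _ ((tent_cst H / 4096 * (1 / 2)) * (1 / 4 - 1 / 8))%:E).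
  by rewrite lee_fin /wave_lower_cst; lra.
apply: (@energy_ge_slices _ _ (1 / 8) (1 / 4) (13 / 4) (15 / 4)) => //;
  [exact: measurable_wave_slice|lra|].
move=> l /andP[l1 l2]; have l0 : 0 < l by lra.
have ma := measurable_wave_slice 4 r.
have k0 : 0 <= tent_cst H / 4096 by lra.
apply: (@le_trans _ _ (\int[leb1]_(z in `[(13 / 4)%R, (15 / 4)%R]) (tent_cst H / 4096)%:E)%E).
  by rewrite integral_cst_itv//; [rewrite lee_fin; lra|lra].
apply: ge0_le_integral => //.
- apply: measurable_funTS.
  exact: (measurableT_comp (measurable_energy_integrand H ma) (pair1_measurable l)).
move=> z /=; rewrite in_itv/= => /andP[z1 z4]; rewrite lee_fin.
have := window_integral_wave_low r0 r1 l0 l2 z1 z4; set w := window_integral _ _ => hw.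
rewrite /tent_weight l0.
have p : 1 <= l `^ (2 * H - 4).
  apply: (@le_trans _ _ (1 `^ (2 * H - 4))); first by rewrite powR1.
  by apply: powR_neg_le => //; lra.
have w2 : 1 / 4096 <= w ^+ 2 by nra.
rewrite -mulrA; apply: ler_wpM2l; first exact: ltW.
by apply: (@le_trans _ _ (1 * w ^+ 2)); [rewrite mul1r; lra|rewrite ler_wpM2r ?sqr_ge0].
Qed.

(** At time 4 both regimes have room: the windows used lie inside [[0, 4]]. *)
Lemma wave_energy_lower (r : R) : 0 <= r ->
  ((wave_lower_cst * wave_weight r)%:E <= energy H (wave_slice 4 r))%E.
Proof.
move=> r0; have [h1 h2] := andP hH.
have [r1|/ltW r1] := leP 1 r.
  apply: le_trans (wave_energy_lower_high r1); rewrite lee_fin.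
  apply: ler_wpM2l; first exact/ltW/wave_lower_cst_gt0.
  rewrite inv_powR_double; last lra.
  apply: ge0_ler_powR; rewrite ?nnegrE ?invr_ge0 ?addr_ge0 ?sqr_ge0//; first lra.
  by rewrite lef_pV2 ?posrE ?exprn_gt0 ?ltr_wpDr ?sqr_ge0// ?lerDr//; lra.
apply: le_trans (wave_energy_lower_low r0 r1); rewrite lee_fin.
rewrite ler_piMr//; first exact/ltW/wave_lower_cst_gt0.
rewrite /wave_weight; apply: (@le_trans _ _ (1 `^ (H + 1 / 2))); last by rewrite powR1.
apply: ge0_ler_powR; rewrite ?nnegrE ?invr_ge0 ?addr_ge0 ?sqr_ge0//; first lra.
by rewrite invf_le1 ?ltr_wpDr ?sqr_ge0// lerDl sqr_ge0.
Qed.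

End wave_multiplier.

(** * Gaussian integrals on the line *)

Section gauss1.
Context {R : realType}.
Notation leb1 := (@lebesgue_measure R).

Definition gauss (a w x : R) : R := expR (- a * (x - w) ^+ 2).

Lemma continuous_gauss a w : continuous (gauss a w).
Proof.
move=> x; apply: continuous_comp; last exact: continuous_expR.
apply: cvgM; first exact: cvg_cst.
apply: (@continuous_comp _ _ _ (fun x => x - w) (fun y => y ^+ 2)); last exact: exprn_continuous.
by apply: cvgB; [exact: cvg_id|exact: cvg_cst].
Qed.

Lemma continuous_sin_affine xi th : continuous (fun x : R => sin (x * xi + th)).
Proof.
move=> x; apply: continuous_comp; last exact: continuous_sin.
by apply: cvgD; [apply: cvgM; [exact: cvg_id|exact: cvg_cst]|exact: cvg_cst].
Qed.

Lemma continuous_cos_affine xi th : continuous (fun x : R => cos (x * xi + th)).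
Proof.
move=> x; apply: continuous_comp; last exact: continuous_cos.
by apply: cvgD; [apply: cvgM; [exact: cvg_id|exact: cvg_cst]|exact: cvg_cst].
Qed.

Lemma integral_gauss (a w : R) : 0 < a ->
  (\int[leb1]_x (gauss a w x)%:E = (Num.sqrt (pi / a))%:E)%E.
Proof.
move=> a0; have sa : 0 < Num.sqrt a by rewrite sqrtr_gt0.
have sa0 : Num.sqrt a != 0 by rewrite gt_eqF.
have mg : measurable_fun setT (fun x : R => (gauss_fun x)%:E).
  by apply/measurable_EFinP; exact: measurable_gauss_fun.
have := @integral_affine R (Num.sqrt a) (- Num.sqrt a * w) (fun x => (gauss_fun x)%:E) sa0 mg.
move=> h; have {h} := h (fun x => gauss_fun_ge0 x).
rewrite integralT_gauss gtr0_norm// => h.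
have -> : (\int[leb1]_x (gauss a w x)%:E = \int[leb1]_x (gauss_fun (Num.sqrt a * x + - Num.sqrt a * w))%:E)%E.
  apply: eq_integral => x _; congr EFin; rewrite /gauss /gauss_fun; congr expR.
  by rewrite -{1}(sqr_sqrtr (ltW a0)); ring.
move: h; case: (\int[leb1]_x _)%E => [y| |].
- move=> -[h]; congr EFin; rewrite sqrtrM ?pi_ge0// sqrtrV ?ltW// h mulrAC divff// mul1r//.
- by rewrite gt0_muley ?lte_fin.
- by rewrite gt0_muleNy ?lte_fin.
Qed.

Lemma integrable_gauss (a w : R) : 0 < a -> leb1.-integrable setT (EFin \o gauss a w).
Proof.
move=> a0; apply/integrableP; split.
  by apply/measurable_EFinP; apply: continuous_measurable_fun; exact: continuous_gauss.
under eq_integral => x _ do rewrite gee0_abs ?lee_fin ?expR_ge0//.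
by rewrite integral_gauss// ltry.
Qed.

Lemma x_gauss_le (x : R) : `|x| * expR (- x ^+ 2) <= expR (- (1 / 2) * x ^+ 2).
Proof.
have -> : - x ^+ 2 = - (1 / 2) * x ^+ 2 + - (x ^+ 2 / 2) by field.
rewrite expRD mulrCA ler_piMr ?expR_ge0//.
rewrite expRN ler_pdivrMr ?expR_gt0// mul1r.
apply: le_trans (expR_ge1Dx _).
have : x ^+ 2 = `|x| ^+ 2 by rewrite real_normK// num_real.
by move=> ->; have := sqr_ge0 (`|x| - 1); lra.
Qed.

Lemma bounded_gauss_integrable (g : R -> R) (M a w : R) : 0 < a -> measurable_fun setT g ->
  (forall x, `|g x| <= M) -> leb1.-integrable setT (fun x => (g x * gauss a w x)%:E).
Proof.
move=> a0 mg gM.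
have I1 : leb1.-integrable setT (fun x => (M * gauss a w x)%:E).
  under eq_fun do rewrite EFinM.
  by apply: integrableZl => //; exact: integrable_gauss.
apply: le_integrable I1 => //.
- apply/measurable_EFinP; apply: measurable_funM => //.
  apply: continuous_measurable_fun; exact: continuous_gauss.
- move=> x _; rewrite lee_fin !normrM ler_wpM2r// (le_trans (gM x))// ler_norm//.
Qed.

Lemma xsin_gauss_integrable (g : R -> R) : measurable_fun setT g -> (forall x, `|g x| <= 1) ->
  leb1.-integrable setT (fun x => (x * g x * gauss 1 0 x)%:E).
Proof.
move=> mg g1.
have I1 : leb1.-integrable setT (EFin \o gauss (1 / 2) 0) by exact: integrable_gauss.
apply: le_integrable I1 => //.
- apply/measurable_EFinP; apply: measurable_funM; first exact: measurable_funM.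
  apply: continuous_measurable_fun; exact: continuous_gauss.
- move=> x _; rewrite lee_fin /gauss !normrM subr0 mulN1r.
  rewrite [X in _ <= X]ger0_norm ?expR_ge0// (ger0_norm (expR_ge0 (- x ^+ 2))).
  apply: le_trans (x_gauss_le x); rewrite ler_wpM2r ?expR_ge0// ler_piMr//.
Qed.

Lemma is_derive_sin_affine (xi th x : R) :
  is_derive x 1 (fun x => sin (x * xi + th)) (cos (x * xi + th) * xi).
Proof.
have h : is_derive x 1 (fun x => x * xi + th) xi.
  by apply: is_derive_eq; rewrite /GRing.scale /=; ring.
exact: is_derive1_comp.
Qed.

Lemma is_derive_cos_freq (th x xi : R) :
  is_derive xi 1 (fun xi => cos (x * xi + th)) (- (x * sin (x * xi + th))).
Proof.
have h : is_derive xi 1 (fun xi => x * xi + th) x.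
  by apply: is_derive_eq; rewrite /GRing.scale /=; ring.
have : is_derive xi 1 (cos \o (fun xi => x * xi + th)) (- sin (x * xi + th) * x).
  exact: is_derive1_comp.
by move=> /is_derive_eq; apply; ring.
Qed.

Lemma is_derive_gauss (a w x : R) :
  is_derive x 1 (gauss a w) (- 2 * a * (x - w) * gauss a w x).
Proof.
have h : is_derive x 1 (fun x => - a * (x - w) ^+ 2) (- 2 * a * (x - w)).
  by apply: is_derive_eq; rewrite /GRing.scale /=; ring.
have : is_derive x 1 (expR \o (fun x => - a * (x - w) ^+ 2))
   (expR (- a * (x - w) ^+ 2) * (- 2 * a * (x - w))).
  exact: is_derive1_comp.
by move=> /is_derive_eq; apply; rewrite /gauss; ring.
Qed.

Lemma norm_sin_le1 (x : R) : `|sin x| <= 1.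
Proof. by rewrite ler_norml sin_geN1 sin_le1. Qed.

Lemma norm_cos_le1 (x : R) : `|cos x| <= 1.
Proof. by rewrite ler_norml cos_geN1 cos_le1. Qed.

Lemma gauss_cvg0 : (gauss 1 0 n%:R : R) @[n --> \oo] --> (0 : R).
Proof.
apply/(squeeze_cvgr (f := fun=> 0) (h := fun n => n.+1%:R^-1)).
- apply: nearW => n; rewrite expR_ge0 /gauss subr0 mulN1r expRN lef_pV2 ?posrE ?expR_gt0//.
  apply: le_trans (expR_ge1Dx _); rewrite -natr1 addrC lerD2l.
  by rewrite -natrX ler_nat; case: n => // n; rewrite expnS leq_pmulr// expn_gt0.
- exact: cvg_cst.
- exact: (@cvg_harmonic R).
Qed.

Let gibp (xi th x : R) : R :=
  cos (x * xi + th) * xi * gauss 1 0 x - 2 * (x * sin (x * xi + th) * gauss 1 0 x).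

Let continuous_gibp xi th : continuous (gibp xi th).
Proof.
move=> x; apply: cvgB.
  apply: cvgM; last exact: continuous_gauss.
  by apply: cvgM; [exact: continuous_cos_affine|exact: cvg_cst].
apply: cvgM; first exact: cvg_cst.
apply: cvgM; last exact: continuous_gauss.
by apply: cvgM; [exact: cvg_id|exact: continuous_sin_affine].
Qed.

Let integrable_gibp xi th : leb1.-integrable setT (fun x => (gibp xi th x)%:E).
Proof.
rewrite /gibp; under eq_fun do rewrite EFinB.
apply: integrableB => //.
  apply: (@bounded_gauss_integrable _ `|xi|) => //.
    apply: measurable_funM => //; apply: continuous_measurable_fun; exact: continuous_cos_affine.
  by move=> x; rewrite normrM ler_piMl// norm_cos_le1.
under eq_fun do rewrite EFinM.
apply: integrableZl => //; apply: xsin_gauss_integrable.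
  apply: continuous_measurable_fun; exact: continuous_sin_affine.
by move=> x; exact: norm_sin_le1.
Qed.

Let is_derive_gibp (xi th x : R) :
  is_derive x 1 (fun x => sin (x * xi + th) * gauss 1 0 x) (gibp xi th x).
Proof.
have h1 := is_derive_sin_affine xi th x; have h2 := is_derive_gauss 1 0 x.
apply: is_derive_eq; rewrite /gibp /GRing.scale /= subr0; ring.
Qed.

(** [gibp] is the derivative of [sin (x xi + th) exp (- x^2)], which vanishes at infinity. *)
Lemma gauss_ibp (xi th : R) : (\int[leb1]_x (gibp xi th x)%:E = 0)%E.
Proof.
pose h n : R -> \bar R := (fun x : R => (gibp xi th x)%:E) \_ `[- n.+1%:R, n.+1%:R].
have E n : (\int[leb1]_x h n x =
   (sin (n.+1%:R * xi + th) * gauss 1 0 n.+1%:R)%:E - (sin (- n.+1%:R * xi + th) * gauss 1 0 n.+1%:R)%:E)%E.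
  rewrite /h -integral_mkcond.
  pose F := (fun x => sin (x * xi + th) * gauss 1 0 x).
  have cF : continuous F.
    by move=> x; apply: cvgM; [exact: continuous_sin_affine|exact: continuous_gauss].
  rewrite (@continuous_FTC2 _ _ F).
  - by rewrite /F; congr (_ - (_ * _)%:E)%E; rewrite /gauss !subr0 sqrrN.
  - by rewrite gtrN.
  - apply: continuous_subspaceT; exact: continuous_gibp.
  - split; [|by apply: cvg_at_right_filter; exact: cF|by apply: cvg_at_left_filter; exact: cF].
    by move=> x _; have [] := is_derive_gibp xi th x.
  - by move=> x _; rewrite derive1E; have [_] := is_derive_gibp xi th x.
have c1 : (\int[leb1]_x h n x)%E @[n --> \oo] -->
    (\int[leb1]_x (gibp xi th x)%:E)%E.
  apply: (@dominated_cvg _ _ _ leb1 setT _ _ _ (fun x => `|(gibp xi th x)%:E|%E)) => //.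
  - move=> n; rewrite /h; apply/measurable_restrict => //; rewrite setTI.
    apply/measurable_EFinP; apply: measurable_funTS; apply: continuous_measurable_fun; exact: continuous_gibp.
  - move=> x _; apply: cvg_near_cst.
    near=> n; rewrite /h patchE ifT// mem_setE in_itv/= -ler_norml.
    by near: n; exists (Num.truncn `|x|) => // n /= nx; rewrite ltW// (lt_le_trans (truncnS_gt _))// ler_nat.
  - by apply: integrable_abse; exact: integrable_gibp.
  - by move=> n x _; rewrite /h patchE; case: ifP => // _; rewrite abse0.
have c2 : (\int[leb1]_x h n x)%E @[n --> \oo] --> 0%E.
  under eq_fun do rewrite E -EFinB -mulrBl.
  apply: cvg_EFin; first exact: nearW.
  have h0 : 2 * gauss 1 0 n.+1%:R @[n --> \oo] --> (0 : R).
    rewrite -[X in _ --> X](mulr0 2); apply: cvgM; first exact: cvg_cst.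
    by have := gauss_cvg0; rewrite -(cvg_shiftS (fun n => gauss 1 0 n%:R)).
  apply/norm_cvg0P.
  apply: (squeeze_cvgr (f := fun=> 0) (h := fun n => 2 * gauss 1 0 n.+1%:R)) => //.
    apply: nearW => n /=; rewrite normr_ge0/= normrM (ger0_norm (expR_ge0 _)) ler_wpM2r ?expR_ge0//.
    apply: le_trans (ler_normB _ _) _.
    by have := lerD (norm_sin_le1 (n.+1%:R * xi + th)) (norm_sin_le1 (- n.+1%:R * xi + th)); lra.
  exact: cvg_cst.
by have := cvg_unique _ c1 c2; apply.
Unshelve. all: by end_near. Qed.

Lemma Rintegral_xsin_gauss (xi th : R) :
  (\int[leb1]_x (x * sin (x * xi + th) * gauss 1 0 x) =
   xi / 2 * \int[leb1]_x (cos (x * xi + th) * gauss 1 0 x))%R.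
Proof.
have := gauss_ibp xi th; rewrite /gibp.
have mc : measurable_fun setT (fun x : R => cos (x * xi + th)).
  by apply: continuous_measurable_fun; exact: continuous_cos_affine.
have ms : measurable_fun setT (fun x : R => sin (x * xi + th)).
  by apply: continuous_measurable_fun; exact: continuous_sin_affine.
have I1 : leb1.-integrable setT (EFin \o (fun x => cos (x * xi + th) * gauss 1 0 x)).
  by apply: (@bounded_gauss_integrable _ 1) => // x; exact: norm_cos_le1.
have I2 : leb1.-integrable setT (EFin \o (fun x => x * sin (x * xi + th) * gauss 1 0 x)).
  by apply: xsin_gauss_integrable => // x; exact: norm_sin_le1.
move=> /(congr1 fine) /=; rewrite -/(Rintegral _ _ _).
have -> : (\int[leb1]_x (cos (x * xi + th) * xi * gauss 1 0 x - 2 * (x * sin (x * xi + th) * gauss 1 0 x)) =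
  \int[leb1]_x (xi * (cos (x * xi + th) * gauss 1 0 x) - 2 * (x * sin (x * xi + th) * gauss 1 0 x)))%R.
  by apply: eq_Rintegral => x _; ring.
rewrite RintegralB//; last 2 first.
- exact: (integrableZl measurableT xi I1).
- exact: (integrableZl measurableT 2 I2).
by rewrite !RintegralZl//; lra.
Qed.

Lemma is_derive_gauss_fourier (th xi : R) :
  is_derive xi 1 (fun xi => \int[leb1]_x (cos (x * xi + th) * gauss 1 0 x))%R
   (- (xi / 2 * \int[leb1]_x (cos (x * xi + th) * gauss 1 0 x)))%R.
Proof.
pose f (xi x : R) := cos (x * xi + th) * gauss 1 0 x.
have df (x y : R) : is_derive x 1 (f^~ y) (- (y * sin (y * x + th)) * gauss 1 0 y).
  have h := is_derive_cos_freq th y x.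
  by apply: is_derive_eq; rewrite /GRing.scale /=; ring.
have pE (x y : R) : partial1of2 f x y = - (y * sin (y * x + th)) * gauss 1 0 y.
  by rewrite /partial1of2 derive1E; have [_] := df x y.
have Ia : `]xi - 1, xi + 1[%classic xi by rewrite /= in_itv/=; lra.
have intf x : `]xi - 1, xi + 1[%classic x -> leb1.-integrable setT (EFin \o f x).
  move=> _; apply: (@bounded_gauss_integrable _ 1) => // [|y]; last exact: norm_cos_le1.
  by apply: continuous_measurable_fun; exact: continuous_cos_affine.
have derf x y : `]xi - 1, xi + 1[%classic x -> setT y -> derivable (f^~ y) x 1.
  by move=> _ _; have [] := df x y.
have G0 y : 0 <= gauss (1 / 2) 0 y by exact: expR_ge0.
have intG : leb1.-integrable setT (EFin \o gauss (1 / 2) 0) by exact: integrable_gauss.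
have Gub x y : `]xi - 1, xi + 1[%classic x -> setT y -> `|partial1of2 f x y| <= gauss (1 / 2) 0 y.
  move=> _ _; rewrite pE !normrM normrN normrM (ger0_norm (expR_ge0 _)) /gauss !subr0 mulN1r.
  apply: le_trans (x_gauss_le y); rewrite ler_wpM2r ?expR_ge0// ler_piMr//.
  exact: norm_sin_le1.
have D := derivable_under_integral measurableT Ia intf derf G0 intG Gub.
have E := differentiation_under_integral measurableT Ia intf derf G0 intG Gub.
apply: DeriveDef; first exact: D.
rewrite -derive1E E.
have -> : (\int[leb1]_y partial1of2 f xi y = \int[leb1]_x (-1 * (x * sin (x * xi + th) * gauss 1 0 x)))%R.
  by apply: eq_Rintegral => x _; rewrite pE; ring.
rewrite RintegralZl//; first by rewrite Rintegral_xsin_gauss; ring.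
apply: xsin_gauss_integrable; last by move=> x; exact: norm_sin_le1.
by apply: continuous_measurable_fun; exact: continuous_sin_affine.
Qed.

(** By [Rintegral_xsin_gauss] the transform solves [y' = - (xi / 2) y]; its product with
    [exp (xi^2 / 4)] is constant. *)
Lemma gauss_fourier_std (th xi : R) :
  (\int[leb1]_x (cos (x * xi + th) * gauss 1 0 x) =
   Num.sqrt pi * (expR (- (xi ^+ 2 / 4)) * cos th))%R.
Proof.
pose I xi := (\int[leb1]_x (cos (x * xi + th) * gauss 1 0 x))%R.
pose E xi := expR (xi ^+ 2 / 4) : R.
have dE (x : R) : is_derive x 1 E (x / 2 * E x).
  have h : is_derive x 1 (fun x : R => x ^+ 2 / 4) (x / 2).
    by apply: is_derive_eq; rewrite /GRing.scale /=; field.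
  have : is_derive x 1 (expR \o (fun x : R => x ^+ 2 / 4)) (expR (x ^+ 2 / 4) * (x / 2)).
    exact: is_derive1_comp.
  by move=> /is_derive_eq; apply; rewrite /E; ring.
have cst : E xi * I xi = E 0 * I 0.
  apply: (@is_derive_0_is_cst _ (fun x => E x * I x)) => x.
  have h1 := dE x; have h2 := is_derive_gauss_fourier th x.
  apply: is_derive_eq; rewrite /GRing.scale /= /I; ring.
have I0 : I 0 = Num.sqrt pi * cos th.
  have -> : (I 0 = \int[leb1]_x (cos th * gauss 1 0 x))%R.
    by apply: eq_Rintegral => x _; rewrite mulr0 add0r.
  rewrite RintegralZl//; last exact: integrable_gauss.
  by rewrite /Rintegral integral_gauss// divr1 mulrC.
move: cst; rewrite I0 {2}/E expr0n/= mul0r expR0 mul1r => cst.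
rewrite -/(I xi) expRN mulrCA -cst mulrA mulVf ?mul1r//.
by rewrite gt_eqF// expR_gt0.
Qed.

(** The integrand is kept nonnegative so that its higher dimensional analogue
    follows from Tonelli's theorem. *)
Lemma integral_cos_gauss (a w xi th A B : R) : 0 < a -> `|B| <= A ->
  (\int[leb1]_x ((A + B * cos (x * xi + th)) * gauss a w x)%:E =
   (Num.sqrt (pi / a) * (A + B * expR (- (xi ^+ 2 / (4 * a))) * cos (w * xi + th)))%:E)%E.
Proof.
move=> a0 BA; have sa : 0 < Num.sqrt a by rewrite sqrtr_gt0.
have sa0 : (Num.sqrt a)^-1 != 0 by rewrite gt_eqF// invr_gt0.
have sa' : Num.sqrt a != 0 by rewrite gt_eqF.
have A0 : 0 <= A by exact: le_trans BA.
have pos x : 0 <= A + B * cos x.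
  have : `|B * cos x| <= A.
    by rewrite normrM; apply: le_trans BA; rewrite ler_piMr// norm_cos_le1.
  by rewrite ler_norml => /andP[h _]; lra.
have mg : measurable_fun setT (fun x : R => ((A + B * cos (x * xi + th)) * gauss a w x)%:E).
  apply/measurable_EFinP; apply: measurable_funM; last first.
    apply: continuous_measurable_fun; exact: continuous_gauss.
  apply: measurable_funD => //; apply: measurable_funM => //.
  apply: continuous_measurable_fun; exact: continuous_cos_affine.
rewrite (@integral_affine _ (Num.sqrt a)^-1 w)//; last first.
  by move=> x; rewrite lee_fin mulr_ge0// expR_ge0.
rewrite gtr0_norm ?invr_gt0//.
pose xi' := xi / Num.sqrt a; pose th' := w * xi + th.
rewrite (_ : (fun x => _) = (fun x => (A * gauss 1 0 x)%:E + (B * (cos (x * xi' + th') * gauss 1 0 x))%:E)%E); last first.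
  apply/funext => x; rewrite -EFinD; congr EFin.
  have -> : ((Num.sqrt a)^-1 * x + w) * xi + th = x * xi' + th'.
    by rewrite /xi' /th'; ring.
  have -> : gauss a w ((Num.sqrt a)^-1 * x + w) = gauss 1 0 x.
    rewrite /gauss; congr expR; rewrite addrK subr0 exprMn exprVn sqr_sqrtr ?ltW//.
    by field; rewrite gt_eqF.
  by ring.
have I1 : leb1.-integrable setT (EFin \o gauss 1 0) by exact: integrable_gauss.
have I2 : leb1.-integrable setT (EFin \o (fun x => cos (x * xi' + th') * gauss 1 0 x)).
  apply: (@bounded_gauss_integrable _ 1) => // [|y]; last exact: norm_cos_le1.
  by apply: continuous_measurable_fun; exact: continuous_cos_affine.
rewrite integralD//; last 2 first.
- by under eq_fun do rewrite EFinM; exact: integrableZl.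
- by under eq_fun do rewrite EFinM; exact: integrableZl.
under eq_integral do rewrite EFinM.
rewrite integralZl// integral_gauss//.
under [X in (_ * (_ + X))%E]eq_integral do rewrite EFinM.
rewrite integralZl//.
have -> : (\int[leb1]_x (cos (x * xi' + th') * gauss 1 0 x)%:E)%E =
   (Num.sqrt pi * (expR (- (xi' ^+ 2 / 4)) * cos th'))%:E.
  rewrite -gauss_fourier_std /Rintegral fineK//; exact: integrable_fin_num.
transitivity ((Num.sqrt a)^-1 * (A * Num.sqrt (pi / 1) +
  B * (Num.sqrt pi * (expR (- (xi' ^+ 2 / 4)) * cos th'))))%:E => //.
congr EFin; rewrite divr1.
rewrite sqrtrM ?pi_ge0// sqrtrV ?ltW//.
have -> : xi' ^+ 2 / 4 = xi ^+ 2 / (4 * a).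
  by rewrite /xi' exprMn exprVn sqr_sqrtr ?ltW//; field; rewrite gt_eqF.
by rewrite /th'; ring.
Qed.

End gauss1.

(** * Lebesgue measure and Gaussians on row vectors *)

Section rV_algebra.
Context {R : realType} {d : nat}.
Implicit Types x y z : 'rV[R]_d.

Lemma dotpC x y : dotp x y = dotp y x.
Proof. by apply: eq_bigr => i _; rewrite mulrC. Qed.

Lemma dotpDl x y z : dotp (x + y) z = dotp x z + dotp y z.
Proof. by rewrite -big_split; apply: eq_bigr => i _; rewrite mxE mulrDl. Qed.

Lemma dotpZl a x y : dotp (a *: x) y = a * dotp x y.
Proof. by rewrite /dotp mulr_sumr; apply: eq_bigr => i _; rewrite mxE mulrA. Qed.

Lemma dotpNl x y : dotp (- x) y = - dotp x y.
Proof. by rewrite -scaleN1r dotpZl mulN1r. Qed.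

Lemma dotpBl x y z : dotp (x - y) z = dotp x z - dotp y z.
Proof. by rewrite dotpDl dotpNl. Qed.

Lemma dotpDr x y z : dotp z (x + y) = dotp z x + dotp z y.
Proof. by rewrite dotpC dotpDl !(dotpC z). Qed.

Lemma dotpZr a x y : dotp y (a *: x) = a * dotp y x.
Proof. by rewrite dotpC dotpZl (dotpC y). Qed.

Lemma dotpNr x y : dotp y (- x) = - dotp y x.
Proof. by rewrite dotpC dotpNl (dotpC y). Qed.

Lemma dotpBr x y z : dotp z (x - y) = dotp z x - dotp z y.
Proof. by rewrite dotpDr dotpNr. Qed.

Lemma dotp0l x : dotp 0 x = 0.
Proof. by rewrite -(scale0r x) dotpZl mul0r. Qed.

Lemma dotp0r x : dotp x 0 = 0. Proof. by rewrite dotpC dotp0l. Qed.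

Definition sqn x : R := dotp x x.

Lemma sqn_ge0 x : 0 <= sqn x.
Proof. by apply: sumr_ge0 => i _; rewrite -expr2 sqr_ge0. Qed.

Lemma enorm2 x : enorm x ^+ 2 = sqn x.
Proof. by rewrite sqr_sqrtr ?sqn_ge0. Qed.

Lemma enorm_ge0 x : 0 <= enorm x. Proof. exact: sqrtr_ge0. Qed.

Lemma sqnN x : sqn (- x) = sqn x.
Proof. by rewrite /sqn dotpNl dotpNr opprK. Qed.

Lemma sqnB x y : sqn (x - y) = sqn x + sqn y - 2 * dotp x y.
Proof. by rewrite /sqn !dotpBl !dotpBr (dotpC y x); ring. Qed.

Lemma sqnZ a x : sqn (a *: x) = a ^+ 2 * sqn x.
Proof. by rewrite /sqn dotpZl dotpZr mulrA. Qed.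

Lemma sqn_leD x y : sqn (x + y) <= 2 * sqn x + 2 * sqn y.
Proof.
have := sqn_ge0 (x - y); rewrite sqnB -[y in sqn (x + y)]opprK sqnB sqnN dotpNr; lra.
Qed.

Lemma sqr_coord_le x i : x 0 i ^+ 2 <= sqn x.
Proof.
rewrite /sqn /dotp (bigD1 i)//= expr2 lerDl; apply: sumr_ge0 => j _.
by rewrite -expr2 sqr_ge0.
Qed.

End rV_algebra.

Section rV_measurability.
Context {R : realType} {d : nat} d' (T : measurableType d').
Implicit Types f g : T -> 'rV[R]_d.

Lemma measurable_rV_coord f i : measurable_fun setT f ->
  measurable_fun setT (fun t => f t 0 i).
Proof. by move=> /measurable_fun_rVP. Qed.

Lemma measurable_rVD f g : measurable_fun setT f -> measurable_fun setT g ->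
  measurable_fun setT (fun t => f t + g t).
Proof.
move=> mf mg; apply/measurable_fun_rVP => i; under eq_fun do rewrite mxE.
by apply: measurable_funD; exact: measurable_rV_coord.
Qed.

Lemma measurable_rVZ (a : T -> R) f : measurable_fun setT a -> measurable_fun setT f ->
  measurable_fun setT (fun t => a t *: f t).
Proof.
move=> ma mf; apply/measurable_fun_rVP => i; under eq_fun do rewrite mxE.
by apply: measurable_funM => //; exact: measurable_rV_coord.
Qed.

Lemma measurable_rVN f : measurable_fun setT f -> measurable_fun setT (fun t => - f t).
Proof.
move=> mf; apply/measurable_fun_rVP => i; under eq_fun do rewrite mxE.
by apply: measurable_funN; exact: measurable_rV_coord.
Qed.

Lemma measurable_dotp f g : measurable_fun setT f -> measurable_fun setT g ->
  measurable_fun setT (fun t => dotp (f t) (g t)).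
Proof.
move=> mf mg; rewrite /dotp; apply: measurable_sum => i.
by apply: measurable_funM; exact: measurable_rV_coord.
Qed.

Lemma measurable_sqn f : measurable_fun setT f -> measurable_fun setT (fun t => sqn (f t)).
Proof. by move=> mf; exact: measurable_dotp. Qed.

Lemma measurable_enorm f : measurable_fun setT f -> measurable_fun setT (fun t => enorm (f t)).
Proof.
move=> mf; apply: measurableT_comp (measurable_sqn mf).
by apply: continuous_measurable_fun; exact: sqrt_continuous.
Qed.

End rV_measurability.

Lemma measurable_cos_comp {R : realType} d (T : measurableType d) (f : T -> R) :
  measurable_fun setT f -> measurable_fun setT (fun t => cos (f t)).
Proof. by apply: measurableT_comp; apply: continuous_measurable_fun; exact: continuous_cos. Qed.

Lemma measurable_sin_comp {R : realType} d (T : measurableType d) (f : T -> R) :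
  measurable_fun setT f -> measurable_fun setT (fun t => sin (f t)).
Proof. by apply: measurableT_comp; apply: continuous_measurable_fun; exact: continuous_sin. Qed.

Lemma measurable_rV_cons_comp {R : realType} {d : nat} d' (T : measurableType d')
  (a : T -> R) (f : T -> 'rV[R]_d) : measurable_fun setT a -> measurable_fun setT f ->
  measurable_fun setT (fun t => rV_cons (a t, f t)).
Proof.
move=> ma mf; apply: (measurableT_comp (@measurable_rV_cons R d)).
exact: measurable_fun_pair.
Qed.

Ltac meas2 := match goal with
| |- measurable_fun _ (fun x => dotp (@?f x) (@?g x)) => apply: (@measurable_dotp _ _ _ _ f g)
| |- measurable_fun _ (fun x => sqn (@?f x)) => apply: (@measurable_sqn _ _ _ _ f)
| |- measurable_fun _ (fun x => enorm (@?f x)) => apply: (@measurable_enorm _ _ _ _ f)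
| |- measurable_fun _ (fun x => cos (@?f x)) => apply: (@measurable_cos_comp _ _ _ f)
| |- measurable_fun _ (fun x => sin (@?f x)) => apply: (@measurable_sin_comp _ _ _ f)
| |- measurable_fun _ (fun x => rV_cons (@?f x, @?g x)) => apply: (@measurable_rV_cons_comp _ _ _ _ f g)
| |- measurable_fun _ (fun x => @GRing.scale _ _ (@?f x) (@?g x)) => apply: (@measurable_rVZ _ _ _ _ f g)
| |- measurable_fun _ (fun x => @GRing.opp _ (@?f x)) => apply: (@measurable_rVN _ _ _ _ f)
| |- measurable_fun _ (fun x => @GRing.add _ (@?f x) (@?g x)) => apply: (@measurable_rVD _ _ _ _ f g)
end.
Ltac meas_hint ::= meas2.

Section lebesgue_rV_theory.
Context {R : realType}.
Notation leb1 := (@lebesgue_measure R).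

(** The measure is defined by adding one coordinate at a time, so that statements in
    dimension [d] follow by induction. *)
Lemma integral_leb_cons d (F : 'rV[R]_d.+1 -> \bar R) :
  measurable_fun setT F -> (forall x, (0 <= F x)%E) ->
  (\int[leb d.+1]_x F x = \int[leb1]_t \int[leb d]_y F (rV_cons (t, y)))%E.
Proof.
move=> mF F0.
have mG : measurable_fun setT (fun q : R * 'rV[R]_d => F (rV_cons (q.1, q.2))).
  by apply: (measurableT_comp mF); meas.
rewrite -(integral_prod_measure leb1 (leb d) (fun t y => F (rV_cons (t, y))))//.
pose pm : {measure set 'rV[R]_d.+1 -> \bar R} :=
  pushforward (sigma_finite_product leb1 (leb d)) (@rV_cons R d).
have h := @ge0_integral_pushforward _ _ (measurableTypeR R * 'rV[R]_d)%type _ R (@rV_cons R d) (@measurable_rV_cons R d) (sigma_finite_product leb1 (leb d)) setT F measurableT mF (fun x _ => F0 x).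
transitivity (\int[leb1 \x leb d]_(x in @rV_cons R d @^-1` setT) (F \o @rV_cons R d) x)%E.
  apply: etrans h.
  by apply: (eq_measure_integral (pm (@measurable_rV_cons R d))) => A mA _.
by rewrite preimage_setT; apply: eq_integral => -[t y].
Qed.

Lemma rV_cons_affine d (c : R) (b : 'rV[R]_d.+1) t y :
  c *: rV_cons (t, y) + b = rV_cons (c * t + b 0 ord0, c *: y + \row_j b 0 (lift ord0 j)).
Proof.
apply/rowP => i; rewrite 2!mxE [in LHS]/=; case: (unliftP ord0 i) => [j ->|->].
  by rewrite !rV_consS !mxE.
by rewrite !rV_cons0.
Qed.

Lemma dotp_rV_cons d t (y : 'rV[R]_d) (xi : 'rV[R]_d.+1) :
  dotp (rV_cons (t, y)) xi = t * xi 0 ord0 + dotp y (\row_j xi 0 (lift ord0 j)).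
Proof.
rewrite /dotp big_ord_recl rV_cons0; congr (_ + _).
by apply: eq_bigr => i _; rewrite rV_consS mxE.
Qed.

Lemma sqn_rV d (x : 'rV[R]_d.+1) :
  sqn x = x 0 ord0 ^+ 2 + sqn (\row_j x 0 (lift ord0 j)).
Proof.
by rewrite /sqn /dotp big_ord_recl; congr (_ + _); apply: eq_bigr => i _; rewrite mxE.
Qed.

Lemma rV_consK d (x : 'rV[R]_d.+1) : rV_cons (x 0 ord0, \row_j x 0 (lift ord0 j)) = x.
Proof.
apply/rowP => i; case: (unliftP ord0 i) => [j ->|->]; first by rewrite rV_consS mxE.
by rewrite rV_cons0.
Qed.

Lemma integral_leb0 (F : 'rV[R]_0 -> \bar R) : measurable_fun setT F ->
  (\int[leb 0]_x F x = F 0%R)%E.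
Proof. by move=> mF; rewrite /= integral_dirac// diracT mul1e. Qed.

Lemma integral_leb_affine d (c : R) (b : 'rV[R]_d) (F : 'rV[R]_d -> \bar R) : c != 0 ->
  measurable_fun setT F -> (forall x, (0 <= F x)%E) ->
  (\int[leb d]_x F x = (`|c| ^+ d)%:E * \int[leb d]_x F (c *: x + b)%R)%E.
Proof.
move=> c0; elim: d b F => [|d IH] b F mF F0.
  rewrite !integral_leb0//; last by apply: (measurableT_comp mF); meas.
  by rewrite expr0 mul1e; congr F; apply/rowP => -[].
rewrite [LHS]integral_leb_cons// integral_leb_cons//; last by apply: (measurableT_comp mF); meas.
have mFc (t : R) : measurable_fun setT (fun y => F (rV_cons (t, y))).
  by apply: (measurableT_comp mF); meas.
have m1 : measurable_fun setT (fun t => \int[leb d]_y F (rV_cons (t, y)))%E.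
  apply: (measurable_integralr (leb d) (fun t y => F (rV_cons (t, y)))) => //.
  by apply: (measurableT_comp mF); meas.
have p1 t : (0 <= \int[leb d]_y F (rV_cons (t, y)))%E by apply: integral_ge0.
rewrite (integral_affine (b 0 ord0) c0 m1 p1).
under eq_integral => t _ do rewrite (IH (\row_j b 0 (lift ord0 j)) _ (mFc _) (fun _ => F0 _)).
have m2 : measurable_fun setT (fun t => \int[leb d]_y F (rV_cons (c * t + b 0 ord0, c *: y + \row_j b 0 (lift ord0 j))%R))%E.
  apply: (measurable_integralr (leb d) (fun t y => F (rV_cons (c * t + b 0 ord0, c *: y + \row_j b 0 (lift ord0 j))%R))) => //.
  by apply: (measurableT_comp mF); meas.
rewrite ge0_integralZl//; try solve [exact: m2|by move=> t _; apply: integral_ge0|by rewrite lee_fin exprn_ge0].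
rewrite muleA -EFinM -exprS; congr (_ * _)%E.
by apply: eq_integral => t _; apply: eq_integral => y _; rewrite rV_cons_affine.
Qed.

Lemma integral_leb_isometry d (c : R) (b : 'rV[R]_d) (F : 'rV[R]_d -> \bar R) : `|c| = 1 ->
  measurable_fun setT F ->
  (\int[leb d]_x F x = \int[leb d]_x F (c *: x + b)%R)%E.
Proof.
move=> c1 mF; have c0 : c != 0 by rewrite -normr_eq0 c1 oner_eq0.
rewrite integralE [RHS]integralE; congr (_ - _)%E.
- rewrite (@integral_leb_affine d c b)//; last exact: measurable_funepos.
  by rewrite c1 expr1n mul1e; apply: eq_integral => x _; rewrite !funeposE.
- rewrite (@integral_leb_affine d c b)//; last exact: measurable_funeneg.
  by rewrite c1 expr1n mul1e; apply: eq_integral => x _; rewrite !funenegE.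
Qed.

Lemma integral_leb_shift d (b : 'rV[R]_d) (F : 'rV[R]_d -> \bar R) : measurable_fun setT F ->
  (\int[leb d]_x F x = \int[leb d]_x F (x + b)%R)%E.
Proof.
move=> mF; rewrite (@integral_leb_isometry d 1 b)// ?normr1//.
by under eq_integral do rewrite scale1r.
Qed.

Lemma integral_leb_reflect d (b : 'rV[R]_d) (F : 'rV[R]_d -> \bar R) : measurable_fun setT F ->
  (\int[leb d]_x F x = \int[leb d]_x F (b - x)%R)%E.
Proof.
move=> mF; rewrite (@integral_leb_isometry d (-1) b)// ?normrN1//.
by under eq_integral do rewrite scaleN1r addrC.
Qed.

Definition gaussd d (a : R) (w x : 'rV[R]_d) : R := expR (- a * sqn (x - w)).

Lemma gaussd_ge0 d a (w x : 'rV[R]_d) : 0 <= gaussd a w x.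
Proof. exact: expR_ge0. Qed.

Lemma gaussd_gt0 d a (w x : 'rV[R]_d) : 0 < gaussd a w x.
Proof. exact: expR_gt0. Qed.

Lemma measurable_gaussd d (a : R) d' (T : measurableType d') (w x : T -> 'rV[R]_d) :
  measurable_fun setT w -> measurable_fun setT x ->
  measurable_fun setT (fun t => gaussd a (w t) (x t)).
Proof. by move=> mw mx; rewrite /gaussd; meas. Qed.

Definition gauss_mass d (a : R) : R := Num.sqrt (pi / a) ^+ d.

Lemma gauss_mass_gt0 d a : 0 < a -> 0 < gauss_mass d a.
Proof. by move=> a0; rewrite exprn_gt0// sqrtr_gt0 divr_gt0// pi_gt0. Qed.

Lemma cos_combination_ge0 (A B x : R) : `|B| <= A -> 0 <= A + B * cos x.
Proof.
move=> BA; have : `|B * cos x| <= A.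
  by rewrite normrM; apply: le_trans BA; rewrite ler_piMr// norm_cos_le1.
by rewrite ler_norml => /andP[h _]; lra.
Qed.

(** The induction integrates one coordinate and absorbs the others into the phase [th],
    which is why the phase and the constants [A], [B] are there. *)
Lemma integral_cos_gaussd d (a : R) (w xi : 'rV[R]_d) (th A B : R) : 0 < a -> `|B| <= A ->
  (\int[leb d]_x ((A + B * cos (dotp x xi + th)) * gaussd a w x)%:E =
   (gauss_mass d a * (A + B * expR (- (sqn xi / (4 * a))) * cos (dotp w xi + th)))%:E)%E.
Proof.
move=> a0; elim: d w xi th B => [|d IH] w xi th B BA.
  rewrite integral_leb0; last by rewrite /gaussd; meas.
  by rewrite /gaussd /gauss_mass /sqn /dotp !big_ord0 mulr0 mul0r oppr0 expR0 expr0; congr EFin; ring.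
rewrite integral_leb_cons//; last 2 first.
- by rewrite /gaussd; meas.
- by move=> x; rewrite lee_fin mulr_ge0 ?cos_combination_ge0 ?gaussd_ge0.
set xi' := \row_j xi 0 (lift ord0 j); set w' := \row_j w 0 (lift ord0 j).
set e' := expR (- (sqn xi' / (4 * a))).
have e'1 : `|B * e'| <= A.
  rewrite normrM (ger0_norm (expR_ge0 _)); apply: le_trans BA; rewrite ler_piMr//.
  by rewrite -expR0 ler_expR oppr_le0 divr_ge0 ?sqn_ge0// mulr_ge0// ltW.
transitivity (\int[leb1]_t ((gauss_mass d a)%:E *
    (((A + B * e' * cos (t * xi 0 ord0 + (dotp w' xi' + th))) * gauss a (w 0 ord0) t)%:E)))%E.
  apply: eq_integral => t _.
  transitivity (\int[leb d]_y ((gauss a (w 0 ord0) t)%:E *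
      ((A + B * cos (dotp y xi' + (t * xi 0 ord0 + th))) * gaussd a w' y)%:E))%E.
    apply: eq_integral => y _; rewrite dotp_rV_cons -/xi' -EFinM; congr EFin.
    have -> : gaussd a w (rV_cons (t, y)) = gauss a (w 0 ord0) t * gaussd a w' y.
      rewrite /gaussd sqn_rV /gauss -expRD; congr expR.
      rewrite [(_ - w) 0 ord0]mxE rV_cons0 [(- w) 0 ord0]mxE mulrDr; congr (_ + _ * sqn _).
      by apply/rowP => j; rewrite [LHS]mxE [LHS]mxE rV_consS !mxE.
    rewrite [X in cos X](_ : _ = dotp y xi' + (t * xi 0 ord0 + th)); first by ring.
    by ring.
  rewrite ge0_integralZl//; last 3 first.
  - by rewrite /gaussd; meas.
  - by move=> y _; rewrite lee_fin mulr_ge0 ?cos_combination_ge0 ?gaussd_ge0.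
  - by rewrite lee_fin expR_ge0.
  rewrite IH// -!EFinM; congr EFin; rewrite -/e'.
  rewrite [X in cos X](_ : _ = t * xi 0 ord0 + (dotp w' xi' + th)); first by ring.
  by ring.
rewrite ge0_integralZl//; last 3 first.
- by rewrite /gauss; meas.
- by move=> y _; rewrite lee_fin mulr_ge0 ?cos_combination_ge0 ?expR_ge0.
- by rewrite lee_fin ltW// gauss_mass_gt0.
rewrite integral_cos_gauss// -EFinM; congr EFin.
have -> : sqn xi / (4 * a) = sqn xi' / (4 * a) + xi 0 ord0 ^+ 2 / (4 * a).
  by rewrite sqn_rV -/xi'; ring.
rewrite opprD expRD -/e' /gauss_mass [_ ^+ d.+1]exprS.
have -> : dotp w xi = w 0 ord0 * xi 0 ord0 + dotp w' xi'.
  by rewrite -[w in LHS]rV_consK dotp_rV_cons.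
rewrite -[in RHS]addrA; ring.
Qed.

Lemma integral_gaussd d (a : R) (w : 'rV[R]_d) : 0 < a ->
  (\int[leb d]_x (gaussd a w x)%:E = (gauss_mass d a)%:E)%E.
Proof.
move=> a0; have := @integral_cos_gaussd d a w 0 0 1 0 a0.
rewrite normr0 ler01 => /(_ isT); rewrite !mul0r addr0 mulr1 => <-.
by apply: eq_integral => x _; rewrite mul0r addr0 mul1r.
Qed.

Lemma integrable_gaussd d (a : R) (w : 'rV[R]_d) : 0 < a ->
  (leb d).-integrable setT (fun x => (gaussd a w x)%:E).
Proof.
move=> a0; apply/integrableP; split; first by rewrite /gaussd; meas.
under eq_integral => x _ do rewrite gee0_abs ?lee_fin ?gaussd_ge0//.
by rewrite integral_gaussd// ltry.
Qed.

(** Completing the square. *)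
Lemma gaussdM d (a b : R) (x w y : 'rV[R]_d) : 0 < a -> 0 < b ->
  gaussd a x y * gaussd b w y =
  gaussd (a * b / (a + b)) x w * gaussd (a + b) ((a + b)^-1 *: (a *: x + b *: w)) y.
Proof.
move=> a0 b0; rewrite /gaussd -!expRD; congr expR.
rewrite !sqnB !sqnZ /sqn !(dotpZr, dotpDr, dotpDl, dotpZl) ?(dotpC w x) ?(dotpC y x) ?(dotpC y w).
by field; rewrite gt_eqF// addr_gt0.
Qed.

Lemma coord_le_norm d (x : 'rV[R]_d) i : `|x 0 i| <= `|x|.
Proof.
rewrite [leRHS]mx_normrE.
exact: (le_bigmax _ (fun ij : 'I_1 * 'I_d => `|x ij.1 ij.2|) (0, i)).
Qed.

Lemma sqn_le_norm d (x : 'rV[R]_d) : sqn x <= d%:R * `|x| ^+ 2.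
Proof.
rewrite /sqn /dotp mulr_natl -[d in _ *+ d]card_ord -sumr_const; apply: ler_sum => i _.
by rewrite -expr2 -[_ ^+ 2]real_normK ?num_real// lerXn2r ?nnegrE// coord_le_norm.
Qed.

Lemma norm_le_enorm d (x : 'rV[R]_d) : `|x| <= enorm x.
Proof.
rewrite [leLHS]mx_normrE; apply: bigmax_le => [|[i j] _]; first exact: enorm_ge0.
rewrite /= (ord1 i) -sqrtr_sqr ler_wsqrtr//; exact: sqr_coord_le.
Qed.

Lemma bounded_sqn d (A : set 'rV[R]_d) : bounded_set A ->
  exists2 M, 0 <= M & forall x, A x -> sqn x <= M.
Proof.
move=> [N [Nr hN]]; pose N' := Num.max 0 (N + 1).
have N'0 : 0 <= N' by rewrite le_max lexx.
exists (d%:R * N' ^+ 2); first by rewrite mulr_ge0// exprn_ge0.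
move=> x Ax; apply: le_trans (sqn_le_norm x) _; rewrite ler_wpM2l// lerXn2r ?nnegrE//.
by apply: (hN N') => //; rewrite lt_max ltrDl ltr01 orbT.
Qed.

Lemma indic_le_gaussd d (A : set 'rV[R]_d) (a : R) : 0 < a -> bounded_set A ->
  exists2 M, 0 <= M & forall x, \1_A x <= M * gaussd a 0 x.
Proof.
move=> a0 /bounded_sqn[M M0 AM]; exists (expR (a * M)); first exact: expR_ge0.
move=> x; rewrite indicE; have [|] := boolP (x \in A); last first.
  by move=> _; apply: mulr_ge0; [exact: expR_ge0|exact: gaussd_ge0].
rewrite inE => /AM xM; rewrite /gaussd subr0 -expRD -[leLHS]expR0 ler_expR mulNr subr_ge0.
by rewrite ler_pM2l.
Qed.

Lemma leb_bounded_fin d (A : set 'rV[R]_d) : bounded_borel A -> (leb d A < +oo)%E.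
Proof.
move=> [mA bA]; have [M M0 hM] := indic_le_gaussd ltr01 bA.
have mg : measurable_fun setT (fun x : 'rV[R]_d => (gaussd 1 0 x)%:E) by rewrite /gaussd; meas.
have g0 (x : 'rV[R]_d) : (0 <= (gaussd 1 0 x)%:E)%E by rewrite lee_fin gaussd_ge0.
rewrite -[A]setIT -integral_indic//.
apply: (@le_lt_trans _ _ (M%:E * \int[leb d]_x (gaussd 1 0 x)%:E)%E); last first.
  by rewrite integral_gaussd// ltry.
have m1 : measurable_fun setT (fun x => (\1_A x)%:E : \bar R).
  by apply/measurable_EFinP; exact: measurable_indic.
rewrite -ge0_integralZl//; apply: ge0_le_integral => //; try solve [exact: (measurable_funeM M%:E mg)
  |by move=> x _; rewrite -EFinM lee_fin; apply: mulr_ge0 => //; exact: gaussd_ge0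
  |by move=> x _; rewrite -EFinM lee_fin; exact: hM].
Qed.

End lebesgue_rV_theory.

(** * Schwartz functions *)

Section lines.
Context {R : realType} {d : nat}.
Implicit Types (f g : 'rV[R]_d -> R) (x v w : 'rV[R]_d).

(** Directional derivatives are derivatives along lines, where the one variable rules
    apply. *)
Lemma is_derive_lineE f x v (l : R) :
  is_derive x v f l <-> is_derive (0 : R) 1 (fun t : R => f (t *: v + x)) l.
Proof.
have E : (fun h : R => h^-1 *: ((f \o shift x) (h *: v) - f x)) =
   (fun h : R => h^-1 *: (((fun t : R => f (t *: v + x)) \o shift 0) (h *: (1 : R)) - (fun t : R => f (t *: v + x)) 0)).
  apply/funext => h /=; rewrite scale0r add0r addr0.
  by rewrite /GRing.scale /= mulr1.
split=> -[D V]; apply: DeriveDef.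
- by rewrite /derivable -E.
- by rewrite /derive -E.
- by rewrite /derivable E.
- by rewrite /derive E.
Qed.

Lemma is_derive_coord (i j : 'I_d) x :
  is_derive x (delta_mx 0 i) (fun y : 'rV[R]_d => y 0 j) (i == j)%:R.
Proof.
apply/is_derive_lineE.
rewrite (_ : (fun t : R => _) = (fun t => t * (i == j)%:R + x 0 j)); last first.
  by apply/funext => t; rewrite !mxE eqxx andTb eq_sym.
by apply: is_derive_eq; rewrite /GRing.scale /=; ring.
Qed.

Lemma sqn_line (t : R) v x : sqn (t *: v + x) = t ^+ 2 * sqn v + t * (2 * dotp v x) + sqn x.
Proof.
by rewrite /sqn !(dotpDl, dotpDr, dotpZl, dotpZr) (dotpC x v); ring.
Qed.

Lemma is_derive_gaussd a w x v :
  is_derive x v (gaussd a w) (- 2 * a * dotp v (x - w) * gaussd a w x).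
Proof.
apply/is_derive_lineE.
pose p (t : R) := - a * (t ^+ 2 * sqn v + t * (2 * dotp v (x - w)) + sqn (x - w)).
have dp : is_derive (0 : R) 1 p (- 2 * a * dotp v (x - w)).
  by apply: is_derive_eq; rewrite /GRing.scale /=; ring.
have pE t : p t = - a * sqn (t *: v + x - w) by rewrite -addrA sqn_line.
rewrite (_ : (fun t : R => _) = expR \o p); last first.
  by apply/funext => t; rewrite /gaussd /= pE.
have := is_derive1_comp (is_derive_expR (p 0)) dp.
by move=> /is_derive_eq; apply; rewrite pE scale0r add0r /gaussd mulrC.
Qed.

Lemma is_derive_cos_dotp xi (th : R) y v :
  is_derive y v (fun y => cos (dotp y xi + th)) (- dotp v xi * sin (dotp y xi + th)).
Proof.
apply/is_derive_lineE.
pose p (t : R) := t * dotp v xi + (dotp y xi + th).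
have dp : is_derive (0 : R) 1 p (dotp v xi).
  by apply: is_derive_eq; rewrite /GRing.scale /=; ring.
have pE t : p t = dotp (t *: v + y) xi + th by rewrite dotpDl dotpZl /p; ring.
rewrite (_ : (fun t : R => _) = cos \o p); last by apply/funext => t /=; rewrite pE.
have := is_derive1_comp (is_derive_cos (p 0)) dp.
by move=> /is_derive_eq; apply; rewrite pE scale0r add0r; ring.
Qed.

Lemma is_derive_reflect f (b y v : 'rV[R]_d) l : is_derive (b - y) v f l ->
  is_derive y v (fun y => f (b - y)) (- l).
Proof.
move=> /is_derive_lineE h; apply/is_derive_lineE.
have dp : is_derive (0 : R) 1 (fun t : R => - t) (-1).
  by apply: is_derive_eq; rewrite ?mulN1r.
rewrite (_ : (fun t : R => _) = (fun t : R => f (t *: v + (b - y))) \o (fun t : R => - t)); last first.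
  by apply/funext => t /=; congr f; rewrite opprD scaleNr addrCA.
have h' : is_derive (- 0 : R) 1 (fun t : R => f (t *: v + (b - y))) l by rewrite oppr0.
have := is_derive1_comp h' dp.
by move=> /is_derive_eq; apply; rewrite mulrN1.
Qed.

End lines.

Section schwartz_functions.
Context {R : realType} {d : nat}.
Implicit Types (f g : 'rV[R]_d -> R) (x v w b xi : 'rV[R]_d).

Definition weight (k : nat) x : R := (1 + sqn x) ^+ k.

Lemma weight_ge0 k x : 0 <= weight k x.
Proof. by rewrite exprn_ge0// addr_ge0// sqn_ge0. Qed.

Definition rapidly_decreasing f := forall k, exists M : R, forall x, weight k x * `|f x| <= M.

Lemma schwartz_realP f : schwartz_real f <->
  (forall s i x, derivable (partials s f) x (delta_mx 0 i)) /\
  (forall s, rapidly_decreasing (partials s f)).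
Proof.
split=> -[D B]; split=> // s k; have [M hM] := B s k; exists M => x;
  by have := hM x; rewrite /weight enorm2.
Qed.

(** By induction on the sequence of directions, all the iterated derivatives stay in the
    class. *)
Lemma schwartz_of_class (S : ('rV[R]_d -> R) -> Prop) :
  (forall g, S g -> forall i, exists2 g', S g' &
     forall x, is_derive x (delta_mx 0 i) g (g' x)) ->
  (forall g, S g -> rapidly_decreasing g) ->
  forall g, S g -> schwartz_real g.
Proof.
move=> SD SB g Sg; apply/schwartz_realP.
have SP s : S (partials s g).
  elim: s => [//|i s IH]; have [g' Sg' dg'] := SD _ IH i.
  rewrite (_ : partials _ _ = g')//; apply/funext => x /=.
  by have [_] := dg' x.
split=> [s i x|s]; last exact: SB.
by have [g' _ dg'] := SD _ (SP s) i; have [] := dg' x.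
Qed.

Lemma rapidly_decreasingD f g : rapidly_decreasing f -> rapidly_decreasing g ->
  rapidly_decreasing (fun x => f x + g x).
Proof.
move=> Bf Bg k; have [M hM] := Bf k; have [N hN] := Bg k; exists (M + N) => x.
apply: le_trans (lerD (hM x) (hN x)); rewrite -mulrDr.
by rewrite ler_wpM2l ?weight_ge0// ler_normD.
Qed.

Inductive poly_gauss (a : R) w : ('rV[R]_d -> R) -> Prop :=
| poly_gauss0 c : poly_gauss a w (fun y => c * gaussd a w y)
| poly_gaussX i p : poly_gauss a w p -> poly_gauss a w (fun y => y 0 i * p y)
| poly_gaussD p q : poly_gauss a w p -> poly_gauss a w q ->
    poly_gauss a w (fun y => p y + q y).

Lemma coord_le_weight (i : 'I_d) x : `|x 0 i| <= 1 + sqn x.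
Proof.
have := sqr_coord_le x i; rewrite -[x 0 i ^+ 2]real_normK ?num_real//.
by have := sqr_ge0 (`|x 0 i| - 1); nra.
Qed.

Lemma weight_gaussd_bounded (a : R) w k : 0 < a ->
  exists M, forall x, weight k x * gaussd a w x <= M.
Proof.
move=> a0; pose c := 2 * (1 + sqn w); have c0 : 1 <= c by rewrite /c; have := sqn_ge0 w; lra.
(* 1 + s <= max(1, k/a) e^{(a/k) s} *)
pose B := Num.max 1 (k%:R / a).
have B0 : 0 < B by rewrite lt_max ltr01.
have key (s : R) : 0 <= s -> (1 + s) ^+ k * expR (- a * s) <= B ^+ k.
  move=> s0; rewrite -ler_pdivlMr ?expR_gt0// mulNr expRN invrK.
  case: k @B B0 => [|k] B B0; first by rewrite !expr0 mul1r -[leLHS]expR0 ler_expR mulr_ge0// ltW.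
  have -> : a * s = k.+1%:R * (a * s / k.+1%:R) by rewrite [RHS]mulrC mulfVK// pnatr_eq0.
  rewrite expRM_natl -exprMn lerXn2r ?nnegrE ?addr_ge0// ?mulr_ge0 ?expR_ge0// ?(ltW B0)//.
  have k0 : 0 < k.+1%:R :> R by rewrite ltr0n.
  apply: (@le_trans _ _ (B * (1 + a * s / k.+1%:R))); last by rewrite ler_wpM2l ?expR_ge1Dx// ltW.
  have B1 : 1 <= B by rewrite le_max lexx.
  have B2 : k.+1%:R / a <= B by rewrite le_max lexx orbT.
  have : 1 <= B * (a / k.+1%:R).
    by rewrite -ler_pdivrMr ?divr_gt0// invf_div mul1r.
  move=> B3; have : s <= B * (a / k.+1%:R) * s by rewrite ler_peMl.
  have -> : B * (1 + a * s / k.+1%:R) = B + B * (a / k.+1%:R) * s by ring.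
  by move=> h; apply: lerD.
exists (c ^+ k * B ^+ k) => x.
apply: (@le_trans _ _ (c ^+ k * ((1 + sqn (x - w)) ^+ k * expR (- a * sqn (x - w))))); last first.
  by rewrite ler_wpM2l ?key ?sqn_ge0// exprn_ge0// (le_trans ler01).
rewrite mulrA -exprMn /gaussd; apply: ler_wpM2r; first exact: expR_ge0.
have c1 : 0 <= c by exact: le_trans c0.
have p1 (z : 'rV[R]_d) : 0 <= 1 + sqn z by rewrite addr_ge0 ?sqn_ge0.
apply: lerXn2r; rewrite ?nnegrE ?p1//; first by apply: mulr_ge0.
have := sqn_leD (x - w) w; rewrite subrK /c.
by have := mulr_ge0 (sqn_ge0 w) (sqn_ge0 (x - w)); have := sqn_ge0 (x - w); have := sqn_ge0 w; nra.
Qed.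

Lemma poly_gauss_decreasing a w p : 0 < a -> poly_gauss a w p -> rapidly_decreasing p.
Proof.
move=> a0; elim=> {p} [c|i p _ IH|p q _ IHp _ IHq]; last exact: rapidly_decreasingD.
- move=> k; have [M hM] := weight_gaussd_bounded w k a0; exists (`|c| * M) => x.
  rewrite normrM (ger0_norm (gaussd_ge0 _ _ _)) mulrCA.
  by apply: ler_wpM2l => //.
- move=> k; have [M hM] := IH k.+1; exists M => x; apply: le_trans (hM x).
  rewrite normrM mulrA; apply: ler_wpM2r => //.
  rewrite /weight exprSr; apply: ler_wpM2l; first exact: (weight_ge0 k x).
  exact: coord_le_weight.
Qed.

Lemma poly_gaussZ a w p c : poly_gauss a w p -> poly_gauss a w (fun y => c * p y).
Proof.
elim=> {p} [c'|i p _ IH|p q _ IHp _ IHq].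
- by under eq_fun do rewrite mulrA; exact: poly_gauss0.
- by under eq_fun do rewrite mulrCA; exact: poly_gaussX.
- by under eq_fun do rewrite mulrDr; exact: poly_gaussD.
Qed.

Lemma poly_gauss_derive a w p i : poly_gauss a w p -> exists2 g, poly_gauss a w g &
  forall x, is_derive x (delta_mx 0 i) p (g x).
Proof.
elim=> {p} [c|j p Pp [g Pg dg]|p q _ [g Pg dg] _ [g' Pg' dg']].
- exists (fun y : 'rV[R]_d => y 0 i * ((- 2 * a * c) * gaussd a w y) + (2 * a * c * w 0 i) * gaussd a w y).
    by apply: poly_gaussD; [apply: poly_gaussX|]; exact: poly_gauss0.
  move=> x; have h := is_derive_gaussd a w x (delta_mx 0 i).
  apply: is_derive_eq; rewrite /GRing.scale /=.
  have -> : dotp (delta_mx 0 i) (x - w) = x 0 i - w 0 i.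
    rewrite /dotp (bigD1 i)//= big1 ?addr0 => [|j ji]; first by rewrite !mxE !eqxx mul1r.
    by rewrite !mxE eqxx (negbTE ji) mul0r.
  by ring.
- exists (fun y : 'rV[R]_d => (i == j)%:R * p y + y 0 j * g y).
    by apply: poly_gaussD; [exact: poly_gaussZ|exact: poly_gaussX].
  move=> x; have h1 := is_derive_coord i j x; have h2 := dg x.
  by apply: is_derive_eq; rewrite /GRing.scale /=; ring.
- exists (fun y => g y + g' y); first exact: poly_gaussD.
  by move=> x; have h1 := dg x; have h2 := dg' x; exact: is_deriveD.
Qed.

Lemma schwartz_real_poly_gauss a w p : 0 < a -> poly_gauss a w p -> schwartz_real p.
Proof.
move=> a0; apply: schwartz_of_class => g Pg; last exact: poly_gauss_decreasing Pg.
by move=> i; exact: poly_gauss_derive.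
Qed.

Lemma schwartz_gaussd a w : 0 < a -> schwartz (fun x => (gaussd a w x)%:C%C).
Proof.
move=> a0; split => /=.
- have := schwartz_real_poly_gauss a0 (poly_gauss0 a w 1).
  by under eq_fun do rewrite mul1r.
- have := schwartz_real_poly_gauss a0 (poly_gauss0 a w 0).
  by under eq_fun do rewrite mul0r.
Qed.

(** The derivatives of [cos (y . xi) f (b - y)] stay in this class; the sine is a cosine
    with shifted phase. *)
Inductive modulated f b xi : ('rV[R]_d -> R) -> Prop :=
| modulated0 c th s : modulated f b xi (fun y => c * (cos (dotp y xi + th) * partials s f (b - y)))
| modulatedD p q : modulated f b xi p -> modulated f b xi q ->
    modulated f b xi (fun y => p y + q y).

Lemma weight_reflect k b y : weight k y <= (2 * (1 + sqn b)) ^+ k * weight k (b - y).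
Proof.
rewrite /weight -exprMn lerXn2r ?nnegrE ?addr_ge0 ?mulr_ge0 ?addr_ge0 ?sqn_ge0//.
have := sqn_leD b (- (b - y)); rewrite opprB addrC subrK -[in sqn (y - b)]opprB sqnN.
have := mulr_ge0 (sqn_ge0 b) (sqn_ge0 (b - y)); have := sqn_ge0 (b - y); have := sqn_ge0 b.
by nra.
Qed.

Lemma sin_cosB (x : R) : sin x = cos (x + - (pi / 2)).
Proof. by rewrite cosB cos_pihalf sin_pihalf mulr0 add0r mulr1. Qed.

Lemma schwartz_real_modulated f b xi p : schwartz_real f -> modulated f b xi p -> schwartz_real p.
Proof.
move=> /schwartz_realP[fD fB]; apply: schwartz_of_class => {}p.
- move=> Mp i; elim: Mp => {p} [c th s|p q _ [g Pg dg] _ [g' Pg' dg']].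
    exists (fun y => (- c * dotp (delta_mx 0 i) xi) * (cos (dotp y xi + (th - pi / 2)) * partials s f (b - y))
       + (- c) * (cos (dotp y xi + th) * partials (i :: s) f (b - y))).
      by apply: modulatedD; exact: modulated0.
    move=> x; have h1 := is_derive_cos_dotp xi th x (delta_mx 0 i).
    have h2 : is_derive x (delta_mx 0 i) (fun y => partials s f (b - y)) (- partials (i :: s) f (b - x)).
      by apply: is_derive_reflect; apply: DeriveDef.
    by apply: is_derive_eq; rewrite /GRing.scale /= addrA -sin_cosB; ring.
  exists (fun y => g y + g' y); first exact: modulatedD.
  by move=> x; have h1 := dg x; have h2 := dg' x; exact: is_deriveD.
- elim=> {p} [c th s|p q _ IHp _ IHq]; last exact: rapidly_decreasingD.
  move=> k; have [M hM] := fB s k; exists (`|c| * ((2 * (1 + sqn b)) ^+ k * M)) => x.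
  rewrite !normrM mulrCA; apply: ler_wpM2l => //.
  apply: (@le_trans _ _ (weight k x * `|partials s f (b - x)|)).
    by rewrite ler_wpM2l ?weight_ge0// ler_piMl// norm_cos_le1.
  apply: (@le_trans _ _ ((2 * (1 + sqn b)) ^+ k * (weight k (b - x) * `|partials s f (b - x)|))).
    by rewrite mulrA; apply: ler_wpM2r => //; exact: weight_reflect.
  by rewrite ler_wpM2l// exprn_ge0// mulr_ge0// addr_ge0// sqn_ge0.
Qed.

Lemma partials_reflect f b s : schwartz_real f ->
  partials s (fun y => f (b - y)) = (fun y => (-1) ^+ size s * partials s f (b - y)).
Proof.
move=> [fD _]; elim: s => [|i s IH]; first by apply/funext => y /=; rewrite mul1r.
apply/funext => y /=; rewrite IH.
have h : is_derive y (delta_mx 0 i) (fun y => partials s f (b - y)) (- partials (i :: s) f (b - y)).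
  by apply: is_derive_reflect; apply: DeriveDef.
have h2 : is_derive y (delta_mx 0 i) (fun y => (-1) ^+ size s * partials s f (b - y))
   ((-1) ^+ (size s).+1 * partials (i :: s) f (b - y)).
  by apply: is_derive_eq; rewrite /GRing.scale /= exprS; ring.
by have [_] := h2.
Qed.

Lemma schwartz_realD f g : schwartz_real f -> schwartz_real g ->
  schwartz_real (fun x => f x + g x).
Proof.
move=> /schwartz_realP[fD fB] /schwartz_realP[gD gB].
apply: (@schwartz_of_class (fun h => exists s, h = (fun x => partials s f x + partials s g x))).
- move=> _ [s ->] i; exists (fun x => partials (i :: s) f x + partials (i :: s) g x); first by exists (i :: s).
  by move=> x; apply: is_deriveD; apply: DeriveDef.
- by move=> _ [s ->]; exact: rapidly_decreasingD.
- by exists [::].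
Qed.

Lemma schwartz_modulated (phi : 'rV[R]_d -> R[i]) b xi : schwartz phi ->
  schwartz (fun y => cexp (dotp y xi) * phi (b - y)).
Proof.
move=> [sr si]; split.
- have -> : (fun y => complex.Re (cexp (dotp y xi) * phi (b - y))) =
    (fun y => 1 * (cos (dotp y xi + 0) * complex.Re (phi (b - y))) +
       (-1) * (cos (dotp y xi + - (pi / 2)) * complex.Im (phi (b - y)))).
    by apply/funext => y; rewrite -sin_cosB addr0 /cexp; case: (phi _) => u v /=; ring.
  apply: schwartz_realD.
  + exact: schwartz_real_modulated sr (modulated0 _ b xi 1 0 [::]).
  + exact: schwartz_real_modulated si (modulated0 _ b xi (-1) (- (pi / 2)) [::]).
- have -> : (fun y => complex.Im (cexp (dotp y xi) * phi (b - y))) =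
    (fun y => 1 * (cos (dotp y xi + 0) * complex.Im (phi (b - y))) +
       1 * (cos (dotp y xi + - (pi / 2)) * complex.Re (phi (b - y)))).
    by apply/funext => y; rewrite -sin_cosB addr0 /cexp; case: (phi _) => u v /=; ring.
  apply: schwartz_realD.
  + exact: schwartz_real_modulated si (modulated0 _ b xi 1 0 [::]).
  + exact: schwartz_real_modulated sr (modulated0 _ b xi 1 (- (pi / 2)) [::]).
Qed.

Lemma schwartz_reflect (phi : 'rV[R]_d -> R[i]) b : schwartz phi ->
  schwartz (fun y => phi (b - y)).
Proof.
move=> sp; have := schwartz_modulated b 0 sp.
rewrite (_ : (fun y => _) = (fun y => phi (b - y)))//; apply/funext => y.
by rewrite dotp0r /cexp cos0 sin0 mul1r.
Qed.

Lemma seminorm_reflect k (phi : 'rV[R]_d -> R[i]) b M : schwartz phi -> seminorm_le k phi M ->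
  seminorm_le k (fun y => phi (b - y)) ((2 * (1 + sqn b)) ^+ k * M).
Proof.
move=> [sr si] hM s sk y.
have key f : schwartz_real f -> (forall x, (1 + enorm x ^+ 2) ^+ k * `|partials s f x| <= M) ->
   (1 + enorm y ^+ 2) ^+ k * `|partials s (fun y => f (b - y)) y| <= (2 * (1 + sqn b)) ^+ k * M.
  move=> sf hf; rewrite (partials_reflect b s sf) normrM normrX normrN1 expr1n mul1r.
  rewrite enorm2 -/(weight k y).
  apply: (@le_trans _ _ ((2 * (1 + sqn b)) ^+ k * (weight k (b - y) * `|partials s f (b - y)|))).
    by rewrite mulrA; apply: ler_wpM2r => //; exact: weight_reflect.
  rewrite ler_wpM2l//; first by rewrite exprn_ge0// mulr_ge0// addr_ge0// sqn_ge0.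
  by have := hf (b - y); rewrite enorm2.
by split; [apply: (key (fun y => complex.Re (phi y)))|apply: (key (fun y => complex.Im (phi y)))] => // x;
  have [] := hM s sk x.
Qed.

(** [1 + |y|^2 <= 2 (1 + |b|^2) (1 + |b - y|^2)] compares the seminorms. *)
Lemma tempered_reflect b (D : rV_distr R d) : tempered D -> tempered (distr_reflect b D).
Proof.
move=> [lin [k [C hC]]]; split.
  move=> a phi psi sp sq; rewrite /distr_reflect.
  by rewrite (lin a (fun y => phi (b - y)) (fun y => psi (b - y)))//; exact: schwartz_reflect.
exists k, (C * (2 * (1 + sqn b)) ^+ k) => phi M sp hM.
by rewrite -mulrA; apply: hC; [exact: schwartz_reflect|exact: seminorm_reflect].
Qed.

Lemma tempered0 : tempered ((fun=> 0) : rV_distr R d).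
Proof.
split=> [a phi psi _ _|]; first by rewrite mulr0 addr0.
by exists 0%N, 0 => phi M _ _; rewrite mul0r /= expr0n/= addr0 sqrtr0.
Qed.

End schwartz_functions.

(** * The transform of the wave integrand *)

Section continuity_rV.
Context {R : realType} {d : nat}.

Lemma cvg_dotp (T : Type) (F : set_system T) (FF : Filter F) (f g : T -> 'rV[R]_d) a b :
  f x @[x --> F] --> a -> g x @[x --> F] --> b -> dotp (f x) (g x) @[x --> F] --> dotp a b.
Proof.
move=> fa gb; rewrite /dotp.
have key (s : seq 'I_d) : \sum_(i <- s) f x 0 i * g x 0 i @[x --> F] --> \sum_(i <- s) a 0 i * b 0 i.
  elim: s => [|i s IH].
    by rewrite big_nil; under eq_fun do rewrite big_nil; exact: cvg_cst.
  rewrite big_cons; under eq_fun do rewrite big_cons; apply: cvgD => //; apply: cvgM.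
    exact: (cvg_comp _ _ fa (@coord_continuous _ _ _ _ _ _)).
  exact: (cvg_comp _ _ gb (@coord_continuous _ _ _ _ _ _)).
exact: key.
Qed.

Lemma continuous_dotpr (x : 'rV[R]_d) : continuous (dotp x).
Proof. by move=> y; apply: (@cvg_dotp _ (nbhs y) _ (fun=> x) id); [exact: cvg_cst|exact: cvg_id]. Qed.

Lemma continuous_sqn : continuous (@sqn R d).
Proof. by move=> y; apply: (@cvg_dotp _ (nbhs y) _ id id); exact: cvg_id. Qed.

Lemma continuous_enorm : continuous (@enorm R d).
Proof. by move=> y; apply: continuous_comp; [exact: continuous_sqn|exact: sqrt_continuous]. Qed.

Lemma continuous_wave_freq (t : R) : continuous (fun r : R => wave r t).
Proof.
have mull (c : R) : continuous (fun x : R => c * x).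
  by move=> x; apply: cvgM; [exact: cvg_cst|exact: cvg_id].
have cs : continuous (fun r : R => sin (t * r)).
  by move=> r; apply: continuous_comp; [exact: mull|exact: continuous_sin].
move=> r; have [->|r0] := eqVneq r 0.
- apply/continuous_withinNx; rewrite {2}/wave eqxx.
  have d1 : is_derive (0 : R) 1 (fun r : R => t * r) t.
    by apply: is_derive_eq; rewrite /GRing.scale /=; ring.
  have d2 : is_derive (0 : R) 1 (sin \o (fun r : R => t * r)) (cos (t * 0) * t).
    exact: is_derive1_comp.
  have [D V] := d2.
  have := D; rewrite /derivable => /cvg_ex[l hl].
  have lt : l = t.
    have := cvg_lim (@Rhausdorff R) hl; rewrite -/('D_1 (sin \o (fun r : R => t * r)) 0) V.
    by rewrite mulr0 cos0 mul1r => ->.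
  rewrite lt in hl; apply: cvg_trans hl; apply: near_eq_cvg; near=> h.
  have h0 : h != 0 by near: h; exact: nbhs_dnbhs_neq.
  by rewrite /wave (negbTE h0) /= mulr0 sin0 subr0 addr0 /GRing.scale /= mulr1 mulrC.
- have ne : \forall s \near r, s != 0.
    by apply: (@open_neq R 0).
  rewrite /continuous_at; have -> : wave r t = sin (t * r) / r by rewrite /wave (negbTE r0).
  have : (sin (t * s) / s) @[s --> r] --> sin (t * r) / r.
    by apply: cvgM; [exact: cs|apply: cvgV => //; exact: cvg_id].
  apply: cvg_trans; apply: near_eq_cvg; near=> s.
  have s0 : s != 0 by near: s.
  by rewrite /wave (negbTE s0).
Unshelve. all: by end_near. Qed.

Lemma measurable_wave2 d' (T : measurableType d') (r t : T -> R) :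
  measurable_fun setT r -> measurable_fun setT t -> (forall x, 0 <= r x) ->
  measurable_fun setT (fun x => wave (r x) (t x)).
Proof.
move=> mr mt r0; rewrite /wave.
apply: measurable_fun_ifT; [exact: measurable_fun_eqr|exact: mt|].
apply: measurable_funM; first by meas.
apply: (eq_measurable_fun (fun x => r x `^ (-1))) => [x _|]; first by rewrite powR_inv1.
by meas.
Qed.

End continuity_rV.

Section wave_profile.
Context {R : realType} {d : nat}.
Implicit Types (x xi : 'rV[R]_d).

(** The transform in space at [xi] of the integrand at time [s]. *)
Definition wave_profile (t : R) x (s : R) xi : R[i] :=
  Complex (cos (dotp x xi) * wave_slice t (enorm xi) s)
          (- sin (dotp x xi) * wave_slice t (enorm xi) s).

Lemma wave_profile_in t x s xi : 0 <= s <= t ->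
  wave_profile t x s xi = cexp (- dotp x xi) * (wave_fourier (t - s) xi)%:C%C.
Proof.
move=> st; rewrite /wave_profile /wave_slice st /cexp cosN sinN /real_complex_def.
have -> : wave_fourier (t - s) xi = wave (enorm xi) (t - s) by [].
by apply/eqP; rewrite eq_complex /=; apply/andP; split; apply/eqP; ring.
Qed.

Lemma wave_profile_out t x s xi : ~~ (0 <= s <= t) -> wave_profile t x s xi = 0.
Proof. by move=> /negbTE st; rewrite /wave_profile /wave_slice st !mulr0. Qed.

Lemma continuous_wave_profile t x s : ccontinuous (wave_profile t x s).
Proof.
have cw : continuous (fun xi => wave_slice t (enorm xi) s).
  rewrite /wave_slice; case: (boolP (_ && _)) => _; last exact: (@cst_continuous _ R 0).
  move=> xi; apply: (@continuous_comp _ _ _ (@enorm R d) (fun r => wave r (t - s))).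
    exact: continuous_enorm.
  exact: continuous_wave_freq.
have cc : continuous (fun xi => cos (dotp x xi)).
  by move=> xi; apply: (@continuous_comp _ _ _ (dotp x) cos); [exact: continuous_dotpr|exact: continuous_cos].
have cs : continuous (fun xi => sin (dotp x xi)).
  by move=> xi; apply: (@continuous_comp _ _ _ (dotp x) sin); [exact: continuous_dotpr|exact: continuous_sin].
split.
- have : continuous (fun xi => cos (dotp x xi) * wave_slice t (enorm xi) s).
    by move=> xi; exact: (cvgM (cc xi) (cw xi)).
  by [].
- have : continuous (fun xi => - sin (dotp x xi) * wave_slice t (enorm xi) s).
    by move=> xi; exact: (cvgM (cvgN (cs xi)) (cw xi)).
  by [].
Qed.

Lemma measurable_wave_slice2 d' (T : measurableType d') (t : R) (r s : T -> R) :
  measurable_fun setT r -> measurable_fun setT s -> (forall z, 0 <= r z) ->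
  measurable_fun setT (fun z => wave_slice t (r z) (s z)).
Proof.
move=> mr ms r0; rewrite /wave_slice.
apply: measurable_fun_ifT; [by meas| |by []].
by apply: measurable_wave2 => //; meas.
Qed.

Lemma measurable_wave_profile t x :
  cmeasurable setT (fun p : R * 'rV[R]_d => wave_profile t x p.1 p.2).
Proof.
have m1 : measurable_fun setT (fun p : R * 'rV[R]_d => wave_slice t (enorm p.2) p.1).
  by apply: measurable_wave_slice2; [by meas|by meas|move=> p; exact: enorm_ge0].
by split=> /=; apply: measurable_funM => //; meas.
Qed.

Lemma normc_le (a b : R) : ComplexField.Normc.normc (Complex a b) <= `|a| + `|b|.
Proof.
rewrite /= -[leRHS]sqrtr_sqr_ge0 || idtac.
rewrite -[leRHS]ger0_norm ?addr_ge0// -sqrtr_sqr ler_wsqrtr// sqrrD.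
rewrite !real_normK ?num_real// [leRHS]addrAC lerDl mulrn_wge0// mulr_ge0//.
Qed.

Lemma wave_slice_le (t r s : R) : 0 <= t -> 0 <= r -> `|wave_slice t r s| <= t.
Proof.
by move=> t0 r0; have [_ h _] := wave_slice_tame r0 t0 (lexx t).
Qed.

Lemma normc_wave_profile t x s xi : 0 <= t ->
  ComplexField.Normc.normc (wave_profile t x s xi) <= 2 * t.
Proof.
move=> t0; apply: le_trans (normc_le _ _) _.
have h := wave_slice_le s t0 (enorm_ge0 xi).
rewrite !normrM normrN.
have h1 : `|cos (dotp x xi)| * `|wave_slice t (enorm xi) s| <= t.
  by apply: le_trans h; rewrite ler_piMl// norm_cos_le1.
have h2 : `|sin (dotp x xi)| * `|wave_slice t (enorm xi) s| <= t.
  by apply: le_trans h; rewrite ler_piMl// norm_sin_le1.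
by lra.
Qed.

Lemma admissible_wave_profile t x : 0 <= t -> admissible t (wave_profile t x).
Proof.
move=> t0; split; first exact: measurable_wave_profile.
- by move=> xi; exists (2 * t) => s; exact: normc_wave_profile.
- move=> s xi ts; apply: wave_profile_out; apply/negP => /andP[s0 st].
  by move: ts; rewrite ger0_norm// ltNge st.
Qed.

Lemma cenergy_wave_profile (H : R) (hH : 1 / 2 < H < 1) t x xi : 0 <= t ->
  cenergy H ((wave_profile t x)^~ xi) = energy H (wave_slice t (enorm xi)).
Proof.
move=> t0; apply: (cenergy_phase hH (b := t) (M := t)).
  by rewrite sqrrN cos2Dsin2.
by apply: wave_slice_tame => //; exact: enorm_ge0.
Qed.

End wave_profile.

Section uniqueness.
Context {R : realType} {d : nat}.
Implicit Types (k : 'rV[R]_d -> R) (w : 'rV[R]_d).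

Lemma measurable_box (a b : 'I_d -> R) :
  measurable [set x : 'rV[R]_d | forall i, a i <= x 0 i <= b i].
Proof.
rewrite (_ : [set _ | _] = \bigcap_(i in [set: 'I_d])
  ((fun x : 'rV[R]_d => x 0 i) @^-1` `[a i, b i]%classic)).
  apply: fin_bigcap_measurable => // i _; rewrite -[X in measurable X]setTI.
  exact: measurable_coord.
apply/seteqP; split => x /= xab i; last by have := xab i I; rewrite /= in_itv.
by move=> _; rewrite /= in_itv/=.
Qed.

Lemma measurable_eball (w : 'rV[R]_d) (r : R) : measurable [set y | sqn (y - w) <= r].
Proof.
rewrite -[X in measurable X]setTI.
have -> : [set y | sqn (y - w) <= r] = (fun y => sqn (y - w)) @^-1` `]-oo, r].
  by apply/seteqP; split => y /=; rewrite in_itv.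
have m : measurable_fun setT (fun y : 'rV[R]_d => sqn (y - w)) by meas.
exact: m.
Qed.

Lemma leb_eball_gt0 (w : 'rV[R]_d) (r : R) : 0 < r -> (0 < leb d [set y | (sqn (y - w) <= r)%R])%E.
Proof.
move=> r0; pose e := Num.min 1 (r / d.+1%:R).
have e0 : 0 < e by rewrite lt_min ltr01 divr_gt0.
apply: (@lt_le_trans _ _ (leb d [set x | forall i, w 0 i - e <= x 0 i <= w 0 i + e])).
  rewrite leb_box => [|i]; last by lra.
  by rewrite lte_fin; apply: prodr_gt0 => i _; lra.
apply: le_measure; rewrite ?inE.
- exact: (measurable_box (fun i => w 0 i - e) (fun i => w 0 i + e)).
- exact: measurable_eball.
move=> x /= xe; apply: (@le_trans _ _ (\sum_(i < d) e)).
  apply: ler_sum => i _; rewrite !mxE -expr2 -[_ ^+ 2]real_normK ?num_real//.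
  have h : `|x 0 i - w 0 i| <= e by have := xe i; rewrite ler_distl; lra.
  have e1 : e <= 1 by rewrite ge_min lexx.
  by have := normr_ge0 (x 0 i - w 0 i); nra.
rewrite sumr_const card_ord -mulr_natl; apply: (@le_trans _ _ (d.+1%:R * e)).
  by rewrite ler_wpM2r ?ler_nat// ltW.
by rewrite -ler_pdivlMl// mulrC ge_min lexx orbT.
Qed.

(** If [k w > 0] then [k] is bounded below on a ball around [w], and for narrow Gaussians
    the rest of the integral is exponentially smaller. *)
Lemma gauss_tests_le0 k w : continuous k ->
  (forall a, 0 < a -> (leb d).-integrable setT (fun x => (k x * gaussd a w x)%:E)) ->
  (forall a, 0 < a -> (\int[leb d]_x (k x * gaussd a w x)%:E = 0)%E) -> k w <= 0.
Proof.
move=> ck ik k0; rewrite leNgt; apply/negP => kw.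
have [e e0 he] : exists2 e : R, 0 < e & forall y, sqn (y - w) <= e -> k w / 2 <= k y.
  have : \forall y \near w, k w / 2 <= k y.
    have := ck w => /cvgrPdist_le /(_ (k w / 2)).
    have -> : 0 < k w / 2 by rewrite divr_gt0.
    move=> /(_ isT); apply: filterS => y; rewrite ler_norml => /andP[_ h]; lra.
  move=> /nbhs_ballP[e /= e0 he]; exists (e ^+ 2 / 4); first by rewrite divr_gt0// exprn_gt0.
  move=> y yw; apply: he; rewrite -ball_normE /ball_/= distrC.
  apply: le_lt_trans (norm_le_enorm _) _.
  rewrite -(ltr_pXn2r (n := 2)) ?nnegrE ?enorm_ge0 ?ltW// enorm2.
  by have := exprn_gt0 2 e0; lra.
pose N := [set y | sqn (y - w) <= e].
have mN : measurable N by exact: measurable_eball.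
have mk : measurable_fun setT k by exact: continuous_measurable_rV.
pose u n y := expR (n.+1%:R * e) * gaussd n.+1%:R w y.
have uE n y : u n y = expR (n.+1%:R * (e - sqn (y - w))).
  by rewrite /u /gaussd -expRD; congr expR; ring.
have mu n : measurable_fun setT (u n).
  by rewrite /u /gaussd; meas.
have iu n : (leb d).-integrable setT (fun x => (k x * u n x)%:E).
  rewrite (_ : (fun x => _) = (fun x => (expR (n.+1%:R * e))%:E * (k x * gaussd n.+1%:R w x)%:E)%E).
    by apply: integrableZl => //; exact: ik.
  by apply/funext => x; rewrite -EFinM; congr EFin; rewrite /u; ring.
have ku0 n : (\int[leb d]_x (k x * u n x)%:E = 0)%E.
  rewrite (_ : (fun x => _) = (fun x => (expR (n.+1%:R * e))%:E * (k x * gaussd n.+1%:R w x)%:E)%E).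
    rewrite integralZl//; last exact: ik.
    by rewrite k0// mule0.
  by apply/funext => x; rewrite -EFinM; congr EFin; rewrite /u; ring.
pose far n x := (k x * u n x * \1_(~` N) x).
pose nearp n x := (k x * u n x * \1_N x).
have mfar n : measurable_fun setT (far n).
  by apply: measurable_funM; [exact: measurable_funM|apply: measurable_indic; exact: measurableC].
have mnear n : measurable_fun setT (nearp n).
  by apply: measurable_funM; [exact: measurable_funM|exact: measurable_indic].
have split n x : k x * u n x = far n x + nearp n x.
  rewrite /far /nearp -mulrDr !indicE in_setC; case: (x \in N) => /=; by rewrite ?addr0 ?add0r mulr1.
have ifar n : (leb d).-integrable setT (fun x => (far n x)%:E).
  apply: le_integrable (iu n) => //; first exact/measurable_EFinP.
  move=> x _; rewrite lee_fin /far [`|_ * \1_ _ _|]normrM ler_piMr// indicE.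
  by case: (_ \in _); rewrite ?normr1 ?normr0.
have inear n : (leb d).-integrable setT (fun x => (nearp n x)%:E).
  apply: le_integrable (iu n) => //; first exact/measurable_EFinP.
  move=> x _; rewrite lee_fin /nearp [`|_ * \1_ _ _|]normrM ler_piMr// indicE.
  by case: (_ \in _); rewrite ?normr1 ?normr0.
have m0 : (0 < (k w / 2)%:E * leb d N)%E.
  by apply: mule_gt0; [rewrite lte_fin divr_gt0|exact: leb_eball_gt0].
have near_ge n : ((k w / 2)%:E * leb d N <= \int[leb d]_x (nearp n x)%:E)%E.
  rewrite -[N]setIT -integral_indic// -ge0_integralZl//; try by rewrite lee_fin divr_ge0// ltW.
    apply: ge0_le_integral => //.
    - by move=> x _; rewrite -EFinM lee_fin; apply: mulr_ge0 => //; rewrite divr_ge0// ltW.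
    - by apply: measurable_funeM; apply/measurable_EFinP; exact: measurable_indic.
    - exact/measurable_EFinP.
    - move=> x _; rewrite -EFinM lee_fin /nearp indicE; have [|] := boolP (x \in N); last by rewrite !mulr0.
      rewrite inE /= !mulr1 => xN; apply: (@le_trans _ _ (k x)); first exact: he.
      apply: ler_peMr; first by apply: le_trans (he _ xN); rewrite divr_ge0// ltW.
      by rewrite uE -[leLHS]expR0 ler_expR mulr_ge0// subr_ge0.
  by apply/measurable_EFinP; exact: measurable_indic.
have far_le n : (\int[leb d]_x (far n x)%:E <= - ((k w / 2)%:E * leb d N))%E.
  have := ku0 n; under eq_integral do rewrite split EFinD.
  rewrite integralD// => /eqP; rewrite addeC -(@fineK _ (\int[leb d]_x (nearp n x)%:E)%E); last exact: integrable_fin_num.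
  rewrite -(@fineK _ (\int[leb d]_x (far n x)%:E)%E); last exact: integrable_fin_num.
  have := near_ge n; rewrite -(@fineK _ (\int[leb d]_x (nearp n x)%:E)%E); last exact: integrable_fin_num.
  move: (fine _) (fine _) ((k w / 2)%:E * leb d N)%E m0 => p q [m||]//=; rewrite ?leye_eq//.
  by move=> _; rewrite !lee_fin => mp /eqP; rewrite -EFinD => -[]; lra.
have far_cvg : (\int[leb d]_x (far n x)%:E)%E @[n --> \oo] --> (\int[leb d]_x (cst 0 x))%E.
  apply: (@dominated_cvg _ _ _ (leb d) setT _ _ _ (fun x => `|(k x * u 0%N x)%:E|%E)) => //.
  - by move=> n; exact/measurable_EFinP.
  - move=> x _; apply: cvg_EFin; first exact: nearW.
    rewrite /far indicE in_setC; have [xN|xN] := boolP (x \in N) => /=.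
      by under eq_fun do rewrite mulr0; exact: cvg_cst.
    under eq_fun do rewrite mulr1.
    rewrite -[X in nbhs X](mulr0 (k x)); apply: (@cvgM _ _ _ _ (fun=> k x)); first exact: cvg_cst.
    have ex : 0 < sqn (x - w) - e.
      by rewrite subr_gt0 ltNge; apply: contra xN => xN; rewrite inE.
    rewrite (_ : (fun n => u n x) = (fun n => expR (- (sqn (x - w) - e)) ^+ n.+1)); last first.
      by apply/funext => n; rewrite uE -expRM_natl; congr expR; ring.
    have := @cvg_expr _ (expR (- (sqn (x - w) - e))).
    rewrite ger0_norm ?expR_ge0// -[X in _ < X]expR0 ltr_expR oppr_lt0 => /(_ ex).
    by rewrite -(cvg_shiftS (fun n : nat => expR (- (sqn (x - w) - e)) ^+ n)).
  - by apply: integrable_abse; exact: iu.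
  - move=> n x _; rewrite lee_fin /far indicE in_setC; have [xN|xN] := boolP (x \in N) => /=.
      by rewrite mulr0 normr0.
    have u0 m : 0 <= u m x by rewrite uE expR_ge0.
    rewrite mulr1 !(normrM (k x)) (ger0_norm (u0 n)) (ger0_norm (u0 0%N)) ler_wpM2l// !uE ler_expR.
    have ex : 0 < sqn (x - w) - e.
      by rewrite subr_gt0 ltNge; apply: contra xN => xN; rewrite inE.
    by apply: ler_wnM2r; [lra|rewrite ler_nat].
rewrite integral0 in far_cvg.
have : (0 <= - ((k w / 2)%:E * leb d N))%E.
  by apply: (cvge_le _ far_cvg) || apply: (@cvge_le _ _ _ _ _ _ _ far_cvg); exact: nearW.
by rewrite oppe_ge0 leNgt m0.
Qed.

Lemma gauss_tests_eq0 k : continuous k ->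
  (forall a w, 0 < a -> (leb d).-integrable setT (fun x => (k x * gaussd a w x)%:E)) ->
  (forall a w, 0 < a -> (\int[leb d]_x (k x * gaussd a w x)%:E = 0)%E) -> forall w, k w = 0.
Proof.
move=> ck ik k0 w; apply/eqP; rewrite eq_le gauss_tests_le0//=; [|by move=> a; exact: ik|by move=> a; exact: k0].
rewrite -oppr_le0; apply: (@gauss_tests_le0 (fun x => - k x)).
- by move=> x; apply: (@cvgN _ _ _ (nbhs x)); exact: ck.
- move=> a a0; rewrite (_ : (fun x => _) = (fun x => (-1)%:E * (k x * gaussd a w x)%:E)%E).
    by apply: integrableZl => //; exact: (ik a w a0).
  by apply/funext => x; rewrite -EFinM !mulNr mul1r.
- move=> a a0; rewrite (_ : (fun x => _) = (fun x => (-1)%:E * (k x * gaussd a w x)%:E)%E).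
    by rewrite integralZl ?k0 ?mule0//; exact: (ik a w a0).
  by apply/funext => x; rewrite -EFinM !mulNr mul1r.
Qed.

End uniqueness.

Section schwartz_continuity.
Context {R : realType} {d : nat}.
Implicit Types (f : 'rV[R]_d -> R) (x y v : 'rV[R]_d).

Lemma is_derive_line_at f x v (t l : R) : is_derive (t *: v + x) v f l ->
  is_derive t 1 (fun t : R => f (t *: v + x)) l.
Proof.
move=> /is_derive_lineE h.
have dp : is_derive t 1 (fun s : R => s - t) 1.
  by apply: is_derive_eq; rewrite subr0.
have h' : is_derive (t - t : R) 1 (fun s : R => f (s *: v + (t *: v + x))) l by rewrite subrr.
have := @is_derive1_comp _ _ (fun s : R => s - t) t _ _ h' dp; rewrite mulr1.
rewrite (_ : _ \o _ = (fun t : R => f (t *: v + x)))//.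
by apply/funext => s /=; rewrite addrA -scalerDl subrK.
Qed.

Lemma lipschitz_line f x v (M : R) : (forall z, exists2 l, is_derive z v f l & `|l| <= M) ->
  forall t : R, `|f (t *: v + x) - f x| <= M * `|t|.
Proof.
move=> h.
pose g (t : R) := f (t *: v + x).
have /choice[l hl] : forall t : R, exists l, is_derive t 1 g l /\ `|l| <= M.
  by move=> t; have [l dl lM] := h (t *: v + x); exists l; split => //; exact: is_derive_line_at.
have cg : continuous g.
  by move=> t; apply: differentiable_continuous; apply/derivable1_diffP; have [[]] := hl t.
have key (a b : R) : a <= b -> `|g b - g a| <= M * `|b - a|.
  move=> ab; have [c _ ->] := @MVT_segment R g l a b ab (fun t _ => (hl t).1) (continuous_subspaceT cg).
  by rewrite normrM ler_wpM2r//; have [] := hl c.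
move=> t; have -> : f x = g 0 by rewrite /g scale0r add0r.
have [t0|/ltW t0] := leP 0 t; first by have := key 0 t t0; rewrite subr0.
by have := key t 0 t0; rewrite distrC sub0r normrN.
Qed.

(** Moving along the coordinate axes one at a time, with bounded partial derivatives. *)
Lemma schwartz_real_continuous f : schwartz_real f -> continuous f.
Proof.
move=> /schwartz_realP[fD fB].
have [M M0 hM] : exists2 M, 0 <= M & forall i z, exists2 l, is_derive z (delta_mx 0 i) f l & `|l| <= M.
  have /choice[m hm] : forall i : 'I_d, exists m : R, forall z, weight 0 z * `|partials [:: i] f z| <= m.
    by move=> i; exact: fB.
  have m0 i : 0 <= m i by apply: le_trans (hm i 0); rewrite mulr_ge0 ?weight_ge0.
  exists (\sum_i m i); first by apply: sumr_ge0 => i _.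
  move=> i z; exists (partials [:: i] f z); first by apply: DeriveDef => //; exact: (fD [::]).
  have := hm i z; rewrite /weight expr0 mul1r => h; apply: le_trans h _.
  by rewrite (bigD1 i)//= lerDl; apply: sumr_ge0 => j _.
move=> x; apply: (@cvgrPdist_le _ _ _ (nbhs x) _ f (f x)).2 => e e0.
pose C := M * d%:R + 1.
have C0 : 0 < C by rewrite ltr_wpDl// mulr_ge0.
have lip y : `|f y - f x| <= (M * d%:R) * `|y - x|.
  pose z (k : nat) : 'rV[R]_d := \row_j (if (j < k)%N then y 0 j else x 0 j).
  have zS (k : 'I_d) : z k.+1 = (y 0 k - x 0 k) *: delta_mx 0 k + z k.
    apply/rowP => j; rewrite !mxE eqxx andTb ltnS leq_eqVlt.
    have [->|jk] := eqVneq j k; first by rewrite eqxx ltnn /= mulr1 subrK.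
    by rewrite (_ : (j == k :> nat) = false) ?mulr0 ?add0r//; exact: negbTE.
  have z0 : z 0%N = x by apply/rowP => j; rewrite !mxE.
  have zd : z d = y by apply/rowP => j; rewrite !mxE ltn_ord.
  have step k : (k <= d)%N -> `|f (z k) - f x| <= (M * k%:R) * `|y - x|.
    elim: k => [_|k IH kd]; first by rewrite z0 subrr normr0 mulr0 mul0r.
    have -> : f (z k.+1) - f x = (f (z k.+1) - f (z k)) + (f (z k) - f x) by rewrite addrA subrK.
    apply: le_trans (ler_normD _ _) _.
    have -> : M * k.+1%:R * `|y - x| = M * `|y - x| + M * k%:R * `|y - x| by rewrite -natr1; ring.
    apply: lerD (IH (ltnW kd)); rewrite (zS (Ordinal kd)).
    apply: le_trans (lipschitz_line _ (hM (Ordinal kd)) _) _.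
    rewrite ler_wpM2l//; have := coord_le_norm (y - x) (Ordinal kd).
    by rewrite !mxE.
  by rewrite -{1}zd; exact: step.
near=> y; rewrite distrC; apply: le_trans (lip y) _.
apply: (@le_trans _ _ (C * `|y - x|)); first by rewrite ler_wpM2r// lerDl.
rewrite -ler_pdivlMl// mulrC distrC.
near: y; apply: (@cvgrPdist_le _ _ _ (nbhs x) _ id x).1; first exact: cvg_id.
by rewrite divr_gt0.
Unshelve. all: by end_near. Qed.

Lemma schwartz_measurable (phi : 'rV[R]_d -> R[i]) : schwartz phi -> cmeasurable setT phi.
Proof.
by move=> [sr si]; split; apply: continuous_measurable_rV; exact: schwartz_real_continuous.
Qed.

End schwartz_continuity.

Section fourier_of_wave.
Context {R : realType} {d : nat}.
Implicit Types (x y xi : 'rV[R]_d) (phi psi : 'rV[R]_d -> R[i]).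

Lemma Rintegral_leb_reflect b (F : 'rV[R]_d -> R) : measurable_fun setT F ->
  (\int[leb d]_x F x = \int[leb d]_x F (b - x))%R.
Proof.
move=> mF; rewrite /Rintegral; congr fine.
by apply: (@integral_leb_reflect _ _ b (EFin \o F)); apply/measurable_EFinP.
Qed.

Lemma integrable_leb_reflect b (F : 'rV[R]_d -> R) :
  (leb d).-integrable setT (EFin \o F) -> (leb d).-integrable setT (fun x => (F (b - x))%:E).
Proof.
move=> /integrableP[/measurable_EFinP mF iF]; apply/integrableP; split.
  apply/measurable_EFinP; apply: (measurableT_comp mF (g := fun x : 'rV[R]_d => b - x)).
  by apply: measurable_rVD; [exact: measurable_cst|apply: measurable_rVN; exact: measurable_id].
move: iF; rewrite (@integral_leb_reflect _ _ b (fun x => `|(F x)%:E|%E))//.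
by apply/measurable_EFinP; apply: measurableT_comp.
Qed.

Lemma cintegral_reflect b phi : cintegrable (leb d) phi ->
  cintegrable (leb d) (fun x => phi (b - x)) /\
  cintegral (leb d) setT phi = cintegral (leb d) setT (fun x => phi (b - x)).
Proof.
move=> [iR iI]; split.
  by split; [exact: (integrable_leb_reflect b iR)|exact: (integrable_leb_reflect b iI)].
have [/measurable_EFinP mR _] := integrableP _ _ _ iR.
have [/measurable_EFinP mI _] := integrableP _ _ _ iI.
rewrite /cintegral; congr Complex.
  exact: (@Rintegral_leb_reflect b (fun x => complex.Re (phi x))).
exact: (@Rintegral_leb_reflect b (fun x => complex.Im (phi x))).
Qed.

Lemma cexpD (a b : R) : cexp (a + b) = cexp a * cexp b.
Proof. by rewrite /cexp cosD sinD; apply/eqP; rewrite eq_complex /=; apply/andP; split; apply/eqP; ring. Qed.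

Lemma cmeasurable_cexpM (a : 'rV[R]_d -> R) phi : measurable_fun setT a -> cmeasurable setT phi ->
  cmeasurable setT (fun x => cexp (a x) * phi x).
Proof.
move=> ma [mR mI]; split.
  rewrite (_ : (fun x => _) = (fun x => cos (a x) * complex.Re (phi x) - sin (a x) * complex.Im (phi x))).
    by meas.
  by apply/funext => x; rewrite /cexp; case: (phi x).
rewrite (_ : (fun x => _) = (fun x => cos (a x) * complex.Im (phi x) + sin (a x) * complex.Re (phi x))).
  by meas.
by apply/funext => x; rewrite /cexp; case: (phi x).
Qed.

Definition modulate x phi : 'rV[R]_d -> R[i] := fun z => cexp (dotp z x) * phi (0 - z).

Lemma fourier_modulate x phi y : schwartz phi -> fourier phi (x - y) = fourier (modulate x phi) y.
Proof.
move=> sp; have mp := schwartz_measurable sp.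
have [mR mI] : cmeasurable setT (fun z => cexp (- dotp (x - y) z) * phi z).
  by apply: cmeasurable_cexpM => //; meas.
rewrite /fourier /cintegral (@Rintegral_leb_reflect 0 _ mR) (@Rintegral_leb_reflect 0 _ mI).
have E z : cexp (- dotp (x - y) (0 - z)) * phi (0 - z) = cexp (- dotp y z) * modulate x phi z.
  rewrite /modulate mulrA -cexpD; congr (cexp _ * _).
  by rewrite sub0r dotpNr opprK dotpBl (dotpC x z) addrC.
by congr Complex; apply: eq_Rintegral => z _; rewrite E.
Qed.

Variable G1 : R -> rV_distr R d.
Hypothesis hG1 : wave_kernel G1.

Lemma distr_is_function0 (D : rV_distr R d) (h : 'rV[R]_d -> R[i]) :
  (forall phi, schwartz phi -> D phi = 0) -> (forall xi, h xi = 0) -> distr_is_function D h.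
Proof.
move=> D0 h0 phi sp; rewrite (_ : (fun x => _) = (fun=> 0)); last first.
  by apply/funext => x; rewrite h0 mul0r.
split; first by split; exact: integrable0.
rewrite D0// /cintegral/= /Rintegral.
have -> : (\int[leb d]_x 0%:E = 0)%E by move=> ?; exact: integral0.
by [].
Qed.

(** The transform of a reflected and translated distribution is the modulated transform,
    because [fourier phi (x - y)] is the transform of [modulate x phi]. *)
Lemma wave_integrand_fourier t x : 0 <= t ->
  fourier_in_space (wave_integrand G1 t x) (wave_profile t x).
Proof.
move=> t0; have [m bd sp] := admissible_wave_profile x t0.
split => //; last first.
  exists t => s ts psi _; rewrite /wave_integrand; case: ifP => // /andP[s0 st].
  by move: ts; rewrite ger0_norm// ltNge st.
move=> s; split; last exact: continuous_wave_profile.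
- rewrite /wave_integrand; case: ifP => [/andP[s0 st]|_]; last exact: tempered0.
  by apply: tempered_reflect; have [] := hG1 (t := t - s); rewrite ?subr_ge0.
- rewrite /wave_integrand; case: ifPn => [st|st]; last first.
    apply: distr_is_function0 => // xi; exact: wave_profile_out.
  move=> phi sphi; have [_ hD] : tempered (G1 (t - s)) /\ distr_is_function (distr_fourier (G1 (t - s))) (fun xi => (wave_fourier (t - s) xi)%:C%C).
    by apply: hG1; rewrite subr_ge0; have /andP[] := st.
  have spsi : schwartz (modulate x phi) by exact: schwartz_modulated.
  have [ci De] := hD _ spsi.
  have [ci' De'] := cintegral_reflect 0 ci.
  have E : (fun z => (wave_fourier (t - s) (0 - z))%:C%C * modulate x phi (0 - z)) =
     (fun z => wave_profile t x s z * phi z).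
    apply/funext => z; rewrite wave_profile_in// /modulate sub0r opprK add0r dotpNl (dotpC z x).
    have -> : wave_fourier (t - s) (- z) = wave_fourier (t - s) z.
      have en : enorm (- z) = enorm z by rewrite /enorm -/(sqn (- z)) sqnN.
      by rewrite /wave_fourier en.
    by rewrite mulrCA mulrA.
  rewrite -E; split => //; rewrite -De' -De /distr_fourier /distr_reflect.
  by congr (G1 _ _); apply/funext => y; rewrite fourier_modulate.
Qed.

Lemma fourier_in_space_unique (phi : R -> rV_distr R d) (h h' : R -> 'rV[R]_d -> R[i]) :
  fourier_in_space phi h -> fourier_in_space phi h' -> h = h'.
Proof.
move=> [H1 _ _ _] [H1' _ _ _]; apply/funext => t.
have [_ D [cR cI]] := H1 t; have [_ D' [cR' cI']] := H1' t.
have key (p : R[i] -> R) (hp : forall z (r : R), p (z * r%:C%C) = p z * r)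
   (ip : forall F, cintegrable (leb d) F -> (leb d).-integrable setT (fun x => (p (F x))%:E))
   (ep : forall F F', cintegral (leb d) setT F = cintegral (leb d) setT F' ->
      (\int[leb d]_x p (F x) = \int[leb d]_x p (F' x))%R) :
   continuous (fun x => p (h t x)) -> continuous (fun x => p (h' t x)) ->
   forall xi, p (h t xi) - p (h' t xi) = 0.
  move=> c c'; apply: gauss_tests_eq0.
  - by move=> x; exact: (cvgB (c x) (c' x)).
  - move=> a w a0; have [ci _] := D _ (schwartz_gaussd w a0); have [ci' _] := D' _ (schwartz_gaussd w a0).
    rewrite (_ : (fun x => _) = (fun x => (p (h t x * (gaussd a w x)%:C%C))%:E - (p (h' t x * (gaussd a w x)%:C%C))%:E)%E).
      by apply: integrableB => //; [exact: ip ci|exact: ip ci'].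
    by apply/funext => x; rewrite !hp mulrBl.
  - move=> a w a0; have [ci e] := D _ (schwartz_gaussd w a0); have [ci' e'] := D' _ (schwartz_gaussd w a0).
    rewrite (_ : (fun x => _) = (fun x => (p (h t x * (gaussd a w x)%:C%C))%:E - (p (h' t x * (gaussd a w x)%:C%C))%:E)%E).
      rewrite integralB//; [|exact: ip ci|exact: ip ci'].
      have := ep _ _ (etrans (esym e) e'); rewrite /Rintegral => E.
      have f1 := integrable_fin_num measurableT (ip _ ci).
      have f2 := integrable_fin_num measurableT (ip _ ci').
      by rewrite -(fineK f1) -(fineK f2) E subee.
    by apply/funext => x; rewrite !hp mulrBl.
apply/funext => xi.
have r : complex.Re (h t xi) - complex.Re (h' t xi) = 0.
  apply: (key (@complex.Re R) _ _ _ cR cR').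
  - by move=> [a b] c /=; ring.
  - by move=> F [].
  - by move=> F F' [].
have i : complex.Im (h t xi) - complex.Im (h' t xi) = 0.
  apply: (key (@complex.Im R) _ _ _ cI cI').
  - by move=> [a b] c /=; ring.
  - by move=> F [].
  - by move=> F F' [].
move: r i; case: (h t xi) => a b; case: (h' t xi) => a' b' /=.
by move=> /subr0_eq -> /subr0_eq ->.
Qed.

(** The transform in the definition is the only possible one, so that it can be replaced
    by the explicit profile. *)
Lemma HP_limit_waveE (H : R) (mu : {measure set 'rV[R]_d -> \bar R}) e t x : 0 <= t ->
  HP_limit H mu e (wave_integrand G1 t x) <->
  (HP_norm2 H mu (fun s xi => wave_profile t x s xi - el_fourier (e n) s xi) @[n --> \oo] --> 0%E).
Proof.
move=> t0; have hw := wave_integrand_fourier x t0.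
split=> [[h hf]|]; last by exists (wave_profile t x).
by rewrite (fourier_in_space_unique hf hw).
Qed.

End fourier_of_wave.

(** * Continuity of translations in the mean *)

Section cvge0.
Context {R : realType} {T : Type} (F : set_system T) (FF : Filter F).

Lemma cvge0_le (u : T -> \bar R) : (forall n, (0 <= u n)%E) ->
  (forall e : R, 0 < e -> \forall n \near F, (u n <= e%:E)%E) -> u n @[n --> F] --> 0%E.
Proof.
move=> u0 ue; apply/fine_cvgP; split.
  by move: (ue 1 ltr01); apply: filterS => n un; rewrite ge0_fin_numE// (le_lt_trans un)// ltry.
apply/(@cvgrPdist_le _ _ _ F) => e e0; move: (ue e e0); apply: filterS => n /=.
move: (u0 n); case: (u n) => [r||]//; rewrite !lee_fin sub0r normrN => r0.
by rewrite ger0_norm.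
Qed.

Lemma cvge0_near (u : T -> \bar R) (e : R) : 0 < e -> u n @[n --> F] --> 0%E ->
  \forall n \near F, (u n <= e%:E)%E.
Proof.
move=> e0 /fine_cvgP[ff /(@cvgrPdist_le _ _ _ F) /(_ e e0) he].
near=> n.
have f1 : u n \is a fin_num by near: n.
rewrite -(fineK f1) lee_fin; apply: le_trans (ler_norm _) _.
have : `|0 - (fine \o u) n| <= e by near: n.
by rewrite sub0r normrN.
Unshelve. all: by end_near. Qed.

End cvge0.

Section translation.
Context {R : realType} {d : nat}.
Implicit Types (B V : set 'rV[R]_d) (h : 'rV[R]_d).

Definition shift_gap B h : \bar R := (\int[leb d]_z (`|\1_B (z - h) - \1_B z|)%:E)%E.

Lemma measurable_indic_comp d' (T : measurableType d') B (g : T -> 'rV[R]_d) : measurable B ->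
  measurable_fun setT g -> measurable_fun setT (fun t => \1_B (g t) : R).
Proof. by move=> mB mg; apply: measurableT_comp mg; exact: measurable_indic. Qed.

Lemma measurable_shift_gap B h : measurable B ->
  measurable_fun setT (fun z : 'rV[R]_d => (`|\1_B (z - h) - \1_B z|)%:E : \bar R).
Proof.
move=> mB; apply/measurable_EFinP; apply: measurableT_comp => //; apply: measurable_funB.
  by apply: measurable_indic_comp => //; meas.
exact: measurable_indic.
Qed.

Lemma shift_gap_ge0 B h : (0 <= shift_gap B h)%E.
Proof. by apply: integral_ge0 => z _; rewrite lee_fin. Qed.

Lemma indic01 (T : Type) (A : set T) (x : T) : 0 <= (\1_A x : R) <= 1.
Proof. by rewrite indicE; case: (_ \in _); rewrite /= ?lexx ler01. Qed.

Let escape V (q : nat -> 'rV[R]_d) : open V -> bounded_set V -> q n @[n --> \oo] --> (0 : 'rV[R]_d) ->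
  (\int[leb d]_z (\1_V z * (1 - \1_V (z - q n)))%:E)%E @[n --> \oo] --> 0%E.
Proof.
move=> oV bV q0; have mV : measurable V by exact: sub_sigma_algebra.
have V0 z : 0 <= (\1_V z : R) <= 1 := indic01 V z.
rewrite -[X in _ --> X](_ : (\int[leb d]_z (cst 0 z))%E = 0%E); last exact: integral0.
apply: (@dominated_cvg _ _ _ (leb d) setT _ _ _ (fun x => (\1_V x)%:E)) => //.
- move=> n; apply/measurable_EFinP; apply: measurable_funM; first exact: measurable_indic.
  by apply: measurable_funB => //; apply: measurable_indic_comp => //; meas.
- move=> z _; apply: cvg_near_cst; have [zV|zV] := boolP (z \in V); last first.
    by apply: nearW => n; rewrite indicE (negbTE zV) mul0r.
  have zq : z - q n @[n --> \oo] --> z.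
    by rewrite -[X in _ --> X]subr0; apply: cvgB => //; exact: cvg_cst.
  have : \forall n \near \oo, V (z - q n).
    by apply: zq; apply: open_nbhs_nbhs; split => //; rewrite inE in zV.
  by apply: filterS => n Vn; rewrite [X in 1 - X]indicE mem_set//= subrr mulr0.
- apply/integrableP; split; first by apply/measurable_EFinP; exact: measurable_indic.
  under eq_integral => z _ do rewrite gee0_abs ?lee_fin ?(andP (V0 z)).1//.
  by rewrite integral_indic// setIT; apply: leb_bounded_fin.
- move=> n z _; have /andP[a0 a1] := V0 z; have /andP[b0 b1] := V0 (z - q n).
  by rewrite lee_fin ger0_norm ?mulr_ge0 ?subr_ge0// ler_piMr// gerBl.
Qed.

Lemma shift_gap_open V (q : nat -> 'rV[R]_d) : open V -> bounded_set V ->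
  q n @[n --> \oo] --> (0 : 'rV[R]_d) -> shift_gap V (q n) @[n --> \oo] --> 0%E.
Proof.
move=> oV bV q0; have mV : measurable V by exact: sub_sigma_algebra.
have V0 z : 0 <= (\1_V z : R) <= 1 := indic01 V z.
have E n : shift_gap V (q n) = (\int[leb d]_z (\1_V z * (1 - \1_V (z - q n)))%:E +
    \int[leb d]_z (\1_V z * (1 - \1_V (z - (- q n))))%:E)%E.
  have m1 w : measurable_fun setT (fun z => (\1_V z * (1 - \1_V (z - w)))%:E : \bar R).
    apply/measurable_EFinP; apply: measurable_funM; first exact: measurable_indic.
    by apply: measurable_funB => //; apply: measurable_indic_comp => //; meas.
  have p w (z : 'rV[R]_d) : (0 <= (\1_V z * (1 - \1_V (z - w)))%:E :> \bar R)%E.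
    have /andP[a0 a1] := V0 z; have /andP[b0 b1] := V0 (z - w).
    by rewrite lee_fin mulr_ge0// subr_ge0.
  rewrite [X in (_ + X)%E](@integral_leb_shift _ _ (- q n))//.
  rewrite -ge0_integralD//; last first.
    by apply: (measurableT_comp (m1 (- q n))); meas.
  apply: eq_integral => z _; rewrite opprK subrK -EFinD; congr EFin.
  rewrite !indicE; case: (_ \in V); case: (_ \in V) => /=;
    by rewrite ?subrr ?subr0 ?sub0r ?normrN ?normr0 ?normr1 ?mulr0 ?mul0r ?mulr1 ?addr0 ?add0r.
rewrite (_ : (fun n => _) = (fun n => (\int[leb d]_z (\1_V z * (1 - \1_V (z - q n)))%:E +
    \int[leb d]_z (\1_V z * (1 - \1_V (z - (- q n))))%:E)%E)); last exact/funext.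
rewrite -[X in _ --> X]adde0; apply: cvgeD => //; first exact: escape.
by apply: (@escape V (fun n => - q n)) => //; rewrite -[X in _ --> X]oppr0; apply: cvgN.
Qed.

Lemma shift_gapD B B' h : measurable B -> measurable B' ->
  forall C, measurable C -> (forall z, (\1_C z : R) = \1_B z - \1_B' z) \/ (forall z, (\1_C z : R) = \1_B z + \1_B' z) ->
  (shift_gap C h <= shift_gap B h + shift_gap B' h)%E.
Proof.
move=> mB mB' C mC hC; rewrite -ge0_integralD//; try exact: measurable_shift_gap.
apply: ge0_le_integral => //; first exact: measurable_shift_gap.
- by apply: emeasurable_funD; exact: measurable_shift_gap.
- move=> z _; rewrite -EFinD lee_fin; case: hC => hC; rewrite !hC.
    by rewrite (_ : _ - _ = (\1_B (z - h) - \1_B z) - (\1_B' (z - h) - \1_B' z)) ?ler_normB//; ring.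
  by rewrite (_ : _ - _ = (\1_B (z - h) - \1_B z) + (\1_B' (z - h) - \1_B' z)) ?ler_normD//; ring.
Qed.

Lemma shift_gap_le B h : measurable B -> (shift_gap B h <= 2%:E * leb d B)%E.
Proof.
move=> mB; have V0 z : 0 <= (\1_B z : R) <= 1 := indic01 B z.
have m1 : measurable_fun setT (fun z => (\1_B z)%:E : \bar R).
  by apply/measurable_EFinP; exact: measurable_indic.
have m2 : measurable_fun setT (fun z : 'rV[R]_d => (\1_B (z - h))%:E : \bar R).
  by apply: (measurableT_comp m1); meas.
have p z : (0 <= (\1_B z)%:E :> \bar R)%E by rewrite lee_fin; have /andP[] := V0 z.
have -> : (2%:E * leb d B = \int[leb d]_z ((\1_B (z - h))%:E + (\1_B z)%:E))%E.
  rewrite ge0_integralD// -(@integral_leb_shift _ _ (- h) (fun z => (\1_B z)%:E))//.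
  by rewrite integral_indic// setIT (_ : 2%:E = (1%:E + 1%:E)%E)// ge0_muleDl ?mul1e// lee_fin.
apply: ge0_le_integral => //; first exact: measurable_shift_gap.
  exact: emeasurable_funD.
move=> z _; rewrite -EFinD lee_fin; have /andP[a0 a1] := V0 z; have /andP[b0 b1] := V0 (z - h).
by rewrite ler_norml; lra.
Qed.

(** Dynkin class argument inside a large ball [Q]: open sets are handled by dominated
    convergence, complements and finite disjoint unions by the triangle inequality, and
    the tail of a countable union has small measure. *)
Lemma shift_gap_cvg B (q : nat -> 'rV[R]_d) : bounded_borel B -> q n @[n --> \oo] --> (0 : 'rV[R]_d) ->
  shift_gap B (q n) @[n --> \oo] --> 0%E.
Proof.
move=> [mB bB] q0; have [r r0 Br] := bounded_sqn bB.
pose Q : set 'rV[R]_d := [set z | sqn z < r + 1].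
have oQ : open Q.
  rewrite (_ : Q = (@sqn R d) @^-1` [set x | x < r + 1]); last by [].
  by apply: open_comp => [x _|]; [exact: continuous_sqn|exact: open_lt].
have bQ : bounded_set Q.
  exists (r + 1); split => [|M rM z]; first exact: num_real.
  move=> /= Qz; apply: le_trans (norm_le_enorm z) _.
  rewrite -(ler_pXn2r (n := 2)) ?nnegrE ?enorm_ge0//; last by lra.
  by rewrite enorm2; apply: le_trans (ltW Qz) _; rewrite expr2; nra.
have mQ : measurable Q by exact: sub_sigma_algebra.
pose P (S : set 'rV[R]_d) := shift_gap (S `&` Q) (q n) @[n --> \oo] --> 0%E.
suff : P B.
  by rewrite /P (_ : B `&` Q = B)//; apply/setIidl => z /Br; rewrite /Q/=; lra.
have bI S : bounded_set (S `&` Q).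
  by move: bQ => [M [Mr hM]]; exists M; split=> // N MN z [_ Qz]; exact: (hM N MN z Qz).
have finQ S : measurable S -> (leb d (S `&` Q) < +oo)%E.
  move=> mS; apply: leb_bounded_fin; split; [exact: measurableI|exact: bI].
suff key : forall S, <<s @open 'rV[R]_d >> S -> P S by exact: key.
have D := @dynkin_induction _ 'rV[R]_d (@open 'rV[R]_d) P erefl.
apply: D.
- by move=> U V; exact: openI.
- by rewrite /P setTI; exact: shift_gap_open.
- move=> U oU; rewrite /P; apply: shift_gap_open => //; exact: openI.
- move=> S mS PS; rewrite /P.
  have sq := shift_gap_open oQ bQ q0.
  apply: (@squeeze_cvge _ _ _ _ (fun=> 0%E) _ (fun n => shift_gap Q (q n) + shift_gap (S `&` Q) (q n))%E).
  + apply: nearW => n; rewrite shift_gap_ge0/=.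
    apply: shift_gapD => //; [exact: measurableI| |left => z].
      by apply: measurableI => //; exact: measurableC.
    rewrite !indicE !in_setI in_setC; case: (z \in S); case: (z \in Q) => /=;
      by rewrite ?subrr ?subr0.
  + exact: cvg_cst.
  + by rewrite -[X in _ --> X]adde0; apply: cvgeD.
- move=> F mF tF PF; rewrite /P.
  (* The first [m] sets of the sequence, and the others. *)
  pose U m := \bigcup_(k in [set k | (k < m)%N]) F k.
  pose V m := \bigcup_(k in [set k | (m <= k)%N]) F k.
  have mU m : measurable (U m) by apply: bigcup_measurable.
  have mV m : measurable (V m) by apply: bigcup_measurable.
  have mUF : measurable (\bigcup_k F k) by exact: bigcup_measurable.
  have PU m : P (U m).
    elim: m => [|m IH].
      rewrite /P (_ : U 0%N `&` Q = set0); last by rewrite /U (_ : [set k | (k < 0)%N] = set0) ?bigcup_set0 ?set0I//; apply/seteqP; split.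
      apply: cvg_near_cst; apply: nearW => n; rewrite /shift_gap.
      by under eq_integral do rewrite !indic0 subrr normr0; rewrite integral0.
    apply: (@squeeze_cvge _ _ _ _ (fun=> 0%E) _ (fun n => shift_gap (U m `&` Q) (q n) + shift_gap (F m `&` Q) (q n))%E).
    + apply: nearW => n; rewrite shift_gap_ge0/=.
      apply: shift_gapD; [exact: measurableI|exact: measurableI|exact: measurableI|right => z].
      rewrite !indicE !in_setI.
      have -> : (z \in U m.+1) = (z \in U m) || (z \in F m).
        apply/idP/orP; rewrite !inE.
        * move=> [k /= km Fk]; move: km; rewrite ltnS leq_eqVlt => /predU1P[km|km]; [right; rewrite -km//|left].
          by exists k.
        * move=> [[k /= km Fk]|Fm]; first by exists k => //=; exact: ltnW.
          by exists m => /=.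
      have [zU|zU] := boolP (z \in U m); have [zF|zF] := boolP (z \in F m) => /=; rewrite ?addr0 ?add0r//.
      exfalso; move: zU zF; rewrite !inE => -[k /= km Fk] Fm.
      have := tF k m I I (ex_intro _ z (conj Fk Fm)).
      by move=> E; rewrite E ltnn in km.
    + exact: cvg_cst.
    + by rewrite -[X in _ --> X]adde0; apply: cvgeD => //; exact: PF.
  have tail : leb d (V m `&` Q) @[m --> \oo] --> 0%E.
    rewrite -[X in _ --> X](_ : leb d (\bigcap_m (V m `&` Q)) = 0%E); last first.
      rewrite (_ : \bigcap_m _ = set0) ?measure0//; apply/seteqP; split => // z /= h.
      have [[k _ Fk] _] := h 0%N I; have [[k' /= kk' Fk'] _] := h k.+1 I.
      have := tF k k' I I (ex_intro _ z (conj Fk Fk')).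
      by move=> E; rewrite E ltnn in kk'.
    apply: (@nonincreasing_cvg_mu _ _ _ (leb d) (fun m => V m `&` Q)).
    - exact: finQ.
    - by move=> m; exact: measurableI.
    - by apply: bigcap_measurable => // m _; exact: measurableI.
    - move=> m n mn; apply/subsetPset => z [[k /= nk Fk] Qz]; split => //.
      by exists k => //=; exact: leq_trans nk.
  apply: cvge0_le => [n|e e0]; first exact: shift_gap_ge0.
  have e4 : 0 < e / 4 by rewrite divr_gt0.
  have [m _ hm] := cvge0_near _ e4 tail.
  have e2 : 0 < e / 2 by rewrite divr_gt0.
  near=> n.
  have hn : (shift_gap (U m `&` Q) (q n) <= (e / 2)%:E)%E.
    by near: n; exact: (@cvge0_near R nat \oo _ (fun n => shift_gap (U m `&` Q) (q n)) _ e2 (PU m)).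
  apply: (@le_trans _ _ (shift_gap (U m `&` Q) (q n) + shift_gap (V m `&` Q) (q n))%E).
    apply: shift_gapD; [exact: measurableI|exact: measurableI|exact: measurableI|right => z].
    rewrite !indicE !in_setI.
    have -> : (z \in \bigcup_k F k) = (z \in U m) || (z \in V m).
      apply/idP/orP; rewrite !inE.
        move=> [k _ Fk]; have [km|km] := ltnP k m; [left|right]; by exists k.
      by move=> [[k _ Fk]|[k _ Fk]]; exists k.
    have [zU|zU] := boolP (z \in U m); have [zF|zF] := boolP (z \in V m) => /=; rewrite ?addr0 ?add0r//.
    exfalso; move: zU zF; rewrite !inE => -[k /= km Fk] [k' /= k'm Fm].
    have := tF k k' I I (ex_intro _ z (conj Fk Fm)).
    by move=> E; rewrite E ltnNge k'm in km.
  have -> : e%:E = ((e / 2)%:E + 2%:E * (e / 4)%:E)%E by rewrite -EFinM -EFinD; congr EFin; field.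
  apply: leeD => //; apply: le_trans (shift_gap_le _ (measurableI _ _ (mV m) mQ)) _.
  by rewrite lee_pmul2l//; exact: (hm m (leqnn m)).
Unshelve. all: by end_near. Qed.

End translation.

(** * Tempered measures tested on Gaussians *)

Section tempered_measures.
Context {R : realType} {d : nat} (mu : {measure set 'rV[R]_d -> \bar R}).
Hypothesis hmu : tempered_measure mu.

Lemma tempered_gauss_fin (e : R) : 0 < e -> (\int[mu]_xi (gaussd e 0 xi)%:E < +oo)%E.
Proof.
move=> e0; have [l [l0 lfin]] := hmu.
pose k := (Num.truncn l).+1; have lk : l <= k%:R by rewrite ltW// truncnS_gt.
have [M hM] := @weight_gaussd_bounded R d e 0 k e0.
have M0 : 0 <= M by apply: le_trans (hM 0); rewrite mulr_ge0 ?weight_ge0 ?gaussd_ge0.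
have m1 : measurable_fun setT (fun xi : 'rV[R]_d => ((1 + enorm xi ^+ 2) `^ (- l))%:E).
  by meas.
apply: (@le_lt_trans _ _ (M%:E * \int[mu]_xi ((1 + enorm xi ^+ 2) `^ (- l))%:E)%E); last first.
  by rewrite lte_mul_pinfty ?lee_fin ?ltry// ge0_fin_numE ?ltry//; apply: integral_ge0.
have p1 (xi : 'rV[R]_d) : [set: 'rV[R]_d] xi -> (0 <= ((1 + enorm xi ^+ 2) `^ (- l))%:E)%E by rewrite lee_fin powR_ge0.
have m2 : measurable_fun setT (fun xi : 'rV[R]_d => (gaussd e 0 xi)%:E).
  by apply/measurable_EFinP; apply: measurable_gaussd; meas.
rewrite -ge0_integralZl//; try by move=> xi _; exact: p1.
apply: ge0_le_integral => //; try exact: (measurable_funeM M%:E m1).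
- by move=> xi _; rewrite lee_fin gaussd_ge0.
move=> xi _; rewrite -EFinM lee_fin enorm2.
have s1 : 1 <= 1 + sqn xi by rewrite lerDl sqn_ge0.
have s0 : 0 < 1 + sqn xi by exact: lt_le_trans s1.
rewrite powRN ler_pdivlMr ?powR_gt0// mulrC; apply: le_trans (hM xi).
apply: ler_wpM2r; first exact: gaussd_ge0.
by rewrite /weight -powR_mulrn; [exact: ler_powR|exact: ltW].
Qed.

Lemma tempered_gauss_integrable (e : R) : 0 < e ->
  mu.-integrable setT (fun xi => (gaussd e 0 xi)%:E).
Proof.
move=> e0; apply/integrableP; split.
  by apply/measurable_EFinP; apply: measurable_gaussd; meas.
under eq_integral => xi _ do rewrite gee0_abs ?lee_fin ?gaussd_ge0//.
exact: tempered_gauss_fin.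
Qed.

Lemma tempered_sigma_finite : sigma_finite setT mu.
Proof.
exists (fun n => [set xi | sqn (xi - 0) <= n%:R]).
  apply/seteqP; split => // xi _; exists (Num.truncn (sqn (xi - 0))).+1 => //=.
  by rewrite ltW// truncnS_gt.
move=> n; split; first exact: measurable_eball.
have mN : measurable [set xi : 'rV[R]_d | sqn (xi - 0) <= n%:R] by exact: measurable_eball.
rewrite -[X in mu X]setIT -integral_indic//.
apply: (@le_lt_trans _ _ (\int[mu]_xi ((expR n%:R)%:E * (gaussd 1 0 xi)%:E))%E); last first.
  rewrite ge0_integralZl//; try by rewrite lee_fin expR_ge0.
  - rewrite lte_mul_pinfty ?lee_fin ?expR_ge0//; exact: tempered_gauss_fin.
  - by apply/measurable_EFinP; apply: measurable_gaussd; meas.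
  - by move=> xi _; rewrite lee_fin gaussd_ge0.
have m2 : measurable_fun setT (fun xi : 'rV[R]_d => (gaussd 1 0 xi)%:E).
  by apply/measurable_EFinP; apply: measurable_gaussd; meas.
apply: ge0_le_integral => //; try solve [exact: (measurable_funeM (expR n%:R)%:E m2)
 |by apply/measurable_EFinP; exact: measurable_indic
 |by move=> xi _; rewrite -EFinM lee_fin; apply: mulr_ge0; [exact: expR_ge0|exact: gaussd_ge0]].
move=> xi _; rewrite -EFinM lee_fin indicE; have [|] := boolP (xi \in _); last first.
  by move=> _; apply: mulr_ge0; [exact: expR_ge0|exact: gaussd_ge0].
by rewrite inE /= /gaussd => xn; rewrite -expRD -[leLHS]expR0 ler_expR; lra.
Qed.

(** The measure [mu] itself, recorded with its sigma-finiteness as Tonelli requires. *)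
Definition tempered_sf of tempered_measure mu : set 'rV[R]_d -> \bar R := mu.

HB.instance Definition _ (h : tempered_measure mu) := isMeasure.Build _ _ _ (tempered_sf h)
  (measure0 mu) (measure_ge0 mu) (@measure_semi_sigma_additive _ _ _ mu).

HB.instance Definition _ (h : tempered_measure mu) :=
  Measure_isSigmaFinite.Build _ _ _ (tempered_sf h) tempered_sigma_finite.

End tempered_measures.

Section gaussian_tests.
Context {R : realType} {d : nat}.
Implicit Types (w x xi : 'rV[R]_d).

Lemma bounded_gaussd_integrable (mu : {measure set 'rV[R]_d -> \bar R}) (g : 'rV[R]_d -> R) (M a : R) w :
  measurable_fun setT g -> (forall x, `|g x| <= M) ->
  mu.-integrable setT (fun x => (gaussd a w x)%:E) ->
  mu.-integrable setT (fun x => (g x * gaussd a w x)%:E).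
Proof.
move=> mg gM iG.
have I1 : mu.-integrable setT (fun x => (M * gaussd a w x)%:E).
  by under eq_fun do rewrite EFinM; apply: integrableZl.
apply: le_integrable I1 => //.
- by apply/measurable_EFinP; apply: measurable_funM => //; apply: measurable_gaussd; meas.
- move=> x _; rewrite lee_fin !normrM ler_wpM2r// (le_trans (gM x))// ler_norm//.
Qed.

Lemma Rintegral_cos_gaussd (a : R) w xi (th : R) : 0 < a ->
  (\int[leb d]_x (cos (dotp x xi + th) * gaussd a w x) =
   gauss_mass d a * (expR (- (sqn xi / (4 * a))) * cos (dotp w xi + th)))%R.
Proof.
move=> a0; have IG := integrable_gaussd w a0.
have Ic : (leb d).-integrable setT (EFin \o (fun x => cos (dotp x xi + th) * gaussd a w x)).
  apply: (@bounded_gaussd_integrable _ _ 1) => //; first by meas.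
  by move=> x; exact: norm_cos_le1.
have := @integral_cos_gaussd R d a w xi th 1 1 a0; rewrite normr1 lexx => /(_ isT).
have -> : (\int[leb d]_x ((1 + 1 * cos (dotp x xi + th)) * gaussd a w x)%:E =
  \int[leb d]_x (gaussd a w x)%:E + \int[leb d]_x (cos (dotp x xi + th) * gaussd a w x)%:E)%E.
  rewrite -integralD//; apply: eq_integral => x _; rewrite -EFinD; congr EFin; ring.
rewrite integral_gaussd// /Rintegral.
have := integrable_fin_num measurableT Ic; rewrite /=.
move: (\int[leb d]_x _)%E => -[r||]// _ [E] /=.
by move: E; rewrite mulrDr mulr1 mul1r => /addrI.
Qed.

Lemma fourier_gaussd (a : R) w xi : 0 < a ->
  fourier (fun x => (gaussd a w x)%:C%C) xi =
  Complex (gauss_mass d a * (expR (- (sqn xi / (4 * a))) * cos (dotp w xi)))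
    (- (gauss_mass d a * (expR (- (sqn xi / (4 * a))) * sin (dotp w xi)))).
Proof.
move=> a0; rewrite /fourier /cintegral; congr Complex.
  transitivity (\int[leb d]_x (cos (dotp x xi + 0) * gaussd a w x))%R.
    by apply: eq_Rintegral => x _ /=; rewrite cosN (dotpC xi) addr0; ring.
  by rewrite Rintegral_cos_gaussd// addr0.
transitivity (\int[leb d]_x (cos (dotp x xi + pi / 2) * gaussd a w x))%R.
  by apply: eq_Rintegral => x _ /=; rewrite sinN (dotpC xi) cosDpihalf; ring.
by rewrite Rintegral_cos_gaussd// cosDpihalf; ring.
Qed.

Section spectral.
Variables (mu : {measure set 'rV[R]_d -> \bar R}) (f : 'rV[R]_d -> R).
Hypothesis hmu : tempered_measure mu.
Hypothesis hf : distr_is_function (distr_fourier (distr_of_measure mu)) (fun x => (f x)%:C%C).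

Lemma damping_gaussd (a : R) xi : expR (- (sqn xi / (4 * a))) = gaussd (1 / (4 * a)) 0 xi.
Proof. by rewrite /gaussd subr0; congr expR; ring. Qed.

Lemma damped_integrable (a : R) (g : 'rV[R]_d -> R) (M : R) : 0 < a -> measurable_fun setT g ->
  (forall x, `|g x| <= M) ->
  mu.-integrable setT (fun xi => (g xi * expR (- (sqn xi / (4 * a))))%:E).
Proof.
move=> a0 mg gM; under eq_fun do rewrite damping_gaussd.
apply: (@bounded_gaussd_integrable _ _ M) => //.
by apply: tempered_gauss_integrable => //; rewrite divr_gt0// mulr_gt0.
Qed.

Lemma gauss_test_integrable (a : R) w : 0 < a ->
  (leb d).-integrable setT (fun x => (f x * gaussd a w x)%:E).
Proof.
move=> a0; have [[iR _] _] := hf (schwartz_gaussd w a0).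
by move: iR; rewrite /= (_ : (fun x => _) = (fun x => (f x * gaussd a w x)%:E))//;
  apply/funext => x /=; congr EFin; ring.
Qed.

(** The defining relation between [f] and [mu], applied to a translated Gaussian; real
    parts. *)
Lemma gauss_test (a : R) w : 0 < a ->
  ((gauss_mass d a)%:E * \int[mu]_xi (cos (dotp w xi) * expR (- (sqn xi / (4 * a))))%:E =
   \int[leb d]_x (f x * gaussd a w x)%:E)%E.
Proof.
move=> a0; have [_ E] := hf (schwartz_gaussd w a0).
have Ic : mu.-integrable setT (fun xi => (cos (dotp w xi) * expR (- (sqn xi / (4 * a))))%:E).
  by apply: (@damped_integrable _ _ 1) => //; [meas|move=> x; exact: norm_cos_le1].
have If := gauss_test_integrable w a0.
move: E; rewrite /distr_fourier /distr_of_measure => /(congr1 (@complex.Re R)) /=.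
have -> : (\int[leb d]_x (f x * gaussd a w x - 0 * 0) = \int[leb d]_x (f x * gaussd a w x))%R.
  by apply: eq_Rintegral => x _; rewrite mul0r subr0.
have -> : (\int[mu]_x complex.Re (fourier (fun x0 => ((gaussd a w x0)%:C)%C) x) =
  \int[mu]_xi (gauss_mass d a * (cos (dotp w xi) * expR (- (sqn xi / (4 * a))))))%R.
  by apply: eq_Rintegral => xi _; rewrite fourier_gaussd//= [cos _ * _]mulrC.
rewrite RintegralZl// /Rintegral => E.
have f1 := integrable_fin_num measurableT Ic; have f2 := integrable_fin_num measurableT If.
by rewrite -(fineK f1) -(fineK f2) -EFinM; congr EFin.
Qed.

End spectral.
End gaussian_tests.

(** * Transforms and overlaps of bounded sets *)

Section real_integrands.
Context d (T : measurableType d) (R : realType) (m : {measure set T -> \bar R}).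

Lemma le_integral_real (f g : T -> R) : measurable_fun setT f -> measurable_fun setT g ->
  (forall x, 0 <= f x) -> (forall x, f x <= g x) ->
  (\int[m]_x (f x)%:E <= \int[m]_x (g x)%:E)%E.
Proof.
move=> mf mg f0 fg; apply: ge0_le_integral => //; try exact/measurable_EFinP.
- by move=> x _; rewrite lee_fin.
- by move=> x _; rewrite lee_fin fg.
Qed.

Lemma integralZl_real (f : T -> R) (k : R) : 0 <= k -> measurable_fun setT f ->
  (forall x, 0 <= f x) -> (\int[m]_x (k * f x)%:E = k%:E * \int[m]_x (f x)%:E)%E.
Proof.
move=> k0 mf f0; rewrite -ge0_integralZl//; first exact/measurable_EFinP.
by move=> x _; rewrite lee_fin.
Qed.

Lemma integralD_real (f g : T -> R) : measurable_fun setT f -> measurable_fun setT g ->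
  (forall x, 0 <= f x) -> (forall x, 0 <= g x) ->
  (\int[m]_x (f x + g x)%:E = \int[m]_x (f x)%:E + \int[m]_x (g x)%:E)%E.
Proof.
move=> mf mg f0 g0; rewrite -ge0_integralD//; try exact/measurable_EFinP.
- by move=> x _; rewrite lee_fin.
- by move=> x _; rewrite lee_fin.
Qed.

End real_integrands.

Section overlap.
Context {R : realType} {d : nat}.
Implicit Types (A B : set 'rV[R]_d) (u y z xi : 'rV[R]_d).

Lemma indic_integrable A (g : 'rV[R]_d -> R) (M : R) : bounded_borel A ->
  measurable_fun setT g -> (forall x, `|g x| <= M) ->
  (leb d).-integrable setT (fun z => (\1_A z * g z)%:E).
Proof.
move=> bA mg gM; have [mA _] := bA.
have M0 : 0 <= M by apply: le_trans (gM 0).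
have mi : measurable_fun setT (fun z => (\1_A z)%:E : \bar R).
  by apply/measurable_EFinP; exact: measurable_indic.
have I1 : (leb d).-integrable setT (fun z => (\1_A z)%:E : \bar R).
  apply/integrableP; split => //.
  under eq_integral => z _ do rewrite gee0_abs ?lee_fin//.
  by rewrite integral_indic// setIT; exact: leb_bounded_fin.
have I2 : (leb d).-integrable setT (fun z => M%:E * (\1_A z)%:E)%E by exact: integrableZl.
apply: le_integrable I2 => //.
  by apply/measurable_EFinP; apply: measurable_funM => //; exact: measurable_indic.
move=> z _; rewrite -EFinM lee_fin !normrM mulrC ler_wpM2r//.
by apply: le_trans (gM z) _; exact: ler_norm.
Qed.

Definition vol A : R := fine (leb d A).
Definition cos_tr A xi : R := (\int[leb d]_z (\1_A z * cos (dotp z xi)))%R.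
Definition sin_tr A xi : R := (\int[leb d]_z (\1_A z * sin (dotp z xi)))%R.

Lemma volE A : bounded_borel A -> (leb d A = (vol A)%:E)%E.
Proof. by move=> bA; rewrite fineK// ge0_fin_numE//; exact: leb_bounded_fin. Qed.

Lemma vol_ge0 A : 0 <= vol A. Proof. exact: fine_ge0. Qed.

Lemma integral_trig A xi (a b c : R) : bounded_borel A ->
  (\int[leb d]_z (\1_A z * (a + b * cos (dotp z xi) + c * sin (dotp z xi)))%:E =
   (a * vol A + b * cos_tr A xi + c * sin_tr A xi)%:E)%E.
Proof.
move=> bA; have [mA _] := bA.
have mi : measurable_fun setT (fun z => (\1_A z)%:E : \bar R).
  by apply/measurable_EFinP; exact: measurable_indic.
have I0 : (leb d).-integrable setT (fun z => (\1_A z * 1)%:E : \bar R).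
  by apply: (@indic_integrable _ _ 1) => // x; rewrite normr1.
have I1 : (leb d).-integrable setT (EFin \o (fun z => (\1_A z * cos (dotp z xi)))).
  by apply: (@indic_integrable _ _ 1) => // [|x]; [meas|exact: norm_cos_le1].
have I2 : (leb d).-integrable setT (EFin \o (fun z => (\1_A z * sin (dotp z xi)))).
  by apply: (@indic_integrable _ _ 1) => // [|x]; [meas|exact: norm_sin_le1].
transitivity (\int[leb d]_z (a%:E * (\1_A z * 1)%:E +
  b%:E * (\1_A z * cos (dotp z xi))%:E + c%:E * (\1_A z * sin (dotp z xi))%:E))%E.
  by apply: eq_integral => z _; rewrite -!EFinM -!EFinD; congr EFin; ring.
have J0 : (leb d).-integrable setT (fun z => a%:E * (\1_A z * 1)%:E)%E by exact: integrableZl.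
have J1 : (leb d).-integrable setT (fun z => b%:E * (\1_A z * cos (dotp z xi))%:E)%E by exact: integrableZl.
have J2 : (leb d).-integrable setT (fun z => c%:E * (\1_A z * sin (dotp z xi))%:E)%E by exact: integrableZl.
rewrite integralD//; last exact: integrableD.
rewrite integralD// !integralZl//.
have -> : (\int[leb d]_z (\1_A z * 1)%:E = (vol A)%:E)%E.
  rewrite -volE//; under eq_integral do rewrite mulr1.
  by rewrite integral_indic// setIT.
rewrite -(fineK (integrable_fin_num measurableT I1)) -(fineK (integrable_fin_num measurableT I2)).
by rewrite -!EFinM -!EFinD.
Qed.

(** The real part of the transform of [A] times the conjugate of that of [B]. *)
Definition pair_tr A B xi : R := cos_tr A xi * cos_tr B xi + sin_tr A xi * sin_tr B xi.

(** The constant 1 is added to keep the integrand nonnegative. *)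
Lemma integral_cos_diff A B xi : bounded_borel A -> bounded_borel B ->
  (\int[leb d]_z \int[leb d]_z' (\1_A z * \1_B z' * (1 + cos (dotp (z - z') xi)))%:E =
   (vol A * vol B + pair_tr A B xi)%:E)%E.
Proof.
move=> bA bB; have [mA _] := bA; have [mB _] := bB.
transitivity (\int[leb d]_z (\1_A z * (vol B + cos_tr B xi * cos (dotp z xi) + sin_tr B xi * sin (dotp z xi)))%:E)%E.
  apply: eq_integral => z _.
  transitivity (\int[leb d]_z' (\1_B z' * (\1_A z + (\1_A z * cos (dotp z xi)) * cos (dotp z' xi) +
      (\1_A z * sin (dotp z xi)) * sin (dotp z' xi)))%:E)%E.
    by apply: eq_integral => z' _; congr EFin; rewrite dotpBl cosB; ring.
  by rewrite integral_trig//; congr EFin; ring.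
by rewrite integral_trig// /pair_tr; congr EFin; ring.
Qed.

Lemma measurable_cos_tr A : measurable A -> measurable_fun setT (cos_tr A).
Proof.
move=> mA; apply: (measurable_Rintegralr (leb d) (fun xi z => \1_A z * cos (dotp z xi))).
apply: measurable_funM; last by meas.
by apply: measurable_indic_comp => //; meas.
Qed.

Lemma measurable_sin_tr A : measurable A -> measurable_fun setT (sin_tr A).
Proof.
move=> mA; apply: (measurable_Rintegralr (leb d) (fun xi z => \1_A z * sin (dotp z xi))).
apply: measurable_funM; last by meas.
by apply: measurable_indic_comp => //; meas.
Qed.

Lemma measurable_pair_tr A B : measurable A -> measurable B -> measurable_fun setT (pair_tr A B).
Proof.
move=> mA mB; apply: measurable_funD; apply: measurable_funM.
- exact: measurable_cos_tr.
- exact: measurable_cos_tr.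
- exact: measurable_sin_tr.
- exact: measurable_sin_tr.
Qed.

Lemma norm_tr_le A xi : bounded_borel A -> `|cos_tr A xi| <= vol A /\ `|sin_tr A xi| <= vol A.
Proof.
move=> bA; have [mA _] := bA.
have key (g : R -> R) : (forall x, `|g x| <= 1) -> measurable_fun setT (fun z => g (dotp z xi)) ->
    `|\int[leb d]_z (\1_A z * g (dotp z xi))|%R <= vol A.
  move=> g1 mg; have I1 : (leb d).-integrable setT (EFin \o (fun z => (\1_A z * g (dotp z xi)))).
    by apply: (@indic_integrable _ _ 1).
  have I0 : (leb d).-integrable setT (EFin \o (fun z => \1_A z * 1) : _ -> \bar R).
    by apply: (@indic_integrable _ _ 1) => // x; rewrite normr1.
  have -> : vol A = (\int[leb d]_z (\1_A z * 1))%R.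
    rewrite /vol /Rintegral; congr fine; under eq_integral do rewrite mulr1.
    by rewrite integral_indic// setIT.
  apply: le_trans (le_normr_Rintegral _ I1) _ => //.
  apply: le_Rintegral => //.
    by move/integrable_abse : I1; rewrite /= .
  by move=> z _; rewrite normrM ger0_norm ?indicE// ler_wpM2l.
split; first by apply: (key cos) => [x|]; [exact: norm_cos_le1|meas].
by apply: (key sin) => [x|]; [exact: norm_sin_le1|meas].
Qed.

(** The measure of the intersection of [A] with a translate of [B]. *)
Definition overlap A B u : R := (\int[leb d]_z (\1_A z * \1_B (z - u)))%R.

Section overlap_bounded.
Variables (A B : set 'rV[R]_d).
Hypotheses (bA : bounded_borel A) (bB : bounded_borel B).

Let mA : measurable A. Proof. by case: bA. Qed.
Let mB : measurable B. Proof. by case: bB. Qed.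

Let measurable_indicB u : measurable_fun setT (fun z : 'rV[R]_d => \1_B (z - u) : R).
Proof. by apply: measurable_indic_comp => //; meas. Qed.

Lemma overlap_integrable u : (leb d).-integrable setT (fun z => (\1_A z * \1_B (z - u))%:E).
Proof.
apply: (@indic_integrable _ _ 1) => // z.
by have /andP[h1 h2] := indic01 (R := R) B (z - u); rewrite ger0_norm.
Qed.

Lemma overlapE u : (\int[leb d]_z (\1_A z * \1_B (z - u))%:E = (overlap A B u)%:E)%E.
Proof. by rewrite /overlap /Rintegral fineK//; exact: integrable_fin_num (overlap_integrable u). Qed.

Lemma overlap_ge0 u : 0 <= overlap A B u.
Proof. by apply: Rintegral_ge0 => z _; apply: mulr_ge0; rewrite indicE. Qed.

Lemma measurable_overlap : measurable_fun setT (overlap A B).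
Proof.
apply: (measurable_Rintegralr (leb d) (fun u z => \1_A z * \1_B (z - u))).
by apply: measurable_funM; apply: measurable_indic_comp => //; meas.
Qed.

Lemma overlap_le : exists2 M, 0 <= M & forall u, overlap A B u <= M * gaussd 1 0 u.
Proof.
have [_ bA'] := bA; have [_ bB'] := bB.
have a2 : 0 < 2 :> R by [].
have [M M0 hM] := indic_le_gaussd a2 bA'; have [N N0 hN] := indic_le_gaussd a2 bB'.
exists (M * N * gauss_mass d 4%:R).
  by apply: mulr_ge0; [exact: mulr_ge0|rewrite ltW// gauss_mass_gt0].
move=> u; rewrite -lee_fin -overlapE.
pose m := ((2 + 2)^-1 *: (2 *: 0 + 2 *: u) : 'rV[R]_d).
have mg : measurable_fun setT (fun z => gaussd (2 + 2) m z) by apply: measurable_gaussd; meas.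
have k0 : 0 <= M * N * gaussd 1 0 u by apply: mulr_ge0; [exact: mulr_ge0|exact: gaussd_ge0].
apply: (@le_trans _ _ (\int[leb d]_z (M * N * gaussd 1 0 u * gaussd (2 + 2) m z)%:E)%E).
  apply: le_integral_real.
  - by apply: measurable_funM => //; exact: measurable_indic.
  - exact: measurable_funM.
  - by move=> z; apply: mulr_ge0; rewrite indicE.
  move=> z.
  have -> : M * N * gaussd 1 0 u * gaussd (2 + 2) m z = (M * gaussd 2 0 z) * (N * gaussd 2 0 (z - u)).
    have -> : gaussd 2 0 (z - u) = gaussd 2 u z by rewrite /gaussd subr0.
    have E1 : gaussd 2 0 z * gaussd 2 u z = gaussd 1 0 u * gaussd (2 + 2) m z.
      have h := gaussdM 0 u z a2 a2; have e1 : 2 * 2 / (2 + 2) = 1 :> R by field.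
      by rewrite e1 in h.
    have -> : M * gaussd 2 0 z * (N * gaussd 2 u z) = M * N * (gaussd 2 0 z * gaussd 2 u z) by ring.
    by rewrite E1; ring.
  by apply: ler_pM => //; rewrite indicE.
rewrite integralZl_real// => [|z]; last exact: gaussd_ge0.
by rewrite integral_gaussd// -EFinM lee_fin (_ : 4%:R = 2 + 2); [lra|ring].
Qed.

Lemma overlap_cvg (q : nat -> 'rV[R]_d) u : q n @[n --> \oo] --> (0 : 'rV[R]_d) ->
  overlap A B (q n + u) @[n --> \oo] --> overlap A B u.
Proof.
move=> q0; have gap := shift_gap_cvg bB q0.
apply/(@cvgrPdist_le _ _ _ \oo) => e e0.
near=> n.
rewrite -lee_fin; apply: (@le_trans _ _ (shift_gap B (q n))); last first.
  by near: n; exact: (@cvge0_near R nat \oo _ (fun n => shift_gap B (q n)) _ e0 gap).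
pose F z := \1_A z * \1_B (z - u) - \1_A z * \1_B (z - (q n + u)) : R.
have IF : (leb d).-integrable setT (EFin \o F).
  rewrite (_ : EFin \o F = (fun z => (\1_A z * \1_B (z - u))%:E - (\1_A z * \1_B (z - (q n + u)))%:E)%E)//.
  by apply: integrableB => //; exact: overlap_integrable.
have -> : overlap A B u - overlap A B (q n + u) = (\int[leb d]_z F z)%R.
  by rewrite /overlap -RintegralB//; exact: overlap_integrable.
have -> : (`|\int[leb d]_z F z|%R%:E = `|\int[leb d]_z (F z)%:E|)%E.
  by rewrite /Rintegral -abse_EFin fineK//; exact: integrable_fin_num IF.
have mF : measurable_fun setT (fun z => (F z)%:E) by have /integrableP[] := IF.
apply: le_trans (le_abse_integral _ measurableT mF) _.
rewrite /shift_gap [leRHS](@integral_leb_shift _ _ (- u)); last exact: measurable_shift_gap.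
apply: ge0_le_integral => //.
- exact: measurableT_comp.
- by apply: (measurableT_comp (measurable_shift_gap (q n) mB)); meas.
move=> z _; rewrite lee_fin /F -mulrBr normrM distrC opprD (addrC (- q n)) addrA.
by rewrite ler_piMl// indicE; case: (_ \in _); rewrite ?normr1 ?normr0.
Unshelve. all: by end_near. Qed.

End overlap_bounded.
End overlap.

(** * Parseval identity for bounded sets *)

Section parseval.
Context {R : realType} {d : nat} (mu : {sigma_finite_measure set 'rV[R]_d -> \bar R})
  (f : 'rV[R]_d -> R).
Hypothesis hmu : tempered_measure mu.
Hypothesis f_ge0 : forall x, 0 <= f x.
Hypothesis mf : measurable_fun setT f.
Hypothesis hf : distr_is_function (distr_fourier (distr_of_measure mu)) (fun x => (f x)%:C%C).
Implicit Types (A B : set 'rV[R]_d) (u y z xi : 'rV[R]_d).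

Let mass := @gauss_mass R d.
Let mass_gt0 a : 0 < a -> 0 < mass a. Proof. exact: gauss_mass_gt0. Qed.

Definition damp (a : R) xi : R := expR (- (sqn xi / (4 * a))).

Lemma damp_ge0 a xi : 0 <= damp a xi. Proof. exact: expR_ge0. Qed.

Lemma measurable_damp a d' (T : measurableType d') (g : T -> 'rV[R]_d) :
  measurable_fun setT g -> measurable_fun setT (fun x => damp a (g x)).
Proof. by move=> mg; rewrite /damp; meas. Qed.

Section sets.
Variables (A B : set 'rV[R]_d).
Hypotheses (bA : bounded_borel A) (bB : bounded_borel B).

Let mA : measurable A. Proof. by case: bA. Qed.
Let mB : measurable B. Proof. by case: bB. Qed.
Let iA z : 0 <= (\1_A z : R). Proof. by rewrite indicE. Qed.
Let iB z : 0 <= (\1_B z : R). Proof. by rewrite indicE. Qed.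

(** The Gaussian mollification of the overlap function. *)
Definition kern a y : \bar R := (\int[leb d]_u (gaussd a u y / mass a * overlap A B u)%:E)%E.

Lemma kern_ge0 a y : 0 < a -> (0 <= kern a y)%E.
Proof.
move=> a0; apply: integral_ge0 => u _; rewrite lee_fin; apply: mulr_ge0; last exact: overlap_ge0.
by rewrite divr_ge0 ?gaussd_ge0// ltW// mass_gt0.
Qed.

Lemma measurable_kern a : 0 < a -> measurable_fun setT (kern a).
Proof.
move=> a0; apply: (measurable_integralr (leb d) (fun y u => (gaussd a u y / mass a * overlap A B u)%:E)).
  apply/measurable_EFinP; apply: measurable_funM.
    by apply: measurable_funM => //; apply: measurable_gaussd; meas.
  by apply: (measurableT_comp (measurable_overlap bA bB)); meas.
move=> y u; rewrite lee_fin; apply: mulr_ge0; last exact: overlap_ge0.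
by rewrite divr_ge0 ?gaussd_ge0// ltW// mass_gt0.
Qed.

Lemma kernE a y : 0 < a ->
  (\int[leb d]_z \int[leb d]_z' (\1_A z * \1_B z' * (gaussd a (z - z') y / mass a))%:E = kern a y)%E.
Proof.
move=> a0; have g0 u : 0 <= gaussd a u y / mass a.
  by rewrite divr_ge0 ?gaussd_ge0// ltW// mass_gt0.
pose F z u := (gaussd a u y / mass a * (\1_A z * \1_B (z - u)))%:E : \bar R.
transitivity (\int[leb d]_z \int[leb d]_u F z u)%E.
  apply: eq_integral => z _; rewrite (@integral_leb_reflect _ _ z); last first.
    apply/measurable_EFinP; apply: measurable_funM.
      by apply: measurable_funM => //; apply: measurable_indic_comp => //; meas.
    by apply: measurable_funM => //; apply: measurable_gaussd; meas.
  by apply: eq_integral => u _; rewrite /F subKr; congr EFin; ring.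
rewrite (integral_swap (leb d) (leb d) F); last 2 first.
- apply/measurable_EFinP; apply: measurable_funM.
    by apply: measurable_funM => //; apply: measurable_gaussd; meas.
  by apply: measurable_funM; apply: measurable_indic_comp => //; meas.
- by move=> z u; rewrite lee_fin; apply: mulr_ge0 => //; apply: mulr_ge0.
apply: eq_integral => u _; rewrite /F integralZl_real//.
- by rewrite overlapE// -EFinM.
- by apply: measurable_funM; apply: measurable_indic_comp => //; meas.
Qed.

Lemma kern_affine a y : 0 < a ->
  kern a y = (\int[leb d]_v (gaussd 1 0 v / mass 1 * overlap A B ((Num.sqrt a)^-1 *: v + y))%:E)%E.
Proof.
move=> a0; have sa : 0 < Num.sqrt a by rewrite sqrtr_gt0.
have c0 : (Num.sqrt a)^-1 != 0 by rewrite gt_eqF// invr_gt0.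
have g0 u : 0 <= gaussd a u y / mass a.
  by rewrite divr_ge0 ?gaussd_ge0// ltW// mass_gt0.
have mo : measurable_fun setT (overlap A B) by exact: measurable_overlap.
have mF : measurable_fun setT (fun u => (gaussd a u y / mass a * overlap A B u)%:E).
  apply/measurable_EFinP; apply: measurable_funM => //.
  by apply: measurable_funM => //; apply: measurable_gaussd; meas.
rewrite /kern (integral_leb_affine y c0 mF); last first.
  by move=> u; rewrite lee_fin; apply: mulr_ge0 => //; exact: overlap_ge0.
rewrite -integralZl_real; last 3 first.
- by rewrite exprn_ge0.
- by have /measurable_EFinP h := mF; apply: (measurableT_comp h); meas.
- by move=> v; apply: mulr_ge0 => //; exact: overlap_ge0.
apply: eq_integral => v _; congr EFin.
rewrite gtr0_norm ?invr_gt0// mulrA; congr (_ * _).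
have -> : gaussd a ((Num.sqrt a)^-1 *: v + y) y = gaussd 1 0 v.
  rewrite /gaussd opprD addrCA subrr addr0 sqnN subr0 sqnZ exprVn sqr_sqrtr ?ltW//.
  by congr expR; field; rewrite gt_eqF.
have -> : mass a = mass 1 * (Num.sqrt a)^-1 ^+ d.
  by rewrite /mass /gauss_mass divr1 -exprMn sqrtrM ?pi_ge0// sqrtrV// ltW.
have m1 : mass 1 != 0 by rewrite gt_eqF// mass_gt0.
have cd : (Num.sqrt a)^-1 ^+ d != 0 by rewrite expf_neq0.
by rewrite mulrCA invfM [_ ^+ d * _]mulrCA mulfV// mulr1.
Qed.

Lemma kern_cvg y : kern n.+1%:R y @[n --> \oo] --> (overlap A B y)%:E.
Proof.
have mo : measurable_fun setT (overlap A B) by exact: measurable_overlap.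
have mg : measurable_fun setT (fun v : 'rV[R]_d => gaussd 1 0 v / mass 1).
  by apply: measurable_funM => //; apply: measurable_gaussd; meas.
have g0 (v : 'rV[R]_d) : 0 <= gaussd 1 0 v / mass 1.
  by rewrite divr_ge0 ?gaussd_ge0// ltW// mass_gt0.
have g1 : (\int[leb d]_v (gaussd 1 0 v / mass 1)%:E = 1)%E.
  under eq_integral do rewrite mulrC.
  rewrite integralZl_real//; last 3 first.
  - by rewrite invr_ge0 ltW// mass_gt0.
  - by apply: measurable_gaussd; meas.
  - by move=> v; exact: gaussd_ge0.
  by rewrite integral_gaussd// -EFinM mulVf// gt_eqF// mass_gt0.
have E : (\int[leb d]_v (gaussd 1 0 v / mass 1 * overlap A B y)%:E = (overlap A B y)%:E)%E.
  under eq_integral do rewrite mulrC.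
  by rewrite integralZl_real ?g1 ?mule1//; exact: overlap_ge0.
have [M M0 hM] := overlap_le bA bB.
have hM' u : overlap A B u <= M.
  apply: le_trans (hM u) _; rewrite ler_piMr// /gaussd -[leRHS]expR0 ler_expR subr0.
  by rewrite mulN1r oppr_le0 sqn_ge0.
rewrite -E (_ : (fun n => _) = (fun n => (\int[leb d]_v (gaussd 1 0 v / mass 1 *
  overlap A B ((Num.sqrt n.+1%:R)^-1 *: v + y))%:E)%E)); last first.
  by apply/funext => n; rewrite kern_affine.
have I1 : (leb d).-integrable setT (fun v => (gaussd 1 0 v / mass 1 * M)%:E).
  rewrite (_ : (fun v => _) = (fun v => (M / mass 1)%:E * (gaussd 1 0 v)%:E)%E).
    by apply: integrableZl => //; exact: integrable_gaussd.
  by apply/funext => v; rewrite -EFinM; congr EFin; ring.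
apply: (@dominated_cvg _ _ _ (leb d) setT _ _ _ (fun v => (gaussd 1 0 v / mass 1 * M)%:E)) => //.
- move=> n; apply/measurable_EFinP; apply: measurable_funM => //.
  by apply: (measurableT_comp mo); meas.
- move=> v _; apply: cvg_EFin; first exact: nearW.
  apply: cvgM; first exact: cvg_cst.
  apply: (overlap_cvg bA bB (q := fun n => (Num.sqrt n.+1%:R)^-1 *: v)).
  rewrite -[X in _ --> X](scale0r v); apply: cvgZ; last exact: cvg_cst.
  rewrite (_ : (fun n => _) = (fun n => Num.sqrt (harmonic n))); last first.
    by apply/funext => n; rewrite /harmonic sqrtrV.
  rewrite -[X in _ --> X](@sqrtr0 R); apply: continuous_cvg; first exact: sqrt_continuous.
  exact: cvg_harmonic.
- move=> n v _; rewrite lee_fin ger0_norm; last by apply: mulr_ge0 => //; exact: overlap_ge0.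
  by rewrite ler_wpM2l.
Qed.

Lemma gauss_mass_le (a b : R) : 0 < a -> a <= b -> mass b <= mass a.
Proof.
move=> a0 ab; have b0 := lt_le_trans a0 ab.
rewrite /mass /gauss_mass lerXn2r ?nnegrE ?sqrtr_ge0// ler_wsqrtr//.
by rewrite ler_pM2l ?pi_gt0// lef_pV2.
Qed.

(** The overlap is below a multiple of a Gaussian, and Gaussians are stable under
    convolution; the bound is uniform in the width. *)
Lemma kern_le : exists2 K, 0 <= K & forall a, 1 <= a -> forall y,
  (kern a y <= (K * gaussd (1 / 2) 0 y)%:E)%E.
Proof.
have [M M0 hM] := overlap_le bA bB; exists M => // a a1 y.
have a0 : 0 < a by exact: lt_le_trans a1.
have ma := mass_gt0 a0.
have mo : measurable_fun setT (overlap A B) by exact: measurable_overlap.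
pose m := ((a + 1)^-1 *: (a *: y + 1 *: 0) : 'rV[R]_d).
pose k := M / mass a * gaussd (a * 1 / (a + 1)) y 0.
have k0 : 0 <= k.
  by apply: mulr_ge0; [rewrite divr_ge0// ltW|exact: gaussd_ge0].
have mg : measurable_fun setT (fun u => gaussd (a + 1) m u) by apply: measurable_gaussd; meas.
apply: (@le_trans _ _ (\int[leb d]_u (k * gaussd (a + 1) m u)%:E)%E).
  apply: le_integral_real.
  - apply: measurable_funM => //.
    by apply: measurable_funM => //; apply: measurable_gaussd; meas.
  - exact: measurable_funM.
  - by move=> u; apply: mulr_ge0; [rewrite divr_ge0 ?gaussd_ge0// ltW|exact: overlap_ge0].
  move=> u; have -> : k * gaussd (a + 1) m u =
      M / mass a * (gaussd (a * 1 / (a + 1)) y 0 * gaussd (a + 1) m u) by rewrite /k mulrA.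
  rewrite -(gaussdM y 0 u a0 ltr01).
  have -> : gaussd a u y = gaussd a y u by rewrite /gaussd -sqnN opprB.
  have -> : M / mass a * (gaussd a y u * gaussd 1 0 u) = gaussd a y u / mass a * (M * gaussd 1 0 u) by ring.
  by rewrite ler_wpM2l// divr_ge0 ?gaussd_ge0// ltW.
rewrite integralZl_real// => [|u]; last exact: gaussd_ge0.
have a10 : 0 < a + 1 by rewrite addr_gt0.
rewrite integral_gaussd// -EFinM lee_fin /k.
have h1 : mass (a + 1) / mass a <= 1.
  by rewrite ler_pdivrMr// mul1r gauss_mass_le// lerDl.
have h2 : gaussd (a * 1 / (a + 1)) y 0 <= gaussd (1 / 2) 0 y.
  rewrite /gaussd ler_expR sub0r sqnN subr0 !mulNr lerN2 ler_wpM2r ?sqn_ge0//.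
  by rewrite mulr1 ler_pdivlMr//; lra.
rewrite -/(mass (a + 1)).
have -> : M / mass a * gaussd (a * 1 / (a + 1)) y 0 * mass (a + 1) =
  M * (mass (a + 1) / mass a * gaussd (a * 1 / (a + 1)) y 0) by ring.
rewrite ler_wpM2l//; apply: le_trans h2; rewrite ler_piMl// gaussd_ge0//.
Qed.

Lemma damped_pair_integrable a : 0 < a ->
  mu.-integrable setT (fun xi => (damp a xi * pair_tr A B xi)%:E).
Proof.
move=> a0; under eq_fun do rewrite mulrC.
apply: (damped_integrable hmu (M := 2 * (vol A * vol B))) => //; first exact: measurable_pair_tr.
move=> xi; have [cA sA] := norm_tr_le xi bA; have [cB sB] := norm_tr_le xi bB.
apply: le_trans (ler_normD _ _) _; rewrite !normrM.
by rewrite mulr2n mulrDl !mul1r; apply: lerD; apply: ler_pM.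
Qed.

(** [gauss_test] at [z - z'], integrated over [z] in [A] and [z'] in [B]; [1 + cos]
    replaces the cosine so that Tonelli applies. *)
Lemma damped_parseval a : 0 < a ->
  (\int[mu]_xi (damp a xi * pair_tr A B xi)%:E = \int[leb d]_y ((f y)%:E * kern a y))%E.
Proof.
move=> a0; have ma := mass_gt0 a0.
have iE : mu.-integrable setT (fun xi => (damp a xi)%:E).
  rewrite (_ : (fun xi => _) = (fun xi => (1 * expR (- (sqn xi / (4 * a))))%:E)).
    by apply: (damped_integrable hmu (M := 1) (g := fun=> 1)) => // x; rewrite normr1.
  by apply/funext => xi; rewrite mul1r.
pose Ma := fine (\int[mu]_xi (damp a xi)%:E)%E.
have MaE : (\int[mu]_xi (damp a xi)%:E = Ma%:E)%E by rewrite fineK//; exact: integrable_fin_num iE.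
have Ma0 : 0 <= Ma by apply: fine_ge0; apply: integral_ge0 => xi _; rewrite lee_fin damp_ge0.
pose c xi z z' := 1 + cos (dotp (z - z') xi) : R.
have c0 xi z z' : 0 <= c xi z z' by have := cos_geN1 (dotp (z - z') xi); rewrite /c; lra.
have mc d' (T : measurableType d') (p q r : T -> 'rV[R]_d) :
  measurable_fun setT p -> measurable_fun setT q -> measurable_fun setT r ->
  measurable_fun setT (fun t => c (p t) (q t) (r t)).
  by move=> mp mq mr; rewrite /c; meas.
pose F xi z z' := (damp a xi * (\1_A z * \1_B z' * c xi z z')) : R.
have F0 xi z z' : 0 <= F xi z z' by apply: mulr_ge0; [exact: damp_ge0|apply: mulr_ge0 => //; exact: mulr_ge0].
have mF d' (T : measurableType d') (p q r : T -> 'rV[R]_d) :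
  measurable_fun setT p -> measurable_fun setT q -> measurable_fun setT r ->
  measurable_fun setT (fun t => F (p t) (q t) (r t)).
  move=> mp mq mr; apply: measurable_funM; first exact: measurable_damp.
  by apply: measurable_funM; [apply: measurable_funM; exact: measurable_indic_comp|exact: mc].
have L : (\int[mu]_xi \int[leb d]_z \int[leb d]_z' (F xi z z')%:E =
   (Ma * (vol A * vol B))%:E + \int[mu]_xi (damp a xi * pair_tr A B xi)%:E)%E.
  transitivity (\int[mu]_xi (((vol A * vol B)%:E * (damp a xi)%:E) + (damp a xi * pair_tr A B xi)%:E))%E.
    apply: eq_integral => xi _.
    transitivity ((damp a xi)%:E * \int[leb d]_z \int[leb d]_z' (\1_A z * \1_B z' * c xi z z')%:E)%E.
      have p1 z z' : 0 <= \1_A z * \1_B z' * c xi z z' by apply: mulr_ge0 => //; exact: mulr_ge0.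
      have m1 d' (T : measurableType d') (p q : T -> 'rV[R]_d) :
        measurable_fun setT p -> measurable_fun setT q ->
        measurable_fun setT (fun t => \1_A (p t) * \1_B (q t) * c xi (p t) (q t)).
        by move=> mp mq; apply: measurable_funM; [apply: measurable_funM; exact: measurable_indic_comp|apply: mc => //; meas].
      rewrite -ge0_integralZl//; last 3 first.
      - apply: (measurable_integralr (leb d) (fun z z' => (\1_A z * \1_B z' * c xi z z')%:E)) => [|z z'].
          by apply/measurable_EFinP; apply: m1; meas.
        by rewrite lee_fin.
      - by move=> z _; apply: integral_ge0 => z' _; rewrite lee_fin.
      - by rewrite lee_fin damp_ge0.
      apply: eq_integral => z _; rewrite -integralZl_real//; first exact: damp_ge0.
      by apply: (m1 _ _ (fun=> z) id); meas.
    by rewrite integral_cos_diff// -!EFinM -EFinD; congr EFin; ring.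
  rewrite integralD//; last 2 first.
  - exact: integrableZl.
  - exact: damped_pair_integrable.
  by rewrite integralZl// MaE -EFinM mulrC.
have T1 : (\int[mu]_xi \int[leb d]_z \int[leb d]_z' (F xi z z')%:E =
  \int[leb d]_z \int[leb d]_z' \int[mu]_xi (F xi z z')%:E)%E.
  rewrite (integral_swap mu (leb d) (fun xi z => \int[leb d]_z' (F xi z z')%:E))%E; last 2 first.
  - apply: (measurable_integralr (leb d) (fun (q : 'rV[R]_d * 'rV[R]_d) z' => (F q.1 q.2 z')%:E)) => [|q z'].
      by apply/measurable_EFinP; apply: mF; meas.
    by rewrite lee_fin.
  - by move=> xi z; apply: integral_ge0 => z' _; rewrite lee_fin.
  apply: eq_integral => z _.
  rewrite (integral_swap mu (leb d) (fun xi z' => (F xi z z')%:E))//.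
    by apply/measurable_EFinP; apply: mF; meas.
  by move=> xi z'; rewrite lee_fin.
pose G z z' y := (\1_A z * \1_B z' * (gaussd a (z - z') y / mass a)) * f y : R.
have G0 z z' y : 0 <= G z z' y.
  by apply: mulr_ge0 => //; apply: mulr_ge0; [exact: mulr_ge0|rewrite divr_ge0 ?gaussd_ge0// ltW].
have mG d' (T : measurableType d') (p q r : T -> 'rV[R]_d) :
  measurable_fun setT p -> measurable_fun setT q -> measurable_fun setT r ->
  measurable_fun setT (fun t => G (p t) (q t) (r t)).
  move=> mp mq mr; apply: measurable_funM; last exact: measurableT_comp mr.
  apply: measurable_funM; first by apply: measurable_funM; exact: measurable_indic_comp.
  by apply: measurable_funM => //; apply: measurable_gaussd; meas.
have inner z z' : (\int[mu]_xi (F xi z z')%:E = (\1_A z * \1_B z' * Ma)%:E + \int[leb d]_y (G z z' y)%:E)%E.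
  have Ic : mu.-integrable setT (fun xi => (cos (dotp (z - z') xi) * damp a xi)%:E).
    by apply: (damped_integrable hmu (M := 1)) => //; [meas|move=> x; exact: norm_cos_le1].
  transitivity ((\1_A z * \1_B z')%:E * (Ma%:E + (mass a)^-1%:E * \int[leb d]_y (f y * gaussd a (z - z') y)%:E))%E.
    rewrite -(gauss_test hmu hf)// muleA -EFinM mulVf ?gt_eqF// mul1e -MaE.
    rewrite -integralD//.
    rewrite (_ : (fun xi => (F xi z z')%:E) = (fun xi => ((\1_A z * \1_B z') * (damp a xi * c xi z z'))%:E)); last first.
      by apply/funext => xi; congr EFin; rewrite /F; ring.
    rewrite integralZl_real; last 3 first.
    - exact: mulr_ge0.
    - by apply: measurable_funM; [exact: measurable_damp|apply: mc; meas].
    - by move=> xi; apply: mulr_ge0; [exact: damp_ge0|exact: c0].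
    congr (_ * _)%E; apply: eq_integral => xi _; rewrite -EFinD; congr EFin; rewrite /c /damp; ring.
  have fg0 y : 0 <= f y * gaussd a (z - z') y by apply: mulr_ge0 => //; exact: gaussd_ge0.
  have mfg : measurable_fun setT (fun y => f y * gaussd a (z - z') y).
    by apply: measurable_funM => //; apply: measurable_gaussd; meas.
  rewrite -integralZl_real//; last by rewrite invr_ge0 ltW.
  rewrite ge0_muleDr ?lee_fin//; last first.
    by apply: integral_ge0 => y _; rewrite lee_fin mulr_ge0// invr_ge0 ltW.
  congr (_ + _)%E; rewrite -integralZl_real; last 3 first.
  - exact: mulr_ge0.
  - exact: measurable_funM.
  - by move=> y; rewrite mulr_ge0// invr_ge0 ltW.
  by apply: eq_integral => y _; congr EFin; rewrite /G; ring.
have mInt : measurable_fun setT (fun q : 'rV[R]_d * 'rV[R]_d => \int[leb d]_y (G q.1 q.2 y)%:E)%E.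
  apply: (measurable_integralr (leb d) (fun (q : 'rV[R]_d * 'rV[R]_d) y => (G q.1 q.2 y)%:E)) => [|q y].
    by apply/measurable_EFinP; apply: mG; meas.
  by rewrite lee_fin.
have Int0 z z' : (0 <= \int[leb d]_y (G z z' y)%:E)%E by apply: integral_ge0 => y _; rewrite lee_fin.
have Rr : (\int[leb d]_z \int[leb d]_z' \int[mu]_xi (F xi z z')%:E =
   (Ma * (vol A * vol B))%:E + \int[leb d]_z \int[leb d]_z' \int[leb d]_y (G z z' y)%:E)%E.
  have vI C : bounded_borel C -> (\int[leb d]_z (\1_C z : R)%:E = (vol C)%:E)%E.
    by move=> bC; have [mC _] := bC; rewrite integral_indic// setIT; exact: volE.
  transitivity (\int[leb d]_z ((\1_A z * (Ma * vol B))%:E + \int[leb d]_z' \int[leb d]_y (G z z' y)%:E))%E.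
    apply: eq_integral => z _; under eq_integral do rewrite inner.
    have m1 : measurable_fun setT (fun z' => (\1_A z * \1_B z' * Ma)%:E : \bar R).
      have mIB : measurable_fun setT (fun z' => \1_B z' : R) by exact: measurable_indic.
      by meas.
    have m2 : measurable_fun setT (fun z' => \int[leb d]_y (G z z' y)%:E)%E.
      by apply: (measurableT_comp mInt (g := fun z' => (z, z'))); meas.
    have p1 z' : (0 <= (\1_A z * \1_B z' * Ma)%:E :> \bar R)%E.
      by rewrite lee_fin; apply: mulr_ge0 => //; exact: mulr_ge0.
    rewrite ge0_integralD//.
    congr (_ + _)%E.
    transitivity (\int[leb d]_z' ((\1_A z * Ma) * \1_B z')%:E)%E.
      by apply: eq_integral => z' _; congr EFin; ring.
    rewrite integralZl_real//; try exact: mulr_ge0.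
    by rewrite vI// -EFinM; congr EFin; ring.
  have m1 : measurable_fun setT (fun z => (\1_A z * (Ma * vol B))%:E : \bar R).
    by apply/measurable_EFinP; apply: measurable_funM => //; exact: measurable_indic.
  have m2 : measurable_fun setT (fun z => \int[leb d]_z' \int[leb d]_y (G z z' y)%:E)%E.
    by apply: (measurable_integralr (leb d) (fun z z' => \int[leb d]_y (G z z' y)%:E)%E).
  have p1 z : (0 <= (\1_A z * (Ma * vol B))%:E :> \bar R)%E.
    by rewrite lee_fin mulr_ge0// mulr_ge0// vol_ge0.
  have p2 z : (0 <= \int[leb d]_z' \int[leb d]_y (G z z' y)%:E)%E.
    by apply: integral_ge0 => z' _; exact: Int0.
  rewrite ge0_integralD//.
  congr (_ + _)%E; under eq_integral do rewrite mulrC.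
  rewrite integralZl_real//; try by rewrite mulr_ge0// vol_ge0.
  by rewrite vI// -EFinM; congr EFin; ring.
have K : (\int[leb d]_z \int[leb d]_z' \int[leb d]_y (G z z' y)%:E = \int[leb d]_y ((f y)%:E * kern a y))%E.
  transitivity (\int[leb d]_z \int[leb d]_y \int[leb d]_z' (G z z' y)%:E)%E.
    apply: eq_integral => z _; rewrite (integral_swap (leb d) (leb d) (fun z' y => (G z z' y)%:E))//.
      by apply/measurable_EFinP; apply: mG; meas.
    by move=> *; rewrite lee_fin.
  rewrite (integral_swap (leb d) (leb d) (fun z y => \int[leb d]_z' (G z z' y)%:E))%E; last 2 first.
  - apply: (measurable_integralr (leb d) (fun (q : 'rV[R]_d * 'rV[R]_d) z' => (G q.1 z' q.2)%:E)) => [|q z'].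
      by apply/measurable_EFinP; apply: mG; meas.
    by rewrite lee_fin.
  - by move=> *; apply: integral_ge0 => z' _; rewrite lee_fin.
  apply: eq_integral => y _; rewrite -kernE//.
  pose h z z' := \1_A z * \1_B z' * (gaussd a (z - z') y / mass a) : R.
  have h0 z z' : 0 <= h z z'.
    by apply: mulr_ge0; [exact: mulr_ge0|rewrite divr_ge0 ?gaussd_ge0// ltW].
  have mh d' (T : measurableType d') (p q : T -> 'rV[R]_d) :
    measurable_fun setT p -> measurable_fun setT q ->
    measurable_fun setT (fun t => h (p t) (q t)).
    move=> mp mq; apply: measurable_funM; first by apply: measurable_funM; exact: measurable_indic_comp.
    by apply: measurable_funM => //; apply: measurable_gaussd; meas.
  rewrite -ge0_integralZl//; last 3 first.
  - apply: (measurable_integralr (leb d) (fun z z' => (h z z')%:E)) => [|z z'].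
      by apply/measurable_EFinP; apply: mh; meas.
    by rewrite lee_fin.
  - by move=> z _; apply: integral_ge0 => z' _; rewrite lee_fin; exact: h0.
  - by rewrite lee_fin.
  apply: eq_integral => z _; rewrite -integralZl_real//.
  - by apply: eq_integral => z' _; congr EFin; rewrite /G mulrC.
  - by apply: (mh _ _ (fun=> z) id); meas.
  - by move=> z'; exact: h0.
move: L; rewrite T1 Rr K => /eqP; rewrite eq_sym => /eqP E.
have := integrable_fin_num measurableT (damped_pair_integrable a0); move: E.
move: (\int[mu]_xi _)%E (\int[leb d]_y _)%E => [p||]// [q||]// [/addrI ->]//.
Qed.

End sets.
End parseval.

Lemma le_limn_einf {R : realType} (u v : (\bar R)^nat) : (forall n, (u n <= v n)%E) ->
  (limn_einf u <= limn_einf v)%E.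
Proof.
move=> uv; rewrite !limn_einf_lim; apply: lee_lim; try exact: is_cvg_einfs.
apply: nearW => n; apply: le_ereal_inf_tmp => _ [k /= nk <-].
by apply: le_trans (uv k); apply: ereal_inf_lbound; exists k.
Qed.

Lemma fatou_le d (T : measurableType d) (R : realType) (m : {measure set T -> \bar R})
  (u : nat -> T -> \bar R) (v : T -> \bar R) (c : (\bar R)^nat) (l : \bar R) :
  (forall n, measurable_fun setT (u n)) -> (forall n x, (0 <= u n x)%E) ->
  (forall x, u n x @[n --> \oo] --> v x) -> (forall n, (\int[m]_x u n x <= c n)%E) ->
  c n @[n --> \oo] --> l -> (\int[m]_x v x <= l)%E.
Proof.
move=> mu u0 uv uc cl.
have -> : (\int[m]_x v x = \int[m]_x limn_einf (u^~ x))%E.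
  by apply: eq_integral => x _; have [-> _] := cvg_limn_einf_sup (uv x).
apply: le_trans (fatou _ measurableT mu (fun n x _ => u0 n x)) _.
have [<- _] := cvg_limn_einf_sup cl; exact: le_limn_einf.
Qed.

Section parseval_sets.
Context {R : realType} {d : nat} (mu : {sigma_finite_measure set 'rV[R]_d -> \bar R})
  (f : 'rV[R]_d -> R).
Hypothesis hmu : tempered_measure mu.
Hypothesis f_ge0 : forall x, 0 <= f x.
Hypothesis mf : measurable_fun setT f.
Hypothesis hf : distr_is_function (distr_fourier (distr_of_measure mu)) (fun x => (f x)%:C%C).
Implicit Types (A B : set 'rV[R]_d) (u y z xi : 'rV[R]_d).

Lemma damp_cvg (xi : 'rV[R]_d) : damp n.+1%:R xi @[n --> \oo] --> (1 : R).
Proof.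
rewrite -[X in _ --> X](@expR0 R) /damp; apply: continuous_cvg; first exact: continuous_expR.
rewrite (_ : (fun n => _) = (fun n => - (sqn xi / 4) * harmonic n)); last first.
  by apply/funext => n; rewrite /harmonic /=; field; rewrite ?pnatr_eq0.
rewrite -[X in _ --> X](mulr0 (- (sqn xi / 4))); apply: cvgM; first exact: cvg_cst.
exact: cvg_harmonic.
Qed.

Lemma damp_le1 (a : R) (xi : 'rV[R]_d) : 0 < a -> damp a xi <= 1.
Proof.
by move=> a0; rewrite /damp -[leRHS]expR0 ler_expR oppr_le0 divr_ge0 ?sqn_ge0// mulr_ge0// ltW.
Qed.

Lemma f_overlap_integrable A B : bounded_borel A -> bounded_borel B ->
  (leb d).-integrable setT (fun y => (f y * overlap A B y)%:E).
Proof.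
move=> bA bB; have [M M0 hM] := overlap_le bA bB.
have I1 : (leb d).-integrable setT (fun y => M%:E * (f y * gaussd 1 0 y)%:E)%E.
  by apply: integrableZl => //; exact: (gauss_test_integrable hf).
apply: le_integrable I1 => //.
  by apply/measurable_EFinP; apply: measurable_funM => //; exact: measurable_overlap.
move=> y _; rewrite -EFinM lee_fin !ger0_norm.
- by rewrite mulrCA; apply: ler_wpM2l.
- by apply: mulr_ge0 => //; apply: mulr_ge0 => //; exact: gaussd_ge0.
- by apply: mulr_ge0 => //; exact: overlap_ge0.
Qed.

Lemma f_overlapE A B : bounded_borel A -> bounded_borel B ->
  (\int[leb d]_y (f y * overlap A B y)%:E =
   \int[leb d]_z \int[leb d]_z' (\1_A z * \1_B z' * f (z - z'))%:E)%E.
Proof.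
move=> bA bB; have [mA _] := bA; have [mB _] := bB.
have iA z : 0 <= (\1_A z : R) by rewrite indicE.
have iB z : 0 <= (\1_B z : R) by rewrite indicE.
pose F y z := f y * (\1_A z * \1_B (z - y)) : R.
have F0 y z : 0 <= F y z by apply: mulr_ge0 => //; exact: mulr_ge0.
transitivity (\int[leb d]_y \int[leb d]_z (F y z)%:E)%E.
  apply: eq_integral => y _.
  have m1 : measurable_fun setT (fun z => \1_A z * \1_B (z - y) : R).
    by apply: measurable_funM; apply: measurable_indic_comp => //; meas.
  have p1 z : 0 <= \1_A z * \1_B (z - y) by exact: mulr_ge0.
  by rewrite integralZl_real// overlapE.
rewrite (integral_swap (leb d) (leb d) (fun y z => (F y z)%:E)); last 2 first.
- apply/measurable_EFinP; apply: measurable_funM; first by apply: (measurableT_comp mf); meas.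
  by apply: measurable_funM; apply: measurable_indic_comp => //; meas.
- by move=> *; rewrite lee_fin.
apply: eq_integral => z _; rewrite (@integral_leb_reflect _ _ z).
  by apply: eq_integral => y _; rewrite /F subKr; congr EFin; ring.
apply/measurable_EFinP; apply: measurable_funM.
  by apply: measurable_funM => //; apply: measurable_indic_comp => //; meas.
by apply: (measurableT_comp mf); meas.
Qed.

Lemma f_kern_cvg A B : bounded_borel A -> bounded_borel B ->
  (\int[leb d]_y ((f y)%:E * kern A B n.+1%:R y))%E @[n --> \oo] -->
  (\int[leb d]_y (f y * overlap A B y)%:E)%E.
Proof.
move=> bA bB; have [K K0 hK] := kern_le bA bB.
have I1 : (leb d).-integrable setT (fun y => K%:E * (f y * gaussd (1 / 2) 0 y)%:E)%E.
  by apply: integrableZl => //; apply: (gauss_test_integrable hf); rewrite divr_gt0.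
apply: (@dominated_cvg _ _ _ (leb d) setT _ _ _ (fun y => K%:E * (f y * gaussd (1 / 2) 0 y)%:E)%E) => //.
- move=> n; apply: emeasurable_funM; first exact/measurable_EFinP.
  exact: measurable_kern.
- move=> y _; rewrite EFinM; by apply: cvgeZl => //; exact: kern_cvg.
- move=> n y _; rewrite gee0_abs; last by rewrite mule_ge0 ?lee_fin ?kern_ge0.
  rewrite -EFinM mulrCA EFinM; apply: lee_wpmul2l; first by rewrite lee_fin.
  by apply: hK; rewrite ler1n.
Qed.

Lemma pair_tr_ge0 A xi : 0 <= pair_tr A A xi.
Proof. by rewrite /pair_tr -!expr2 addr_ge0// sqr_ge0. Qed.

(** For [A = B] the damped integrands are nonnegative: Fatou as the damping disappears. *)
Lemma pair_tr_diag_integrable A : bounded_borel A ->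
  mu.-integrable setT (fun xi => (pair_tr A A xi)%:E).
Proof.
move=> bA; have [mA _] := bA; have mp := measurable_pair_tr mA mA.
apply/integrableP; split; first exact/measurable_EFinP.
under eq_integral => xi _ do rewrite gee0_abs ?lee_fin ?pair_tr_ge0//.
apply: (@le_lt_trans _ _ (\int[leb d]_y (f y * overlap A A y)%:E)%E).
  apply: (@fatou_le _ _ _ mu (fun n xi => (damp n.+1%:R xi * pair_tr A A xi)%:E) _
    (fun n => \int[leb d]_y ((f y)%:E * kern A A n.+1%:R y))%E).
  - by move=> n; apply/measurable_EFinP; apply: measurable_funM => //; apply: measurable_damp; meas.
  - by move=> n xi; rewrite lee_fin mulr_ge0 ?damp_ge0 ?pair_tr_ge0.
  - move=> xi; apply: cvg_EFin; first exact: nearW.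
    rewrite -[X in _ --> X](mul1r (pair_tr A A xi)); apply: cvgM; last exact: cvg_cst.
    exact: damp_cvg.
  - by move=> n; rewrite (damped_parseval hmu f_ge0 mf hf).
  - exact: f_kern_cvg.
have := integrable_fin_num measurableT (f_overlap_integrable bA bA).
by rewrite fin_numE => /andP[_]; rewrite ltey.
Qed.

(** The diagonal case dominates, since [2 |x y| <= x^2 + y^2]; both sides of the damped
    identity then converge. *)
Lemma parseval_sets A B : bounded_borel A -> bounded_borel B ->
  mu.-integrable setT (fun xi => (pair_tr A B xi)%:E) /\
  (\int[mu]_xi (pair_tr A B xi)%:E =
   \int[leb d]_z \int[leb d]_z' (\1_A z * \1_B z' * f (z - z'))%:E)%E.
Proof.
move=> bA bB; have [mA _] := bA; have [mB _] := bB.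
have mp := measurable_pair_tr mA mB.
have IA := pair_tr_diag_integrable bA; have IB := pair_tr_diag_integrable bB.
have dom xi : `|pair_tr A B xi| <= pair_tr A A xi + pair_tr B B xi.
  rewrite /pair_tr; set a := cos_tr A xi; set b := cos_tr B xi.
  set a' := sin_tr A xi; set b' := sin_tr B xi.
  rewrite ler_norml; apply/andP; split.
    have := sqr_ge0 (a + b); have := sqr_ge0 (a' + b'); have := sqr_ge0 a; have := sqr_ge0 b.
    have := sqr_ge0 a'; have := sqr_ge0 b'; nra.
  have := sqr_ge0 (a - b); have := sqr_ge0 (a' - b'); have := sqr_ge0 a; have := sqr_ge0 b.
  have := sqr_ge0 a'; have := sqr_ge0 b'; nra.
have Isum : mu.-integrable setT (fun xi => (pair_tr A A xi)%:E + (pair_tr B B xi)%:E)%E.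
  exact: integrableD.
have I : mu.-integrable setT (fun xi => (pair_tr A B xi)%:E).
  apply: le_integrable Isum => //; first exact/measurable_EFinP.
  move=> xi _; rewrite -EFinD lee_fin (le_trans (dom xi))// ler_norm//.
split=> //; rewrite -f_overlapE//.
have c1 : (\int[mu]_xi (damp n.+1%:R xi * pair_tr A B xi)%:E)%E @[n --> \oo] -->
    (\int[mu]_xi (pair_tr A B xi)%:E)%E.
  apply: (@dominated_cvg _ _ _ mu setT _ _ _ (fun xi => `|(pair_tr A B xi)%:E|%E)) => //.
  - by move=> n; apply/measurable_EFinP; apply: measurable_funM => //; apply: measurable_damp; meas.
  - move=> xi _; apply: cvg_EFin; first exact: nearW.
    rewrite -[X in _ --> X](mul1r (pair_tr A B xi)); apply: cvgM; last exact: cvg_cst.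
    exact: damp_cvg.
  - exact: integrable_abse.
  - by move=> n xi _; rewrite lee_fin normrM ler_piMl// ger0_norm ?damp_ge0// damp_le1.
have c2 := f_kern_cvg bA bB.
rewrite (_ : (fun n => _) = (fun n => \int[mu]_xi (damp n.+1%:R xi * pair_tr A B xi)%:E)%E) in c2.
  by have := cvg_unique _ c1 c2; apply.
by apply/funext => n; rewrite (damped_parseval hmu f_ge0 mf hf).
Qed.

Lemma integral_set_pair A B (g : 'rV[R]_d -> R) :
  (\int[leb d]_(x in A) \int[leb d]_(y in B) (g (x - y))%:E =
   \int[leb d]_z \int[leb d]_z' (\1_A z * \1_B z' * g (z - z'))%:E)%E.
Proof.
rewrite integral_mkcond; apply: eq_integral => z _; rewrite patchE indicE.
case: ifPn => zA /=; last first.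
  by under eq_integral do rewrite !mul0r; rewrite integral0.
rewrite integral_mkcond; apply: eq_integral => z' _; rewrite patchE indicE.
by case: ifPn => _ /=; rewrite mul1r ?mul1r ?mul0r.
Qed.

End parseval_sets.

(** * The norm of simple functions *)

Section step_energy.
Context {R : realType} (H : R).
Notation leb1 := (@lebesgue_measure R).
Hypothesis hH : 1 / 2 < H < 1.

Definition steps n (c t : 'I_n -> R) (u : R) : R :=
  \sum_j c j * \1_(`[0, t j]%classic) u.

Lemma measurable_itv_indic (t : R) : measurable_fun setT (fun u : R => \1_(`[0, t]%classic) u : R).
Proof. exact: measurable_indic. Qed.

Lemma measurable_steps n (c t : 'I_n -> R) : measurable_fun setT (steps c t).
Proof.
rewrite /steps; apply: measurable_sum => j; apply: measurable_funM => //.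
Qed.

Lemma tame_steps n (c t : 'I_n -> R) (b : R) : (forall j, t j <= b) ->
  tame b (\sum_j `|c j|) (steps c t).
Proof.
move=> tb; split; first exact: measurable_steps.
- move=> u; apply: le_trans (ler_norm_sum _ _ _) _; apply: ler_sum => j _.
  by rewrite normrM ler_piMr// indicE; case: (_ \in _); rewrite ?normr1 ?normr0.
- move=> u bu; apply: big1 => j _; rewrite indicE memNset ?mulr0//= in_itv/=.
  move=> /andP[u0 ut]; move: bu; rewrite ger0_norm// => bu.
  by have := le_lt_trans (le_trans ut (tb j)) bu; rewrite ltxx.
Qed.

(** The energy is the quadratic form of the kernel, which is [RH] on indicators. *)
Lemma energy_steps n (c t : 'I_n -> R) : (forall j, 0 <= t j) ->
  energy H (steps c t) = (\sum_j \sum_k c j * c k * RH H (t j) (t k))%:E.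
Proof.
move=> t0; pose b := \sum_j t j.
have b0 : 0 <= b by apply: sumr_ge0.
have tb j : t j <= b by rewrite /b (bigD1 j)//= lerDl; apply: sumr_ge0.
rewrite (energy_kernel hH b0 (tame_steps c tb)).
pose F (p : 'I_n * 'I_n) (q : R * R) : \bar R := ((c p.1 * c p.2)%:E *
  (time_kernel H q.1 q.2 * (\1_(`[0, t p.1]%classic) q.1 * \1_(`[0, t p.2]%classic) q.2))%:E)%E.
have mK (p : 'I_n * 'I_n) : measurable_fun setT (fun q : R * R => (time_kernel H q.1 q.2 * (\1_(`[0, t p.1]%classic) q.1 * \1_(`[0, t p.2]%classic) q.2))).
  apply: measurable_funM; first exact: measurable_time_kernel.
  by apply: measurable_funM; apply: (measurableT_comp (measurable_itv_indic _)); meas.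
have K0 (p : 'I_n * 'I_n) (u v : R) : 0 <= time_kernel H u v * (\1_(`[0, t p.1]%classic) u * \1_(`[0, t p.2]%classic) v).
  by apply: mulr_ge0; [exact: time_kernel_ge0|apply: mulr_ge0; rewrite indicE].
have KE (p : 'I_n * 'I_n) : (\int[leb1 \x leb1]_q (time_kernel H q.1 q.2 * (\1_(`[0, t p.1]%classic) q.1 * \1_(`[0, t p.2]%classic) q.2))%:E = (RH H (t p.1) (t p.2))%:E)%E.
  rewrite (integral_prod_measure leb1 leb1 (fun u v => (time_kernel H u v * (\1_(`[0, t p.1]%classic) u * \1_(`[0, t p.2]%classic) v))%:E)).
  - exact: integral_kernel_indic.
  - by apply/measurable_EFinP; exact: mK.
  - by move=> u v; rewrite lee_fin.
have IK (p : 'I_n * 'I_n) : (leb1 \x leb1)%E.-integrable setT (fun q : R * R => (time_kernel H q.1 q.2 * (\1_(`[0, t p.1]%classic) q.1 * \1_(`[0, t p.2]%classic) q.2))%:E).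
  apply/integrableP; split; first by apply/measurable_EFinP; exact: mK.
  under eq_integral => q _ do rewrite gee0_abs ?lee_fin//.
  by rewrite KE ltry.
have IF p : (leb1 \x leb1)%E.-integrable setT (F p) by apply: integrableZl.
transitivity (\int[leb1 \x leb1]_q (\sum_(p : 'I_n * 'I_n) F p q))%E.
  apply: eq_integral => q _; rewrite /F; under eq_bigr do rewrite -EFinM.
  rewrite sumEFin; congr EFin; rewrite /steps big_distrlr /= mulr_sumr.
  rewrite -(pair_big predT predT (fun i j => c i * c j * (time_kernel H q.1 q.2 *
    (\1_(`[0, t i]%classic) q.1 * \1_(`[0, t j]%classic) q.2)))) /=.
  by apply: eq_bigr => i _; rewrite mulr_sumr; apply: eq_bigr => j _; ring.
rewrite integral_sum//; under eq_bigr => p _ do rewrite /F integralZl// KE -EFinM.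
rewrite sumEFin; congr EFin.
by rewrite -(pair_big predT predT (fun i j => c i * c j * RH H (t i) (t j))).
Qed.
End step_energy.

Section elementary_fourier.
Context {R : realType} {d : nat}.
Implicit Types (e : @elementary R d) (xi y : 'rV[R]_d) (s : R).

Lemma Rintegral_sum d' (T : measurableType d') (m : {measure set T -> \bar R}) (I : Type)
  (r : seq I) (F : I -> T -> R) : (forall i, m.-integrable setT (EFin \o F i)) ->
  (\int[m]_x \sum_(i <- r) F i x)%R = \sum_(i <- r) (\int[m]_x F i x)%R.
Proof.
move=> IF; rewrite /Rintegral.
under eq_integral => x _ do rewrite -sumEFin.
rewrite (@integral_sum _ _ _ m setT measurableT _ (fun i x => (F i x)%:E))//.
under eq_bigr => i _ do rewrite -(fineK (integrable_fin_num measurableT (IF i))).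
by rewrite sumEFin.
Qed.

Lemma el_fourierE e s xi : el_fourier e s xi =
  Complex (steps (fun j => el_coef j * cos_tr (el_set j) xi) (@el_time _ _ e) s)
    (- steps (fun j => el_coef j * sin_tr (el_set j) xi) (@el_time _ _ e) s).
Proof.
pose k (j : 'I_(el_size e)) : R := el_coef j * \1_(`[0, el_time j]%classic) s.
have I (g : R -> R) j : (forall x, `|g x| <= 1) -> measurable_fun setT (fun z : 'rV[R]_d => g (dotp z xi)) ->
    (leb d).-integrable setT (EFin \o (fun z => \1_(@el_set _ _ e j) z * g (dotp z xi))).
  by move=> g1 mg; apply: (@indic_integrable _ _ _ _ 1) => //; exact: el_set_bounded_borel.
have key (g : R -> R) : (forall x, `|g x| <= 1) -> measurable_fun setT (fun z : 'rV[R]_d => g (dotp z xi)) ->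
   (\int[leb d]_z (el_fun e s z * g (dotp z xi)) =
    \sum_j k j * \int[leb d]_z (\1_(@el_set _ _ e j) z * g (dotp z xi)))%R.
  move=> g1 mg.
  transitivity (\int[leb d]_z \sum_j (k j * (\1_(@el_set _ _ e j) z * g (dotp z xi))))%R.
    apply: eq_Rintegral => z _; rewrite /el_fun mulr_suml; apply: eq_bigr => j _; rewrite /k; ring.
  rewrite Rintegral_sum => [|j]; last exact: (integrableZl measurableT (k j) (I g j g1 mg)).
  by apply: eq_bigr => j _; rewrite RintegralZl//; exact: I.
rewrite /el_fourier /fourier /cintegral; congr Complex.
- transitivity (\int[leb d]_z (el_fun e s z * cos (dotp z xi)))%R.
    by apply: eq_Rintegral => z _ /=; rewrite cosN (dotpC xi); ring.
  rewrite key => [|x|]; [|exact: norm_cos_le1|by meas].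
  by apply: eq_bigr => j _; rewrite /k /cos_tr; ring.
- transitivity (\int[leb d]_z (-1 * (el_fun e s z * sin (dotp z xi))))%R.
    by apply: eq_Rintegral => z _ /=; rewrite sinN (dotpC xi); ring.
  rewrite RintegralZl//; last first.
    rewrite (_ : EFin \o _ = (fun z => \sum_j ((k j * (\1_(@el_set _ _ e j) z * sin (dotp z xi)))%:E))).
      apply: integrable_sum => // j _.
      exact: (integrableZl measurableT (k j) (I _ j norm_sin_le1 (measurable_sin_comp (measurable_dotp (@measurable_id _ _ setT) (measurable_cst xi))))).
    apply/funext => z; rewrite /= sumEFin; congr EFin; rewrite /el_fun mulr_suml.
    by apply: eq_bigr => j _; rewrite /k; ring.
  rewrite key => [|x|]; [|exact: norm_sin_le1|by meas].
  by rewrite mulN1r; congr (- _); apply: eq_bigr => j _; rewrite /k /sin_tr; ring.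
Qed.

Definition el_bound e : R := \sum_j @el_time _ _ e j.

Lemma el_bound_ge0 e : 0 <= el_bound e.
Proof. by apply: sumr_ge0 => j _; exact: el_time_ge0. Qed.

Lemma el_time_le e j : @el_time _ _ e j <= el_bound e.
Proof.
by rewrite /el_bound (bigD1 j)//= lerDl; apply: sumr_ge0 => i _; exact: el_time_ge0.
Qed.

Lemma admissible_el e : admissible (el_bound e) (el_fourier e).
Proof.
have mS (g : 'I_(el_size e) -> 'rV[R]_d -> R) : (forall j, measurable_fun setT (g j)) ->
   measurable_fun setT (fun p : R * 'rV[R]_d => steps (fun j => g j p.2) (@el_time _ _ e) p.1).
  move=> mg; apply: measurable_sum => j; apply: measurable_funM.
    by apply: (measurableT_comp (mg j)); meas.
  by apply: (measurableT_comp (measurable_itv_indic _)); meas.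
have mA j : measurable (@el_set _ _ e j) by have [] := @el_set_bounded_borel _ _ e j.
split; first split.
- under eq_fun do rewrite el_fourierE /=.
  by apply: (mS (fun j xi => el_coef j * cos_tr (el_set j) xi)) => j; apply: measurable_funM => //; exact: measurable_cos_tr.
- under eq_fun do rewrite el_fourierE /=.
  apply: measurable_funN.
  by apply: (mS (fun j xi => el_coef j * sin_tr (el_set j) xi)) => j; apply: measurable_funM => //; exact: measurable_sin_tr.
- move=> xi; eexists => s; rewrite el_fourierE; apply: le_trans (normc_le _ _) _.
  rewrite normrN; apply: lerD.
    by have [_ h _] := tame_steps (fun j => el_coef j * cos_tr (el_set j) xi) (@el_time_le e); exact: h.
  by have [_ h _] := tame_steps (fun j => el_coef j * sin_tr (el_set j) xi) (@el_time_le e); exact: h.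
- move=> s xi bs; rewrite el_fourierE.
  have [_ _ ->//] := tame_steps (fun j => el_coef j * cos_tr (el_set j) xi) (@el_time_le e).
  by have [_ _ ->//] := tame_steps (fun j => el_coef j * sin_tr (el_set j) xi) (@el_time_le e); rewrite oppr0.
Qed.

Lemma cenergy_el (H : R) (hH : 1 / 2 < H < 1) e xi :
  cenergy H ((el_fourier e)^~ xi) =
  (\sum_j \sum_k (@el_coef _ _ e j * @el_coef _ _ e k * RH H (el_time j) (el_time k)) *
     pair_tr (el_set j) (el_set k) xi)%:E.
Proof.
have t0 := @el_time_ge0 _ _ e.
rewrite /cenergy.
have -> : (fun u => complex.Re (el_fourier e u xi)) = steps (fun j => el_coef j * cos_tr (el_set j) xi) (@el_time _ _ e).
  by apply/funext => u; rewrite el_fourierE.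
have -> : (fun u => complex.Im (el_fourier e u xi)) = (fun u => - steps (fun j => el_coef j * sin_tr (el_set j) xi) (@el_time _ _ e) u).
  by apply/funext => u; rewrite el_fourierE.
have -> : energy H (fun u => - steps (fun j => el_coef j * sin_tr (el_set j) xi) (@el_time _ _ e) u) =
   energy H (steps (fun j => el_coef j * sin_tr (el_set j) xi) (@el_time _ _ e)).
  have := energyZ hH (-1) (tame_steps (fun j => el_coef j * sin_tr (el_set j) xi) (@el_time_le e)).
  rewrite sqrrN expr1n mul1e => <-; congr (energy H _).
  by apply/funext => u; rewrite mulN1r.
rewrite !energy_steps// -EFinD; congr EFin; rewrite -big_split; apply: eq_bigr => j _ /=.
rewrite -big_split; apply: eq_bigr => k _ /=; rewrite /pair_tr; ring.
Qed.

Section norm.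
Variables (mu : {measure set 'rV[R]_d -> \bar R}) (f : 'rV[R]_d -> R) (H : R).
Hypothesis hH : 1 / 2 < H < 1.
Hypothesis hmu : tempered_measure mu.
Hypothesis f_ge0 : forall x, 0 <= f x.
Hypothesis mf : measurable_fun setT f.
Hypothesis hf : distr_is_function (distr_fourier (distr_of_measure mu)) (fun x => (f x)%:C%C).

Lemma parseval_tempered A B : bounded_borel A -> bounded_borel B ->
  mu.-integrable setT (fun xi => (pair_tr A B xi)%:E) /\
  (\int[mu]_xi (pair_tr A B xi)%:E =
   \int[leb d]_(x in A) \int[leb d]_(y in B) (f (x - y))%:E)%E.
Proof.
rewrite integral_set_pair; exact: (@parseval_sets R d (tempered_sf hmu) f hmu f_ge0 mf hf A B).
Qed.

Definition cov A B : R := fine (\int[leb d]_(x in A) \int[leb d]_(y in B) (f (x - y))%:E)%E.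

Lemma covE A B : bounded_borel A -> bounded_borel B ->
  (\int[leb d]_(x in A) \int[leb d]_(y in B) (f (x - y))%:E = (cov A B)%:E)%E.
Proof.
move=> bA bB; rewrite fineK//; have [I <-] := parseval_tempered bA bB.
exact: integrable_fin_num I.
Qed.

Definition el_norm2 e : R :=
  \sum_j \sum_k @el_coef _ _ e j * @el_coef _ _ e k * RH H (el_time j) (el_time k) *
    cov (el_set j) (el_set k).

Lemma HP_norm2_el e : HP_norm2 H mu (el_fourier e) = (el_norm2 e)%:E.
Proof.
rewrite (HP_norm2E hH mu (el_bound_ge0 e) (admissible_el e)) /xi_energy.
under eq_integral do rewrite cenergy_el//.
pose F (p : 'I_(el_size e) * 'I_(el_size e)) xi : \bar R :=
  ((@el_coef _ _ e p.1 * @el_coef _ _ e p.2 * RH H (el_time p.1) (el_time p.2))%:E *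
     (pair_tr (el_set p.1) (el_set p.2) xi)%:E)%E.
have P p q := parseval_tempered (@el_set_bounded_borel _ _ e p) (@el_set_bounded_borel _ _ e q).
have IF p : mu.-integrable setT (F p) by apply: integrableZl => //; have [] := P p.1 p.2.
transitivity (\int[mu]_xi (\sum_(p : 'I_(el_size e) * 'I_(el_size e)) F p xi))%E.
  apply: eq_integral => xi _; rewrite /F; under [RHS]eq_bigr do rewrite -EFinM.
  rewrite sumEFin; congr EFin.
  by rewrite -(pair_big predT predT (fun j k => @el_coef _ _ e j * @el_coef _ _ e k * RH H (el_time j) (el_time k) *
     pair_tr (el_set j) (el_set k) xi)).
rewrite integral_sum//.
under eq_bigr => p _.
  rewrite /F integralZl//; last by have [] := P p.1 p.2.
  have [_ ->] := P p.1 p.2; rewrite covE; [|exact: el_set_bounded_borel|exact: el_set_bounded_borel].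
  rewrite -EFinM; over.
rewrite sumEFin; congr EFin.
by rewrite -(pair_big predT predT (fun j k => @el_coef _ _ e j * @el_coef _ _ e k * RH H (el_time j) (el_time k) *
     cov (el_set j) (el_set k))).
Qed.

End norm.
End elementary_fourier.

(** * Operations on simple functions *)

Section elementary_operations.
Context {R : realType} {d : nat}.
Implicit Types (e : @elementary R d) (xi y z : 'rV[R]_d) (s t : R).

Section concatenation.
Variables e e' : @elementary R d.
Let n := el_size e.
Let n' := el_size e'.
Let pick (T : Type) (f : 'I_n -> T) (g : 'I_n' -> T) (j : 'I_(n + n')) : T :=
  match fintype.split j with inl i => f i | inr i => g i end.

Let time_ge0 j : 0 <= pick (@el_time _ _ e) (@el_time _ _ e') j.
Proof. by rewrite /pick; case: fintype.split => i; exact: el_time_ge0. Qed.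

Let set_bounded j : bounded_borel (pick (@el_set _ _ e) (@el_set _ _ e') j).
Proof. by rewrite /pick; case: fintype.split => i; exact: el_set_bounded_borel. Qed.

Definition el_cat : @elementary R d :=
  @Elementary R d (n + n') (pick (@el_coef _ _ e) (@el_coef _ _ e')) _ _ time_ge0 set_bounded.

Lemma sum_el_cat (V : nmodType) (F : R -> R -> set 'rV[R]_d -> V) :
  \sum_(j < el_size el_cat) F (el_coef j) (el_time j) (el_set j) =
  \sum_(j < el_size e) F (el_coef j) (el_time j) (el_set j) +
  \sum_(j < el_size e') F (el_coef j) (el_time j) (el_set j).
Proof.
rewrite /el_cat /= /pick big_split_ord /=; congr (_ + _); apply: eq_bigr => i _.
  by rewrite (unsplitK (inl i)).
by rewrite (unsplitK (inr i)).
Qed.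

End concatenation.

Definition el_scale (k : R) e : @elementary R d :=
  @Elementary R d (el_size e) (fun j => k * @el_coef _ _ e j) _ _ (@el_time_ge0 _ _ e) (@el_set_bounded_borel _ _ e).

(** Moves all the time intervals to [[0, t]], keeping the spatial part. *)
Definition el_retime t (t0 : 0 <= t) e : @elementary R d :=
  @Elementary R d (el_size e) (@el_coef _ _ e) (fun=> t) _ (fun=> t0) (@el_set_bounded_borel _ _ e).

Definition el_sub e e' := el_cat e (el_scale (-1) e').

(** The transforms of the spatial part of a linear combination, that is of the
    function [\sum_j c_j 1_{A_j}]. *)
Definition cos_el e xi : R := \sum_(j < el_size e) el_coef j * cos_tr (el_set j) xi.
Definition sin_el e xi : R := \sum_(j < el_size e) el_coef j * sin_tr (el_set j) xi.
Definition space_el e z : R := \sum_(j < el_size e) el_coef j * \1_(@el_set _ _ e j) z.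

Lemma cos_el_cat e e' xi : cos_el (el_cat e e') xi = cos_el e xi + cos_el e' xi.
Proof. exact: (sum_el_cat e e' (fun c t A => c * cos_tr A xi)). Qed.

Lemma sin_el_cat e e' xi : sin_el (el_cat e e') xi = sin_el e xi + sin_el e' xi.
Proof. exact: (sum_el_cat e e' (fun c t A => c * sin_tr A xi)). Qed.

Lemma space_el_cat e e' xi : space_el (el_cat e e') xi = space_el e xi + space_el e' xi.
Proof. exact: (sum_el_cat e e' (fun c t A => c * \1_A xi)). Qed.

Lemma cos_el_scale k e xi : cos_el (el_scale k e) xi = k * cos_el e xi.
Proof. by rewrite /cos_el mulr_sumr; apply: eq_bigr => j _ /=; rewrite mulrA. Qed.

Lemma sin_el_scale k e xi : sin_el (el_scale k e) xi = k * sin_el e xi.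
Proof. by rewrite /sin_el mulr_sumr; apply: eq_bigr => j _ /=; rewrite mulrA. Qed.

Lemma space_el_scale k e xi : space_el (el_scale k e) xi = k * space_el e xi.
Proof. by rewrite /space_el mulr_sumr; apply: eq_bigr => j _ /=; rewrite mulrA. Qed.

Lemma el_fourier_cat e e' s xi : el_fourier (el_cat e e') s xi = el_fourier e s xi + el_fourier e' s xi.
Proof.
rewrite !el_fourierE /steps.
have h1 := sum_el_cat e e' (fun c t A => c * cos_tr A xi * \1_(`[0, t]%classic) s).
have h2 := sum_el_cat e e' (fun c t A => c * sin_tr A xi * \1_(`[0, t]%classic) s).
rewrite h1 h2; apply/eqP; rewrite eq_complex /=; apply/andP; split => //; apply/eqP.
by rewrite opprD.
Qed.

Lemma el_fourier_scale k e s xi : el_fourier (el_scale k e) s xi = k%:C%C * el_fourier e s xi.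
Proof.
rewrite !el_fourierE /steps; apply/eqP; rewrite eq_complex /=; apply/andP; split; apply/eqP.
  by rewrite mul0r subr0 mulr_sumr; apply: eq_bigr => j _; ring.
by rewrite mul0r addr0 mulrN mulr_sumr; congr (- _); apply: eq_bigr => j _; ring.
Qed.

Lemma el_fourier_sub e e' s xi : el_fourier (el_sub e e') s xi = el_fourier e s xi - el_fourier e' s xi.
Proof.
rewrite el_fourier_cat el_fourier_scale; congr (_ + _).
by case: (el_fourier _ _ _) => a b; apply/eqP; rewrite eq_complex /=; apply/andP; split; apply/eqP; ring.
Qed.

Lemma el_fourier_retime t (t0 : 0 <= t) e s xi : el_fourier (el_retime t0 e) s xi =
  Complex (\1_(`[0, t]%classic) s * cos_el e xi) (- (\1_(`[0, t]%classic) s * sin_el e xi)).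
Proof.
rewrite !el_fourierE /steps /cos_el /sin_el !mulr_sumr; congr Complex; [|congr (- _)];
  by apply: eq_bigr => j _ /=; ring.
Qed.

Lemma measurable_cos_el e : measurable_fun setT (cos_el e).
Proof.
apply: measurable_sum => j; apply: measurable_funM => //; apply: measurable_cos_tr.
by have [] := @el_set_bounded_borel _ _ e j.
Qed.

Lemma measurable_sin_el e : measurable_fun setT (sin_el e).
Proof.
apply: measurable_sum => j; apply: measurable_funM => //; apply: measurable_sin_tr.
by have [] := @el_set_bounded_borel _ _ e j.
Qed.

Lemma measurable_space_el e : measurable_fun setT (space_el e).
Proof.
apply: measurable_sum => j; apply: measurable_funM => //; apply: measurable_indic.
by have [] := @el_set_bounded_borel _ _ e j.
Qed.

Section square_norm.
Variables (mu : {measure set 'rV[R]_d -> \bar R}) (f : 'rV[R]_d -> R).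
Hypothesis hmu : tempered_measure mu.
Hypothesis f_ge0 : forall x, 0 <= f x.
Hypothesis mf : measurable_fun setT f.
Hypothesis hf : distr_is_function (distr_fourier (distr_of_measure mu)) (fun x => (f x)%:C%C).

Definition sq_norm (g1 g2 : 'rV[R]_d -> R) : \bar R := (\int[mu]_xi (g1 xi ^+ 2 + g2 xi ^+ 2)%:E)%E.

Lemma sq_norm_ge0 g1 g2 : (0 <= sq_norm g1 g2)%E.
Proof. by apply: integral_ge0 => xi _; rewrite lee_fin addr_ge0// sqr_ge0. Qed.

(** By Parseval the left side is the double integral of the spatial part against [f], and
    [f] is nonnegative. *)
Lemma sq_norm_el_le e :
  (sq_norm (cos_el e) (sin_el e) <=
   \int[leb d]_z \int[leb d]_z' (`|space_el e z| * `|space_el e z'| * f (z - z'))%:E)%E.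
Proof.
pose F (p : 'I_(el_size e) * 'I_(el_size e)) xi : \bar R :=
  ((@el_coef _ _ e p.1 * @el_coef _ _ e p.2)%:E * (pair_tr (el_set p.1) (el_set p.2) xi)%:E)%E.
pose K (p : 'I_(el_size e) * 'I_(el_size e)) (q : 'rV[R]_d * 'rV[R]_d) : R :=
   \1_(@el_set _ _ e p.1) q.1 * \1_(@el_set _ _ e p.2) q.2 * f (q.1 - q.2).
have bS j := @el_set_bounded_borel _ _ e j.
have P p q := parseval_tempered hmu f_ge0 mf hf (bS p) (bS q).
have IF p : mu.-integrable setT (F p) by apply: integrableZl => //; have [] := P p.1 p.2.
have mfd : measurable_fun setT (fun q : 'rV[R]_d * 'rV[R]_d => f (q.1 - q.2)).
  by apply: (measurableT_comp mf); meas.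
have mK p : measurable_fun setT (K p).
  apply: measurable_funM => //.
  by apply: measurable_funM; apply: measurable_indic_comp; [have [] := bS p.1|meas|have [] := bS p.2|meas].
have K0 p q : 0 <= K p q by apply: mulr_ge0 => //; apply: mulr_ge0; rewrite indicE.
have KE p : (\int[leb d \x leb d]_q (K p q)%:E = \int[mu]_xi (pair_tr (el_set p.1) (el_set p.2) xi)%:E)%E.
  have [_ ->] := P p.1 p.2; rewrite integral_set_pair.
  rewrite -(integral_prod_measure (leb d) (leb d) (fun z z' => (K p (z, z'))%:E)).
  - by apply: eq_integral => -[z z'].
  - by apply/measurable_EFinP; apply: eq_measurable_fun (mK p) => -[].
  - by move=> z z'; rewrite lee_fin.
have IK p : (leb d \x leb d)%E.-integrable setT (fun q => (K p q)%:E).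
  apply/integrableP; split; first exact/measurable_EFinP.
  under eq_integral => q _ do rewrite gee0_abs ?lee_fin//.
  rewrite KE; have [I _] := P p.1 p.2.
  have := integrable_fin_num measurableT I; rewrite fin_numE ltey => /andP[_ ?]; by [].
pose G q := \sum_p (@el_coef _ _ e p.1 * @el_coef _ _ e p.2) * K p q.
have GE q : G q = space_el e q.1 * space_el e q.2 * f (q.1 - q.2).
  rewrite /G /space_el big_distrlr /= mulr_suml.
  rewrite -(pair_big predT predT (fun i j => @el_coef _ _ e i * @el_coef _ _ e j * K (i, j) q)) /=.
  by apply: eq_bigr => i _; rewrite mulr_suml; apply: eq_bigr => j _; rewrite /K /=; ring.
have Isum p : (leb d \x leb d)%E.-integrable setT (fun q => ((@el_coef _ _ e p.1 * @el_coef _ _ e p.2)%:E * (K p q)%:E)%E).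
  exact: integrableZl.
have IG : (leb d \x leb d)%E.-integrable setT (fun q => (G q)%:E).
  rewrite (_ : (fun q => _) = (fun q => \sum_p ((@el_coef _ _ e p.1 * @el_coef _ _ e p.2)%:E * (K p q)%:E)%E)).
    by apply: integrable_sum.
  by apply/funext => q; rewrite /G -sumEFin; apply: eq_bigr => p _; rewrite EFinM.
have -> : sq_norm (cos_el e) (sin_el e) = (\int[leb d \x leb d]_q (G q)%:E)%E.
  transitivity (\sum_p (\int[mu]_xi F p xi)%E).
    rewrite -integral_sum//; apply: eq_integral => xi _; rewrite /F; under [RHS]eq_bigr do rewrite -EFinM.
    rewrite sumEFin; congr EFin; rewrite !expr2 /cos_el /sin_el !big_distrlr /= -big_split /=.
    rewrite -(pair_big predT predT (fun j k => @el_coef _ _ e j * @el_coef _ _ e k * pair_tr (el_set j) (el_set k) xi)) /=.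
    apply: eq_bigr => i _; rewrite -big_split; apply: eq_bigr => j _ /=; rewrite /pair_tr; ring.
  transitivity (\sum_p (\int[leb d \x leb d]_q ((@el_coef _ _ e p.1 * @el_coef _ _ e p.2)%:E * (K p q)%:E))%E).
    apply: eq_bigr => p _; rewrite /F !integralZl// ?KE//.
    by have [] := P p.1 p.2.
  rewrite -integral_sum//; apply: eq_integral => q _.
  by rewrite /G -sumEFin; apply: eq_bigr => p _; rewrite EFinM.
have mabs : measurable_fun setT (fun q : 'rV[R]_d * 'rV[R]_d => `|space_el e q.1| * `|space_el e q.2| * f (q.1 - q.2)).
  have ms := measurable_space_el e.
  apply: measurable_funM => //; apply: measurable_funM.
    by apply: measurableT_comp => //; apply: (measurableT_comp ms); meas.
  by apply: measurableT_comp => //; apply: (measurableT_comp ms); meas.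
rewrite -(integral_prod_measure (leb d) (leb d) (fun z z' => (`|space_el e z| * `|space_el e z'| * f (z - z'))%:E)).
- apply: (@le_trans _ _ (`|\int[leb d \x leb d]_q (G q)%:E|)%E); first exact: lee_abs.
  apply: le_trans (le_abse_integral _ measurableT _) _.
    by have /integrableP[] := IG.
  rewrite le_eqVlt; apply/orP; left; apply/eqP; apply: eq_integral => q _.
  by rewrite /= GE !normrM (ger0_norm (f_ge0 _)).
- exact/measurable_EFinP.
- by move=> z z'; rewrite lee_fin; apply: mulr_ge0 => //; apply: mulr_ge0.
Qed.

End square_norm.
End elementary_operations.

(** * Approximation of damped characters *)

Section gaussian_approximation.
Context {R : realType} {d : nat}.
Implicit Types (e : @elementary R d) (xi y z x : 'rV[R]_d).

Lemma bounded_eball (w : 'rV[R]_d) (r : R) : bounded_set [set y | sqn (y - w) <= r].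
Proof.
pose r' := Num.max 0 r; have r0 : 0 <= r' by rewrite le_max lexx.
exists (1 + 2 * r' + 2 * sqn w); split; first exact: num_real.
move=> M rM y /= yr; apply: le_trans (norm_le_enorm y) _.
have yr' : sqn (y - w) <= r' by rewrite le_max yr orbT.
have s1 : sqn y <= 2 * r' + 2 * sqn w.
  by have := sqn_leD (y - w) w; rewrite subrK; lra.
have w0 := sqn_ge0 w.
rewrite -(ler_pXn2r (n := 2)) ?nnegrE ?enorm_ge0//; last by lra.
by rewrite enorm2; apply: le_trans s1 _; rewrite expr2; nra.
Qed.

Section approximant.
Variables (a : R) (x : 'rV[R]_d).
Hypothesis a0 : 0 < a.
Let G := gaussd a x.

Let G01 z : 0 < G z <= 1.
Proof.
rewrite gaussd_gt0 /G /gaussd -[leRHS]expR0 ler_expR mulNr oppr_le0.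
by rewrite mulr_ge0 ?sqn_ge0// ltW.
Qed.

Let mG : measurable_fun setT G. Proof. by apply: measurable_gaussd; meas. Qed.

Definition level_set (c : R) : set 'rV[R]_d := [set z | c <= gaussd a x z].

Lemma level_set_bounded_borel c : 0 < c -> bounded_borel (level_set c).
Proof.
move=> c0; split.
  rewrite -[X in measurable X]setTI (_ : level_set c = G @^-1` `[c, +oo[); first exact: mG.
  by apply/seteqP; split => z /=; rewrite in_itv/= andbT.
have [N [Nr hN]] := bounded_eball x (- ln c / a); exists N; split => // M NM z cz.
apply: (hN M NM z) => /=; rewrite ler_pdivlMr//.
move: cz; rewrite /level_set /= -[c in c <= _](@lnK _ c) ?posrE// ler_expR mulNr; lra.
Qed.

Let lvl n (k : 'I_n.+1) : R := k.+1%:R / n.+1%:R.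
Let lvl_gt0 n (k : 'I_n.+1) : 0 < lvl k. Proof. by rewrite divr_gt0. Qed.

(** The staircase of step [1 / (n + 1)] below the Gaussian: the average of the indicators
    of its upper level sets, which are bounded. *)
Definition gauss_el n : @elementary R d :=
  @Elementary R d n.+1 (fun=> n.+1%:R^-1) (fun=> 0) (fun k => level_set (lvl k))
    (fun=> lexx 0) (fun k => level_set_bounded_borel (lvl_gt0 k)).

Let count_lt (N m : nat) : (m <= N)%N -> \sum_(k < N) ((k < m)%N : nat)%:R = m%:R :> R.
Proof.
move=> mN; rewrite -natr_sum; congr (_%:R).
rewrite -[RHS]card_ord -sum1_card (big_ord_widen N (fun=> 1%N) mN) [RHS]big_mkcond /=.
by apply: eq_bigr => k _; case: ifP.
Qed.

Lemma space_gauss_el n z : space_el (gauss_el n) z <= G z /\ G z - space_el (gauss_el n) z <= n.+1%:R^-1.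
Proof.
have /andP[g0 g1] := G01 z.
pose m := Num.truncn (n.+1%:R * G z).
have N0 : 0 < n.+1%:R :> R by rewrite ltr0n.
have NG0 : 0 <= n.+1%:R * G z by rewrite mulr_ge0// ltW.
have mN : (m <= n.+1)%N.
  by rewrite truncn_le_nat; apply: (@le_lt_trans _ _ n.+1%:R); [rewrite ler_piMr|rewrite ltr_nat].
have -> : space_el (gauss_el n) z = m%:R / n.+1%:R.
  rewrite /space_el /= -(count_lt mN) mulr_suml; apply: eq_bigr => k _.
  rewrite mulrC; congr (_ * _); rewrite indicE; congr (_%:R); congr nat_of_bool.
  rewrite /m truncn_gt_nat /level_set /lvl; apply/idP/idP; rewrite inE /= ler_pdivrMr//;
    by rewrite mulrC.
have h1 : m%:R <= n.+1%:R * G z by rewrite truncn_le.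
have h2 : n.+1%:R * G z < m.+1%:R by exact: truncnS_gt.
split; first by rewrite ler_pdivrMr// mulrC.
by rewrite lerBlDr -[X in X + _]div1r -mulrDl ler_pdivlMr// mulrC addrC natr1 ltW.
Qed.

Lemma space_gauss_el_ge0 n z : 0 <= space_el (gauss_el n) z.
Proof. by apply: sumr_ge0 => k _; apply: mulr_ge0; rewrite ?invr_ge0// indicE. Qed.

Lemma space_gauss_el_cvg z : space_el (gauss_el n) z @[n --> \oo] --> G z.
Proof.
apply: (squeeze_cvgr (f := fun n => G z - n.+1%:R^-1) (h := fun=> G z)).
- by apply: nearW => n; have [-> h2] := space_gauss_el n z; move: h2; rewrite !lerBlDr addrC => ->.
- rewrite -[X in _ --> X]subr0; apply: cvgB; first exact: cvg_cst.
  exact: (@cvg_harmonic R).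
- exact: cvg_cst.
Qed.

(** Dominates the error of the staircase and decreases to 0, while staying below the
    Gaussian. *)
Definition gauss_gap n z : R := Num.min n.+1%:R^-1 (G z).

Lemma gauss_gap_ge0 n z : 0 <= gauss_gap n z.
Proof. by have /andP[g0 _] := G01 z; rewrite le_min invr_ge0 ler0n ltW. Qed.

Lemma space_gauss_gap n m z : (n <= m)%N ->
  `|space_el (gauss_el m) z - space_el (gauss_el n) z| <= gauss_gap n z.
Proof.
move=> nm; have [a1 a2] := space_gauss_el n z; have [b1 b2] := space_gauss_el m z.
have c1 := space_gauss_el_ge0 n z; have c2 := space_gauss_el_ge0 m z.
have nm' : m.+1%:R^-1 <= n.+1%:R^-1 :> R by rewrite lef_pV2 ?posrE// ler_nat.
have /andP[g0 _] := G01 z; rewrite /gauss_gap; move: a1 a2 b1 b2 c1 c2 nm'.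
set u := space_el _ _; set v := space_el _ _; move: (m.+1%:R^-1) (n.+1%:R^-1) (G z) => p q r *.
by rewrite le_min; apply/andP; split; rewrite ler_norml; apply/andP; split; lra.
Qed.

Section spectral_side.
Variables (mu : {measure set 'rV[R]_d -> \bar R}) (f : 'rV[R]_d -> R).
Hypothesis hmu : tempered_measure mu.
Hypothesis f_ge0 : forall x, 0 <= f x.
Hypothesis mf : measurable_fun setT f.
Hypothesis hf : distr_is_function (distr_fourier (distr_of_measure mu)) (fun x => (f x)%:C%C).

Let mfd d' (T : measurableType d') (p q : T -> 'rV[R]_d) : measurable_fun setT p ->
  measurable_fun setT q -> measurable_fun setT (fun t => f (p t - q t)).
Proof. by move=> mp mq; apply: (measurableT_comp mf); meas. Qed.

Let mGc d' (T : measurableType d') (p : T -> 'rV[R]_d) : measurable_fun setT p ->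
  measurable_fun setT (fun t => G (p t)).
Proof. by move=> mp; apply: measurable_gaussd; meas. Qed.

(** Integrating first with [q.1 - q.2] fixed, by completing the square, leaves a Gaussian
    test of [f]. *)
Lemma gauss_pair_integrable : (leb d \x leb d)%E.-integrable setT
  (fun q : 'rV[R]_d * 'rV[R]_d => (G q.1 * G q.2 * f (q.1 - q.2))%:E).
Proof.
have G0 z : 0 <= G z by have /andP[/ltW] := G01 z.
have mq : measurable_fun setT (fun q : 'rV[R]_d * 'rV[R]_d => G q.1 * G q.2 * f (q.1 - q.2)).
  by apply: measurable_funM; [apply: measurable_funM; apply: mGc; meas|apply: mfd; meas].
have q0 z z' : 0 <= G z * G z' * f (z - z') by apply: mulr_ge0 => //; exact: mulr_ge0.
apply/integrableP; split; first exact/measurable_EFinP.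
under eq_integral => q _ do rewrite gee0_abs ?lee_fin//.
rewrite (integral_prod_measure (leb d) (leb d) (fun z z' => (G z * G z' * f (z - z'))%:E)); last 2 first.
- exact/measurable_EFinP.
- by move=> z z'; rewrite lee_fin.
pose F z y := f y * (G z * G (z - y)) : R.
have F0 z y : 0 <= F z y by apply: mulr_ge0 => //; exact: mulr_ge0.
have -> : (\int[leb d]_z \int[leb d]_z' (G z * G z' * f (z - z'))%:E = \int[leb d]_z \int[leb d]_y (F z y)%:E)%E.
  apply: eq_integral => z _; rewrite (@integral_leb_reflect _ _ z).
    by apply: eq_integral => y _; rewrite /F subKr; congr EFin; ring.
  by apply/measurable_EFinP; apply: measurable_funM; [apply: measurable_funM => //|apply: mfd; meas].
rewrite (integral_swap (leb d) (leb d) (fun z y => (F z y)%:E)); last 2 first.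
- apply/measurable_EFinP; apply: measurable_funM; first by apply: (measurableT_comp mf); meas.
  by apply: measurable_funM; apply: mGc; meas.
- by move=> z y; rewrite lee_fin.
have aa : 0 < a + a by rewrite addr_gt0.
have E y : (\int[leb d]_z (F z y)%:E = (gauss_mass d (a + a))%:E * (f y * gaussd (a * a / (a + a)) 0 y)%:E)%E.
  pose m := ((a + a)^-1 *: (a *: x + a *: (x + y)) : 'rV[R]_d).
  transitivity (\int[leb d]_z ((f y * gaussd (a * a / (a + a)) 0 y) * gaussd (a + a) m z)%:E)%E.
    apply: eq_integral => z _; congr EFin; rewrite /F -mulrA; congr (_ * _).
    have -> : G (z - y) = gaussd a (x + y) z by rewrite /G /gaussd opprD addrA addrAC.
    rewrite /G gaussdM//; congr (_ * _); rewrite /gaussd subr0; congr expR; congr (_ * sqn _).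
    by rewrite addrC addKr.
  rewrite integralZl_real.
  - by rewrite integral_gaussd// muleC.
  - by apply: mulr_ge0 => //; exact: gaussd_ge0.
  - by apply: measurable_gaussd; meas.
  - by move=> z; exact: gaussd_ge0.
under eq_integral do rewrite E.
have I : (leb d).-integrable setT (fun y => (f y * gaussd (a * a / (a + a)) 0 y)%:E).
  by apply: (gauss_test_integrable hf); rewrite divr_gt0// mulr_gt0.
rewrite integralZl//; have := integrable_fin_num measurableT I.
by case: (\int[leb d]_y _)%E => // r _; rewrite -EFinM ltry.
Qed.

Definition gap_energy n : \bar R :=
  (\int[leb d \x leb d]_q (gauss_gap n q.1 * gauss_gap n q.2 * f (q.1 - q.2))%:E)%E.

Let measurable_gapc n d' (T : measurableType d') (p : T -> 'rV[R]_d) : measurable_fun setT p ->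
  measurable_fun setT (fun t => gauss_gap n (p t)).
Proof. by move=> mp; apply: measurable_minr => //; exact: mGc. Qed.

Let measurable_gap_pair n : measurable_fun setT
  (fun q : 'rV[R]_d * 'rV[R]_d => gauss_gap n q.1 * gauss_gap n q.2 * f (q.1 - q.2)).
Proof.
by apply: measurable_funM; [apply: measurable_funM; apply: measurable_gapc; meas|apply: mfd; meas].
Qed.

Lemma gap_energy_cvg : gap_energy n @[n --> \oo] --> 0%E.
Proof.
have G0 z : 0 <= G z by have /andP[/ltW] := G01 z.
have g0 := gauss_gap_ge0.
rewrite -[X in _ --> X](_ : (\int[leb d \x leb d]_q (cst 0 q))%E = 0%E); last exact: integral0.
apply: (@dominated_cvg _ _ _ (leb d \x leb d)%E setT measurableT _ _
  (fun q : 'rV[R]_d * 'rV[R]_d => (G q.1 * G q.2 * f (q.1 - q.2))%:E)) => //.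
- by move=> n; exact/measurable_EFinP.
- move=> q _; apply: cvg_EFin; first exact: nearW.
  have c z : gauss_gap n z @[n --> \oo] --> (0 : R).
    apply: (squeeze_cvgr (f := fun=> 0) (h := fun n => n.+1%:R^-1)).
    - by apply: nearW => n; rewrite g0/= /gauss_gap ge_min lexx.
    - exact: cvg_cst.
    - exact: (@cvg_harmonic R).
  rewrite -[X in _ --> X](mul0r (f (q.1 - q.2))); apply: cvgM; last exact: cvg_cst.
  by rewrite -[X in _ --> X](mul0r (0 : R)); apply: cvgM.
- exact: gauss_pair_integrable.
- move=> n q _; rewrite lee_fin ger0_norm; last by apply: mulr_ge0 => //; exact: mulr_ge0.
  by rewrite ler_wpM2r// ler_pM// /gauss_gap ge_min lexx orbT.
Qed.

Lemma sq_norm_gauss_sub n m : (n <= m)%N ->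
  (sq_norm mu (fun xi => cos_el (gauss_el m) xi - cos_el (gauss_el n) xi)%R
     (fun xi => sin_el (gauss_el m) xi - sin_el (gauss_el n) xi)%R <= gap_energy n)%E.
Proof.
move=> nm; pose e := el_sub (gauss_el m) (gauss_el n).
have -> : (fun xi => cos_el (gauss_el m) xi - cos_el (gauss_el n) xi) = cos_el e.
  by apply/funext => xi; rewrite cos_el_cat cos_el_scale mulN1r.
have -> : (fun xi => sin_el (gauss_el m) xi - sin_el (gauss_el n) xi) = sin_el e.
  by apply/funext => xi; rewrite sin_el_cat sin_el_scale mulN1r.
apply: le_trans (sq_norm_el_le hmu f_ge0 mf hf e) _.
have ms := measurable_space_el e.
rewrite -(integral_prod_measure (leb d) (leb d) (fun z z' => (`|space_el e z| * `|space_el e z'| * f (z - z'))%:E)); last 2 first.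
- apply/measurable_EFinP; apply: measurable_funM; last by apply: mfd; meas.
  by apply: measurable_funM; apply: measurableT_comp => //; apply: (measurableT_comp ms); meas.
- by move=> z z'; rewrite lee_fin; apply: mulr_ge0 => //; exact: mulr_ge0.
apply: le_integral_real => //.
- apply: measurable_funM; last by apply: mfd; meas.
  by apply: measurable_funM; apply: measurableT_comp => //; apply: (measurableT_comp ms); meas.
- by move=> q; apply: mulr_ge0 => //; exact: mulr_ge0.
have h z : `|space_el e z| <= gauss_gap n z.
  by rewrite space_el_cat space_el_scale mulN1r; exact: space_gauss_gap.
by move=> q; rewrite ler_wpM2r// ler_pM.
Qed.

Lemma cos_elE e xi : cos_el e xi = (\int[leb d]_z (space_el e z * cos (dotp z xi)))%R.
Proof.
have I j : (leb d).-integrable setT (EFin \o (fun z => \1_(@el_set _ _ e j) z * cos (dotp z xi))).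
  apply: (@indic_integrable _ _ _ _ 1) => [||z]; [exact: el_set_bounded_borel|meas|exact: norm_cos_le1].
transitivity (\int[leb d]_z \sum_j (@el_coef _ _ e j * (\1_(@el_set _ _ e j) z * cos (dotp z xi))))%R.
  rewrite Rintegral_sum => [|j]; last exact: (integrableZl measurableT (el_coef j) (I j)).
  by apply: eq_bigr => j _; rewrite RintegralZl//; exact: I.
by apply: eq_Rintegral => z _; rewrite /space_el mulr_suml; apply: eq_bigr => j _; rewrite mulrA.
Qed.

Lemma sin_elE e xi : sin_el e xi = (\int[leb d]_z (space_el e z * sin (dotp z xi)))%R.
Proof.
have I j : (leb d).-integrable setT (EFin \o (fun z => \1_(@el_set _ _ e j) z * sin (dotp z xi))).
  apply: (@indic_integrable _ _ _ _ 1) => [||z]; [exact: el_set_bounded_borel|meas|exact: norm_sin_le1].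
transitivity (\int[leb d]_z \sum_j (@el_coef _ _ e j * (\1_(@el_set _ _ e j) z * sin (dotp z xi))))%R.
  rewrite Rintegral_sum => [|j]; last exact: (integrableZl measurableT (el_coef j) (I j)).
  by apply: eq_bigr => j _; rewrite RintegralZl//; exact: I.
by apply: eq_Rintegral => z _; rewrite /space_el mulr_suml; apply: eq_bigr => j _; rewrite mulrA.
Qed.

Let trig_el_cvg xi th (g : @elementary R d -> R) :
  (forall e, g e = \int[leb d]_z (space_el e z * cos (dotp z xi + th)))%R ->
  g (gauss_el n) @[n --> \oo] -->
  gauss_mass d a * (expR (- (sqn xi / (4 * a))) * cos (dotp x xi + th)).
Proof.
move=> gE; rewrite -Rintegral_cos_gaussd//.
have IG := integrable_gaussd x a0.
have I e : (leb d).-integrable setT (EFin \o (fun z => space_el e z * cos (dotp z xi + th))).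
  have J j : (leb d).-integrable setT (EFin \o (fun z => \1_(@el_set _ _ e j) z * cos (dotp z xi + th))).
    apply: (@indic_integrable _ _ _ _ 1) => [||z]; [exact: el_set_bounded_borel|meas|exact: norm_cos_le1].
  rewrite (_ : EFin \o _ = (fun z => \sum_j ((@el_coef _ _ e j * (\1_(@el_set _ _ e j) z * cos (dotp z xi + th)))%:E))).
    by apply: integrable_sum => // j _; exact: (integrableZl measurableT (el_coef j) (J j)).
  apply/funext => z; rewrite /= sumEFin; congr EFin; rewrite /space_el mulr_suml.
  by apply: eq_bigr => j _; rewrite mulrA.
have Ic : (leb d).-integrable setT (EFin \o (fun z => cos (dotp z xi + th) * gaussd a x z)).
  apply: (@bounded_gaussd_integrable _ _ _ _ 1) => //; first by meas.
  by move=> z; exact: norm_cos_le1.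
have : (\int[leb d]_z (space_el (gauss_el n) z * cos (dotp z xi + th))%:E)%E @[n --> \oo] -->
   (\int[leb d]_z (cos (dotp z xi + th) * gaussd a x z)%:E)%E.
  apply: (@dominated_cvg _ _ _ (leb d) setT _ _ _ (fun z => (gaussd a x z)%:E)) => //.
  - by move=> n; have /integrableP[] := I (gauss_el n).
  - move=> z _; apply: cvg_EFin; first exact: nearW.
    rewrite mulrC; apply: cvgM; last exact: cvg_cst.
    exact: space_gauss_el_cvg.
  - move=> n z _; rewrite lee_fin normrM.
    have [h _] := space_gauss_el n z; have h0 := space_gauss_el_ge0 n z.
    by rewrite (ger0_norm h0); apply: le_trans h; rewrite ler_piMr// norm_cos_le1.
rewrite -(fineK (integrable_fin_num measurableT Ic)) => /fine_cvgP[_].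
by apply: cvg_trans; apply: near_eq_cvg; apply: nearW => n; rewrite gE.
Qed.

(** The transforms converge pointwise and are Cauchy in square norm by
    [sq_norm_gauss_sub]; Fatou. *)
Lemma gauss_el_approx :
  sq_norm mu (fun xi => gauss_mass d a * (expR (- (sqn xi / (4 * a))) * cos (dotp x xi)) - cos_el (gauss_el n) xi)
    (fun xi => gauss_mass d a * (expR (- (sqn xi / (4 * a))) * sin (dotp x xi)) - sin_el (gauss_el n) xi) @[n --> \oo] --> 0%E.
Proof.
apply: (@squeeze_cvge _ _ _ _ (fun=> 0%E) _ gap_energy); last exact: gap_energy_cvg.
  apply: nearW => n; rewrite sq_norm_ge0/=.
  pose D m (g : @elementary R d -> 'rV[R]_d -> R) xi := g (gauss_el (m + n)) xi - g (gauss_el n) xi.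
  apply: (@fatou_le _ _ _ mu (fun m xi => (D m (@cos_el R d) xi ^+ 2 + D m (@sin_el R d) xi ^+ 2)%:E) _ (fun=> gap_energy n)).
  - move=> m; have mc := @measurable_cos_el R d; have ms := @measurable_sin_el R d.
    by apply/measurable_EFinP; apply: measurable_funD; apply: measurable_funX; apply: measurable_funB.
  - by move=> m xi; rewrite lee_fin addr_ge0// sqr_ge0.
  - move=> xi; apply: cvg_EFin; first exact: nearW.
    have key (u : nat -> R) l k : u m @[m --> \oo] --> l -> (u (m + n)%N - k) ^+ 2 @[m --> \oo] --> (l - k) ^+ 2.
      move=> ul; rewrite expr2; under eq_fun do rewrite expr2.
      have h : u (m + n)%N - k @[m --> \oo] --> l - k.
        by apply: cvgB; [rewrite (cvg_shiftn n u)|exact: cvg_cst].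
      exact: cvgM.
    apply: cvgD.
    + apply: (key (fun m => cos_el (gauss_el m) xi)).
      have := @trig_el_cvg xi 0 (fun e => cos_el e xi); rewrite addr0; apply => e.
      by rewrite cos_elE; apply: eq_Rintegral => z _; rewrite addr0.
    + apply: (key (fun m => sin_el (gauss_el m) xi)).
      have := @trig_el_cvg xi (- (pi / 2)) (fun e => sin_el e xi); rewrite -sin_cosB; apply => e.
      by rewrite sin_elE; apply: eq_Rintegral => z _; rewrite -sin_cosB.
  - by move=> m; apply: sq_norm_gauss_sub; exact: leq_addl.
  - exact: cvg_cst.
exact: cvg_cst.
Qed.

End spectral_side.
End approximant.
End gaussian_approximation.

(** * Approximation of the damped wave multiplier *)

Section exponential_bounds.
Context {R : realType}.

Lemma exp_partial_sum_le (x : R) (m : nat) : 0 <= x -> \sum_(i < m) x ^+ i / i`!%:R <= expR x.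
Proof.
move=> x0; rewrite -(big_mkord predT (fun i => x ^+ i / i`!%:R)).
have -> : \sum_(0 <= i < m) x ^+ i / i`!%:R = series (exp_coeff x) m by [].
rewrite /expR.
apply: nondecreasing_cvgn_le; last exact: is_cvg_series_exp_coeff.
apply: nondecreasing_series => i _ _.
by rewrite /exp_coeff /= divr_ge0// exprn_ge0.
Qed.

Lemma pow_fact_le (x : R) (i : nat) : 0 <= x -> x ^+ i / i`!%:R <= expR x.
Proof.
move=> x0; apply: le_trans (exp_partial_sum_le i.+1 x0).
by rewrite big_ord_recr /= lerDr; apply: sumr_ge0 => j _; rewrite divr_ge0// exprn_ge0.
Qed.

(** The binomial coefficient [(2 i + 1) choose i] is at least 1. *)
Lemma fact_square_le (i : nat) : (i`! * i`! <= (i.*2.+1)`!)%N.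
Proof.
have h : (i <= i.*2.+1)%N by rewrite -addnn leqW// leq_addr.
rewrite -(bin_fact h) -addnn -addnS addKn.
have b : (0 < 'C(i + i.+1, i))%N by rewrite bin_gt0 leq_addr.
apply: leq_trans (leq_pmull _ b); rewrite leq_mul2l factS leq_pmull ?orbT//.
Qed.

(** The partial sums of the series of [sin (t r) / r] as a function of [r ^+ 2]. *)
Definition sinc_poly (t : R) (m : nat) (y : R) : R :=
  \sum_(i < m) (-1) ^+ i * t ^+ i.*2.+1 / (i.*2.+1)`!%:R * y ^+ i.

Lemma sinc_poly_cvg (t r : R) : 0 <= r -> sinc_poly t m.+1 (r ^+ 2) @[m --> \oo] --> wave r t.
Proof.
move=> r0; rewrite /wave; case: eqP => [->|/eqP rn0].
  apply: cvg_near_cst; apply: nearW => m; rewrite /sinc_poly big_ord_recl big1 => [|i _].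
    by rewrite /= !expr0 double0 expr1 !mul1r mulr1 addr0 divr1.
  by rewrite expr0n /= expr0n mulr0.
have h := @cvg_sin_coeff' R (t * r).
have h' : series (sin_coeff' (t * r)) m.+1 @[m --> \oo] --> sin (t * r).
  by rewrite -(cvg_shiftS (fun m => series (sin_coeff' (t * r)) m)) in h.
rewrite (_ : (fun m => _) = (fun m => series (sin_coeff' (t * r)) m.+1 / r)).
  by apply: cvgM => //; exact: cvg_cst.
apply/funext => m; rewrite /series /= big_mkord mulr_suml; apply: eq_bigr => i _.
rewrite /sin_coeff' -exprnP [(t * r) ^+ _]exprMn -exprM mul2n.
have -> : r ^+ i.*2.+1 = r * r ^+ i.*2 by rewrite exprS.
by field; rewrite rn0 /= pnatr_eq0 -lt0n fact_gt0.
Qed.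

(** The coefficients of the series of the sine decrease like the squares of inverse
    factorials, so that any exponential dominates, whatever its rate [c]. *)
Lemma sinc_poly_le (t c : R) : 0 < c -> exists2 K, 0 <= K &
  forall m y, 0 <= y -> `|sinc_poly t m y| <= K * expR (c * y).
Proof.
move=> c0; pose L := t ^+ 2 / c; have L0 : 0 <= L by rewrite divr_ge0 ?sqr_ge0// ltW.
exists (`|t| * expR L); first by rewrite mulr_ge0// expR_ge0.
move=> m y y0; have cy0 : 0 <= c * y by rewrite mulr_ge0// ltW.
apply: le_trans (ler_norm_sum _ _ _) _.
have f0 i : 0 < (i`!)%:R :> R by rewrite ltr0n fact_gt0.
apply: (@le_trans _ _ (\sum_(i < m) (`|t| * expR L) * ((c * y) ^+ i / i`!%:R))).
  apply: ler_sum => i _.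
  rewrite !normrM normrX normrN1 expr1n mul1r normrX normfV (ger0_norm (ltW (f0 _))) normrX (ger0_norm y0).
  have -> : `|t| ^+ i.*2.+1 = `|t| * (t ^+ 2) ^+ i.
    by rewrite exprS -mul2n exprM real_normK ?num_real.
  have -> : `|t| * (t ^+ 2) ^+ i / (i.*2.+1)`!%:R * y ^+ i =
     `|t| * (L ^+ i * ((c * y) ^+ i / (i.*2.+1)`!%:R)).
    rewrite [L ^+ i * _]mulrA -exprMn (_ : L * (c * y) = t ^+ 2 * y) ?exprMn; first by ring.
    by rewrite /L; field; rewrite gt_eqF.
  rewrite -mulrA ler_wpM2l//.
  apply: (@le_trans _ _ (L ^+ i / i`!%:R * ((c * y) ^+ i / i`!%:R))).
    rewrite mulrACA -invfM mulrA ler_wpM2l ?mulr_ge0 ?exprn_ge0//.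
    by rewrite lef_pV2 ?posrE ?mulr_gt0// -natrM ler_nat fact_square_le.
  rewrite ler_wpM2r ?divr_ge0 ?exprn_ge0 ?(ltW (f0 i))//; exact: pow_fact_le.
rewrite -mulr_sumr ler_wpM2l ?mulr_ge0 ?expR_ge0//; exact: exp_partial_sum_le.
Qed.

Lemma pow_le_exp (c : R) (k : nat) : 0 < c -> exists2 K, 0 <= K &
  forall y, 0 <= y -> y ^+ k <= K * expR (c * y).
Proof.
move=> c0; exists (k`!%:R / c ^+ k); first by rewrite divr_ge0// exprn_ge0// ltW.
move=> y y0; have cy0 : 0 <= c * y by rewrite mulr_ge0// ltW.
have f0 : 0 < (k`!)%:R :> R by rewrite ltr0n fact_gt0.
have := pow_fact_le k cy0; rewrite ler_pdivrMr// exprMn => h.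
by rewrite -mulrA [c ^- k * _]mulrC mulrA ler_pdivlMr ?exprn_gt0// mulrC (le_trans h)// mulrC.
Qed.

(** Converges to [y], and is a combination of exponentials, which only change the damping. *)
Definition exp_slope (n : nat) (y : R) : R := n.+1%:R * (1 - expR (- (y / n.+1%:R))).

Lemma exp_slope_bounds n y : 0 <= y -> y - y ^+ 2 / n.+1%:R <= exp_slope n y <= y.
Proof.
move=> y0; have n0 : 0 < n.+1%:R :> R by [].
have yE : y = n.+1%:R * (y / n.+1%:R) by rewrite mulrC mulfVK ?gt_eqF.
set u := y / n.+1%:R in yE *; have u0 : 0 <= u by rewrite divr_ge0.
have e1 := expR_ge1Dx (- u).
have e2 : expR (- u) <= (1 + u)^-1.
  by rewrite expRN lef_pV2 ?posrE ?expR_gt0 ?expR_ge1Dx// ltr_pwDl.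
have e3 : (1 + u)^-1 <= 1 - u + u ^+ 2.
  by rewrite -[leLHS]div1r ler_pdivrMr; [have := mulr_ge0 u0 (mulr_ge0 u0 u0); nra|lra].
rewrite /exp_slope -/u; apply/andP; split; last by rewrite [leRHS]yE ler_wpM2l//; lra.
have -> : y - y ^+ 2 / n.+1%:R = n.+1%:R * (u - u ^+ 2).
  by rewrite /u; field.
by rewrite ler_wpM2l//; lra.
Qed.

Lemma exp_slope_cvg y : 0 <= y -> exp_slope n y @[n --> \oo] --> y.
Proof.
move=> y0; apply: (squeeze_cvgr (f := fun n => y - y ^+ 2 / n.+1%:R) (h := fun=> y)).
- by apply: nearW => n; exact: exp_slope_bounds.
- rewrite -[X in _ --> X]subr0; apply: cvgB; first exact: cvg_cst.
  rewrite -[X in _ --> X](mulr0 (y ^+ 2)); apply: cvgM; first exact: cvg_cst.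
  exact: (@cvg_harmonic R).
- exact: cvg_cst.
Qed.

End exponential_bounds.

Section spatial_approximation.
Context {R : realType} {d : nat}.
Variables (mu : {measure set 'rV[R]_d -> \bar R}) (f : 'rV[R]_d -> R).
Hypothesis hmu : tempered_measure mu.
Hypothesis f_ge0 : forall x, 0 <= f x.
Hypothesis mf : measurable_fun setT f.
Hypothesis hf : distr_is_function (distr_fourier (distr_of_measure mu)) (fun x => (f x)%:C%C).
Implicit Types (g h : 'rV[R]_d -> R) (xi x : 'rV[R]_d) (phi : R -> R).

Lemma sq_normD g1 g2 h1 h2 : measurable_fun setT g1 -> measurable_fun setT g2 ->
  measurable_fun setT h1 -> measurable_fun setT h2 ->
  (sq_norm mu (fun xi => g1 xi + h1 xi)%R (fun xi => g2 xi + h2 xi)%R <=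
   2%:E * sq_norm mu g1 g2 + 2%:E * sq_norm mu h1 h2)%E.
Proof.
move=> m1 m2 n1 n2.
have mg : measurable_fun setT (fun xi => g1 xi ^+ 2 + g2 xi ^+ 2) by meas.
have mh : measurable_fun setT (fun xi => h1 xi ^+ 2 + h2 xi ^+ 2) by meas.
have g0 xi : 0 <= g1 xi ^+ 2 + g2 xi ^+ 2 by rewrite addr_ge0// sqr_ge0.
have h0 xi : 0 <= h1 xi ^+ 2 + h2 xi ^+ 2 by rewrite addr_ge0// sqr_ge0.
rewrite /sq_norm -!integralZl_real// -integralD_real; last 4 first.
- exact: measurable_funM.
- exact: measurable_funM.
- by move=> xi; rewrite mulr_ge0.
- by move=> xi; rewrite mulr_ge0.
apply: le_integral_real.
- by meas.
- by meas.
- by move=> xi; rewrite addr_ge0// sqr_ge0.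
move=> xi; have := sqr_ge0 (g1 xi - h1 xi); have := sqr_ge0 (g2 xi - h2 xi); nra.
Qed.

Definition sp_approx g1 g2 : Prop :=
  [/\ measurable_fun setT g1, measurable_fun setT g2 &
  forall eps : R, 0 < eps -> exists e,
    (sq_norm mu (fun xi => g1 xi - cos_el e xi)%R (fun xi => g2 xi - sin_el e xi)%R <= eps%:E)%E].

(** Approximations are added by concatenating the simple functions. *)
Lemma sp_approxD g1 g2 h1 h2 : sp_approx g1 g2 -> sp_approx h1 h2 ->
  sp_approx (fun xi => g1 xi + h1 xi) (fun xi => g2 xi + h2 xi).
Proof.
move=> [m1 m2 ag] [n1 n2 ah]; split; [exact: measurable_funD|exact: measurable_funD|].
move=> eps e0; have e4 : 0 < eps / 4 by rewrite divr_gt0.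
have [e he] := ag _ e4; have [e' he'] := ah _ e4; exists (el_cat e e').
have mc := @measurable_cos_el R d; have ms := @measurable_sin_el R d.
have E1 : (fun xi => g1 xi + h1 xi - cos_el (el_cat e e') xi) =
  (fun xi => (g1 xi - cos_el e xi) + (h1 xi - cos_el e' xi)).
  by apply/funext => xi; rewrite cos_el_cat; ring.
have E2 : (fun xi => g2 xi + h2 xi - sin_el (el_cat e e') xi) =
  (fun xi => (g2 xi - sin_el e xi) + (h2 xi - sin_el e' xi)).
  by apply/funext => xi; rewrite sin_el_cat; ring.
rewrite E1 E2; apply: le_trans (sq_normD _ _ _ _) _; try exact: measurable_funB.
have -> : eps%:E = (2%:E * (eps / 4)%:E + 2%:E * (eps / 4)%:E)%E.
  by rewrite -EFinM -EFinD; congr EFin; field.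
by apply: leeD; rewrite lee_pmul2l.
Qed.

Lemma sp_approxZ k g1 g2 : sp_approx g1 g2 ->
  sp_approx (fun xi => k * g1 xi) (fun xi => k * g2 xi).
Proof.
move=> [m1 m2 ag]; split; [exact: measurable_funM|exact: measurable_funM|].
move=> eps e0; have k1 : 0 < k ^+ 2 + 1 by rewrite ltr_pwDr// sqr_ge0.
have [e he] := ag (eps / (k ^+ 2 + 1)) (divr_gt0 e0 k1); exists (el_scale k e).
have mc := @measurable_cos_el R d; have ms := @measurable_sin_el R d.
have -> : sq_norm mu (fun xi => k * g1 xi - cos_el (el_scale k e) xi)
   (fun xi => k * g2 xi - sin_el (el_scale k e) xi) =
  ((k ^+ 2)%:E * sq_norm mu (fun xi => g1 xi - cos_el e xi)%R (fun xi => g2 xi - sin_el e xi)%R)%E.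
  rewrite /sq_norm -integralZl_real ?sqr_ge0//.
  - apply: eq_integral => xi _; congr EFin; rewrite cos_el_scale sin_el_scale; ring.
  - by apply: measurable_funD; apply: measurable_funX; apply: measurable_funB.
  - by move=> xi; rewrite addr_ge0// sqr_ge0.
apply: le_trans (lee_wpmul2l _ he) _; first by rewrite lee_fin sqr_ge0.
by rewrite -EFinM lee_fin mulrA ler_pdivrMr//; nra.
Qed.

Lemma sp_approx_lim g1 g2 : measurable_fun setT g1 -> measurable_fun setT g2 ->
  (forall eps : R, 0 < eps -> exists h1 h2, sp_approx h1 h2 /\
     (sq_norm mu (fun xi => g1 xi - h1 xi)%R (fun xi => g2 xi - h2 xi)%R <= eps%:E)%E) ->
  sp_approx g1 g2.
Proof.
move=> m1 m2 H; split => // eps e0; have e4 : 0 < eps / 4 by rewrite divr_gt0.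
have [h1 [h2 [[n1 n2 ah] hh]]] := H _ e4; have [e he] := ah _ e4; exists e.
have mc := @measurable_cos_el R d; have ms := @measurable_sin_el R d.
have E1 : (fun xi => g1 xi - cos_el e xi) = (fun xi => (g1 xi - h1 xi) + (h1 xi - cos_el e xi)).
  by apply/funext => xi; ring.
have E2 : (fun xi => g2 xi - sin_el e xi) = (fun xi => (g2 xi - h2 xi) + (h2 xi - sin_el e xi)).
  by apply/funext => xi; ring.
rewrite E1 E2; apply: le_trans (sq_normD _ _ _ _) _; try exact: measurable_funB.
have -> : eps%:E = (2%:E * (eps / 4)%:E + 2%:E * (eps / 4)%:E)%E.
  by rewrite -EFinM -EFinD; congr EFin; field.
by apply: leeD; rewrite lee_pmul2l.
Qed.

(** [gauss_el_approx] with the width [1 / (4 b)], up to the total mass. *)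
Lemma sp_approx_gauss x (b : R) : 0 < b ->
  sp_approx (fun xi => expR (- (b * sqn xi)) * cos (dotp x xi))
            (fun xi => expR (- (b * sqn xi)) * sin (dotp x xi)).
Proof.
move=> b0; pose a := 1 / (4 * b); have a0 : 0 < a by rewrite divr_gt0// mulr_gt0.
have aE xi : sqn xi / (4 * a) = b * sqn xi.
  by rewrite /a; field; rewrite gt_eqF.
have m0 := gauss_mass_gt0 d a0.
have S : sp_approx (fun xi => gauss_mass d a * (expR (- (sqn xi / (4 * a))) * cos (dotp x xi)))
  (fun xi => gauss_mass d a * (expR (- (sqn xi / (4 * a))) * sin (dotp x xi))).
  split; [by meas|by meas|move=> eps e0].
  have := gauss_el_approx x a0 hmu f_ge0 mf hf => /(cvge0_near _ e0) [n _ hn].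
  by exists (gauss_el x a0 n); exact: (hn n (leqnn n)).
have := sp_approxZ (gauss_mass d a)^-1 S.
have E (c : 'rV[R]_d -> R) : (fun xi => (gauss_mass d a)^-1 * (gauss_mass d a * (expR (- (sqn xi / (4 * a))) * c xi))) =
   (fun xi => expR (- (b * sqn xi)) * c xi).
  by apply/funext => xi; rewrite aE mulKf ?gt_eqF.
by rewrite (E (fun xi => cos (dotp x xi))) (E (fun xi => sin (dotp x xi))).
Qed.

(** Quantifying over all dampings and all translations makes the class stable under
    products with exponentials and under limits. *)
Definition radial phi : Prop := measurable_fun setT phi /\ forall x (b : R), 0 < b ->
  sp_approx (fun xi => phi (sqn xi) * (expR (- (b * sqn xi)) * cos (dotp x xi)))
            (fun xi => phi (sqn xi) * (expR (- (b * sqn xi)) * sin (dotp x xi))).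

Lemma radial1 : radial (fun=> 1).
Proof.
split=> // x b b0; have := sp_approx_gauss x b0.
rewrite (_ : (fun xi => 1 * _) = (fun xi => expR (- (b * sqn xi)) * cos (dotp x xi))); last first.
  by apply/funext => xi; rewrite mul1r.
by rewrite (_ : (fun xi => 1 * _) = (fun xi => expR (- (b * sqn xi)) * sin (dotp x xi)))//;
  apply/funext => xi; rewrite mul1r.
Qed.

Lemma radialD phi psi : radial phi -> radial psi -> radial (fun y => phi y + psi y).
Proof.
move=> [m1 a1] [m2 a2]; split; first exact: measurable_funD.
move=> x b b0; have := sp_approxD (a1 x b b0) (a2 x b b0).
have E (c : 'rV[R]_d -> R) : (fun xi => phi (sqn xi) * c xi + psi (sqn xi) * c xi) =
  (fun xi => (phi (sqn xi) + psi (sqn xi)) * c xi) by apply/funext => xi; rewrite mulrDl.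
by rewrite (E (fun xi => expR (- (b * sqn xi)) * cos (dotp x xi)))
  (E (fun xi => expR (- (b * sqn xi)) * sin (dotp x xi))).
Qed.

Lemma radialZ k phi : radial phi -> radial (fun y => k * phi y).
Proof.
move=> [m1 a1]; split; first exact: measurable_funM.
move=> x b b0; have := sp_approxZ k (a1 x b b0).
have E (c : 'rV[R]_d -> R) : (fun xi => k * (phi (sqn xi) * c xi)) =
  (fun xi => k * phi (sqn xi) * c xi) by apply/funext => xi; rewrite mulrA.
by rewrite (E (fun xi => expR (- (b * sqn xi)) * cos (dotp x xi)))
  (E (fun xi => expR (- (b * sqn xi)) * sin (dotp x xi))).
Qed.

Lemma radial_exp c phi : 0 < c -> radial phi -> radial (fun y => expR (- (c * y)) * phi y).
Proof.
move=> c0 [m1 a1]; split; first by meas.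
move=> x b b0; have := a1 x (b + c) (addr_gt0 b0 c0).
have E (g : 'rV[R]_d -> R) : (fun xi => phi (sqn xi) * (expR (- ((b + c) * sqn xi)) * g xi)) =
  (fun xi => expR (- (c * sqn xi)) * phi (sqn xi) * (expR (- (b * sqn xi)) * g xi)).
  by apply/funext => xi; rewrite mulrDl opprD expRD; ring.
by rewrite (E (fun xi => cos (dotp x xi))) (E (fun xi => sin (dotp x xi))).
Qed.

(** Half of the damping absorbs the growth of [u n], the other half is integrable for
    [mu]. *)
Lemma radial_lim (u : nat -> R -> R) phi : (forall n, radial (u n)) -> measurable_fun setT phi ->
  (forall y, 0 <= y -> u n y @[n --> \oo] --> phi y) ->
  (forall c, 0 < c -> exists K, forall n y, 0 <= y -> `|u n y| <= K * expR (c * y)) ->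
  radial phi.
Proof.
move=> ru mphi uphi ub; split => // x b b0.
have mc (g : R -> R) : measurable_fun setT g -> forall p : 'rV[R]_d -> R, measurable_fun setT p ->
  measurable_fun setT (fun xi => g (sqn xi) * (expR (- (b * sqn xi)) * p xi)).
  move=> mg p mp; apply: measurable_funM; first by apply: (measurableT_comp mg); exact: measurable_sqn.
  by apply: measurable_funM => //; meas.
have mcos : measurable_fun setT (fun xi => cos (dotp x xi)) by meas.
have msin : measurable_fun setT (fun xi => sin (dotp x xi)) by meas.
apply: sp_approx_lim; [exact: mc|exact: mc|].
have b2 : 0 < b / 2 by rewrite divr_gt0.
have [K hK] := ub _ b2.
have hK' y : 0 <= y -> `|phi y| <= K * expR (b / 2 * y).
  move=> y0.
  have h : `|u n y| @[n --> \oo] --> `|phi y| by apply: cvg_norm; exact: uphi.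
  have := cvg_lim (@Rhausdorff R) h => <-; apply: limr_le; first by apply/cvg_ex; eexists; exact: h.
  by apply: nearW => n; exact: hK.
pose D n (p : 'rV[R]_d -> R) xi := phi (sqn xi) * (expR (- (b * sqn xi)) * p xi) - u n (sqn xi) * (expR (- (b * sqn xi)) * p xi).
have DE n xi : D n (fun xi => cos (dotp x xi)) xi ^+ 2 + D n (fun xi => sin (dotp x xi)) xi ^+ 2 =
    ((phi (sqn xi) - u n (sqn xi)) * expR (- (b * sqn xi))) ^+ 2.
  rewrite /D; transitivity (((phi (sqn xi) - u n (sqn xi)) * expR (- (b * sqn xi))) ^+ 2 *
    (cos (dotp x xi) ^+ 2 + sin (dotp x xi) ^+ 2)); first by ring.
  by rewrite cos2Dsin2 mulr1.
have : sq_norm mu (D n (fun xi => cos (dotp x xi))) (D n (fun xi => sin (dotp x xi))) @[n --> \oo] --> 0%E.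
  rewrite -[X in _ --> X](_ : (\int[mu]_xi (cst 0 xi))%E = 0%E); last exact: integral0.
  have I0 : mu.-integrable setT (fun xi => ((4 * K ^+ 2)%:E * (gaussd b 0 xi)%:E)%E).
    by apply: integrableZl => //; exact: tempered_gauss_integrable.
  apply: (@dominated_cvg _ _ _ mu setT _ _ _ (fun xi => (4 * K ^+ 2)%:E * (gaussd b 0 xi)%:E)%E) => //.
  - move=> n; apply/measurable_EFinP; have [mu_ _] := ru n.
    by apply: measurable_funD; apply: measurable_funX; apply: measurable_funB; exact: mc.
  - move=> xi _; apply: cvg_EFin; first exact: nearW.
    rewrite (_ : fine \o _ = (fun n => ((phi (sqn xi) - u n (sqn xi)) * expR (- (b * sqn xi))) ^+ 2)); last first.
      by apply/funext => n /=; rewrite DE.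
    have h : (phi (sqn xi) - u n (sqn xi)) * expR (- (b * sqn xi)) @[n --> \oo] --> (0 : R).
      rewrite -[X in _ --> X](mul0r (expR (- (b * sqn xi)))); apply: cvgM; last exact: cvg_cst.
      rewrite -[X in _ --> X](subrr (phi (sqn xi))); apply: cvgB; first exact: cvg_cst.
      by apply: uphi; exact: sqn_ge0.
    by rewrite -[X in _ --> X](mul0r (0 : R)); under eq_fun do rewrite expr2; exact: cvgM.
  - move=> n xi _; rewrite -EFinM lee_fin DE ger0_norm ?sqr_ge0//.
    have s0 := sqn_ge0 xi; have k1 := hK n _ s0; have k2 := hK' _ s0.
    have -> : 4 * K ^+ 2 * gaussd b 0 xi = (2 * K * expR (b / 2 * sqn xi) * expR (- (b * sqn xi))) ^+ 2.
      rewrite !exprMn -!expRM_natl /gaussd subr0.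
      have -> : 2 ^+ 2 = 4 :> R by ring.
      rewrite -[in RHS]mulrA -expRD; congr (_ * _ * expR _); by field.
    set v := _ * expR (- (b * sqn xi)); have -> : v ^+ 2 = `|v| ^+ 2 by rewrite real_normK ?num_real.
    rewrite {}/v; apply: lerXn2r; rewrite ?nnegrE//.
      apply: mulr_ge0; last exact: expR_ge0.
      by have := le_trans (normr_ge0 _) k1; lra.
    rewrite normrM (ger0_norm (expR_ge0 _)) ler_wpM2r ?expR_ge0//.
    by apply: le_trans (ler_normB _ _) _; lra.
move=> h eps e0; have [n _ hn] := cvge0_near _ e0 h.
exists (fun xi => u n (sqn xi) * (expR (- (b * sqn xi)) * cos (dotp x xi))),
  (fun xi => u n (sqn xi) * (expR (- (b * sqn xi)) * sin (dotp x xi))).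
by split; [have [_ r] := ru n; exact: r|exact: (hn n (leqnn n))].
Qed.

(** [y^(k+1)] is the limit of [exp_slope n y * y^k]. *)
Lemma radial_monomial k : radial (fun y => y ^+ k).
Proof.
elim: k => [|k IH]; first exact: radial1.
apply: (@radial_lim (fun n y => exp_slope n y * y ^+ k)).
- move=> n.
  rewrite (_ : (fun y => _) = (fun y => n.+1%:R * y ^+ k + (- n.+1%:R) * (expR (- (n.+1%:R^-1 * y)) * y ^+ k))); last first.
    by apply/funext => y; rewrite /exp_slope [y / _]mulrC; ring.
  by apply: radialD; apply: radialZ => //; apply: radial_exp => //; rewrite invr_gt0.
- by meas.
- by move=> y y0; rewrite exprS; apply: cvgM; [exact: exp_slope_cvg|exact: cvg_cst].
- move=> c c0; have [K K0 hK] := pow_le_exp k.+1 c0; exists K => n y y0.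
  have /andP[_ h2] := exp_slope_bounds n y0.
  have h1 : 0 <= exp_slope n y.
    by rewrite mulr_ge0// subr_ge0 -[leRHS]expR0 ler_expR oppr_le0 divr_ge0.
  rewrite ger0_norm; last by rewrite mulr_ge0// exprn_ge0.
  by apply: le_trans (hK y y0); rewrite exprS ler_wpM2r// exprn_ge0.
Qed.

Lemma radial_wave (t : R) : radial (fun y => wave (Num.sqrt y) t).
Proof.
apply: (@radial_lim (fun n => sinc_poly t n.+1)).
- move=> n; rewrite /sinc_poly; elim: (n.+1) => [|m IH].
    rewrite (_ : (fun y => _) = (fun y => 0 * 1)); first exact: (radialZ 0 radial1).
    by apply/funext => y; rewrite big_ord0 mul0r.
  rewrite (_ : (fun y => _) = (fun y => \sum_(i < m) (-1) ^+ i * t ^+ i.*2.+1 / (i.*2.+1)`!%:R * y ^+ i +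
    (-1) ^+ m * t ^+ m.*2.+1 / (m.*2.+1)`!%:R * y ^+ m)); last first.
    by apply/funext => y; rewrite big_ord_recr.
  by apply: radialD => //; apply: radialZ; exact: radial_monomial.
- have ms : measurable_fun setT (Num.sqrt : R -> R).
    by apply: continuous_measurable_fun; exact: sqrt_continuous.
  exact: (@measurable_wave2 _ _ _ _ (fun=> t) ms (measurable_cst t) (fun y => sqrtr_ge0 y)).
- by move=> y y0; have := @sinc_poly_cvg R t (Num.sqrt y) (sqrtr_ge0 y); rewrite sqr_sqrtr.
- move=> c c0; have [K K0 hK] := sinc_poly_le t c0; exists K => n y y0; exact: hK.
Qed.

Lemma sp_approx_wave x (t b : R) : 0 < b ->
  sp_approx (fun xi => wave (enorm xi) t * (expR (- (b * sqn xi)) * cos (dotp x xi)))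
            (fun xi => wave (enorm xi) t * (expR (- (b * sqn xi)) * sin (dotp x xi))).
Proof. by have [_ h] := radial_wave t; exact: h. Qed.

End spatial_approximation.

(** * Approximation in time *)

Section admissible_algebra.
Context {R : realType} {d : nat}.
Implicit Types (h : R -> 'rV[R]_d -> R[i]) (a : R -> 'rV[R]_d -> R).

Lemma admissible_le b c h : b <= c -> admissible b h -> admissible c h.
Proof. by move=> bc [mh bh sh]; split => // t xi ct; apply: sh; exact: le_lt_trans ct. Qed.

Lemma admissibleN b h : admissible b h -> admissible b (fun s xi => - h s xi).
Proof.
move=> [[mr mi] bh sh]; split; first split.
- by rewrite (_ : (fun p => _) = (fun p => - complex.Re (h p.1 p.2)));
    [exact: measurable_funN|apply/funext => p; case: (h p.1 p.2)].
- by rewrite (_ : (fun p => _) = (fun p => - complex.Im (h p.1 p.2)));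
    [exact: measurable_funN|apply/funext => p; case: (h p.1 p.2)].
- move=> xi; have [M hM] := bh xi; exists M => t.
  by move: (hM t); case: (h t xi) => u v /=; rewrite !sqrrN.
- by move=> t xi bt; rewrite sh// oppr0.
Qed.

Lemma admissibleD b h h' : admissible b h -> admissible b h' ->
  admissible b (fun s xi => h s xi + h' s xi).
Proof.
move=> [[mr mi] bh sh] [[mr' mi'] bh' sh']; split; first split.
- rewrite (_ : (fun p => _) = (fun p => complex.Re (h p.1 p.2) + complex.Re (h' p.1 p.2))).
    exact: measurable_funD.
  by apply/funext => p; case: (h p.1 p.2) => ? ?; case: (h' p.1 p.2).
- rewrite (_ : (fun p => _) = (fun p => complex.Im (h p.1 p.2) + complex.Im (h' p.1 p.2))).
    exact: measurable_funD.
  by apply/funext => p; case: (h p.1 p.2) => ? ?; case: (h' p.1 p.2).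
- move=> xi; have [M hM] := bh xi; have [M' hM'] := bh' xi; exists ((M + M') + (M + M')) => t.
  have := hM t; have := hM' t.
  have := normc_Re (h t xi); have := normc_Im (h t xi).
  have := normc_Re (h' t xi); have := normc_Im (h' t xi).
  case: (h t xi) => u v; case: (h' t xi) => u' v' /= a1 a2 a3 a4 a5 a6.
  apply: le_trans (normc_le _ _) _; apply: lerD; apply: le_trans (ler_normD _ _) _; lra.
- by move=> t xi bt; rewrite sh// sh'// addr0.
Qed.

Lemma admissibleB b h h' : admissible b h -> admissible b h' ->
  admissible b (fun s xi => h s xi - h' s xi).
Proof. by move=> ah /admissibleN; exact: admissibleD. Qed.

(** The shape of the transform of a real radial function of [xi] translated by [x]. *)
Definition phase_profile x a (s : R) (xi : 'rV[R]_d) : R[i] :=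
  Complex (cos (dotp x xi) * a s xi) (- sin (dotp x xi) * a s xi).

Definition tame_family (b : R) a : Prop :=
  [/\ measurable_fun setT (fun p : R * 'rV[R]_d => a p.1 p.2),
    forall xi, exists M, forall s, `|a s xi| <= M &
    forall s xi, b < `|s| -> a s xi = 0].

Lemma tame_family_tame b a xi : tame_family b a -> exists M, tame b M (a^~ xi).
Proof.
move=> [ma ba sa]; have [M hM] := ba xi; exists M; split => //.
- exact: (measurableT_comp ma (g := fun u : R => (u, xi))).
- by move=> u; exact: sa.
Qed.

Lemma admissible_phase x b a : tame_family b a -> admissible b (phase_profile x a).
Proof.
move=> [ma ba sa]; split; first split.
- by apply: measurable_funM => //; meas.
- by apply: measurable_funM => //; meas.
- move=> xi; have [M hM] := ba xi; exists (M + M) => s; apply: le_trans (normc_le _ _) _.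
  have M0 := le_trans (normr_ge0 _) (hM s).
  rewrite !normrM normrN; apply: lerD; apply: le_trans (hM s).
    by rewrite ler_piMl// norm_cos_le1.
  by rewrite ler_piMl// norm_sin_le1.
- by move=> s xi bs; rewrite /phase_profile sa// !mulr0.
Qed.

Lemma cenergy_phase_profile (H : R) (hH : 1 / 2 < H < 1) x b a xi : tame_family b a ->
  cenergy H ((phase_profile x a)^~ xi) = energy H (a^~ xi).
Proof.
move=> /(tame_family_tame xi)[M ta]; apply: (cenergy_phase hH (b := b) (M := M)) => //.
by rewrite sqrrN cos2Dsin2.
Qed.

End admissible_algebra.

Lemma integral_le_double d (T : measurableType d) (R : realType) (m : {measure set T -> \bar R})
    (F G K : T -> \bar R) :
  measurable_fun setT F -> measurable_fun setT G -> measurable_fun setT K ->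
  (forall x, 0 <= F x)%E -> (forall x, 0 <= G x)%E -> (forall x, 0 <= K x)%E ->
  (forall x, K x <= 2%:E * F x + 2%:E * G x)%E ->
  (\int[m]_x K x <= 2%:E * \int[m]_x F x + 2%:E * \int[m]_x G x)%E.
Proof.
move=> mF mG mK F0 G0 K0 h.
have n1 : measurable_fun setT (fun x => (2%:E * F x)%E) by exact: measurable_funeM.
have n2 : measurable_fun setT (fun x => (2%:E * G x)%E) by exact: measurable_funeM.
rewrite -!ge0_integralZl// -ge0_integralD//; try by move=> x _; rewrite mule_ge0.
by apply: ge0_le_integral => //; exact: emeasurable_funD.
Qed.

Section energy_seminorm.
Context {R : realType} {d : nat} (H : R) (hH : 1 / 2 < H < 1).
Variable mu : {measure set 'rV[R]_d -> \bar R}.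
Implicit Types (h : R -> 'rV[R]_d -> R[i]).

Lemma xi_energy_ge0 h : (0 <= xi_energy H mu h)%E.
Proof. by apply: integral_ge0 => xi _; exact: cenergy_ge0. Qed.

Lemma xi_energyD b h h' : admissible b h -> admissible b h' ->
  (xi_energy H mu (fun s xi => (h s xi + h' s xi)%R) <=
   2%:E * xi_energy H mu h + 2%:E * xi_energy H mu h')%E.
Proof.
move=> ah ah'; rewrite /xi_energy.
have m1 := measurable_cenergy hH ah; have m2 := measurable_cenergy hH ah'.
have m3 := measurable_cenergy hH (admissibleD ah ah').
have c0 h0 xi : (0 <= cenergy H (h0^~ xi))%E := cenergy_ge0 hH (h0^~ xi).
apply: (@integral_le_double _ _ _ mu (fun xi => cenergy H (h^~ xi)) (fun xi => cenergy H (h'^~ xi)) _ m1 m2 m3 (c0 h) (c0 h') (c0 _)).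
move=> xi; have [M tM] := admissible_ctame xi ah; have [M' tM'] := admissible_ctame xi ah'.
exact: cenergyD tM tM'.
Qed.

Lemma xi_energyN b h : admissible b h -> xi_energy H mu (fun s xi => - h s xi) = xi_energy H mu h.
Proof.
move=> ah; apply: eq_integral => xi _; have [M tM] := admissible_ctame xi ah.
exact: cenergyN tM.
Qed.

Lemma xi_energyB_sym b h h' : admissible b h -> admissible b h' ->
  xi_energy H mu (fun s xi => h s xi - h' s xi) = xi_energy H mu (fun s xi => h' s xi - h s xi).
Proof.
move=> ah ah'; rewrite -(xi_energyN (admissibleB ah ah')).
by congr (xi_energy H mu); apply/funext => s; apply/funext => xi; rewrite opprB.
Qed.

End energy_seminorm.

Section telescope_steps.
Context {R : realType}.

Lemma telescope_threshold (n m : nat) (w : nat -> R) : (m <= n)%N ->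
  \sum_(k < n) (if (m <= k)%N then w k - w k.+1 else 0) = w m - w n.
Proof.
elim: n => [|n IH].
  by rewrite leqn0 => /eqP ->; rewrite big_ord0 subrr.
rewrite leq_eqVlt => /orP[/eqP -> | mn].
  by rewrite subrr big1// => i _; rewrite leqNgt ltn_ord.
by rewrite ltnS in mn; rewrite big_ord_recr /= IH// mn; ring.
Qed.

Definition step_time (t : R) (n k : nat) : R := t * k%:R / n.+1%:R.

Lemma step_time_ge0 t n k : 0 <= t -> 0 <= step_time t n k.
Proof. by move=> t0; rewrite divr_ge0// mulr_ge0. Qed.

Lemma step_time_le t n k l : 0 <= t -> (k <= l)%N -> step_time t n k <= step_time t n l.
Proof. by move=> t0 kl; rewrite ler_wpM2r ?invr_ge0// ler_wpM2l// ler_nat. Qed.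

Lemma step_time_last t n : step_time t n n.+1 = t.
Proof. by rewrite /step_time mulfK. Qed.

Lemma step_timeS t n k : step_time t n k.+1 = step_time t n k + t / n.+1%:R.
Proof. by rewrite /step_time -[k.+1]addn1 natrD; field. Qed.

(** The step function in [s] that equals, on each subinterval, the value of the wave
    slice at the right end point. It is written with the indicators of [[0, t_k]], the only
    time sets from which simple functions are made. *)
Definition wave_step (n : nat) (t r s : R) : R :=
  \sum_(k < n.+1) \1_(`[0, step_time t n k]%classic) s *
    (wave r (t - step_time t n k) - wave r (t - step_time t n k.+1)).

Lemma wave_step_out n t r s : 0 <= t -> ~~ (0 <= s <= t) -> wave_step n t r s = 0.
Proof.
move=> t0 st; apply: big1 => k _; rewrite indicE; case: (boolP (_ \in _)) => [|_]; last by rewrite mul0r.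
rewrite inE /= in_itv /= => /andP[s0 sk]; move: st; rewrite s0 /= (le_trans sk)//.
by rewrite -[leRHS](step_time_last t n); apply: step_time_le => //; exact: ltnW.
Qed.

(** The multiplier is 1-Lipschitz in time, and vanishes at the end of the interval. *)
Lemma wave_step_close n t r s : 0 <= t -> 0 <= r ->
  `|wave_slice t r s - wave_step n t r s| <= t / n.+1%:R.
Proof.
move=> t0 r0; have tn : 0 <= t / n.+1%:R by rewrite divr_ge0.
rewrite /wave_slice; case: (boolP (0 <= s <= t)) => [/andP[s0 st]|st]; last first.
  by rewrite wave_step_out// subr0 normr0.
have ex : exists k, s <= step_time t n k by exists n.+1; rewrite step_time_last.
(* The index of the first grid point to the right of [s]. *)
pose m := ex_minn ex.
have [sm mmin] : s <= step_time t n m /\ forall k, s <= step_time t n k -> (m <= k)%N.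
  by rewrite /m; case: ex_minnP => k h1 h2; split.
have mn : (m <= n.+1)%N by apply: mmin; rewrite step_time_last.
have E : wave_step n t r s = wave r (t - step_time t n m).
  (* The last value is [wave r 0 = 0], so that the telescoping sum has a single term. *)
  rewrite -[RHS]subr0 -[X in _ - X](_ : wave r (t - step_time t n n.+1) = 0); last first.
    by rewrite step_time_last subrr /wave mul0r sin0 mul0r; case: eqP.
  rewrite -(telescope_threshold (fun k => wave r (t - step_time t n k)) mn).
  apply: eq_bigr => k _; rewrite indicE; case: (leqP m k) => mk.
    rewrite mem_set ?mul1r//= in_itv /= s0 (le_trans sm)//; exact: step_time_le.
  rewrite memNset ?mul0r//= in_itv /= s0 /= => sk; have := mmin _ sk; by rewrite leqNgt mk.
rewrite E; apply: le_trans (wave_lipschitz _ _ r0) _.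
rewrite (_ : _ - _ - _ = step_time t n m - s); last by ring.
rewrite ger0_norm ?subr_ge0// lerBlDr.
case: (posnP m) => [m0|mp]; first by rewrite m0 /step_time mulr0 mul0r addr_ge0.
rewrite -(prednK mp) step_timeS addrC lerD2l leNgt; apply/negP => sm'.
by have := mmin _ (ltW sm'); rewrite leqNgt prednK// leqnn.
Qed.

End telescope_steps.

Lemma double_bound (R : realType) (x y : \bar R) (a b : R) :
  (x <= a%:E)%E -> (y <= b%:E)%E -> (2%:E * x + 2%:E * y <= (2 * a + 2 * b)%:E)%E.
Proof.
move=> xa yb; have -> : (2 * a + 2 * b)%R%:E = (2%:E * a%:E + 2%:E * b%:E)%E by rewrite -!EFinM -EFinD.
by apply: leeD; rewrite lee_pmul2l.
Qed.

Lemma double_quarter (R : realType) (x y : \bar R) (eps : R) :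
  (x <= (eps / 4)%:E)%E -> (y <= (eps / 4)%:E)%E -> (2%:E * x + 2%:E * y <= eps%:E)%E.
Proof. by move=> hx hy; apply: le_trans (double_bound hx hy) _; rewrite lee_fin; lra. Qed.

Section time_steps.
Context {R : realType} {d : nat} (H : R) (hH : 1 / 2 < H < 1).
Variable mu : {measure set 'rV[R]_d -> \bar R}.
Implicit Types (h : R -> 'rV[R]_d -> R[i]) (g : 'rV[R]_d -> R).

(** The transforms of elements of the space of integrands. *)
Definition el_approx h : Prop :=
  (exists2 b, 0 <= b & admissible b h) /\
  forall eps : R, 0 < eps -> exists e,
    (xi_energy H mu (fun s xi => (h s xi - el_fourier e s xi)%R) <= eps%:E)%E.

Lemma admissible_common b c h h' : admissible b h -> admissible c h' ->
  exists2 a, b <= a & admissible a h /\ admissible a h'.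
Proof.
move=> ah ah'; exists (Num.max b c); first by rewrite le_max lexx.
by split; [apply: admissible_le ah|apply: admissible_le ah'];
  rewrite le_max lexx ?orbT.
Qed.

Lemma el_approxD h h' : el_approx h -> el_approx h' -> el_approx (fun s xi => h s xi + h' s xi).
Proof.
move=> [[b b0 ah] aph] [[c c0 ah'] aph'].
have [a ba [ah1 ah2]] := admissible_common ah ah'.
split; first by exists a; [exact: le_trans ba|exact: admissibleD].
move=> eps e0; have e4 : 0 < eps / 4 by rewrite divr_gt0.
have [e he] := aph _ e4; have [e' he'] := aph' _ e4; exists (el_cat e e').
have -> : (fun s xi => h s xi + h' s xi - el_fourier (el_cat e e') s xi) =
  (fun s xi => (h s xi - el_fourier e s xi) + (h' s xi - el_fourier e' s xi)).
  by apply/funext => s; apply/funext => xi; rewrite el_fourier_cat opprD addrACA.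
have [a1 _ [k1 k2]] := admissible_common ah1 (admissible_el e).
have [a2 h12 [k3 k4]] := admissible_common ah2 (admissible_el e').
have [a3 _ [k5 k6]] := admissible_common (admissibleB k1 k2) (admissibleB k3 k4).
apply: le_trans (xi_energyD hH mu k5 k6) _.
exact: (double_quarter he he').
Qed.

Lemma el_approx_lim b h : 0 <= b -> admissible b h ->
  (forall eps : R, 0 < eps -> exists h', el_approx h' /\
     (xi_energy H mu (fun s xi => (h s xi - h' s xi)%R) <= eps%:E)%E) ->
  el_approx h.
Proof.
move=> b0 ah lim; split; first by exists b.
move=> eps e0; have e4 : 0 < eps / 4 by rewrite divr_gt0.
have [h' [[[c c0 ah'] aph'] hh']] := lim _ e4; have [e he] := aph' _ e4; exists e.
have -> : (fun s xi => h s xi - el_fourier e s xi) =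
  (fun s xi => (h s xi - h' s xi) + (h' s xi - el_fourier e s xi)).
  by apply/funext => s; apply/funext => xi; rewrite addrA subrK.
have [a1 _ [k1 k2]] := admissible_common ah ah'.
have [a2 _ [k3 k4]] := admissible_common ah' (admissible_el e).
have [a3 _ [k5 k6]] := admissible_common (admissibleB k1 k2) (admissibleB k3 k4).
apply: le_trans (xi_energyD hH mu k5 k6) _.
exact: (double_quarter hh' he).
Qed.

Definition time_step (t : R) g1 g2 (s : R) (xi : 'rV[R]_d) : R[i] :=
  Complex (\1_(`[0, t]%classic) s * g1 xi) (- (\1_(`[0, t]%classic) s * g2 xi)).

Lemma tame_step t (c : R) : 0 <= t -> tame t `|c| (fun s => \1_(`[0, t]%classic) s * c).
Proof.
move=> t0; split; first by apply: measurable_funM => //; exact: measurable_itv_indic.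
- move=> s; rewrite normrM ler_piMl//; have /andP[h1 h2] := @indic01 R _ (`[0, t]%classic) s.
  by rewrite ger0_norm.
- move=> s ts; rewrite indicE memNset ?mul0r//= in_itv /= => /andP[s0 st].
  by move: ts; rewrite ger0_norm// ltNge st.
Qed.

Lemma admissible_time_step t g1 g2 : 0 <= t -> measurable_fun setT g1 -> measurable_fun setT g2 ->
  admissible t (time_step t g1 g2).
Proof.
move=> t0 m1 m2.
have mI : measurable_fun setT (fun p : R * 'rV[R]_d => \1_(`[0, t]%classic) p.1 : R).
  by apply: (measurableT_comp (measurable_itv_indic _)); meas.
split; first split.
- by apply: measurable_funM => //; exact: measurableT_comp m1 _.
- by apply: measurable_funN; apply: measurable_funM => //; exact: measurableT_comp m2 _.
- move=> xi; exists (`|g1 xi| + `|g2 xi|) => s; apply: le_trans (normc_le _ _) _; rewrite normrN.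
  by apply: lerD; [have [_ h _] := tame_step (g1 xi) t0|have [_ h _] := tame_step (g2 xi) t0]; exact: h.
- move=> s xi ts; have [_ _ e1] := tame_step (g1 xi) t0; have [_ _ e2] := tame_step (g2 xi) t0.
  by rewrite /time_step e1// e2// oppr0.
Qed.

Lemma xi_energy_time_step t g1 g2 : 0 <= t -> measurable_fun setT g1 -> measurable_fun setT g2 ->
  (xi_energy H mu (time_step t g1 g2) <= (t `^ (2 * H))%:E * sq_norm mu g1 g2)%E.
Proof.
move=> t0 m1 m2; rewrite /sq_norm -integralZl_real ?powR_ge0//; last 2 first.
- by apply: measurable_funD; exact: measurable_funX.
- by move=> xi; rewrite addr_ge0// sqr_ge0.
apply: ge0_le_integral => //.
- by move=> xi _; exact: cenergy_ge0.
- exact: measurable_cenergy hH _ _ _ (admissible_time_step t0 m1 m2).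
- apply/measurable_EFinP; apply: measurable_funM => //; apply: measurable_funD; exact: measurable_funX.
move=> xi _; rewrite /cenergy /time_step /= [X in X%:E]mulrDr EFinD.
have K (c : R) : (energy H (fun u : R => (\1_(`[0, t]%classic) u * c)%R) <= (t `^ (2 * H) * c ^+ 2)%:E)%E.
  have := energy_finite_le hH t0 (tame_step c t0); rewrite real_normK ?num_real// => /le_trans; apply.
  by rewrite lee_fin mulrC.
apply: leeD; first exact: K.
have := K (- g2 xi); rewrite sqrrN; apply: le_trans.
by rewrite le_eqVlt; apply/orP; left; apply/eqP; congr energy; apply/funext => u; rewrite mulrN.
Qed.

(** A function of the frequency on the time interval [[0, t]] costs its square norm times
    [t^(2H)]. *)
Lemma el_approx_step t g1 g2 : 0 <= t -> sp_approx mu g1 g2 -> el_approx (time_step t g1 g2).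
Proof.
move=> t0 [m1 m2 ap]; split; first by exists t => //; exact: admissible_time_step.
move=> eps e0; pose K := t `^ (2 * H) + 1.
have K0 : 0 < K by rewrite ltr_pwDr// powR_ge0.
have [e he] := ap (eps / K) (divr_gt0 e0 K0); exists (el_retime t0 e).
have mc := @measurable_cos_el R d e; have ms := @measurable_sin_el R d e.
have -> : (fun s xi => time_step t g1 g2 s xi - el_fourier (el_retime t0 e) s xi) =
  time_step t (fun xi => g1 xi - cos_el e xi) (fun xi => g2 xi - sin_el e xi).
  apply/funext => s; apply/funext => xi; rewrite el_fourier_retime /time_step.
  by apply/eqP; rewrite eq_complex /=; apply/andP; split; apply/eqP; ring.
apply: le_trans (xi_energy_time_step t0 _ _) _; [exact: measurable_funB|exact: measurable_funB|].
apply: le_trans (lee_wpmul2l _ he) _; first by rewrite lee_fin powR_ge0.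
rewrite -EFinM lee_fin mulrA ler_pdivrMr// mulrC ler_wpM2l ?ltW// /K ltrDl//.
Qed.

Lemma el_approx_steps n (tau : nat -> R) (g1 g2 : nat -> 'rV[R]_d -> R) :
  (forall k, 0 <= tau k) -> (forall k, sp_approx mu (g1 k) (g2 k)) ->
  el_approx (fun s xi =>
    Complex (\sum_(k < n) \1_(`[0, tau k]%classic) s * g1 k xi)
            (- \sum_(k < n) \1_(`[0, tau k]%classic) s * g2 k xi)).
Proof.
move=> t0 ap; elim: n => [|n IH].
  have := el_approx_step (t0 0%N) (sp_approxZ 0 (ap 0%N)); congr el_approx.
  by apply/funext => s; apply/funext => xi; rewrite /time_step !big_ord0 !mul0r !mulr0.
have := el_approxD IH (el_approx_step (t0 n) (ap n)); congr el_approx.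
by apply/funext => s; apply/funext => xi; rewrite !big_ord_recr /= /time_step opprD.
Qed.

End time_steps.

Lemma measurable_wave_weight (R : realType) (d : nat) (H : R) :
  measurable_fun setT (fun xi : 'rV[R]_d => wave_weight H (enorm xi)).
Proof.
rewrite /wave_weight; apply: (measurableT_comp (measurable_powR _)).
apply: (eq_measurable_fun (fun xi : 'rV[R]_d => (1 + enorm xi ^+ 2) `^ (-1))) => [xi _|]; last by meas.
by rewrite powR_inv1// addr_ge0// sqr_ge0.
Qed.

Section wave_density.
Context {R : realType} {d : nat} (H : R) (hH : 1 / 2 < H < 1).
Variables (mu : {measure set 'rV[R]_d -> \bar R}) (f : 'rV[R]_d -> R).
Hypothesis hmu : tempered_measure mu.
Hypothesis f_ge0 : forall x, 0 <= f x.
Hypothesis mf : measurable_fun setT f.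
Hypothesis hf : distr_is_function (distr_fourier (distr_of_measure mu)) (fun x => (f x)%:C%C).
Implicit Types (xi x : 'rV[R]_d).

Let gdamp (b : R) xi : R := expR (- (b * sqn xi)).

Let gdamp_ge0 b xi : 0 <= gdamp b xi. Proof. exact: expR_ge0. Qed.

Let gdamp_le1 b xi : 0 <= b -> gdamp b xi <= 1.
Proof. by move=> b0; rewrite -expR0 ler_expR oppr_le0 mulr_ge0// sqn_ge0. Qed.

Let measurable_damp b : measurable_fun setT (gdamp b).
Proof. by rewrite /gdamp; meas. Qed.

Let measurable_enorm2 : measurable_fun setT (fun p : R * 'rV[R]_d => enorm p.2).
Proof. by meas. Qed.

Let measurable_wave_step n t :
  measurable_fun setT (fun p : R * 'rV[R]_d => wave_step n t (enorm p.2) p.1).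
Proof.
apply: measurable_sum => k; apply: measurable_funM.
  by apply: (measurableT_comp (measurable_itv_indic _)); meas.
by apply: measurable_funB; apply: (@measurable_wave2 _ _ _ (fun p : R * 'rV[R]_d => enorm p.2) (fun=> _)) => //;
  move=> p; exact: enorm_ge0.
Qed.

Let measurable_slice t :
  measurable_fun setT (fun p : R * 'rV[R]_d => wave_slice t (enorm p.2) p.1).
Proof. by apply: measurable_wave_slice2 => // p; exact: enorm_ge0. Qed.

Let measurable_damp2 b : measurable_fun setT (fun p : R * 'rV[R]_d => gdamp b p.2).
Proof. by rewrite /gdamp; meas. Qed.

Lemma tame_family_damped (c : 'rV[R]_d -> R) t : 0 <= t -> measurable_fun setT c ->
  tame_family t (fun s xi => c xi * wave_slice t (enorm xi) s).
Proof.
move=> t0 mc; split.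
- by apply: measurable_funM; [apply: (measurableT_comp mc); meas|exact: measurable_slice].
- move=> xi; exists (`|c xi| * t) => s; rewrite normrM ler_wpM2l//.
  by apply: wave_slice_le => //; exact: enorm_ge0.
- move=> s xi ts; have [_ _ ->] := wave_slice_tame (enorm_ge0 xi) t0 (lexx t); by rewrite ?mulr0.
Qed.

Lemma tame_family_step_error b t n : 0 <= t ->
  tame_family t (fun s xi => gdamp b xi * (wave_slice t (enorm xi) s - wave_step n t (enorm xi) s)).
Proof.
move=> t0; split.
- by apply: measurable_funM; [exact: measurable_damp2|apply: measurable_funB; [exact: measurable_slice|exact: measurable_wave_step]].
- move=> xi; exists (gdamp b xi * (t / n.+1%:R)) => s.
  by rewrite normrM (ger0_norm (gdamp_ge0 _ _)) ler_wpM2l// wave_step_close// enorm_ge0.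
- move=> s xi ts; have [_ _ ->//] := wave_slice_tame (enorm_ge0 xi) t0 (lexx t).
  rewrite wave_step_out ?subrr ?mulr0//; apply/negP => /andP[s0 st].
  by move: ts; rewrite ger0_norm// ltNge st.
Qed.

Lemma el_approx_damped_step x b t n : 0 < b -> 0 <= t ->
  el_approx H mu (phase_profile x (fun s xi => gdamp b xi * wave_step n t (enorm xi) s)).
Proof.
move=> b0 t0.
pose g (c : R -> R) k xi := wave (enorm xi) (t - step_time t n k) * (gdamp b xi * c (dotp x xi)) +
   (-1) * (wave (enorm xi) (t - step_time t n k.+1) * (gdamp b xi * c (dotp x xi))).
have ap k : sp_approx mu (g cos k) (g sin k).
  by apply: sp_approxD; [|apply: sp_approxZ]; exact: (sp_approx_wave hmu f_ge0 mf hf x _ b0).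
have := el_approx_steps hH n.+1 (fun k => step_time_ge0 n k t0) ap; congr el_approx.
have E (c : R -> R) s xi : \sum_(k < n.+1) \1_(`[0, step_time t n k]%classic) s * g c k xi =
  c (dotp x xi) * (gdamp b xi * wave_step n t (enorm xi) s).
  by rewrite /wave_step !mulr_sumr; apply: eq_bigr => k _; rewrite /g; ring.
by apply/funext => s; apply/funext => xi; rewrite (E cos) (E sin) /phase_profile mulNr.
Qed.

Lemma phase_profileB x a a' s xi : phase_profile x a s xi - phase_profile x a' s xi =
  phase_profile x (fun s xi => a s xi - a' s xi) s xi.
Proof. by apply/eqP; rewrite eq_complex /=; apply/andP; split; apply/eqP; ring. Qed.

(** The error of the time steps is at most [t / (n + 1)] uniformly, and the damping makes
    it square integrable for [mu]. *)
Lemma el_approx_damped x b t : 0 < b -> 0 <= t ->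
  el_approx H mu (phase_profile x (fun s xi => gdamp b xi * wave_slice t (enorm xi) s)).
Proof.
move=> b0 t0; have b2 : 0 < 2 * b by rewrite mulr_gt0.
apply: (@el_approx_lim _ _ _ hH _ t) => //.
  by apply: admissible_phase; apply: tame_family_damped.
have IG := tempered_gauss_integrable hmu b2.
pose G : R := fine (\int[mu]_xi (gaussd (2 * b) 0 xi)%:E)%E.
have GE : (\int[mu]_xi (gaussd (2 * b) 0 xi)%:E)%E = G%:E.
  by rewrite fineK//; exact: (integrable_fin_num measurableT IG).
have G0 : 0 <= G by rewrite fine_ge0// integral_ge0// => xi _; rewrite lee_fin gaussd_ge0.
pose K := t ^+ 2 * t `^ (2 * H) * G.
have K0 : 0 <= K by rewrite !mulr_ge0// powR_ge0.
move=> eps e0; pose n := Num.truncn (K / eps).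
have nK : K / n.+1%:R <= eps.
  by rewrite ler_pdivrMr// mulrC -ler_pdivrMr// ltW// truncnS_gt.
exists (phase_profile x (fun s xi => gdamp b xi * wave_step n t (enorm xi) s)); split.
  exact: el_approx_damped_step.
have tf := tame_family_step_error b n t0.
have -> : (fun s xi => phase_profile x (fun s xi => gdamp b xi * wave_slice t (enorm xi) s) s xi -
    phase_profile x (fun s xi => gdamp b xi * wave_step n t (enorm xi) s) s xi) =
  phase_profile x (fun s xi => gdamp b xi * (wave_slice t (enorm xi) s - wave_step n t (enorm xi) s)).
  apply/funext => s; apply/funext => xi; rewrite phase_profileB.
  by congr (phase_profile x _ s xi); apply/funext => s'; apply/funext => xi'; rewrite mulrBr.
pose k := (t / n.+1%:R) ^+ 2 * t `^ (2 * H).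
have k0 : 0 <= k by rewrite mulr_ge0 ?sqr_ge0// powR_ge0.
apply: (@le_trans _ _ (\int[mu]_xi (k * gaussd (2 * b) 0 xi)%:E)%E).
  apply: ge0_le_integral => //.
  - by move=> xi _; exact: cenergy_ge0.
  - exact: (measurable_cenergy hH (admissible_phase x tf)).
  - by apply/measurable_EFinP; apply: measurable_funM => //; exact: measurable_gaussd.
  move=> xi _; rewrite (cenergy_phase_profile hH x xi tf).
  have tm : tame t (gdamp b xi * (t / n.+1%:R))
     (fun s => gdamp b xi * (wave_slice t (enorm xi) s - wave_step n t (enorm xi) s)).
    have [M [m1 m2 m3]] := tame_family_tame xi tf; split => // s.
    by rewrite normrM (ger0_norm (gdamp_ge0 _ _)) ler_wpM2l// wave_step_close// enorm_ge0.
  apply: le_trans (energy_finite_le hH t0 tm) _; rewrite lee_fin exprMn.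
  have -> : gdamp b xi ^+ 2 = gaussd (2 * b) 0 xi.
    by rewrite /gdamp -expRM_natl /gaussd subr0; congr expR; ring.
  by rewrite /k le_eqVlt; apply/orP; left; apply/eqP; ring.
rewrite integralZl_real//; [|exact: measurable_gaussd|by move=> xi; exact: gaussd_ge0].
rewrite GE -EFinM lee_fin; apply: le_trans nK.
rewrite (_ : k * G = K / n.+1%:R * (n.+1%:R)^-1); last by rewrite /k /K; field.
by rewrite ler_piMr ?divr_ge0// invf_le1// ler1n.
Qed.

Hypothesis fin_weight : (\int[mu]_xi (wave_weight H (enorm xi))%:E < +oo)%E.

Lemma integrable_wave_weight : mu.-integrable setT (fun xi => (wave_weight H (enorm xi))%:E).
Proof.
have mw := @measurable_wave_weight R d H.
apply/integrableP; split; first exact/measurable_EFinP.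
by under eq_integral do rewrite abse_EFin ger0_norm ?wave_weight_ge0//.
Qed.

(** Letting the damping tend to 0; the energy of the wave, bounded by the weight,
    dominates. *)
Lemma el_approx_wave x t : 0 <= t -> el_approx H mu (wave_profile t x).
Proof.
move=> t0; apply: (@el_approx_lim _ _ _ hH _ t) => //; first exact: admissible_wave_profile.
have [C C0 hC] := wave_energy_upper hH t0.
pose E xi := energy H (wave_slice t (enorm xi)).
have mE : measurable_fun setT E := measurable_energy hH (a := fun s xi => wave_slice t (enorm xi) s) (measurable_slice t).
have E0 xi : (0 <= E xi)%E by exact: energy_ge0.
have EC xi : (E xi <= (C * wave_weight H (enorm xi))%:E)%E by apply: hC => //; exact: enorm_ge0.
have Efin xi : E xi = (fine (E xi))%:E.
  by rewrite fineK// ge0_fin_numE//; apply: le_lt_trans (EC xi) _; exact: ltry.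
pose bn (n : nat) : R := n.+1%:R^-1.
have bn0 n : 0 < bn n by rewrite invr_gt0.
pose c n xi : R := 1 - gdamp (bn n) xi.
have c01 n xi : 0 <= c n xi <= 1.
  by have := gdamp_le1 xi (ltW (bn0 n)); have := gdamp_ge0 (bn n) xi; rewrite /c => ? ?; apply/andP; split; lra.
have mc n : measurable_fun setT (c n) by apply: measurable_funB.
have I0 : mu.-integrable setT (fun xi => (C%:E * (wave_weight H (enorm xi))%:E)%E).
  by apply: integrableZl => //; exact: integrable_wave_weight.
have lim : (\int[mu]_xi (c n xi ^+ 2 * fine (E xi))%:E)%E @[n --> \oo] --> 0%E.
  rewrite -[X in _ --> X](_ : (\int[mu]_xi (cst 0 xi))%E = 0%E); last exact: integral0.
  apply: (@dominated_cvg _ _ _ mu setT _ _ _ (fun xi => C%:E * (wave_weight H (enorm xi))%:E)%E) => //.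
  - move=> n; apply/measurable_EFinP; apply: measurable_funM; first exact: measurable_funX.
    by apply: (measurableT_comp _ mE); exact: fine_measurable.
  - move=> xi _; apply: cvg_EFin; first exact: nearW.
    rewrite (_ : fine \o _ = (fun n => c n xi ^+ 2 * fine (E xi))) //.
    rewrite -[X in _ --> X](mul0r (fine (E xi))); apply: cvgM; last exact: cvg_cst.
    have h : c n xi @[n --> \oo] --> (0 : R).
      rewrite -[X in _ --> X](subrr (1 : R)); apply: cvgB; first exact: cvg_cst.
      rewrite /gdamp -[X in _ --> X]expR0.
      apply: (continuous_cvg _ (@continuous_expR R _)).
      rewrite -oppr0; apply: cvgN; rewrite -[X in _ --> X](mul0r (sqn xi)).
      by apply: cvgM; [exact: (@cvg_harmonic R)|exact: cvg_cst].
    by rewrite -[X in _ --> X](mul0r (0 : R)); under eq_fun do rewrite expr2; exact: cvgM.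
  - move=> n xi _; rewrite -EFinM abse_EFin lee_fin ger0_norm; last first.
      by rewrite mulr_ge0 ?sqr_ge0// fine_ge0.
    have := EC xi; rewrite (Efin xi) lee_fin; apply: le_trans.
    have /andP[h1 h2] := c01 n xi; rewrite /= ler_piMl ?fine_ge0//; exact: exprn_ile1.
move=> eps e0; have [n _ hn] := cvge0_near _ e0 lim.
exists (phase_profile x (fun s xi => gdamp (bn n) xi * wave_slice t (enorm xi) s)); split.
  exact: el_approx_damped.
have tf := tame_family_damped t0 (mc n).
have -> : (fun s xi => wave_profile t x s xi -
    phase_profile x (fun s xi => gdamp (bn n) xi * wave_slice t (enorm xi) s) s xi) =
  phase_profile x (fun s xi => c n xi * wave_slice t (enorm xi) s).
  apply/funext => s; apply/funext => xi.
  rewrite -[wave_profile t x s xi]/(phase_profile x (fun s xi => wave_slice t (enorm xi) s) s xi) phase_profileB.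
  by congr (phase_profile x _ s xi); apply/funext => s'; apply/funext => xi'; rewrite /c mulrBl mul1r.
apply: le_trans (hn n (leqnn n)).
rewrite /xi_energy le_eqVlt; apply/orP; left; apply/eqP; apply: eq_integral => xi _.
rewrite (cenergy_phase_profile hH x xi tf).
rewrite (energyZ hH (c n xi) (wave_slice_tame (enorm_ge0 xi) t0 (lexx t))).
by rewrite -[energy H _]/(E xi) [in LHS]Efin EFinM.
Qed.

Lemma wave_approximation x t : 0 <= t -> exists e : nat -> elementary,
  HP_norm2 H mu (fun s xi => wave_profile t x s xi - el_fourier (e n) s xi) @[n --> \oo] --> 0%E.
Proof.
move=> t0; have [_ ap] := el_approx_wave x t0.
have [e he] := choice (fun n : nat => ap (n.+1%:R^-1) (ltac:(by rewrite invr_gt0))).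
exists e.
have nE n : HP_norm2 H mu (fun s xi => wave_profile t x s xi - el_fourier (e n) s xi) =
   xi_energy H mu (fun s xi => wave_profile t x s xi - el_fourier (e n) s xi).
  have [a ta [a1 a2]] := admissible_common (admissible_wave_profile x t0) (admissible_el (e n)).
  by apply: (HP_norm2E hH mu _ (admissibleB a1 a2)); exact: le_trans ta.
under eq_fun do rewrite nE.
apply: cvge0_le => [n|eps e0]; first exact: xi_energy_ge0.
near=> n; apply: le_trans (he n) _; rewrite lee_fin.
near: n; exists (Num.truncn eps^-1) => // n /= hn.
rewrite -[leRHS]invrK lef_pV2 ?posrE ?invr_gt0//.
by apply: ltW; apply: lt_le_trans (truncnS_gt _) _; rewrite ler_nat ltnS.
Unshelve. all: by end_near. Qed.

End wave_density.

(** * Moments of Gaussian variables *)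

Section density_formula.
Context {R : realType}.
Notation leb1 := (@lebesgue_measure R).

Let level (u c : R) : R := if 0 <= u < c then 1 else 0.

Let level_ge0 u c : 0 <= level u c.
Proof. by rewrite /level; case: ifP. Qed.

Let integral_level (c : R) : 0 <= c -> (\int[leb1]_u (level u c)%:E = c%:E)%E.
Proof.
move=> c0; transitivity (\int[leb1]_u (\1_(`[0, c[%classic) u)%:E)%E.
  apply: eq_integral => u _; rewrite /level indicE; congr (_%:E).
  by rewrite mem_setE in_itv /=; case: (0 <= u < c).
rewrite integral_indic//= setIT lebesgue_measure_itv /= lte_fin.
by case: ltP => [_|c0']; [rewrite oppr0 adde0|congr EFin; apply/eqP; rewrite eq_le c0 c0'].
Qed.

Let measurable_level d (T : measurableType d) (u c : T -> R) :
  measurable_fun setT u -> measurable_fun setT c -> measurable_fun setT (fun x => level (u x) (c x)).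
Proof.
move=> mu mc; apply: measurable_fun_ifT => //.
by apply: measurable_and; [exact: measurable_fun_ler|exact: measurable_fun_ltr].
Qed.

(** Layer-cake: it suffices to know the law on the level sets of [phi]. *)
Lemma integral_density d (T : measurableType d) (P : probability T R) (X : T -> R) (g : R -> R) :
  measurable_fun setT X -> measurable_fun setT g -> (forall x, 0 <= g x) ->
  (forall B, measurable B -> P (X @^-1` B) = \int[leb1]_(x in B) (g x)%:E)%E ->
  forall phi : R -> R, measurable_fun setT phi -> (forall x, 0 <= phi x) ->
  (\int[P]_w (phi (X w))%:E = \int[leb1]_x (phi x * g x)%:E)%E.
Proof.
move=> mX mg g0 law phi mphi phi0.
have mphiX : measurable_fun setT (fun w => phi (X w)) by exact: measurableT_comp mphi mX.
have m1 : measurable_fun setT (fun q : T * R => (level q.2 (phi (X q.1)))%:E).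
  by apply/measurable_EFinP; apply: measurable_level => //; exact: measurableT_comp mphiX _.
have m2 : measurable_fun setT (fun q : R * R => (level q.2 (phi q.1) * g q.1)%:E).
  apply/measurable_EFinP; apply: measurable_funM; last exact: measurableT_comp mg _.
  by apply: measurable_level => //; exact: measurableT_comp mphi _.
transitivity (\int[P]_w \int[leb1]_u (level u (phi (X w)))%:E)%E.
  by apply: eq_integral => w _; rewrite integral_level.
transitivity (\int[leb1]_x \int[leb1]_u (level u (phi x) * g x)%:E)%E; last first.
  apply: eq_integral => x _; under eq_integral do rewrite mulrC.
  rewrite integralZl_real//; last by exact: (@measurable_level _ _ id (fun=> phi x)).
  by rewrite integral_level// -EFinM mulrC.
rewrite (@integral_swap _ _ _ _ R P leb1 (fun w u => (level u (phi (X w)))%:E) m1); last first.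
  by move=> w u; rewrite lee_fin.
rewrite (@integral_swap _ _ _ _ R leb1 leb1 (fun x u => (level u (phi x) * g x)%:E) m2); last first.
  by move=> x u; rewrite lee_fin mulr_ge0.
apply: eq_integral => u _ /=.
pose B := [set x | 0 <= u < phi x].
have mB : measurable B.
  have := @measurable_level _ _ (fun=> u) phi (measurable_cst u) mphi.
  move=> /(_ measurableT [set 1]) => /(_ (measurable_set1 _)); rewrite setTI; congr measurable.
  apply/seteqP; split => x; rewrite /= /level /B /=; case: (0 <= u < phi x) => //.
  by move=> h; have := oner_neq0 R; rewrite h eqxx.
have lE x : level u (phi x) = \1_B x.
  rewrite indicE /level; case: ifP => h; first by rewrite mem_set.
  by rewrite memNset// /B /= h.
transitivity (\int[P]_w (\1_(X @^-1` B) w)%:E)%E; first by apply: eq_integral => w _; rewrite lE.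
rewrite integral_indic//; last by rewrite -[X in measurable X]setTI; exact: mX.
rewrite setIT; transitivity (\int[leb1]_(x in B) (g x)%:E)%E; first exact: law.
rewrite [LHS]integral_mkcond; apply: eq_integral => x _.
by rewrite lE /patch indicE; case: (x \in B); rewrite ?mul1r ?mul0r.
Qed.

End density_formula.

Section normal_law.
Context {R : realType}.
Notation leb1 := (@lebesgue_measure R).

Definition std_pdf (z : R) : R := normal_pdf 0 1 z.

Lemma std_pdfE z : std_pdf z = normal_peak 1 * expR (- (z ^+ 2 / 2)).
Proof.
rewrite /std_pdf normal_pdfE ?oner_neq0// /normal_fun subr0.
by congr (_ * expR _); rewrite expr1n mulr2n; field.
Qed.

Lemma std_pdf_ge0 z : 0 <= std_pdf z. Proof. exact: normal_pdf_ge0. Qed.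

Lemma measurable_std_pdf : measurable_fun setT std_pdf.
Proof. exact: measurable_normal_pdf. Qed.

Lemma std_pdfN z : std_pdf (- z) = std_pdf z.
Proof. by rewrite !std_pdfE sqrrN. Qed.

Lemma integral_std_pdf : (\int[leb1]_z (std_pdf z)%:E = 1)%E.
Proof. exact: integral_normal_pdf. Qed.

Lemma normal_pdf_affine (m s z : R) : 0 < s -> s * normal_pdf m s (s * z + m) = std_pdf z.
Proof.
move=> s0; have sn0 : s != 0 by rewrite gt_eqF.
rewrite std_pdfE normal_pdfE// /normal_fun mulrA; congr (_ * expR _); last first.
  by rewrite addrK exprMn -mulr_natl; field.
rewrite /normal_peak expr1n mul1r -mulrnAr sqrtrM ?sqr_ge0// sqrtr_sqr gtr0_norm// invfM mulrA.
by rewrite divff// mul1r.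
Qed.

(** A variable of mean [m] and deviation [s] is in law [s z + m], with [z] standard; for
    [s = 0] the law is a point mass. *)
Lemma gaussian_law d (T : measurableType d) (P : probability T R) (X : T -> R) :
  measurable_fun setT X -> gaussian P X -> exists m s : R, 0 <= s /\
  forall phi : R -> R, measurable_fun setT phi -> (forall x, 0 <= phi x) ->
  (\int[P]_w (phi (X w))%:E = \int[leb1]_z (phi (s * z + m) * std_pdf z)%:E)%E.
Proof.
move=> mX [m [s [s0 law]]]; exists m, s; split=> // phi mphi phi0.
have [se|sn0] := eqVneq s 0.
  rewrite se in law *; rewrite eqxx in law.
  transitivity (\int[P]_w (phi m)%:E)%E.
    apply: ge0_ae_eq_integral => //.
    - by apply/measurable_EFinP; exact: measurableT_comp mphi mX.
    - by move=> w _; rewrite lee_fin.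
    - by move=> w _; rewrite lee_fin.
    exists (X @^-1` ~` [set m]); split.
    - by rewrite -[X in measurable X]setTI; apply: mX => //; exact: measurableC.
    - have h : P (X @^-1` [set~ m]) = \d_m [set~ m] by apply: law; exact: measurableC.
      by rewrite [LHS]h diracE memNset//= => -[].
    - by move=> w /= h Xm; apply: h => _; rewrite Xm.
  rewrite integral_cst// [X in (_ * X)%E](_ : _ = 1%E) ?mule1; last exact: probability_setT.
  under eq_integral do rewrite mul0r add0r.
  rewrite integralZl_real//; [|exact: measurable_std_pdf|exact: std_pdf_ge0].
  by rewrite integral_std_pdf mule1.
have sp : 0 < s by rewrite lt_neqAle eq_sym sn0.
rewrite (@integral_density _ _ _ _ X (normal_pdf m s))//; last 3 first.
- exact: measurable_normal_pdf.
- by move=> x; exact: normal_pdf_ge0.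
- by move=> B mB; rewrite law// (negbTE sn0).
have mf : measurable_fun setT (fun x => (phi x * normal_pdf m s x)%:E).
  by apply/measurable_EFinP; apply: measurable_funM => //; exact: measurable_normal_pdf.
rewrite (@integral_affine _ s m _ sn0 mf); last by move=> x; rewrite lee_fin mulr_ge0// normal_pdf_ge0.
have ma : measurable_fun setT (fun z : R => s * z + m) by meas.
rewrite -integralZl_real//; last 2 first.
- by apply: measurable_funM; [exact: measurableT_comp mphi _|apply: measurableT_comp ma; exact: measurable_normal_pdf].
- by move=> z; rewrite mulr_ge0// normal_pdf_ge0.
apply: eq_integral => z _; congr EFin.
by rewrite -(normal_pdf_affine m z sp) gtr0_norm//; ring.
Qed.

(** A lower bound on the variance of the standard density, from its values on [[1, 2]]. *)
Definition var_lb : R := normal_peak 1 * expR (- 2).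

Lemma var_lb_gt0 : 0 < var_lb.
Proof. by rewrite mulr_gt0 ?expR_gt0// normal_peak_gt0 ?oner_neq0. Qed.

Lemma var_lb_le : (var_lb%:E <= \int[leb1]_z (z ^+ 2 * std_pdf z)%:E)%E.
Proof.
apply: (@le_trans _ _ (\int[leb1]_z (var_lb * \1_(`[1, 2]%classic) z)%:E)%E).
  rewrite integralZl_real ?(ltW var_lb_gt0)//.
  rewrite integral_indic//= setIT lebesgue_measure_itv /= lte_fin ltr1n -EFinD -EFinM lee_fin.
  by rewrite (_ : 2 - 1 = 1) ?mulr1//; ring.
apply: le_integral_real.
- by apply: measurable_funM => //; exact: measurable_indic.
- by apply: measurable_funM; [exact: measurable_funX|exact: measurable_std_pdf].
- by move=> z; rewrite mulr_ge0 ?(ltW var_lb_gt0).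
move=> z; rewrite indicE mem_setE in_itv /=; case: (boolP (1 <= z <= 2)) => [/andP[z1 z2]|_]; last first.
  by rewrite mulr0 mulr_ge0 ?sqr_ge0// std_pdf_ge0.
rewrite mulr1 std_pdfE /var_lb mulrCA ler_wpM2l ?normal_peak_ge0//.
apply: (@le_trans _ _ (expR (- (z ^+ 2 / 2)))); first by rewrite ler_expR; nra.
by rewrite ler_peMl ?expR_ge0//; nra.
Qed.

Lemma abs_moment_fin (p : R) : 0 <= p -> exists2 K, 0 <= K &
  (\int[leb1]_z (((1 + `|z|) `^ p) * std_pdf z)%:E <= K%:E)%E.
Proof.
move=> p0; pose N := (Num.truncn p).+1.
have [K K0 hK] := @pow_le_exp R 1 N ltr01.
pose c : R := K * expR 2 * normal_peak 1.
have c0 : 0 <= c by rewrite !mulr_ge0 ?expR_ge0 ?normal_peak_ge0.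
have a0 : 0 < 1 / 4 :> R by [].
exists (c * Num.sqrt (pi / (1 / 4))); first by rewrite mulr_ge0.
rewrite EFinM -(@integral_gauss _ _ 0 a0) -integralZl_real//; last 2 first.
- by apply: continuous_measurable_fun; exact: continuous_gauss.
- by move=> x; exact: expR_ge0.
apply: le_integral_real.
- apply: measurable_funM; last exact: measurable_std_pdf.
  by apply: (measurableT_comp (measurable_powR _)); apply: measurable_funD => //; exact: normr_measurable.
- by apply: measurable_funM => //; apply: continuous_measurable_fun; exact: continuous_gauss.
- by move=> z; rewrite mulr_ge0 ?powR_ge0 ?std_pdf_ge0.
move=> z; have z1 : 1 <= 1 + `|z| by rewrite lerDl.
have z0 : 0 <= 1 + `|z| by rewrite (le_trans _ z1).
have h1 : (1 + `|z|) `^ p <= K * expR (2 + z ^+ 2 / 4).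
  apply: (@le_trans _ _ ((1 + `|z|) ^+ N)).
    by rewrite -powR_mulrn// ler_powR// ltW// truncnS_gt.
  apply: le_trans (hK _ z0) _; rewrite ler_wpM2l// ler_expR mul1r.
  have : z ^+ 2 = `|z| ^+ 2 by rewrite real_normK ?num_real.
  by move=> ->; have := sqr_ge0 (`|z| - 2); nra.
apply: le_trans (ler_wpM2r (std_pdf_ge0 z) h1) _.
rewrite std_pdfE /c /gauss subr0 le_eqVlt; apply/orP; left; apply/eqP.
transitivity (K * normal_peak 1 * (expR (2 + z ^+ 2 / 4) * expR (- (z ^+ 2 / 2)))); first by ring.
transitivity (K * normal_peak 1 * (expR 2 * expR (- (1 / 4) * z ^+ 2))); last by ring.
by rewrite -!expRD; congr (_ * expR _); field.
Qed.

(** By symmetry of the density, the second moment controls both the mean and the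
    deviation of a Gaussian variable, hence all its moments. *)
Lemma gaussian_moments (p B : R) : 0 <= p -> 0 <= B -> exists2 C, 0 <= C &
  forall d (T : measurableType d) (P : probability T R) (X : T -> R),
  measurable_fun setT X -> gaussian P X -> (\int[P]_w (X w ^+ 2)%:E <= B%:E)%E ->
  (\int[P]_w (`|X w| `^ p)%:E <= C%:E)%E.
Proof.
move=> p0 B0; have [K K0 hK] := abs_moment_fin p0.
pose A : R := Num.sqrt B + Num.sqrt (B / var_lb).
have A0 : 0 <= A by rewrite addr_ge0.
exists (A `^ p * K); first by rewrite mulr_ge0// powR_ge0.
move=> d T P X mX gX XB; have [m [s [s0 law]]] := gaussian_law mX gX.
have mg := measurable_std_pdf; have g0 := std_pdf_ge0.
have msq (a b : R) : measurable_fun setT (fun z : R => (a * z + b) ^+ 2 * std_pdf z).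
  by apply: measurable_funM => //; meas.
have h1 : (\int[leb1]_z ((s * z + m) ^+ 2 * std_pdf z)%:E <= B%:E)%E.
  by rewrite -(law (fun x => x ^+ 2)) ?XB// => x; exact: sqr_ge0.
(* The density is even. *)
have h2 : (\int[leb1]_z ((- s * z + m) ^+ 2 * std_pdf z)%:E <= B%:E)%E.
  apply: le_trans h1.
  rewrite (@integral_affine _ (-1) 0 (fun z => ((- s * z + m) ^+ 2 * std_pdf z)%:E)); last 3 first.
  - by rewrite oppr_eq0 oner_neq0.
  - exact/measurable_EFinP.
  - by move=> z; rewrite lee_fin mulr_ge0// sqr_ge0.
  rewrite normrN1 mul1e le_eqVlt; apply/orP; left; apply/eqP; apply: eq_integral => z _; congr EFin.
  by rewrite addr0 mulN1r std_pdfN mulrNN.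
have m1 : measurable_fun setT (fun z => m ^+ 2 * std_pdf z) by exact: measurable_funM.
have m2 : measurable_fun setT (fun z : R => z ^+ 2 * std_pdf z) by apply: measurable_funM => //; exact: measurable_funX.
have m3 : measurable_fun setT (fun z : R => s ^+ 2 * (z ^+ 2 * std_pdf z)) by exact: measurable_funM.
have p1 z : 0 <= m ^+ 2 * std_pdf z by rewrite mulr_ge0// sqr_ge0.
have p2 z : 0 <= z ^+ 2 * std_pdf z by rewrite mulr_ge0// sqr_ge0.
have p3 z : 0 <= s ^+ 2 * (z ^+ 2 * std_pdf z) by rewrite mulr_ge0// sqr_ge0.
have sum : (\int[leb1]_z ((m ^+ 2) * std_pdf z + s ^+ 2 * (z ^+ 2 * std_pdf z))%:E <= B%:E)%E.
  have q1 (a : R) z : 0 <= (a * z + m) ^+ 2 * std_pdf z by rewrite mulr_ge0// sqr_ge0.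
  have h : (\int[leb1]_z ((s * z + m) ^+ 2 * std_pdf z + (- s * z + m) ^+ 2 * std_pdf z)%:E <= (2 * B)%:E)%E.
    have hD := integralD_real leb1 (msq s m) (msq (- s) m) (q1 s) (q1 (- s)).
    have hE := leeD h1 h2; rewrite -EFinD in hE.
    have -> : (2 * B)%:E = (B + B)%:E by congr EFin; ring.
    by apply: le_trans hE; rewrite le_eqVlt; apply/orP; left; apply/eqP; exact: hD.
  have e : (\int[leb1]_z ((s * z + m) ^+ 2 * std_pdf z + (- s * z + m) ^+ 2 * std_pdf z)%:E =
     2%:E * \int[leb1]_z ((m ^+ 2) * std_pdf z + s ^+ 2 * (z ^+ 2 * std_pdf z))%:E)%E.
    rewrite -integralZl_real//; [|exact: measurable_funD|by move=> z; rewrite addr_ge0].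
    by apply: eq_integral => z _; congr EFin; ring.
  by move: h; rewrite e EFinM lee_pmul2l.
have mB : m ^+ 2 <= B.
  rewrite -lee_fin; apply: le_trans sum; apply: (@le_trans _ _ (\int[leb1]_z (m ^+ 2 * std_pdf z)%:E)%E).
    by rewrite integralZl_real ?sqr_ge0// integral_std_pdf mule1.
  by apply: le_integral_real => //; [exact: measurable_funD|move=> z; rewrite lerDl].
have sB : s ^+ 2 * var_lb <= B.
  rewrite -lee_fin; apply: le_trans sum; apply: (@le_trans _ _ (\int[leb1]_z (s ^+ 2 * (z ^+ 2 * std_pdf z))%:E)%E).
    by rewrite integralZl_real ?sqr_ge0// EFinM; apply: lee_wpmul2l; [rewrite lee_fin sqr_ge0|exact: var_lb_le].
  by apply: le_integral_real => //; [exact: measurable_funD|move=> z; rewrite lerDr].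
have mA : `|m| <= Num.sqrt B by rewrite -sqrtr_sqr ler_wsqrtr.
have sA : s <= Num.sqrt (B / var_lb).
  by rewrite -[leLHS]ger0_norm// -sqrtr_sqr ler_wsqrtr// ler_pdivlMr// var_lb_gt0.
rewrite (law (fun x => `|x| `^ p)); last 2 first.
- by apply: (measurableT_comp (measurable_powR _)); exact: normr_measurable.
- by move=> x; exact: powR_ge0.
apply: (@le_trans _ _ (\int[leb1]_z (A `^ p * ((1 + `|z|) `^ p * std_pdf z))%:E)%E); last first.
  rewrite integralZl_real ?powR_ge0// ?EFinM; last 2 first.
  - apply: measurable_funM => //; apply: (measurableT_comp (measurable_powR _)).
    by apply: measurable_funD => //; exact: normr_measurable.
  - by move=> z; rewrite mulr_ge0// powR_ge0.
  by apply: lee_wpmul2l => //; rewrite lee_fin powR_ge0.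
apply: le_integral_real.
- apply: measurable_funM => //; apply: (measurableT_comp (measurable_powR _)).
  by apply: (measurableT_comp (@normr_measurable R setT)); meas.
- apply: measurable_funM => //; apply: measurable_funM => //; apply: (measurableT_comp (measurable_powR _)).
  by apply: measurable_funD => //; exact: normr_measurable.
- by move=> z; rewrite mulr_ge0// powR_ge0.
move=> z; rewrite mulrA ler_wpM2r// -powRM ?addr_ge0//.
rewrite ge0_ler_powR ?nnegrE// ?mulr_ge0 ?addr_ge0//.
apply: le_trans (ler_normD _ _) _; rewrite normrM (ger0_norm s0).
have nz := normr_ge0 z; have q1 := sqrtr_ge0 B; have q2 := sqrtr_ge0 (B / var_lb).
rewrite /A; nra.
Qed.

End normal_law.

(** * Isometry of the Wiener integral *)

Section square_integrable.
Context {R : realType} d (T : measurableType d) (m : {measure set T -> \bar R}).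

Definition sq_integrable (X : T -> R) : Prop :=
  measurable_fun setT X /\ m.-integrable setT (fun w => (X w ^+ 2)%:E).

Lemma sq_integrableP (X : T -> R) : measurable_fun setT X ->
  (\int[m]_w (X w ^+ 2)%:E < +oo)%E -> sq_integrable X.
Proof.
move=> mX fX; split => //; apply/integrableP; split.
  by apply/measurable_EFinP; exact: measurable_funX.
by under eq_integral do rewrite abse_EFin ger0_norm ?sqr_ge0//.
Qed.

Lemma sq_integrable_mul (X Y : T -> R) : sq_integrable X -> sq_integrable Y ->
  m.-integrable setT (EFin \o (fun w => X w * Y w)).
Proof.
move=> [mX iX] [mY iY]; apply: (le_integrable measurableT _ _ (integrableD measurableT iX iY)).
  by apply/measurable_EFinP; exact: measurable_funM.
move=> w _; rewrite /= lee_fin normrM [leRHS]ger0_norm; last by rewrite addr_ge0// sqr_ge0.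
rewrite -(real_normK (num_real (X w))) -(real_normK (num_real (Y w))).
have := sqr_ge0 (`|X w| - `|Y w|); have := normr_ge0 (X w); have := normr_ge0 (Y w); nra.
Qed.

End square_integrable.

Section noise_moments.
Context {R : realType} {d : nat} (H : R) (hH : 1 / 2 < H < 1).
Variables (mu : {measure set 'rV[R]_d -> \bar R}) (f : 'rV[R]_d -> R).
Hypothesis hmu : tempered_measure mu.
Hypothesis f_ge0 : forall x, 0 <= f x.
Hypothesis mf : measurable_fun setT f.
Hypothesis hf : distr_is_function (distr_fourier (distr_of_measure mu)) (fun x => (f x)%:C%C).
Context {dOm : measure_display} {Om : measurableType dOm} (P : probability Om R).
Variable W : R -> set 'rV[R]_d -> {RV P >-> R}.
Hypothesis hW : gaussian_noise H f W.

Lemma noise_covariance t s A B : 0 <= t -> 0 <= s -> bounded_borel A -> bounded_borel B ->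
  (\int[P]_w (W t A w * W s B w)%:E = (RH H t s * cov f A B)%:E)%E.
Proof.
move=> t0 s0 bA bB; have [_ _ h] := hW.
by have := h t s A B t0 s0 bA bB; rewrite unlock (covE hmu f_ge0 mf hf bA bB) -EFinM.
Qed.

Lemma sq_integrable_noise t A : 0 <= t -> bounded_borel A -> sq_integrable P (W t A).
Proof.
move=> t0 bA; apply: sq_integrableP; first exact: measurable_funPT.
by under eq_integral do rewrite expr2; rewrite noise_covariance// ltry.
Qed.

Lemma measurable_el_integral (e : elementary) : measurable_fun setT (el_integral W e).
Proof.
apply: measurable_sum => j; apply: measurable_funM => //; exact: measurable_funPT.
Qed.

(** Expand the square and use the covariance of the noise. *)
Lemma el_integral_moment2 (e : elementary) :
  (\int[P]_w (el_integral W e w ^+ 2)%:E = (el_norm2 f H e)%:E)%E.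
Proof.
pose X (j : 'I_(el_size e)) (w : Om) : R := W (el_time j) (@el_set _ _ e j) w.
have sX j : sq_integrable P (X j).
  by apply: sq_integrable_noise; [exact: el_time_ge0|exact: el_set_bounded_borel].
pose F (j k : 'I_(el_size e)) w := (el_coef j * el_coef k) * (X j w * X k w).
have IF j k : P.-integrable setT (EFin \o F j k).
  by apply: (integrableZl measurableT _ (sq_integrable_mul (sX j) (sX k))).
have IS j : P.-integrable setT (EFin \o (fun w => \sum_k F j k w)).
  rewrite (_ : _ \o _ = (fun w => \sum_k (F j k w)%:E)%E); last by apply/funext => w; rewrite /= -sumEFin.
  by apply: integrable_sum => // k _; exact: IF.
have ISS : P.-integrable setT (EFin \o (fun w => \sum_j \sum_k F j k w)).
  rewrite (_ : _ \o _ = (fun w => \sum_j (\sum_k F j k w)%R%:E)%E); last by apply/funext => w; rewrite /= -sumEFin.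
  by apply: integrable_sum => // k _; exact: IS.
transitivity (\int[P]_w (\sum_j \sum_k F j k w)%R%:E)%E.
  apply: eq_integral => w _; congr EFin; rewrite expr2 /el_integral big_distrlr /=.
  by apply: eq_bigr => j _; apply: eq_bigr => k _; rewrite /F /X; ring.
rewrite -[LHS]fineK; last exact: (integrable_fin_num measurableT ISS).
congr EFin; rewrite -/(Rintegral P setT (fun w => \sum_j \sum_k F j k w)) Rintegral_sum//.
apply: eq_bigr => j _; rewrite Rintegral_sum//; apply: eq_bigr => k _.
rewrite /Rintegral /F.
under eq_integral do rewrite EFinM.
rewrite integralZl//; last exact: sq_integrable_mul.
rewrite noise_covariance; [|exact: el_time_ge0|exact: el_time_ge0|exact: el_set_bounded_borel|exact: el_set_bounded_borel].
by rewrite -EFinM /= mulrA.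
Qed.

Lemma el_integral_sub e e' w : el_integral W (el_sub e e') w = el_integral W e w - el_integral W e' w.
Proof.
rewrite /el_integral (sum_el_cat e (el_scale (-1) e') (fun c t A => c * W t A w)).
congr (_ + _); rewrite -sumrN; apply: eq_bigr => j _.
by rewrite /= mulN1r mulNr.
Qed.

(** The covariance of the noise is the scalar product of the indicators. *)
Lemma el_integral_isometry e e' :
  (\int[P]_w ((el_integral W e w - el_integral W e' w) ^+ 2)%:E =
   HP_norm2 H mu (fun s xi => (el_fourier e s xi - el_fourier e' s xi)%R))%E.
Proof.
transitivity (\int[P]_w (el_integral W (el_sub e e') w ^+ 2)%:E)%E.
  by apply: eq_integral => w _; rewrite el_integral_sub.
rewrite el_integral_moment2 -(HP_norm2_el hH hmu f_ge0 mf hf).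
by congr (HP_norm2 H mu); apply/funext => s; apply/funext => xi; rewrite el_fourier_sub.
Qed.

Lemma el_integral_norm2 e :
  (\int[P]_w (el_integral W e w ^+ 2)%:E = HP_norm2 H mu (el_fourier e))%E.
Proof. by rewrite el_integral_moment2 (HP_norm2_el hH hmu f_ge0 mf hf). Qed.

End noise_moments.

(** * Mean square limits *)

Section square_limits.
Context {R : realType} d (T : measurableType d) (m : {measure set T -> \bar R}).
Implicit Types (X : T -> R) (Y Z : nat -> T -> R).

(** Fatou, where the convergence holds almost everywhere. *)
Lemma fatou_ae_le (u : nat -> T -> \bar R) (v : T -> \bar R) (c : \bar R) :
  (forall n, measurable_fun setT (u n)) -> (forall n x, (0 <= u n x)%E) ->
  measurable_fun setT v -> (forall x, (0 <= v x)%E) ->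
  {ae m, forall x, u n x @[n --> \oo] --> v x} -> (forall n, (\int[m]_x u n x <= c)%E) ->
  (\int[m]_x v x <= c)%E.
Proof.
move=> mu u0 mv v0 uv uc.
have -> : (\int[m]_x v x = \int[m]_x limn_einf (u^~ x))%E.
  apply: ge0_ae_eq_integral => //.
  - rewrite (_ : (fun x => _) = (fun x => - limn_esup (fun n => - u n x))%E); last first.
      by apply/funext => x; rewrite /limn_einf.
    apply: measurableT_comp => //; apply: measurable_fun_limn_esup => n.
    exact: measurableT_comp.
  - move=> x _; have c0 : (0 : \bar R) @[n --> \oo] --> (0 : \bar R) by exact: cvg_cst.
    have [<- _] := cvg_limn_einf_sup c0; apply: le_limn_einf => n; exact: u0.
  apply: filterS uv => x h _; by have [-> _] := cvg_limn_einf_sup h.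
apply: le_trans (fatou _ measurableT mu (fun n x _ => u0 n x)) _.
have cl : c @[n --> \oo] --> c by exact: cvg_cst.
have [<- _] := cvg_limn_einf_sup cl; exact: le_limn_einf.
Qed.

Lemma geometric_half_le (N : nat) : \sum_(n < N) (2^-1 : R) ^+ n <= 2.
Proof.
have -> : \sum_(n < N) (2^-1 : R) ^+ n = 2 - 2 * 2^-1 ^+ N.
  elim: N => [|N IH]; first by rewrite big_ord0 expr0 mulr1 subrr.
  by rewrite big_ord_recr /= IH exprS; field.
by rewrite gerBl mulr_ge0// exprn_ge0// invr_ge0.
Qed.

Lemma ae_summable (g : nat -> T -> R) : (forall n, measurable_fun setT (g n)) ->
  (forall n x, 0 <= g n x) -> (forall n, (\int[m]_x (g n x)%:E <= ((2^-1) ^+ n)%:E)%E) ->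
  {ae m, forall x, exists M, forall N, \sum_(n < N) g n x <= M}.
Proof.
move=> mg g0 ig; pose G x := (\sum_(0 <= n <oo) (g n x)%:E)%E.
have mG : measurable_fun setT G.
  by apply: ge0_emeasurable_sum => // [n x _ _|n _]; [rewrite lee_fin|exact/measurable_EFinP].
have G0 x : (0 <= G x)%E by apply: nneseries_ge0 => n _ _; rewrite lee_fin.
have IG : m.-integrable setT G.
  apply/integrableP; split => //.
  under eq_integral do rewrite gee0_abs//.
  rewrite integral_nneseries//; [|by move=> n; exact/measurable_EFinP|by move=> n x _; rewrite lee_fin].
  apply: (@le_lt_trans _ _ 2%:E); last exact: ltry.
  apply: lime_le.
    by apply: is_cvg_ereal_nneg_natsum => n _; apply: integral_ge0 => x _; rewrite lee_fin.
  apply: nearW => N; rewrite /= big_mkord.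
  apply: (@le_trans _ _ (\sum_(n < N) ((2^-1 : R) ^+ n)%:E)%E); first by apply: lee_sum => n _; exact: ig.
  by rewrite sumEFin lee_fin; exact: geometric_half_le.
apply: filterS (integrable_ae measurableT IG) => x /(_ I) hx.
exists (fine (G x)) => N; rewrite -lee_fin fineK// -sumEFin -(big_mkord predT (fun n => (g n x)%:E)).
by apply: nneseries_lim_ge => n _ _; rewrite lee_fin.
Qed.

(** The sum of the squared errors has a finite integral. *)
Lemma fast_ae_cvg Y X : (forall n, measurable_fun setT (Y n)) -> measurable_fun setT X ->
  (forall n, (\int[m]_w ((Y n w - X w) ^+ 2)%:E <= ((2^-1) ^+ n)%:E)%E) ->
  {ae m, forall w, Y n w @[n --> \oo] --> X w}.
Proof.
move=> mY mX h.
have mg n : measurable_fun setT (fun w => (Y n w - X w) ^+ 2).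
  by apply: measurable_funX; exact: measurable_funB.
have := ae_summable mg (fun n w => sqr_ge0 _) h; apply: filterS => w [M hM].
have sc : cvgn (series (fun n => (Y n w - X w) ^+ 2)).
  apply: nondecreasing_is_cvgn.
    by apply: nondecreasing_series => n _ _; exact: sqr_ge0.
  by exists M => _ [N _ <-]; rewrite /series /= big_mkord.
have c0 := cvg_series_cvg_0 sc.
have : `|Y n w - X w| @[n --> \oo] --> (0 : R).
  rewrite -[X in _ --> X](@sqrtr0 R).
  rewrite (_ : (fun n => _) = (fun n => Num.sqrt ((Y n w - X w) ^+ 2))); last first.
    by apply/funext => n; rewrite sqrtr_sqr.
  by apply: (continuous_cvg _ (@sqrt_continuous R 0)); exact: c0.
move/norm_cvg0P => h0; rewrite -[X in _ --> X]add0r.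
rewrite (_ : (fun n => _) = (fun n => (Y n w - X w) + X w)); last by apply/funext => n; rewrite subrK.
by apply: cvgD => //; exact: cvg_cst.
Qed.

(** With the factor [4^n] the squared increments are still summable, so that the
    increments are almost everywhere below a geometric sequence. *)
Lemma fast_ae_cauchy Z : (forall n, measurable_fun setT (Z n)) ->
  (forall n, (\int[m]_w ((Z n.+1 w - Z n w) ^+ 2)%:E <= ((8^-1) ^+ n)%:E)%E) ->
  {ae m, forall w, cvgn (fun n => Z n w)}.
Proof.
move=> mZ h.
have md n : measurable_fun setT (fun w => (Z n.+1 w - Z n w) ^+ 2).
  by apply: measurable_funX; exact: measurable_funB.
pose g n w := 4 ^+ n * (Z n.+1 w - Z n w) ^+ 2.
have mg n : measurable_fun setT (g n) by exact: measurable_funM.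
have g0 n w : 0 <= g n w by apply: mulr_ge0; [exact: exprn_ge0|exact: sqr_ge0].
have hg n : (\int[m]_w (g n w)%:E <= ((2^-1) ^+ n)%:E)%E.
  rewrite integralZl_real ?exprn_ge0//; last by move=> w; exact: sqr_ge0.
  apply: (@le_trans _ _ ((4 ^+ n)%:E * ((8^-1) ^+ n)%:E)%E).
    by apply: lee_wpmul2l; [rewrite lee_fin exprn_ge0|exact: h].
  by rewrite -EFinM lee_fin -exprMn (_ : 4 * 8^-1 = 2^-1 :> R)//; field.
have := ae_summable mg g0 hg; apply: filterS => w [M hM].
have gM n : g n w <= M.
  apply: le_trans (hM n.+1); rewrite big_ord_recr /= lerDr; exact: sumr_ge0.
have M0 : 0 <= M := le_trans (g0 0%N w) (gM 0%N).
have dle n : `|telescope (fun n => Z n w) n| <= geometric (Num.sqrt M) 2^-1 n.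
  rewrite /telescope /geometric /= -sqrtr_sqr.
  have -> : (2^-1 : R) ^+ n = Num.sqrt ((4^-1) ^+ n).
    rewrite -[LHS]ger0_norm ?exprn_ge0 ?invr_ge0// -sqrtr_sqr exprAC; congr (Num.sqrt (_ ^+ n)).
    by field.
  rewrite -sqrtrM// ler_wsqrtr// exprVn ler_pdivlMr ?exprn_gt0//.
  by rewrite mulrC; exact: gM.
have cs : cvgn (series (telescope (fun n => Z n w))).
  apply: normed_cvg; apply: (@series_le_cvg _ _ (geometric (Num.sqrt M) 2^-1)) => //.
  - by move=> n; exact: normr_ge0.
  - by move=> n; rewrite /geometric /= mulr_ge0// exprn_ge0// invr_ge0.
  - by apply: is_cvg_geometric_series; rewrite ger0_norm ?invr_ge0// invf_lt1// ltr1n.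
have -> : (fun n => Z n w) = (fun n => Z 0%N w + series (telescope (fun n => Z n w)) n).
  by apply/funext => n; exact: (eq_sum_telescope (fun n => Z n w)).
by apply: is_cvgD => //; exact: is_cvg_cst.
Qed.

(** A fast subsequence converges almost everywhere to the upper limit taken as [X], and
    Fatou's lemma bounds the distance to [X]. *)
Lemma L2_complete Y : (forall n, measurable_fun setT (Y n)) ->
  (forall eps : R, 0 < eps -> exists N, forall p q, (N <= p)%N -> (N <= q)%N ->
     (\int[m]_w ((Y p w - Y q w) ^+ 2)%:E <= eps%:E)%E) ->
  exists2 X : T -> R, measurable_fun setT X &
    (\int[m]_w ((Y n w - X w) ^+ 2)%:E)%E @[n --> \oo] --> 0%E.
Proof.
move=> mY cauchy.
have e8 n : 0 < (8^-1 : R) ^+ n by rewrite exprn_gt0.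
have [N hN] := choice (fun n => cauchy _ (e8 n)).
(* A nondecreasing sequence of indices above the thresholds [N]. *)
pose k n := (\sum_(i < n.+1) N i)%N.
have kN n : (N n <= k n)%N by rewrite /k big_ord_recr /= leq_addl.
have kS n : (k n <= k n.+1)%N by rewrite /k [in leqRHS]big_ord_recr /= leq_addr.
pose Z n := Y (k n).
have mZ n : measurable_fun setT (Z n) := mY (k n).
have aeZ : {ae m, forall w, cvgn (fun n => Z n w)}.
  by apply: fast_ae_cauchy => // n; apply: hN => //; exact: leq_trans (kN n) (kS n).
pose X w := fine (limn_esup (fun n => (Z n w)%:E)).
have mX : measurable_fun setT X.
  apply: (measurableT_comp (@fine_measurable R setT measurableT)).
  by apply: measurable_fun_limn_esup => n; exact/measurable_EFinP.
have ZX : {ae m, forall w, Z n w @[n --> \oo] --> X w}.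
  apply: filterS aeZ => w cw; rewrite /X.
  have h : (Z n w)%:E @[n --> \oo] --> (limn (fun n => Z n w))%:E.
    by apply: cvg_EFin; [exact: nearW|exact: cw].
  by have [_ ->] := cvg_limn_einf_sup h.
exists X => //; apply: cvge0_le => [n|eps e0].
  by apply: integral_ge0 => w _; rewrite lee_fin sqr_ge0.
have [j0 hj0] : exists j0, (8^-1 : R) ^+ j0 <= eps.
  have : (8^-1 : R) ^+ j @[j --> \oo] --> (0 : R).
    by apply: cvg_expr; rewrite ger0_norm ?invr_ge0// invf_lt1// ltr1n.
  by move=> /cvgr0_norm_le /(_ _ e0)[j _ hj]; exists j; have := hj j (leqnn j); rewrite /= ger0_norm// ltW.
have kmono j : (k j0 <= k (j + j0))%N.
  by elim: j => [|j IH]; [rewrite add0n|rewrite addSn; exact: leq_trans IH (kS _)].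
exists (N j0) => // n /= Nn.
apply: (@fatou_ae_le (fun j w => ((Y n w - Z (j + j0)%N w) ^+ 2)%:E)) => //.
- by move=> j; apply/measurable_EFinP; apply: measurable_funX; exact: measurable_funB.
- by move=> j w; rewrite lee_fin sqr_ge0.
- by apply/measurable_EFinP; apply: measurable_funX; exact: measurable_funB.
- by move=> w; rewrite lee_fin sqr_ge0.
- apply: filterS ZX => w cw; apply: cvg_EFin; first exact: nearW.
  have h : Y n w - Z (j + j0)%N w @[j --> \oo] --> Y n w - X w.
    by apply: cvgB; [exact: cvg_cst|rewrite (cvg_shiftn j0 (fun j => Z j w))].
  rewrite (_ : fine \o _ = (fun j => (Y n w - Z (j + j0)%N w) * (Y n w - Z (j + j0)%N w))).
    by rewrite expr2; exact: cvgM.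
  by apply/funext => j; rewrite /= expr2.
- move=> j; apply: le_trans (hN j0 _ _ Nn _) _; last by rewrite lee_fin.
  by apply: leq_trans (kN j0) _; exact: kmono.
Qed.

End square_limits.

(** * Mean square continuity of the wave *)

Section wave_continuity.
Context {R : realType} {d : nat} (H : R) (hH : 1 / 2 < H < 1).
Variable mu : {measure set 'rV[R]_d -> \bar R}.
Hypothesis fin_weight : (\int[mu]_xi (wave_weight H (enorm xi))%:E < +oo)%E.
Implicit Types (xi x : 'rV[R]_d).

(** At times where only one of the two slices is on, the other time is within [|t - t0|]
    of the end point, where the multiplier vanishes. *)
Lemma wave_slice_diff (t t0 r s : R) : 0 <= t -> 0 <= t0 -> 0 <= r ->
  `|wave_slice t r s - wave_slice t0 r s| <= `|t - t0|.
Proof.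
move=> tp t0p rp; rewrite /wave_slice.
have [/andP[s0 st]|st] := boolP (0 <= s <= t); have [/andP[s0' st0]|st0] := boolP (0 <= s <= t0).
- by apply: le_trans (wave_lipschitz _ _ rp) _; rewrite (_ : t - s - (t0 - s) = t - t0)//; ring.
- rewrite subr0; apply: le_trans (norm_wave_le _ rp) _.
  have : t0 < s by move: st0; rewrite s0 /= -ltNge.
  by move=> ts; rewrite !ger0_norm; lra.
- rewrite sub0r normrN; apply: le_trans (norm_wave_le _ rp) _.
  have : t < s by move: st; rewrite s0' /= -ltNge.
  by move=> ts; rewrite ger0_norm ?ler0_norm; lra.
- by rewrite subrr normr0.
Qed.

Let phase_gap x x0 xi : R := `|cos (dotp x xi) - cos (dotp x0 xi)| + `|sin (dotp x xi) - sin (dotp x0 xi)|.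

Lemma ctame_wave_diff t t0 T x x0 xi : 0 <= t -> 0 <= t0 -> t <= T -> t0 <= T ->
  ctame T (`|t - t0| + phase_gap x x0 xi * t0)
    (fun s => wave_profile t x s xi - wave_profile t0 x0 s xi).
Proof.
move=> tp t0p tT t0T.
have [T' hT [a1 a2]] := admissible_common (admissible_le tT (admissible_wave_profile x tp)) (admissible_le t0T (admissible_wave_profile x0 t0p)).
have [M [[m1 _ _] [m2 _ _]]] := admissible_ctame xi (admissibleB a1 a2).
have bd (c c0 s : R) : `|c| <= 1 -> `|c - c0| <= phase_gap x x0 xi ->
   `|c * wave_slice t (enorm xi) s - c0 * wave_slice t0 (enorm xi) s| <= `|t - t0| + phase_gap x x0 xi * t0.
  move=> c1 cc.
  have -> : c * wave_slice t (enorm xi) s - c0 * wave_slice t0 (enorm xi) s =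
    c * (wave_slice t (enorm xi) s - wave_slice t0 (enorm xi) s) + (c - c0) * wave_slice t0 (enorm xi) s by ring.
  apply: le_trans (ler_normD _ _) _; rewrite !normrM; apply: lerD.
    rewrite -[leRHS]mul1r ler_pM// wave_slice_diff// enorm_ge0//.
  by rewrite ler_pM// wave_slice_le// enorm_ge0.
have out (a : R) s : T < `|s| -> 0 <= a -> a <= T -> wave_slice a (enorm xi) s = 0.
  by move=> Ts a0 aT; have [_ _ ->//] := wave_slice_tame (enorm_ge0 xi) a0 (lexx a); exact: le_lt_trans Ts.
split; split.
- exact: m1.
- by move=> s; apply: bd; [exact: norm_cos_le1|rewrite lerDl].
- by move=> s Ts /=; rewrite !out// !mulr0 subrr.
- exact: m2.
- move=> s; apply: bd; first by rewrite normrN norm_sin_le1.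
  by rewrite -opprD normrN lerDr.
- by move=> s Ts /=; rewrite !out// !mulr0 subrr.
Qed.

(** Pointwise in the frequency the profiles converge uniformly in time, and the energies
    are bounded by the weight. *)
Lemma wave_profile_cvg (t : nat -> R) (x : nat -> 'rV[R]_d) t0 x0 :
  0 <= t0 -> (forall n, 0 <= t n <= t0 + 1) -> t n @[n --> \oo] --> t0 ->
  x n @[n --> \oo] --> x0 ->
  xi_energy H mu (fun s xi => wave_profile (t n) (x n) s xi - wave_profile t0 x0 s xi) @[n --> \oo] --> 0%E.
Proof.
move=> t0p tn tt xx; pose T := t0 + 1.
have T0 : 0 <= T by rewrite addr_ge0.
have t0T : t0 <= T by rewrite lerDl.
have tp n : 0 <= t n by have /andP[] := tn n.
have tT n : t n <= T by have /andP[] := tn n.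
have [C C0 hC] := wave_energy_upper hH T0.
have ad n : admissible T (wave_profile (t n) (x n)) by apply: admissible_le (tT n) _; exact: admissible_wave_profile.
have ad0 : admissible T (wave_profile t0 x0) by apply: admissible_le t0T _; exact: admissible_wave_profile.
pose h n xi := cenergy H (fun s => wave_profile (t n) (x n) s xi - wave_profile t0 x0 s xi).
have mh n : measurable_fun setT (h n) := measurable_cenergy hH (admissibleB (ad n) ad0).
have h0 n xi : (0 <= h n xi)%E by exact: cenergy_ge0.
have hb n xi : (h n xi <= (2 * (`|t n - t0| + phase_gap (x n) x0 xi * t0) ^+ 2 * T `^ (2 * H))%:E)%E.
  exact: (cenergy_le hH T0 (ctame_wave_diff _ _ _ (tp n) t0p (tT n) t0T)).
have hd n xi : (h n xi <= (4 * C * wave_weight H (enorm xi))%:E)%E.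
  have [M tM] := admissible_ctame xi (ad n); have [M' tM'] := admissible_ctame xi (admissibleN ad0).
  apply: le_trans (cenergyD hH tM tM') _.
  have [M'' tM''] := admissible_ctame xi ad0; rewrite (cenergyN hH tM'').
  rewrite !cenergy_wave_profile//.
  have e1 := hC (t n) (enorm xi) (tp n) (tT n) (enorm_ge0 xi).
  have e2 := hC t0 (enorm xi) t0p t0T (enorm_ge0 xi).
  have q (w : R) : C * w = 4 * C * w / 4 by field.
  by rewrite !q in e1 e2; exact: (double_quarter e1 e2).
have hfin n xi : h n xi = (fine (h n xi))%:E.
  by rewrite fineK// ge0_fin_numE//; apply: le_lt_trans (hd n xi) _; exact: ltry.
suff L : (\int[mu]_xi h n xi)%E @[n --> \oo] --> (\int[mu]_xi (cst 0 xi))%E.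
  by rewrite integral0 in L.
have I0 : mu.-integrable setT (fun xi => ((4 * C)%:E * (wave_weight H (enorm xi))%:E)%E).
  by apply: integrableZl => //; exact: integrable_wave_weight.
apply: (@dominated_cvg _ _ _ mu setT _ h _ (fun xi => (4 * C)%:E * (wave_weight H (enorm xi))%:E)%E) => //; last first.
  by move=> n xi _; rewrite gee0_abs.
move=> xi _; rewrite (_ : h^~ xi = (fun n => (fine (h n xi))%:E)); last by apply/funext => n.
apply: cvg_EFin; first exact: nearW.
have lim : 2 * (`|t n - t0| + phase_gap (x n) x0 xi * t0) ^+ 2 * T `^ (2 * H) @[n --> \oo] --> (0 : R).
  have c1 : `|t n - t0| @[n --> \oo] --> (0 : R).
    rewrite -[X in _ --> X](@normr0 R R); apply: cvg_norm; rewrite -[X in _ --> X](subrr t0).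
    by apply: cvgB => //; exact: cvg_cst.
  have cd : dotp (x n) xi @[n --> \oo] --> dotp x0 xi.
    by rewrite dotpC; under eq_fun do rewrite dotpC; apply: (continuous_cvg _ (@continuous_dotpr _ _ xi x0)).
  have cg : phase_gap (x n) x0 xi @[n --> \oo] --> (0 : R).
    rewrite -[X in _ --> X](addr0 (0 : R)); apply: cvgD.
      rewrite -[X in _ --> X](@normr0 R R); apply: cvg_norm; rewrite -[X in _ --> X](subrr (cos (dotp x0 xi))).
      by apply: cvgB; [exact: (continuous_cvg _ (@continuous_cos R _))|exact: cvg_cst].
    rewrite -[X in _ --> X](@normr0 R R); apply: cvg_norm; rewrite -[X in _ --> X](subrr (sin (dotp x0 xi))).
    by apply: cvgB; [exact: (continuous_cvg _ (@continuous_sin R _))|exact: cvg_cst].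
  have cM : `|t n - t0| + phase_gap (x n) x0 xi * t0 @[n --> \oo] --> (0 : R).
    rewrite -[X in _ --> X](addr0 (0 : R)); apply: cvgD => //.
    by rewrite -[X in _ --> X](mul0r t0); apply: cvgM => //; exact: cvg_cst.
  rewrite -[X in _ --> X](mul0r (T `^ (2 * H))); apply: cvgM; last exact: cvg_cst.
  rewrite -[X in _ --> X](mulr0 (2 : R)); apply: cvgM; first exact: cvg_cst.
  by rewrite -[X in _ --> X](mul0r (0 : R)); under eq_fun do rewrite expr2; exact: cvgM.
rewrite (_ : fine \o _ = (fun n => fine (h n xi)))//.
apply: (squeeze_cvgr (f := fun=> 0) _ (cvg_cst _) lim).
by apply: nearW => n; rewrite fine_ge0//= -lee_fin -hfin hb.
Qed.

(** The sequential criterion gives continuity in [(t, x)], the space being metric. *)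
Lemma wave_profile_near (t0 : R) x0 (eps : R) : 0 <= t0 -> 0 < eps ->
  \forall z \near within [set z : R * 'rV[R]_d | 0 <= z.1] (nbhs (t0, x0)),
   (xi_energy H mu (fun s xi => (wave_profile z.1 z.2 s xi - wave_profile t0 x0 s xi)%R) <= eps%:E)%E.
Proof.
move=> t0p e0.
pose Phi (z : R * 'rV[R]_d) := xi_energy H mu (fun s xi => wave_profile z.1 z.2 s xi - wave_profile t0 x0 s xi).
have inv0 n : 0 < (n.+1%:R^-1 : R) by rewrite invr_gt0.
(* Otherwise points violating the bound could be chosen in the balls of radius [1 / (n + 1)]. *)
have [n hn] : exists n : nat, forall z : R * 'rV[R]_d, ball (t0, x0) n.+1%:R^-1 z -> 0 <= z.1 -> (Phi z <= eps%:E)%E.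
  apply: contrapT => /forallNP no.
  have pick n : exists z : R * 'rV[R]_d, [/\ ball (t0, x0) n.+1%:R^-1 z, 0 <= z.1 & ~ (Phi z <= eps%:E)%E].
    apply: contrapT => /forallNP no'; apply: (no n) => z bz z0; apply: contrapT => np.
    by apply: (no' z).
  have [z hz] := choice pick.
  have zt n : `|t0 - (z n).1| < n.+1%:R^-1 by have [[]] := hz n.
  have tz : (z n).1 @[n --> \oo] --> t0.
    apply/cvgrPdist_lt => e ep; near=> n; apply: lt_trans (zt n) _.
    by near: n; exact: (near_infty_natSinv_lt (PosNum ep)).
  have xz : (z n).2 @[n --> \oo] --> x0.
    apply/cvg_ballP => e ep; near=> n; have [[_ bx] _ _] := hz n.
    apply: le_ball bx; apply: ltW; near: n; exact: (near_infty_natSinv_lt (PosNum ep)).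
  have t01 n : 0 <= (z n).1 <= t0 + 1.
    have [_ -> _] := hz n; rewrite /=.
    have : (n.+1%:R^-1 : R) <= 1 by rewrite invf_le1// ler1n.
    by move=> i1; rewrite -lerBlDl; apply: le_trans i1; apply: le_trans (ler_norm _) _; rewrite distrC ltW.
  have [k _ hk] := cvge0_near _ e0 (wave_profile_cvg t0p t01 tz xz).
  by have [_ _] := hz k; apply; exact: (hk k (leqnn k)).
apply/nbhs_ballP; exists (n.+1%:R^-1) => //= z bz z0; exact: hn.
Unshelve. all: by end_near. Qed.

End wave_continuity.

(** * The solution *)

(** The logarithm is used away from 0; near 0, [u^p <= u]. *)
Lemma cvg_powR (R : realType) (p : R) (u : nat -> R) (l : R) : 1 <= p -> (forall n, 0 <= u n) ->
  u n @[n --> \oo] --> l -> u n `^ p @[n --> \oo] --> l `^ p.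
Proof.
move=> p1 u0 ul.
have l0 : 0 <= l.
  by rewrite -(cvg_lim (@Rhausdorff R) ul); apply: limr_ge; [apply/cvg_ex; exists l|exact: nearW].
move: l0; rewrite le_eqVlt => /orP[/eqP l0|l0].
  rewrite -l0 powR0 ?gt_eqF ?(lt_le_trans ltr01)//; rewrite -l0 in ul.
  apply: (squeeze_cvgr (f := fun=> 0) (h := u) _ (cvg_cst _) ul).
  near=> n; rewrite powR_ge0 /= -[leRHS]powRr1//.
  have u1 : u n <= 1.
    near: n; move/cvgr0_norm_le : ul => /(_ _ ltr01); apply: filterS => n.
    by rewrite ger0_norm.
  have [->|un0] := eqVneq (u n) 0; first by rewrite !powR0 ?gt_eqF ?(lt_le_trans ltr01)// ?oner_neq0.
  by apply: ger_powR => //; rewrite u1 andbT lt_neqAle eq_sym un0 u0.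
have cl : (fun y => expR (p * ln y)) (u n) @[n --> \oo] --> expR (p * ln l).
  apply: (continuous_cvg _ (@continuous_expR R _)); apply: cvgM; first exact: cvg_cst.
  exact: (continuous_cvg _ (continuous_ln l0)).
rewrite [X in _ --> X](_ : _ = expR (p * ln l)); last by rewrite /powR gt_eqF.
apply: cvg_trans cl; apply: near_eq_cvg; near=> n.
rewrite /powR gt_eqF//; near: n; exact: (cvgr_gt l).
Unshelve. all: by end_near. Qed.

Section solution.
Context {R : realType} {d : nat} (H : R) (hH : 1 / 2 < H < 1).
Variables (mu : {measure set 'rV[R]_d -> \bar R}) (f : 'rV[R]_d -> R).
Hypothesis hmu : tempered_measure mu.
Hypothesis f_ge0 : forall x, 0 <= f x.
Hypothesis mf : measurable_fun setT f.
Hypothesis hf : distr_is_function (distr_fourier (distr_of_measure mu)) (fun x => (f x)%:C%C).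
Context {dOm : measure_display} {Om : measurableType dOm} (P : probability Om R).
Variable W : R -> set 'rV[R]_d -> {RV P >-> R}.
Hypothesis hW : gaussian_noise H f W.
Variable G1 : R -> rV_distr R d.
Hypothesis hG1 : wave_kernel G1.
Implicit Types (x xi : 'rV[R]_d) (t : R) (e : @elementary R d).

Let gap t x e := xi_energy H mu (fun s xi => wave_profile t x s xi - el_fourier e s xi).

Let gapE t x e : 0 <= t -> HP_norm2 H mu (fun s xi => wave_profile t x s xi - el_fourier e s xi) = gap t x e.
Proof.
move=> t0; have [a ta [a1 a2]] := admissible_common (admissible_wave_profile x t0) (admissible_el e).
by apply: (HP_norm2E hH mu _ (admissibleB a1 a2)); exact: le_trans ta.
Qed.

Let gap_cvg (ee : nat -> elementary) t x : 0 <= t -> HP_limit H mu ee (wave_integrand G1 t x) ->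
  gap t x (ee n) @[n --> \oo] --> 0%E.
Proof.
move=> t0 /(HP_limit_waveE hG1 H mu ee x t0).
by have -> : (fun n => HP_norm2 H mu (fun s xi => wave_profile t x s xi - el_fourier (ee n) s xi)) =
   (fun n => gap t x (ee n)) by apply/funext => n; rewrite gapE.
Qed.

Lemma xi_energy_wave t x : 0 <= t ->
  xi_energy H mu (wave_profile t x) = (\int[mu]_xi energy H (wave_slice t (enorm xi)))%E.
Proof. by move=> t0; apply: eq_integral => xi _; rewrite cenergy_wave_profile. Qed.

Let measurable_wave_energy t : measurable_fun setT (fun xi => energy H (wave_slice t (enorm xi))).
Proof.
have me : measurable_fun setT (fun p : R * 'rV[R]_d => enorm p.2) by meas.
have ms : measurable_fun setT (fun p : R * 'rV[R]_d => wave_slice t (enorm p.2) p.1).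
  by apply: measurable_wave_slice2 => // p; exact: enorm_ge0.
exact: (measurable_energy hH (a := fun s xi => wave_slice t (enorm xi) s) ms).
Qed.

Let measurable_weight := @measurable_wave_weight R d H.

Let weight_ge0 xi : 0 <= wave_weight H (enorm xi).
Proof. exact: wave_weight_ge0. Qed.

(** The wave is the sum of a simple function and a remainder of finite norm. *)
Lemma wave_weight_fin x : in_HP H mu (wave_integrand G1 4 x) ->
  (\int[mu]_xi (wave_weight H (enorm xi))%:E < +oo)%E.
Proof.
have t4 : 0 <= 4 :> R by [].
move=> [ee /(gap_cvg t4) /(cvge0_near _ ltr01) [n _ /(_ n (leqnn n)) hn]].
have [a ta [a1 a2]] := admissible_common (admissible_wave_profile x t4) (admissible_el (ee n)).
have a0 : 0 <= a := le_trans t4 ta.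
have el_fin : xi_energy H mu (el_fourier (ee n)) = (el_norm2 f H (ee n))%:E.
  by rewrite -(HP_norm2E hH mu a0 a2) (HP_norm2_el hH hmu f_ge0 mf hf).
have fin4 : (xi_energy H mu (wave_profile 4 x) < +oo)%E.
  have := xi_energyD hH mu (admissibleB a1 a2) a2.
  rewrite (_ : (fun s xi => _ + _) = wave_profile 4 x); last first.
    by apply/funext => s; apply/funext => xi; rewrite subrK.
  move/le_lt_trans; apply; rewrite el_fin.
  exact: (le_lt_trans (double_bound hn (lexx _)) (ltry _)).
have c0 := wave_lower_cst_gt0 hH.
have le4 : ((wave_lower_cst H)%:E * \int[mu]_xi (wave_weight H (enorm xi))%:E <= xi_energy H mu (wave_profile 4 x))%E.
  rewrite xi_energy_wave// -integralZl_real//.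
    by apply: ge0_le_integral => //;
      [move=> xi _; rewrite lee_fin mulr_ge0// ltW
      |by apply/measurable_EFinP; exact: measurable_funM
      |by move=> xi _; apply: (wave_energy_lower hH); exact: enorm_ge0].
  exact: ltW.
have := le_lt_trans le4 fin4; case: (\int[mu]_xi _)%E => [r _| |]; rewrite ?ltry//.
by rewrite gt0_muley ?lte_fin.
Qed.

Hypothesis fin_weight : (\int[mu]_xi (wave_weight H (enorm xi))%:E < +oo)%E.

Lemma wave_in_HP t x : 0 <= t -> in_HP H mu (wave_integrand G1 t x).
Proof.
move=> t0; have [ee hee] := wave_approximation hH hmu f_ge0 mf hf fin_weight x t0.
by exists ee; apply/(HP_limit_waveE hG1 H mu ee x t0).
Qed.

Lemma wave_energy_bounded (T : R) : 0 <= T -> exists2 B, 0 <= B &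
  forall t x, 0 <= t -> t <= T -> (xi_energy H mu (wave_profile t x) <= B%:E)%E.
Proof.
move=> T0; have [C C0 hC] := wave_energy_upper hH T0.
pose B := fine (\int[mu]_xi (wave_weight H (enorm xi))%:E)%E.
have BE : (\int[mu]_xi (wave_weight H (enorm xi))%:E = B%:E)%E.
  by rewrite fineK// ge0_fin_numE//; apply: integral_ge0 => xi _; rewrite lee_fin.
have B0 : 0 <= B by rewrite fine_ge0//; apply: integral_ge0 => xi _; rewrite lee_fin.
exists (C * B); first exact: mulr_ge0.
move=> t x t0 tT; rewrite xi_energy_wave// EFinM -BE -integralZl_real//.
apply: ge0_le_integral => //.
- by move=> xi _; exact: energy_ge0.
- by apply/measurable_EFinP; exact: measurable_funM.
by move=> xi _; apply: hC => //; exact: enorm_ge0.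
Qed.

Let Y (e : elementary) := el_integral W e.

Let mY e : measurable_fun setT (Y e). Proof. exact: measurable_el_integral. Qed.

Let expectation_gap (ee : nat -> elementary) (X : {RV P >-> R}) :
  ('E_P[fun w => ((el_integral W (ee n) w - X w) ^+ 2)%R])%E @[n --> \oo] --> 0%E ->
  (\int[P]_w ((Y (ee n) w - X w) ^+ 2)%:E)%E @[n --> \oo] --> 0%E.
Proof.
by have -> : (fun n => \int[P]_w ((Y (ee n) w - X w) ^+ 2)%:E)%E =
  (fun n => 'E_P[fun w => ((el_integral W (ee n) w - X w) ^+ 2)%R])%E
  by apply/funext => n; rewrite unlock.
Qed.

(** Isometry, and the triangle inequality through the two waves. *)
Lemma el_integral_gap_le e e' t t' x x' (a b c : R) : 0 <= t -> 0 <= t' ->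
  (gap t x e <= a%:E)%E -> (gap t' x' e' <= b%:E)%E ->
  (xi_energy H mu (fun s xi => (wave_profile t x s xi - wave_profile t' x' s xi)%R) <= c%:E)%E ->
  (\int[P]_w ((Y e w - Y e' w) ^+ 2)%:E <= (2 * a + 2 * (2 * c + 2 * b))%:E)%E.
Proof.
move=> t0 t0' ha hb hc.
rewrite (el_integral_isometry hH hmu f_ge0 mf hf hW).
have [k1 tk1 [p1 q1]] := admissible_common (admissible_wave_profile x t0) (admissible_el e).
have [k2 tk2 [p2 q2]] := admissible_common (admissible_wave_profile x' t0') (admissible_el e').
pose k := Num.max k1 k2.
have k1k : k1 <= k by rewrite le_max lexx. have k2k : k2 <= k by rewrite le_max lexx orbT.
have {}p1 := admissible_le k1k p1; have {}q1 := admissible_le k1k q1.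
have {}p2 := admissible_le k2k p2; have {}q2 := admissible_le k2k q2.
have k0 : 0 <= k := le_trans t0 (le_trans tk1 k1k).
rewrite (HP_norm2E hH mu k0 (admissibleB q1 q2)).
rewrite (_ : (fun s xi => _ - _) = (fun s xi => (el_fourier e s xi - wave_profile t x s xi) +
  ((wave_profile t x s xi - wave_profile t' x' s xi) + (wave_profile t' x' s xi - el_fourier e' s xi)))); last first.
  by apply/funext => s; apply/funext => xi; rewrite !addrA !subrK.
apply: le_trans (xi_energyD hH mu (admissibleB q1 p1) (admissibleD (admissibleB p1 p2) (admissibleB p2 q2))) _.
apply: double_bound; first by rewrite (xi_energyB_sym hH mu q1 p1).
apply: le_trans (xi_energyD hH mu (admissibleB p1 p2) (admissibleB p2 q2)) _.
exact: double_bound.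
Qed.

(** The Wiener integrals of the approximations are Cauchy by isometry. *)
Lemma wave_solution_at t x : 0 <= t -> exists X : {RV P >-> R},
  is_wiener_integral H mu W (wave_integrand G1 t x) X.
Proof.
move=> t0; have [ee hee] := wave_in_HP x t0; have gc := gap_cvg t0 hee.
have [X mX XE] : exists2 X : Om -> R, measurable_fun setT X &
    (\int[P]_w ((Y (ee n) w - X w) ^+ 2)%:E)%E @[n --> \oo] --> 0%E.
  (* Two triangle inequalities multiply the two errors by 2 and by 4. *)
  apply: L2_complete => // eps eps0; have e8 : 0 < eps / 8 by rewrite divr_gt0.
  have [N _ hN] := cvge0_near _ e8 gc; exists N => p q Np Nq.
  have z0 : (xi_energy H mu (fun s xi => (wave_profile t x s xi - wave_profile t x s xi)%R) <= 0%:E)%E.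
    rewrite (_ : (fun s xi => _) = (fun s xi => 0)); last by apply/funext => s; apply/funext => xi; rewrite subrr.
    rewrite /xi_energy (eq_integral (cst 0%E)) ?integral0// => xi _.
    have c0 : ctame 0 0 (fun=> 0 : R[i]) by split; split => // u; rewrite normr0.
    have := cenergy_le hH (lexx 0) c0; rewrite expr0n /= mulr0 mul0r => h.
    by apply/eqP; rewrite eq_le h cenergy_ge0.
  apply: le_trans (el_integral_gap_le t0 t0 (hN p Np) (hN q Nq) z0) _.
  by rewrite lee_fin; lra.
pose M := isMeasurableFun.Build _ _ _ _ X mX.
pose X' : {RV P >-> R} := HB.pack X M.
exists X', ee => //.
rewrite (_ : (fun n => 'E_P[_]%E) = (fun n => \int[P]_w ((Y (ee n) w - X w) ^+ 2)%:E)%E)//.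
by apply/funext => n; rewrite unlock.
Qed.

(** A fast subsequence of Wiener integrals of simple functions converges almost surely;
    these are Gaussian with uniformly bounded variance. *)
Lemma wave_solution_moment t x (X : {RV P >-> R}) (p B C : R) : 0 <= t -> 2 <= p ->
  is_wiener_integral H mu W (wave_integrand G1 t x) X ->
  (xi_energy H mu (wave_profile t x) <= B%:E)%E ->
  (forall Z : Om -> R, measurable_fun setT Z -> gaussian P Z ->
    (\int[P]_w (Z w ^+ 2)%:E <= (2 + 2 * B)%:E)%E -> (\int[P]_w (`|Z w| `^ p)%:E <= C%:E)%E) ->
  (\int[P]_w (`|X w| `^ p)%:E <= C%:E)%E.
Proof.
move=> t0 p2 [ee hee hX] hB hC; have gc := gap_cvg t0 hee.
have hX' : (\int[P]_w ((Y (ee n) w - X w) ^+ 2)%:E)%E @[n --> \oo] --> 0%E.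
  exact: expectation_gap.
have sel j : exists n, (\int[P]_w ((Y (ee n) w - X w) ^+ 2)%:E <= ((2^-1) ^+ j)%:E)%E /\
    (gap t x (ee n) <= 1%:E)%E.
  have j0 : 0 < (2^-1 : R) ^+ j by rewrite exprn_gt0// invr_gt0.
  have [n1 _ h1] := cvge0_near _ j0 hX'; have [n2 _ h2] := cvge0_near _ ltr01 gc.
  by exists (maxn n1 n2); split; [apply: h1; exact: leq_maxl|apply: h2; exact: leq_maxr].
have [k hk] := choice sel.
have mX : measurable_fun setT X by exact: measurable_funPT.
have ae := fast_ae_cvg (fun j => mY (ee (k j))) mX (fun j => (hk j).1).
have mp (Z : Om -> R) : measurable_fun setT Z -> measurable_fun setT (fun w => (`|Z w| `^ p)%:E).
  move=> mZ; apply/measurable_EFinP; apply: (measurableT_comp (measurable_powR _)).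
  exact: (measurableT_comp (@normr_measurable R setT)).
apply: (@fatou_ae_le _ _ _ _ (fun j w => (`|Y (ee (k j)) w| `^ p)%:E)) => //.
- by move=> j; exact: mp.
- exact: mp.
- apply: filterS ae => w cw; apply: cvg_EFin; first exact: nearW.
  have c1 : `|Y (ee (k j)) w| @[j --> \oo] --> `|X w| by exact: cvg_norm.
  apply: (cvg_powR _ (fun j => normr_ge0 _) c1); lra.
move=> j; apply: hC => //; first by have [h _ _] := hW; exact: h.
rewrite (el_integral_norm2 hH hmu f_ge0 mf hf hW).
have [a ta [a1 a2]] := admissible_common (admissible_wave_profile x t0) (admissible_el (ee (k j))).
rewrite (HP_norm2E hH mu (le_trans t0 ta) a2).
rewrite (_ : el_fourier _ = (fun s xi => (el_fourier (ee (k j)) s xi - wave_profile t x s xi) + wave_profile t x s xi)); last first.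
  by apply/funext => s; apply/funext => xi; rewrite subrK.
apply: le_trans (xi_energyD hH mu (admissibleB a2 a1) a1) _.
rewrite (xi_energyB_sym hH mu a2 a1).
have := double_bound (hk j).2 hB; rewrite mulr1; exact.
Qed.

(** Triangle inequalities through the Wiener integrals of simple functions close to the
    two waves. *)
Lemma wave_solution_dist t t' x x' (X X' : {RV P >-> R}) (eps : R) : 0 <= t -> 0 <= t' -> 0 < eps ->
  is_wiener_integral H mu W (wave_integrand G1 t x) X ->
  is_wiener_integral H mu W (wave_integrand G1 t' x') X' ->
  (xi_energy H mu (fun s xi => (wave_profile t x s xi - wave_profile t' x' s xi)%R) <= eps%:E)%E ->
  (\int[P]_w ((X w - X' w) ^+ 2)%:E <= (46 * eps)%:E)%E.
Proof.
move=> t0 t0' eps0 [ee hee hX] [ee' hee' hX'] hD.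
have [n1 _ h1] := cvge0_near _ eps0 (gap_cvg t0 hee).
have [n2 _ h2] := cvge0_near _ eps0 (gap_cvg t0' hee').
have [n3 _ h3] := cvge0_near _ eps0 (expectation_gap hX).
have [n4 _ h4] := cvge0_near _ eps0 (expectation_gap hX').
pose n := maxn (maxn n1 n2) (maxn n3 n4).
have {}h1 := h1 n (leq_trans (leq_maxl _ _) (leq_maxl _ _)).
have {}h2 := h2 n (leq_trans (leq_maxr _ _) (leq_maxl _ _)).
have {}h3 := h3 n (leq_trans (leq_maxl _ _) (leq_maxr _ _)).
have {}h4 := h4 n (leq_trans (leq_maxr _ _) (leq_maxr _ _)).
have hYY := el_integral_gap_le t0 t0' h1 h2 hD.
have mX : measurable_fun setT X by exact: measurable_funPT.
have mX' : measurable_fun setT X' by exact: measurable_funPT.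
have mE (Z Z' : Om -> R) : measurable_fun setT Z -> measurable_fun setT Z' ->
    measurable_fun setT (fun w => ((Z w - Z' w) ^+ 2)%:E).
  by move=> mZ mZ'; apply/measurable_EFinP; apply: measurable_funX; exact: measurable_funB.
have E0 (Z Z' : Om -> R) w : (0 <= ((Z w - Z' w) ^+ 2)%:E)%E by rewrite lee_fin sqr_ge0.
have tri (Z Z' Z'' : Om -> R) : measurable_fun setT Z -> measurable_fun setT Z' -> measurable_fun setT Z'' ->
    (\int[P]_w ((Z w - Z'' w) ^+ 2)%:E <= 2%:E * \int[P]_w ((Z w - Z' w) ^+ 2)%:E + 2%:E * \int[P]_w ((Z' w - Z'' w) ^+ 2)%:E)%E.
  move=> mZ mZ' mZ''; apply: integral_le_double; [exact: mE|exact: mE|exact: mE|exact: E0|exact: E0|exact: E0|].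
  move=> w; rewrite -!EFinM -EFinD lee_fin.
  have := sqr_ge0 ((Z w - Z' w) - (Z' w - Z'' w)); nra.
apply: le_trans (tri _ (Y (ee n)) _ mX _ mX') _ => //.
have h3' : (\int[P]_w ((X w - Y (ee n) w) ^+ 2)%:E <= eps%:E)%E.
  by under eq_integral do rewrite -sqrrN opprB.
have h5 := le_trans (tri _ (Y (ee' n)) _ (mY (ee n)) (mY (ee' n)) mX') (double_bound hYY h4).
by apply: le_trans (double_bound h3' h5) _; rewrite lee_fin; lra.
Qed.

End solution.

Theorem theorem3p1 (R : realType) (d : nat) (hd : (1 <= d)%N)
    (H : R) (hH : 1 / 2 < H < 1)
    (mu : {measure set 'rV[R]_d -> \bar R}) (hmu : tempered_measure mu)
    (f : 'rV[R]_d -> R) (hf0 : forall x, 0 <= f x) (hfm : measurable_fun setT f)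
    (hf : distr_is_function (distr_fourier (distr_of_measure mu))
            (fun x => (f x)%:C%C))
    (dOm : measure_display) (Om : measurableType dOm) (P : probability Om R)
    (hP : measure_is_complete P)
    (W : R -> set 'rV[R]_d -> {RV P >-> R}) (hW : gaussian_noise H f W)
    (G1 : R -> rV_distr R d) (hG1 : wave_kernel G1) :
  (wave_solution_exists H mu G1 <->
     (\int[mu]_xi (((1 + enorm xi ^+ 2)^-1) `^ (H + 1 / 2))%R%:E < +oo)%E) /\
  ((\int[mu]_xi (((1 + enorm xi ^+ 2)^-1) `^ (H + 1 / 2))%R%:E < +oo)%E ->
     (exists u : R -> 'rV[R]_d -> {RV P >-> R}, wave_solution H mu G1 W u) /\
     forall u : R -> 'rV[R]_d -> {RV P >-> R}, wave_solution H mu G1 W u ->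
       (forall p T : R, 2 <= p -> 0 < T ->
          (ereal_sup [set m | exists (t : R) (x : 'rV[R]_d), (0 <= t <= T)%R /\
             m = 'E_P[fun w => (`|u t x w| `^ p)%R]] < +oo)%E) /\
       (forall t0 x0, 0 <= t0 ->
          ('E_P[fun w => ((u z.1 z.2 w - u t0 x0 w) ^+ 2)%R])%E
            @[z --> within [set z : R * 'rV[R]_d | 0 <= z.1] (nbhs (t0, x0))]
            --> 0%E)).
Proof.
have fwE : (\int[mu]_xi (((1 + enorm xi ^+ 2)^-1) `^ (H + 1 / 2))%R%:E =
   \int[mu]_xi (wave_weight H (enorm xi))%:E)%E by [].
rewrite fwE; split.
  split=> [ex|fw t x t0]; first exact: (wave_weight_fin hH hmu hf0 hfm hf hG1 (ex 4 0 _)).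
  exact: (wave_in_HP hH hmu hf0 hfm hf hG1 fw x t0).
move=> fw; split.
  have sol (z : R * 'rV[R]_d) : exists X : {RV P >-> R},
      0 <= z.1 -> is_wiener_integral H mu W (wave_integrand G1 z.1 z.2) X.
    case: (leP 0 z.1) => [z0|_]; last by exists (W 0 set0).
    have [X hX] := wave_solution_at hH hmu hf0 hfm hf hW hG1 fw z.2 z0.
    by exists X.
  have [u hu] := choice sol.
  by exists (fun t x => u (t, x)) => t x t0; exact: (hu (t, x)).
move=> u hu; split=> [p T p2 T0|t0 x0 t00].
  have [B B0 hB] := wave_energy_bounded hH fw (ltW T0).
  have p0 : 0 <= p by rewrite (le_trans _ p2).
  have B2 : 0 <= 2 + 2 * B by rewrite addr_ge0// mulr_ge0.
  have [C C0 hC] := @gaussian_moments R p (2 + 2 * B) p0 B2.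
  apply: (@le_lt_trans _ _ C%:E); last exact: ltry.
  apply: ge_ereal_sup => _ [t [x [/andP[tp tT] ->]]]; rewrite unlock.
  apply: (wave_solution_moment hH hmu hf0 hfm hf hW hG1 tp p2 (hu t x tp) (hB t x tp tT)).
  by move=> Z; exact: hC.
apply: cvge0_le => [z|eps e0].
  by rewrite unlock; apply: integral_ge0 => w _; rewrite lee_fin sqr_ge0.
(* The factor of [wave_solution_dist]. *)
have e46 : 0 < eps / 46 by rewrite divr_gt0.
have near0 := wave_profile_near hH fw x0 t00 e46.
have dom : \forall z \near within [set z : R * 'rV[R]_d | 0 <= z.1] (nbhs (t0, x0)), 0 <= z.1.
  by apply: withinT; exact: nbhs_filter.
near=> z; rewrite unlock.
have z0 : 0 <= z.1 by near: z; exact: dom.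
have -> : eps = 46 * (eps / 46) by rewrite mulrC mulfVK.
apply: (wave_solution_dist hH hmu hf0 hfm hf hW hG1 z0 t00 e46 (hu _ _ z0) (hu _ _ t00)).
by near: z.
Unshelve. all: by end_near. Qed.
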